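(* Let $0<p<q\le 1$ and let $f:[0,\infty)\to[0,1]$ be nonincreasing with $0<\sup\{a: f(a)>0\}<\infty$. For $s\in(0,1]$ define $S_sf(r):=s\, f(\sqrt{s}\,r)$. Then $\lambda_{S_pf}<\lambda_{S_qf}$. Moreover, $\lambda_f > \left(2\pi\int_0^\infty r f(r)\,dr\right)^{-1}$ (strict inequality).
   Context: For $\lambda>0$, $\mathscr{P}_\lambda$ is a homogeneous Poisson point process of intensity $\lambda$ in $\mathbb{R}^2$. Given a connection function $g:[0,\infty)\to[0,1]$, the random connection model $RCM(\lambda,g)$ is the random graph with vertex set $\mathscr{P}_\lambda$ in which each pair of vertices $x,y$ is joined by an edge with probability $g(|x-y|)$, independently of all other pairs. When $0<\int_0^\infty r g(r)\,dr<\infty$ there is a critical intensity $\lambda_g\in(0,\infty)$ such that for $\lambda>\lambda_g$ the graph $RCM(\lambda,g)$ a.s. has an infinite connected component and for $\lambda<\lambda_g$ a.s. it has none. *)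

(* Defs.v *)
From HB Require Import structures.
From mathcomp Require Import all_boot all_order all_algebra.
From mathcomp Require Import all_classical all_reals all_analysis.
Set Implicit Arguments. Unset Strict Implicit. Unset Printing Implicit Defensive.
Import Order.TTheory GRing.Theory Num.Theory.
Local Open Scope classical_set_scope.
Local Open Scope ring_scope.

Section RCM.
Variable R : realType.

(* The plane R^2 is R * R with the product (= Borel) sigma-algebra. *)
Definition area (B : set (R * R)) : \bar R :=
  ((@lebesgue_measure R) \x (@lebesgue_measure R))%E B.

Definition dist2 (x y : R * R) : R :=
  Num.sqrt ((x.1 - y.1) ^+ 2 + (x.2 - y.2) ^+ 2).

(* Poisson(m) probability mass at c (m >= 0; Poisson(0) = Dirac at 0). *)
Definition poisson_mass (m : R) (c : nat) : R :=
  m ^+ c / (c`!)%:R * expR (- m).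

(* The point process is given as an enumeration X w : nat -> R^2 of its
   points; N(B) = c  iff exactly c indices n satisfy X w n \in B. *)
Definition count_is {T : Type} (X : T -> nat -> R * R) (B : set (R * R))
  (c : nat) : set T :=
  [set w | exists s : seq nat, [/\ uniq s, size s = c &
     forall n, B (X w n) <-> n \in s]].

(* Realization of RCM(lam, g) on a probability space (Omega, P):
   - X enumerates the points (injectively), each X n is measurable;
   - Poisson point process of intensity lam: counts in finitely many
     pairwise disjoint measurable sets of finite area are independent
     Poisson(lam * area);
   - U a b (a < b) are i.i.d. uniform on [0,1] and independent of X;
   - a, b (a <> b) are joined iff U (min a b) (max a b) < g |X a - X b|. *)
Definition RCM_realization (lam : R) (g : R -> R) (d : measure_display)
  (Omega : measurableType d) (P : probability Omega R)
  (X : Omega -> nat -> R * R) (U : Omega -> nat -> nat -> R) : Prop :=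
  [/\ (forall w, injective (X w)),
      (forall n, measurable_fun setT (fun w => X w n)),
      (forall a b, measurable_fun setT (fun w => U w a b)),
      (forall (k : nat) (B : 'I_k -> set (R * R)) (c : 'I_k -> nat),
          (forall i, measurable (B i)) ->
          (forall i, area (B i) < +oo)%E ->
          (forall i j, i != j -> B i `&` B j = set0) ->
          P (\bigcap_(i in [set: 'I_k]) count_is X (B i) (c i)) =
          (\prod_(i < k) poisson_mass (lam * fine (area (B i))) (c i))%:E)
    & (forall (L : seq (nat * set (R * R))) (E : seq (nat * nat * R)),
          (forall nD, nD \in L -> measurable nD.2) ->
          uniq (map fst E) ->
          (forall e, e \in E -> (e.1.1 < e.1.2)%N /\ 0 <= e.2 <= 1) ->
          P ([set w | forall nD, nD \in L -> nD.2 (X w nD.1)] `&`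
             [set w | forall e, e \in E -> U w e.1.1 e.1.2 <= e.2]) =
          (P [set w | forall nD, nD \in L -> nD.2 (X w nD.1)] *
           (\prod_(e <- E) e.2)%:E)%E) ].

Definition rcm_adj {Omega : Type} (g : R -> R)
  (X : Omega -> nat -> R * R) (U : Omega -> nat -> nat -> R) (w : Omega)
  : rel nat :=
  fun a b => (a != b) && (U w (minn a b) (maxn a b) < g (dist2 (X w a) (X w b))).

Definition has_infinite_component {Omega : Type} (g : R -> R)
  (X : Omega -> nat -> R * R) (U : Omega -> nat -> nat -> R) (w : Omega)
  : Prop :=
  exists n : nat, ~ finite_set
    [set m : nat | exists s : seq nat,
        path (rcm_adj g X U w) n s /\ last n s = m].

Definition percolates (lam : R) (g : R -> R) : Prop :=
  forall (d : measure_display) (Omega : measurableType d)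
    (P : probability Omega R) X U,
    RCM_realization lam g P X U ->
    {ae P, forall w, has_infinite_component g X U w}.

Definition critical_intensity (g : R -> R) : R :=
  inf [set lam : R | 0 < lam /\ percolates lam g].

Definition Sscale (s : R) (f : R -> R) : R -> R :=
  fun r => s * f (Num.sqrt s * r).

End RCM.

(* Main.v *)
(* The plane is cut into cells of side [del / (b * sqrt s)], blocks of [b * b] cells having side
   [del / sqrt s]; up to an error that vanishes as the mesh [1 / b] goes to 0, [RCM(lam, S_s f)]
   then behaves like a site-bond percolation model on the cells, where a cell is occupied with
   probability [1 - exp (- lam * area)] and the bond probability between two occupied cells is
   [s * f] of a distance that does not depend on [s].  Multiplying the bond probabilities by
   [s < 1] and dividing the occupation probability by [s] enlarges the cluster of the origin: the
   probability that a vertex joins a given cluster is [(1 - prod (1 - s F)) / s] instead of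
   [1 - prod (1 - F)], and the gain is bounded below as soon as two cluster vertices are close to
   it.  The gain is collected by "special" vertices that need two close cluster vertices, and
   a lottery among the specials of neighbouring blocks turns it into extra occupation
   probability everywhere, so the critical intensity drops by a definite amount.

   For the second claim, comparison with a branching process shows that [RCM(lam, S_s f)] does not
   percolate when [lam] times the lattice sum of [f] is less than 1, and the lattice sums are at
   most [2 pi int r f(r) dr] because lattice points with positive coordinates in a disc of radius
   [r] number at most a quarter of its area; the bound applied at [s = 1/2], together with the
   strict monotonicity in [s], is strict at [s = 1].

   The definition of [percolates] quantifies over all realizations, so the lower bounds need that
   one exists: it is built from the digits of a single uniform variable. *)
Require Import Defs.
From HB Require Import structures.
From mathcomp Require Import all_boot all_order all_algebra.
From mathcomp Require Import ring lra zify.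
Set Implicit Arguments. Unset Strict Implicit. Unset Printing Implicit Defensive.
Import Order.TTheory GRing.Theory Num.Theory.
Local Open Scope ring_scope.

(** * Percolation on finite random graphs *)

(** Edges are read as pairs of independent directed edges. The law of a hit does not change, since
    an exploration uses each edge in one direction only, and each vertex then owns the coordinates
    entering it, so that two models can be compared through one-vertex activation probabilities. The
    obstacle is that the gain requires two close cluster vertices, whereas extra occupation is
    wanted wherever the cluster sees a block. The bridge is the midpoint of an edge of the cluster:
    it sees both endpoints with definite probability, and from there special points infect one
    another block by block. Infinite clusters enter only through crossings from a box [k] to the
    outside of a box [l]. Multiplied by [b * b], the probabilities in the enhancement are bounded
    independently of [k], [l] and [b], so for fixed [l] the mesh can be refined until the
    discretization error, of order [1 / b], is negligible. A factor [eta < 1] on the bonds is given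
    away to turn [<=] between a uniform variable and its threshold into the strict inequality that
    defines an edge. *)

Section BernoulliSets.
Variables (R : realFieldType) (J : finType).
Implicit Types (rho : J -> R) (A B P : {set J}) (F G : {set J} -> R).

Definition is_prob rho := forall j, 0 <= rho j <= 1.

(** The independent Bernoulli law on the coordinates [J], encoded by its random set of successes.
    Finite sums replace integrals, so that conditioning and resampling are algebraic identities. *)
Definition bern rho A : R := \prod_j (if j \in A then rho j else 1 - rho j).

Definition bexp rho F : R := \sum_(A : {set J}) bern rho A * F A.

Lemma bern_ge0 rho A : is_prob rho -> 0 <= bern rho A.
Proof.
move=> rhoP; apply: prodr_ge0 => j _; have /andP[r0 r1] := rhoP j.
by case: ifP => _ //; rewrite subr_ge0.
Qed.

Lemma sum_bern rho : \sum_(A : {set J}) bern rho A = 1.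
Proof.
rewrite -(bigA_distr _ _ (fun j => rho j) (fun j => 1 - rho j)) /=.
by apply: big1 => j _; rewrite addrC subrK.
Qed.

Lemma eq_bexp rho F G : F =1 G -> bexp rho F = bexp rho G.
Proof. by move=> FG; apply: eq_bigr => A _; rewrite FG. Qed.

Lemma le_bexp rho F G : is_prob rho -> (forall A, F A <= G A) ->
  bexp rho F <= bexp rho G.
Proof.
by move=> rhoP FG; apply: ler_sum => A _; apply: ler_wpM2l (FG A); exact: bern_ge0.
Qed.

Lemma bexp_cst rho c : bexp rho (fun=> c) = c.
Proof. by rewrite /bexp -mulr_suml sum_bern mul1r. Qed.

Lemma bexpD rho F G : bexp rho (fun A => F A + G A) = bexp rho F + bexp rho G.
Proof. by rewrite /bexp -big_split /=; apply: eq_bigr => A _; rewrite mulrDr. Qed.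

Lemma bexpZ rho c F : bexp rho (fun A => c * F A) = c * bexp rho F.
Proof. by rewrite /bexp mulr_sumr; apply: eq_bigr => A _; rewrite mulrCA. Qed.

Lemma bexpZr rho c F : bexp rho (fun A => F A * c) = bexp rho F * c.
Proof. by rewrite mulrC -bexpZ; apply: eq_bexp => A; rewrite mulrC. Qed.

Lemma bexpB rho F G : bexp rho (fun A => F A - G A) = bexp rho F - bexp rho G.
Proof.
rewrite bexpD; congr (_ + _); rewrite -mulN1r -bexpZ.
by apply: eq_bexp => A; rewrite mulN1r.
Qed.

Lemma bexp_sum rho (I : Type) (r : seq I) (Q : pred I) (F : I -> {set J} -> R) :
  bexp rho (fun A => \sum_(i <- r | Q i) F i A) =
  \sum_(i <- r | Q i) bexp rho (F i).
Proof.
rewrite /bexp exchange_big /=; apply: eq_bigr => A _.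
by rewrite mulr_sumr.
Qed.

Lemma bexp_ge0 rho F : is_prob rho -> (forall A, 0 <= F A) -> 0 <= bexp rho F.
Proof. by move=> rP F0; rewrite -(bexp_cst rho 0); exact: le_bexp. Qed.

Lemma bexp_prod rho (g : J -> bool -> R) :
  bexp rho (fun A => \prod_j g j (j \in A)) =
  \prod_j (rho j * g j true + (1 - rho j) * g j false).
Proof.
rewrite bigA_distr; apply: eq_bigr => A _; rewrite -big_split /=.
by apply: eq_bigr => j _; case: (j \in A).
Qed.

Lemma prod_bool (Q : pred J) (b : J -> bool) :
  \prod_(j | Q j) ((b j)%:R : R) = [forall j, Q j ==> b j]%:R.
Proof.
case: forallP => [bP|/forallP].
  by apply: big1 => j Qj; have := bP j; rewrite Qj /= => ->.
rewrite negb_forall => /existsP[j]; rewrite negb_imply => /andP[Qj /negbTE bj].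
by rewrite (bigD1 j) //= bj mul0r.
Qed.

Lemma bexp_cylinder rho P S :
  bexp rho (fun A => (A :&: P == S :&: P)%:R) =
  \prod_(j in P) (if j \in S then rho j else 1 - rho j).
Proof.
rewrite (eq_bexp _ (G := fun A => \prod_j ((j \in P) ==> ((j \in A) == (j \in S)))%:R)).
  rewrite (bexp_prod rho (fun j b => ((j \in P) ==> (b == (j \in S)))%:R)) [RHS]big_mkcond /=; apply: eq_bigr => j _.
  case: (j \in P); case: (j \in S); rewrite /= ?mulr1 ?mulr0 ?addr0 ?add0r //;
  by rewrite addrC subrK.
move=> A; rewrite prod_bool; congr (_%:R); congr (nat_of_bool _).
apply/eqP/forallP => [e j|e].
  apply/implyP => _; apply/implyP => jP; have /setP/(_ j) := e.
  by rewrite !inE jP !andbT => ->.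
by apply/setP => j; rewrite !inE; have /implyP/(_ isT)/implyP := e j;
case: (j \in P) => [/(_ isT)/eqP ->|_]; rewrite ?andbF.
Qed.

(** Fubini for the splitting of [J] into [P] and its complement: the weight of a set is the product
    of the weights of its two traces. Freezing [A] and averaging over [B] is how conditioning on the
    coordinates in [P] is expressed below. *)
Lemma bexp_resample rho P F :
  bexp rho F = bexp rho (fun A => bexp rho (fun B => F ((A :&: P) :|: (B :&: ~: P)))).
Proof.
have split C : bern rho C = bexp rho (fun A => (A :&: P == C :&: P)%:R) *
   bexp rho (fun B => (B :&: ~: P == C :&: ~: P)%:R).
  rewrite !bexp_cylinder /bern (bigID (mem P)) /=; congr (_ * _).
  by apply: eq_bigl => j; rewrite inE.
rewrite {1}/bexp; under eq_bigr => C _ do rewrite split.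
transitivity (\sum_(C : {set J}) bexp rho (fun A => bexp rho (fun B =>
   ((A :&: P) :|: (B :&: ~: P) == C)%:R * F C))).
  apply: eq_bigr => C _; rewrite -mulrA -bexpZr; apply: eq_bexp => A.
  rewrite -bexpZr -bexpZ; apply: eq_bexp => B; rewrite mulrA -natrM mulnb; congr (_%:R * _).
  congr (nat_of_bool _); apply/andP/eqP => [[/eqP e1 /eqP e2]|<-].
    by rewrite e1 e2 -setIUr setUCr setIT.
  rewrite !setIUl -!setIA setIid (setIC (~: P)) setICr !setI0 setU0 set0U.
  by rewrite setIid !eqxx.
rewrite -bexp_sum; apply: eq_bexp => A; rewrite -bexp_sum; apply: eq_bexp => B.
rewrite (bigD1 (A :&: P :|: B :&: ~: P)) //= eqxx mul1r big1 ?addr0 // => C.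
by rewrite eq_sym => /negbTE ->; rewrite mul0r.
Qed.

Lemma bexp_mem rho j : bexp rho (fun A => (j \in A)%:R) = rho j.
Proof.
rewrite (eq_bexp _ (G := fun A => (A :&: [set j] == [set j] :&: [set j])%:R)).
  by rewrite bexp_cylinder big_set1 inE eqxx.
move=> A; congr (_%:R); congr (nat_of_bool _); apply/idP/eqP => [jA|/setP/(_ j)].
  by apply/setP => k; rewrite !inE; case: eqP => [->|]; rewrite ?jA ?andbF.
by rewrite !inE eqxx !andbT => ->.
Qed.

Lemma bexp_avoid rho P : bexp rho (fun A => [disjoint A & P]%:R) = \prod_(j in P) (1 - rho j).
Proof.
rewrite (eq_bexp _ (G := fun A => (A :&: P == set0 :&: P)%:R)).
  by rewrite bexp_cylinder; apply: eq_bigr => j _; rewrite inE.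
by move=> A; rewrite set0I setI_eq0.
Qed.

Lemma bexp_indep rho P F G :
  (forall A, F A = F (A :&: P)) -> (forall A, G A = G (A :&: ~: P)) ->
  bexp rho (fun A => F A * G A) = bexp rho F * bexp rho G.
Proof.
move=> FP GP; rewrite (bexp_resample _ P) -bexpZr; apply: eq_bexp => A.
rewrite -bexpZ; apply: eq_bexp => B; rewrite FP GP.
rewrite !setIUl -!setIA setIid (setIC (~: P)) setICr !setI0 setU0 set0U setIid.
by rewrite -FP -GP.
Qed.

End BernoulliSets.

Section Marginal.
Variables (R : realFieldType) (J1 J : finType) (i : J1 -> J).
Hypothesis i_inj : injective i.

(** Lets models with different coordinates be realized on one disjoint sum of coordinate sets, as
    [hits_domination] works under a single [rho]. *)
Lemma bexp_marginal (rho : J -> R) (F : {set J1} -> R) :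
  bexp rho (fun A => F (i @^-1: A)) = bexp (rho \o i) F.
Proof.
transitivity (\sum_(C : {set J1}) bexp rho (fun A => (A :&: (i @: [set: J1]) == (i @: C) :&: (i @: [set: J1]))%:R * F C)).
  rewrite -bexp_sum; apply: eq_bexp => A; rewrite (bigD1 (i @^-1: A)) //= big1 => [|C neC].
    rewrite addr0 (_ : (_ == _) = true) ?mul1r //; apply/eqP/setP => j; rewrite !inE.
    apply/andP/andP => -[+ /imsetP[k _ jk]]; rewrite jk => jA; split=> //.
    - by apply: imset_f; rewrite inE.
    - exact: imset_f.
    - by move: jA; rewrite mem_imset // inE.
    - exact: imset_f.
  case: eqP => [e|]; rewrite ?mul0r //; move/eqP: neC; case; apply/setP => k.
  have /setP/(_ (i k)) := e; rewrite !inE !mem_imset // inE !andbT => <-.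
  by [].
apply: eq_bigr => C _; rewrite bexpZr; congr (_ * _).
rewrite bexp_cylinder big_imset /=; last by move=> ? ? _ _; exact: i_inj.
rewrite /bern (eq_bigl predT); last by move=> k; rewrite inE.
by apply: eq_bigr => k _; rewrite mem_imset.
Qed.
End Marginal.

(** * Monotone activation systems *)

Section Active.
Variable V : finType.
Implicit Types (a : V -> {set V} -> bool) (S T C : {set V}).

(** [a v S] reads: [v] becomes active once the vertices of [S] are. This format covers site-bond
    clusters, directed or not, as well as enhanced models in which a vertex may require two active
    neighbours at once. *)
Definition monosys a := forall v S S', S \subset S' -> a v S -> a v S'.
Definition active a : {set V} := fixset (fun S => [set v | a v S]).
Definition hits T a : bool := ~~ [disjoint active a & T].
Definition force a v b : V -> {set V} -> bool := fun u S => if u == v then b else a u S.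

Lemma eq_active a a' : a =2 a' -> active a = active a'.
Proof.
move=> e; rewrite /active /fixset; elim: #|V| => //= n ->.
by apply/setP => v; rewrite !inE e.
Qed.

Lemma activeE a v : monosys a -> (v \in active a) = a v (active a).
Proof.
move=> am; have := @fixsetK V (fun S => [set u | a u S]).
rewrite -/(active a) => fK; rewrite -[in LHS]fK ?inE // => S S' SS'.
by apply/subsetP => u; rewrite !inE; exact: am.
Qed.

Lemma active_min a S : monosys a -> (forall v, a v S -> v \in S) -> active a \subset S.
Proof.
move=> am aS; rewrite /active /fixset; elim: #|V| => [|n IH]; first exact: sub0set.
by rewrite iterS; apply/subsetP => v; rewrite inE => /(am _ _ _ IH) /aS.
Qed.

Lemma active_mono a a' : monosys a -> monosys a' -> (forall v S, a v S -> a' v S) ->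
  active a \subset active a'.
Proof. by move=> am a'm aa'; apply: active_min => // v /aa'; rewrite activeE. Qed.

(** No vertex of a least fixed point supports itself: otherwise the active set without [v] would
    already be closed under activation. *)
Lemma active_parent a v : monosys a -> v \in active a -> a v (active a :\ v).
Proof.
move=> am vC; apply/negPn/negP => nav.
have /subsetP/(_ _ vC) : active a \subset active a :\ v.
  apply: active_min => // u au; rewrite !inE activeE // (am _ _ _ _ au) ?subsetDl // andbT.
  by apply: contraNneq nav => uv; rewrite -[X in a X]uv.
by rewrite !inE eqxx.
Qed.

Lemma monosys_force a v b : monosys a -> monosys (force a v b).
Proof. by move=> am u S S' SS'; rewrite /force; case: eqP => // _; exact: am. Qed.

(** Exploring without [v] first decides, by one test of [a v], whether [v] ever activates;
    afterwards its rule may be replaced by a constant. Hence the cluster depends on the randomness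
    at [v] through a single boolean. *)
Lemma active_force a v : monosys a ->
  active a = if a v (active (force a v false)) then active (force a v true)
              else active (force a v false).
Proof.
move=> am; have sub0 : active (force a v false) \subset active a.
  apply: active_mono => //; first exact: monosys_force.
  by move=> u S; rewrite /force; case: eqP.
case: ifP => av.
  apply/eqP; rewrite eqEsubset; apply/andP; split.
    apply: active_mono => //; first exact: monosys_force.
    by move=> u S; rewrite /force; case: eqP.
  apply: active_min; first exact: monosys_force.
  move=> u; rewrite /force; case: eqP => [-> _|_]; rewrite activeE //.
  exact: am av.
apply/eqP; rewrite eqEsubset sub0 andbT; apply: active_min => // u au.
rewrite activeE; last exact: monosys_force.
by rewrite /force; case: eqP au => [->|//]; rewrite av.
Qed.

Lemma hits_mono T a a' : monosys a -> monosys a' -> (forall v S, a v S -> a' v S) ->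
  hits T a -> hits T a'.
Proof.
move=> am a'm aa'; apply: contraNN; apply: disjointWl.
exact: active_mono.
Qed.

Lemma eq_hits T a a' : a =2 a' -> hits T a = hits T a'.
Proof. by move=> e; rewrite /hits (eq_active e). Qed.

End Active.

Section Swap.
Variables (R : realFieldType) (J V : finType) (rho : J -> R) (T : {set V}).
Hypothesis rhoP : is_prob rho.
Implicit Types a : {set J} -> V -> {set V} -> bool.

Lemma le_natbool (b b' : bool) : (b -> b') -> (b%:R : R) <= b'%:R.
Proof. by case: b => [->|] //; rewrite ler0n. Qed.

Lemma bexp_bit j (G : {set J} -> bool -> R) : (forall A b, G (A :\ j) b = G A b) ->
  bexp rho (fun A => G A (j \in A)) =
  rho j * bexp rho (G^~ true) + (1 - rho j) * bexp rho (G^~ false).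
Proof.
move=> Gj.
rewrite (eq_bexp _ (G := fun A => (j \in A)%:R * G A true + (1 - (j \in A)%:R) * G A false)).
  have ind b (h : bool -> R) : bexp rho (fun A => h (j \in A) * G A b) =
    bexp rho (fun A => h (j \in A)) * bexp rho (G^~ b).
    apply: (@bexp_indep _ _ _ [set j]) => A; first by rewrite !inE eqxx andbT.
    by rewrite -setDE Gj.
  rewrite bexpD (ind true (fun b => b%:R)) (ind false (fun b => 1 - b%:R)).
  by rewrite bexpB bexp_cst bexp_mem.
by move=> A; case: (j \in A); rewrite ?subrr ?subr0 ?mul1r ?mul0r ?addr0 ?add0r.
Qed.

(* Given the rest of the randomness, the probability of a hit is affine and
   nondecreasing in the activation probability of v by the active set built without v. *)
Lemma vertex_swap a a' v (P : {set J}) :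
  (forall A, monosys (a A)) -> (forall A, monosys (a' A)) ->
  (forall A u S, u != v -> a A u S = a (A :&: ~: P) u S) ->
  (forall A u S, u != v -> a' A u S = a A u S) ->
  (forall A S, a A v S = a (A :&: P) v S) ->
  (forall A S, a' A v S = a' (A :&: P) v S) ->
  (forall S, bexp rho (fun A => (a A v S)%:R) <= bexp rho (fun A => (a' A v S)%:R)) ->
  bexp rho (fun A => (hits T (a A))%:R) <= bexp rho (fun A => (hits T (a' A))%:R).
Proof.
move=> am a'm au a'u av a'v h.
rewrite (bexp_resample _ (~: P)) [leRHS](bexp_resample _ (~: P)) setCK.
apply: le_bexp => // A.
pose C0 := active (force (a A) v false).
pose H b : R := (hits T (force (a A) v b))%:R.
have key (c : {set J} -> V -> {set V} -> bool) : (forall A, monosys (c A)) ->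
    (forall A u S, u != v -> c A u S = a A u S) ->
    (forall A S, c A v S = c (A :&: P) v S) -> forall B,
    ((hits T (c (A :&: ~: P :|: B :&: P)))%:R : R) =
    H false + (c B v C0)%:R * (H true - H false).
  move=> cm cu cv B; set D := _ :|: _.
  have fD b : active (force (c D) v b) = active (force (a A) v b).
    apply: eq_active => u S; rewrite /force; case: eqP => // /eqP uv.
    rewrite cu // au // [RHS]au //; congr (a _ _ _); rewrite /D.
    by rewrite setIUl -!setIA setIid setICr setI0 setU0.
  rewrite /hits (active_force v (cm D)) !fD -/C0 cv.
  have -> : D :&: P = B :&: P by rewrite /D setIUl -!setIA setIid (setIC _ P) setICr setI0 set0U.
  rewrite -cv; case: (c B v C0); rewrite /H /hits -/C0; last by rewrite mul0r addr0.
  by rewrite mul1r addrC subrK.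
rewrite (eq_bexp _ (key a am (fun _ _ _ _ => erefl) av)).
rewrite (eq_bexp _ (key a' a'm a'u a'v)).
rewrite !bexpD !bexp_cst lerD2l !bexpZr; apply: ler_wpM2r (h C0).
rewrite subr_ge0; apply: le_natbool; apply: hits_mono; try exact: monosys_force.
by move=> u S; rewrite /force; case: eqP.
Qed.

(** The vertices pass from [a] to [a'] one at a time by [vertex_swap]. As the sets [P v] are
    disjoint, it is enough to compare the activation probabilities of each vertex for a fixed [S];
    no coupling of the two systems has to be constructed. *)
Lemma hits_domination a a' (P : V -> {set J}) :
  (forall A, monosys (a A)) -> (forall A, monosys (a' A)) ->
  (forall u v, u != v -> [disjoint P u & P v]) ->
  (forall A v S, a A v S = a (A :&: P v) v S) ->
  (forall A v S, a' A v S = a' (A :&: P v) v S) ->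
  (forall v S, bexp rho (fun A => (a A v S)%:R) <= bexp rho (fun A => (a' A v S)%:R)) ->
  bexp rho (fun A => (hits T (a A))%:R) <= bexp rho (fun A => (hits T (a' A))%:R).
Proof.
move=> am a'm disjP aP a'P h.
pose hyb (l : seq V) A u S := if u \in l then a' A u S else a A u S.
have hm l A : monosys (hyb l A).
  by move=> u S S'; rewrite /hyb; case: ifP => _; [exact: a'm|exact: am].
have hP l A u S : hyb l A u S = hyb l (A :&: P u) u S.
  by rewrite /hyb; case: ifP => _; [exact: a'P|exact: aP].
suff main l : uniq l -> bexp rho (fun A => (hits T (a A))%:R) <=
    bexp rho (fun A => (hits T (hyb l A))%:R).
  apply: le_trans (main (enum V) (enum_uniq _)) _; rewrite le_eqVlt; apply/orP; left.
  apply/eqP; apply: eq_bexp => A; congr (_%:R); congr (nat_of_bool _).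
  by apply: eq_hits => u S; rewrite /hyb mem_enum.
elim: l => [_|v l IH /= /andP[vl /IH {}IH]].
  by apply: le_bexp => // A; apply: le_natbool; rewrite (@eq_hits _ _ _ (hyb [::] A)).
apply: le_trans IH _; apply: (@vertex_swap _ _ v (P v)) => //.
- move=> A u S uv; rewrite hP [RHS]hP -setIA; congr (hyb _ (_ :&: _) _ _).
  by apply/esym/setIidPr; rewrite -disjoints_subset disjoint_sym disjP // eq_sym.
- by move=> A u S uv; rewrite /hyb inE (negbTE uv).
- by move=> S; rewrite /hyb inE eqxx (negbTE vl) /=.
Qed.

End Swap.

Section Graph.
Variables (R : realFieldType) (V : finType) (K T : {set V}).

Definition gsys (occ : pred V) (e : rel V) : V -> {set V} -> bool :=
  fun v S => occ v && ((v \in K) || [exists u in S, e u v]).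

Lemma monosys_gsys occ e : monosys (gsys occ e).
Proof.
move=> v S S' SS' /andP[ov vS]; rewrite /gsys ov; case/orP: vS => [->//|/existsP[u /andP[uS uv]]].
by apply/orP; right; apply/existsP; exists u; rewrite uv (subsetP SS').
Qed.

Lemma gsys_le (occ occ' : pred V) (e e' : rel V) v S :
  (forall u, occ u -> occ' u) -> (forall u w, e u w -> e' u w) ->
  gsys occ e v S -> gsys occ' e' v S.
Proof.
move=> oo ee /andP[/oo ov vS]; rewrite /gsys ov; case/orP: vS => [->//|/existsP[u /andP[uS uv]]].
by apply/orP; right; apply/existsP; exists u; rewrite uS ee.
Qed.

Definition two_edges (e : rel V) (x y : V) (b1 b2 : bool) : rel V := fun u v =>
  if (u == x) && (v == y) then b1 else if (u == y) && (v == x) then b2 else e u v.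

(* Only the direction leaving the set reached without the edge {x, y} matters. *)
Lemma hits_two_edges occ e x y b1 b2 : x != y ->
  hits T (gsys occ (two_edges e x y b1 b2)) =
  if x \in active (gsys occ (two_edges e x y false false))
  then hits T (gsys occ (two_edges e x y b1 false))
  else hits T (gsys occ (two_edges e x y false b2)).
Proof.
move=> xy; set C0 := active _.
have yx : (y == x) = false by rewrite eq_sym (negbTE xy).
have m b b' : monosys (gsys occ (two_edges e x y b b')) by exact: monosys_gsys.
have sub (b b' c c' : bool) : (b -> c) -> (b' -> c') ->
    active (gsys occ (two_edges e x y b b')) \subset active (gsys occ (two_edges e x y c c')).
  move=> bc bc'; apply: active_mono => // v S; apply: gsys_le => // u w; rewrite /two_edges.
  by do 2 case: ifP => // _.
have C0x b b' : C0 \subset active (gsys occ (two_edges e x y b b')) by apply: sub.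
have step b b' (S : {set V}) v u : occ v -> u \in S ->
    two_edges e x y b b' u v -> gsys occ (two_edges e x y b b') v S.
  by move=> ov uS uv; rewrite /gsys ov; apply/orP; right; apply/existsP; exists u; rewrite uS.
rewrite /hits; case: ifP => xC.
  suff -> : active (gsys occ (two_edges e x y b1 b2)) = active (gsys occ (two_edges e x y b1 false)) by [].
  apply/eqP; rewrite eqEsubset (sub b1 false b1 b2) // andbT; apply: active_min => // v /andP[ov].
  case/orP => [vK|/existsP[u /andP[uS uv]]]; first by rewrite activeE // /gsys ov vK.
  have [/andP[/eqP uy /eqP vx]|nyx] := boolP ((u == y) && (v == x)).
    by rewrite vx; apply: subsetP xC.
  rewrite activeE //; apply: step uS _ => //; move: uv; rewrite /two_edges (negbTE nyx).
  by [].
suff -> : active (gsys occ (two_edges e x y b1 b2)) = active (gsys occ (two_edges e x y false b2)) by [].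
apply/eqP; rewrite eqEsubset (sub false b2 b1 b2) // andbT; apply: active_min => // v /andP[ov].
case/orP => [vK|/existsP[u /andP[uS uv]]]; first by rewrite activeE // /gsys ov vK.
have [/andP[/eqP ux /eqP vy]|nxy] := boolP ((u == x) && (v == y)); last first.
  by rewrite activeE //; apply: step uS _ => //; move: uv; rewrite /two_edges (negbTE nxy).
have [yC|yC] := boolP (y \in C0); first by rewrite vy; apply: subsetP yC.
suff /subsetP/(_ _ uS) : active (gsys occ (two_edges e x y false b2)) \subset C0 by rewrite ux xC.
apply: active_min => // w /andP[ow /orP[wK|/existsP[z /andP[zS zw]]]].
  by rewrite activeE // /gsys ow wK.
rewrite activeE //; apply: (step _ _ _ _ z) => //; move: zw; rewrite /two_edges.
case: ifP => //; case: ifP => // /andP[/eqP zy _] _ _.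
by move: yC; rewrite -zy zS.
Qed.

(** [und] stores an undirected edge at the coordinate whose endpoints increase in [enum_rank], while
    [dir] gives the two directions separate coordinates. Both use the same coordinate set, so they
    can be compared under one law. *)
Definition und (A : {set (V + V * V)}) : rel V := fun u v =>
  if (enum_rank u < enum_rank v)%N then inr (u, v) \in A else inr (v, u) \in A.
Definition dir (A : {set (V + V * V)}) : rel V := fun u v => inr (u, v) \in A.
Definition occ_of (A : {set (V + V * V)}) : pred V := fun v => inl v \in A.

Definition gprob (pi : R) (F : V -> V -> R) (j : V + V * V) : R :=
  match j with inl _ => pi | inr uv => F uv.1 uv.2 end.

(** An exploration from [K] can only profit from the direction that leaves the endpoint reached
    first, so independent states for the two directions go unnoticed. Directing the edges provides
    the private coordinates that [hits_domination] demands. *)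
Lemma undirected_directed pi F : is_prob (gprob pi F) -> (forall u v, F u v = F v u) ->
  bexp (gprob pi F) (fun A => (hits T (gsys (occ_of A) (und A)))%:R) =
  bexp (gprob pi F) (fun A => (hits T (gsys (occ_of A) (dir A)))%:R).
Proof.
move=> FP Fsym.
(* Interpolation: decreasing pairs listed in [l] already have a coordinate of their own, the others
   still share that of the increasing pair. *)
pose rd (l : seq (V * V)) (A : {set (V + V * V)}) : rel V := fun u v =>
  if (enum_rank u < enum_rank v)%N || ((u, v) \in l) then inr (u, v) \in A else inr (v, u) \in A.
pose ex l := bexp (gprob pi F) (fun A => (hits T (gsys (occ_of A) (rd l A)))%:R : R).
have eq_rd l e' : (forall A u v, rd l A u v = e' A u v) ->
    ex l = bexp (gprob pi F) (fun A => (hits T (gsys (occ_of A) (e' A)))%:R).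
  move=> e; apply: eq_bexp => A; congr (_%:R); congr (nat_of_bool _); apply: eq_hits => v S.
  rewrite /gsys; congr (_ && (_ || _)); apply: eq_existsb => u; by rewrite e.
rewrite -(eq_rd [::] und); last by move=> A u v; rewrite /rd orbF.
rewrite -(eq_rd (enum {: V * V}) dir); last by move=> A u v; rewrite /rd mem_enum orbT.
have : uniq (enum {: V * V}) by exact: enum_uniq.
elim: (enum _) => //= -[y x] l IH /andP[yxl /IH ->]; rewrite {IH}.
have [xy|nxy] := boolP (enum_rank x < enum_rank y)%N; last first.
  apply: eq_rd => A u v; rewrite /rd inE xpair_eqE.
  case: (eqVneq u y) => [->|] //=; case: (eqVneq v x) => [->|] //=.
  move: nxy; rewrite -leqNgt leq_eqVlt => /orP[/eqP/val_inj/enum_rank_inj->|->//].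
  by rewrite orbT; case: ifP.
have neq : x != y by apply: contraTneq xy => ->; rewrite ltnn.
have yx : (y == x) = false by rewrite eq_sym (negbTE neq).
pose j1 : V + V * V := inr (x, y); pose j2 : V + V * V := inr (y, x).
pose h A b1 b2 : R := (hits T (gsys (occ_of A) (two_edges (rd l A) x y b1 b2)))%:R.
pose C A := active (gsys (occ_of A) (two_edges (rd l A) x y false false)).
have e1 A : (hits T (gsys (occ_of A) (rd l A)))%:R = h A (j1 \in A) (j1 \in A).
  rewrite /h; congr (_%:R); congr (nat_of_bool _); apply: eq_hits => v S.
  rewrite /gsys; congr (_ && (_ || _)); apply: eq_existsb => u; congr (_ && _).
  rewrite /two_edges; have [/andP[/eqP -> /eqP ->]|_] := boolP ((u == x) && (v == y)).
    by rewrite /rd xy.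
  have [/andP[/eqP -> /eqP ->]|_] // := boolP ((u == y) && (v == x)).
  by rewrite /rd (negbTE yxl) ltnNge (ltnW xy).
have e2 A : (hits T (gsys (occ_of A) (rd ((y, x) :: l) A)))%:R = h A (j1 \in A) (j2 \in A).
  rewrite /h; congr (_%:R); congr (nat_of_bool _); apply: eq_hits => v S.
  rewrite /gsys; congr (_ && (_ || _)); apply: eq_existsb => u; congr (_ && _).
  rewrite /two_edges; have [/andP[/eqP -> /eqP ->]|nxy] := boolP ((u == x) && (v == y)).
    by rewrite /rd xy.
  have [/andP[/eqP -> /eqP ->]|nyx] := boolP ((u == y) && (v == x)).
    by rewrite /rd inE eqxx orbT.
  by rewrite /rd inE xpair_eqE (negbTE nyx).
have hD A b1 b2 : h A b1 b2 =
    (x \in C A)%:R * h A b1 false + (x \notin C A)%:R * h A false b2.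
  rewrite /h hits_two_edges // -/(C A); case: (x \in C A);
  by rewrite /= ?mul1r ?mul0r ?addr0 ?add0r.
have rdj j A u v b1 b2 : j \in [:: j1; j2] ->
    two_edges (rd l (A :\ j)) x y b1 b2 u v = two_edges (rd l A) x y b1 b2 u v.
  rewrite /two_edges => jj; case: ifP => // nxy; case: ifP => // nyx; rewrite /rd.
  rewrite !in_setD1.
  have -> : inr (u, v) != j.
    move: jj; rewrite !inE => /orP[]/eqP->; by rewrite (inj_eq inr_inj) xpair_eqE ?nxy ?nyx.
  have -> // : inr (v, u) != j.
  by move: jj; rewrite !inE => /orP[]/eqP->; rewrite (inj_eq inr_inj) xpair_eqE andbC ?nxy ?nyx.
have sysj j A b1 b2 : j \in [:: j1; j2] ->
   gsys (occ_of (A :\ j)) (two_edges (rd l (A :\ j)) x y b1 b2) =2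
   gsys (occ_of A) (two_edges (rd l A) x y b1 b2).
  move=> jj v S; rewrite /gsys; congr (_ && (_ || _)).
    by rewrite /occ_of in_setD1; move: jj; rewrite !inE => /orP[]/eqP->.
  by apply: eq_existsb => u; rewrite rdj.
rewrite /ex (eq_bexp _ e1) (eq_bexp _ e2).
under eq_bexp => A do rewrite hD.
under [RHS]eq_bexp => A do rewrite hD.
(* Only the term where [x] is not reached without the edge distinguishes the two sides. There the
   direction from [y] to [x] is fed by [j1] or by [j2], which are fresh coordinates of equal
   probability. *)
rewrite !bexpD; congr (_ + _).
pose G A b := (x \notin C A)%:R * h A false b : R.
have Gj j A b : j \in [:: j1; j2] -> G (A :\ j) b = G A b.
  by move=> jj; rewrite /G /C /h (eq_active (sysj j A _ _ jj)) (eq_hits _ (sysj j A _ _ jj)).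
rewrite (@bexp_bit _ _ _ j1 G); last by move=> A b; apply: Gj; rewrite inE eqxx.
rewrite (@bexp_bit _ _ _ j2 G); last by move=> A b; apply: Gj; rewrite !inE eqxx orbT.
by rewrite /= Fsym.
Qed.

Lemma gsys_prob pi F v (S : {set V}) :
  bexp (gprob pi F) (fun A => (gsys (occ_of A) (dir A) v S)%:R) =
  pi * (if v \in K then 1 else 1 - \prod_(u in S) (1 - F u v)).
Proof.
rewrite (eq_bexp _ (G := fun A => (occ_of A v)%:R * ((v \in K) || [exists u in S, dir A u v])%:R)); last first.
  by move=> A; rewrite -natrM mulnb.
rewrite (@bexp_indep _ _ _ [set inl v]); last 2 first.
- by move=> A; rewrite /occ_of !inE eqxx andbT.
- move=> A; congr (_%:R); congr (nat_of_bool _); congr (_ || _); apply: eq_existsb => u.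
  by rewrite /dir !inE andbT.
rewrite /occ_of bexp_mem /=; congr (_ * _); case: ifP => vK; first by rewrite bexp_cst.
have ii : injective (fun u : V => inr (u, v) : V + V * V) by move=> ? ? [].
rewrite (eq_bexp _ (G := fun A => 1 - [disjoint A & [set inr (u, v) | u in S]]%:R)).
  rewrite bexpB bexp_cst bexp_avoid; congr (_ - _).
  by rewrite big_imset //= => ? ? _ _; exact: ii.
move=> A; rewrite orFb; case: existsP => [[u /andP[uS uA]]|nu].
  suff /negbTE -> : ~~ [disjoint A & [set inr (u, v) | u in S]] by rewrite subr0.
  by apply/pred0Pn; exists (inr (u, v)); rewrite /= imset_f // andbT.
suff -> : [disjoint A & [set inr (u, v) | u in S]] by rewrite subrr.
apply/pred0P => j /=; apply/negP => /andP[jA /imsetP[u uS ju]].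
by apply: nu; exists u; rewrite uS /dir -ju.
Qed.
End Graph.

(** * Inequalities for products of failure probabilities *)

Section Products.
Variables (R : realFieldType) (I : finType).
Implicit Types (x : I -> R) (S : {set I}) (s : R).

Lemma prod_compl_itv S x : (forall i, 0 <= x i <= 1) ->
  0 <= \prod_(i in S) (1 - x i) <= 1.
Proof.
move=> x01; apply: (big_ind (fun y => 0 <= y <= 1)); rewrite ?ler01 ?lexx //.
  by move=> a b /andP[a0 a1] /andP[b0 b1]; rewrite mulr_ge0 //= mulr_ile1.
by move=> i _; have /andP[? ?] := x01 i; rewrite subr_ge0 gerBl; apply/andP.
Qed.

(** Thinning the trials by separate coins of bias [s] makes a total failure less likely than
    thinning all of them by one common coin. *)
Lemma prod_compl_scale S x s : (forall i, 0 <= x i <= 1) -> 0 <= s <= 1 ->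
  \prod_(i in S) (1 - s * x i) <= 1 - s + s * \prod_(i in S) (1 - x i).
Proof.
move=> x01 /andP[s0 s1].
suff : [&& 0 <= \prod_(i in S) (1 - s * x i), 0 <= \prod_(i in S) (1 - x i),
  \prod_(i in S) (1 - x i) <= 1 &
  \prod_(i in S) (1 - s * x i) <= 1 - s + s * \prod_(i in S) (1 - x i)] by case/and4P.
elim/big_rec2: _ => [|i p q _ /and4P[q0 p0 p1 H]]; first by rewrite ler01 lexx mulr1 subrK lexx.
have /andP[y0 y1] := x01 i; set y := x i in y0 y1 *.
have sy0 : 0 <= s * y by rewrite mulr_ge0.
have sy1 : s * y <= 1 by rewrite mulr_ile1.
have B : (1 - s * y) * q <= (1 - s * y) * (1 - s + s * p) by rewrite ler_wpM2l // subr_ge0.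
have C : 0 <= s * y * ((1 - s) * (1 - p)).
  by rewrite !mulr_ge0 // subr_ge0.
apply/and4P; split; [by apply: mulr_ge0; lra|by apply: mulr_ge0; lra|by apply: mulr_ile1; lra|nra].
Qed.

(** When the trials [u] and [v] both succeed, separate coins keep at least one of them with
    probability [1 - (1 - s) ^+ 2], a common coin with probability [s]; the difference is the gain
    [s * (1 - s)]. The factors of [u] and [v] are set apart and [prod_compl_scale] bounds the
    rest. *)
Lemma prod_compl_scale2 S x s u v : (forall i, 0 <= x i <= 1) -> 0 <= s <= 1 ->
  u \in S -> v \in S -> u != v ->
  \prod_(i in S) (1 - s * x i) + s * (1 - s) * (x u * x v) <=
  1 - s + s * \prod_(i in S) (1 - x i).
Proof.
move=> x01 s01 uS vS uv; have /andP[s0 s1] := s01.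
rewrite [X in X + _](bigD1 u) //= [X in _ * X + _](bigD1 v) /=; last by rewrite vS eq_sym.
rewrite [X in _ <= _ + _ * X](bigD1 u) //= [X in _ <= _ + _ * (_ * X)](bigD1 v) /=; last by rewrite vS eq_sym.
have e1 (y : I -> R) : \prod_(i | (i \in S) && (i != u) && (i != v)) (1 - y i) = \prod_(i in S :\ u :\ v) (1 - y i).
  by apply: eq_bigl => i; rewrite !inE; case: (i == u); case: (i == v); rewrite ?andbF ?andbT.
rewrite (e1 (fun i => s * x i)) (e1 x).
have H := @prod_compl_scale (S :\ u :\ v) x s x01 s01.
have /andP[p0 p1] := @prod_compl_itv (S :\ u :\ v) x x01.
set p := \prod_(i in _) (1 - x i) in H p0 p1 *.
set q := \prod_(i in _) _ in H *.
have /andP[a0 a1] := x01 u; have /andP[b0 b1] := x01 v.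
set a := x u in a0 a1 *; set b := x v in b0 b1 *.
have ab0 : 0 <= a * b by rewrite mulr_ge0.
have sa1 : s * a <= 1 by rewrite mulr_ile1.
have sb1 : s * b <= 1 by rewrite mulr_ile1.
have A1 : (1 - s * a) * ((1 - s * b) * q) <= (1 - s * a) * ((1 - s * b) * (1 - s + s * p)).
  by rewrite !ler_wpM2l // subr_ge0.
(* After the remaining product has been bounded, this is exactly the difference of the two sides. *)
have key : 0 <= s * (1 - p) * (1 - s) * (a + b - a * b - s * (a * b)).
  apply: mulr_ge0; first by rewrite !mulr_ge0 // subr_ge0.
  have : s * (a * b) <= a * b by rewrite ler_piMl.
  have : a * b <= a by rewrite ler_piMr.
  have : a * b <= b by rewrite ler_piMl.
  lra.
apply: le_trans (lerD A1 (lexx _)) _.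
rewrite -subr_ge0; apply: le_trans key _; rewrite le_eqVlt; apply/orP; left; apply/eqP; ring.
Qed.
End Products.

(** * Enhancement *)

Section BlockBits.
Variables (R : realFieldType) (V Bl : finType) (blk : V -> Bl) (nb : nat).
Hypothesis card_blk : forall b, #|[set v | blk v == b]| = nb.

Lemma bexp_fiber (J : finType) (rho : J -> R) (i : V -> J) (r : R) (X S : {set V}) :
  injective i -> (forall v, rho (i v) = r) -> S \subset X ->
  bexp rho (fun B => ([set v in X | i v \in B] == S)%:R) =
  r ^+ #|S| * (1 - r) ^+ (#|X| - #|S|).
Proof.
move=> ii ir SX.
rewrite (eq_bexp _ (G := fun B => (((i @^-1: B) :&: X == S :&: X))%:R)); last first.
  move=> B; congr (_%:R); congr (nat_of_bool _); rewrite (setIidPl SX); congr (_ == _).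
  by apply/setP => v; rewrite !inE andbC.
rewrite (bexp_marginal ii rho (fun A => (A :&: X == S :&: X)%:R)) bexp_cylinder.
rewrite (bigID (mem S)) /=; congr (_ * _).
  rewrite (eq_bigr (fun=> r)); last by move=> v /andP[_ vS]; rewrite vS /= ir.
  rewrite prodr_const; congr (_ ^+ _); apply: eq_card => v.
  by rewrite unfold_in /=; case: (boolP (v \in S)) => vS; rewrite ?andbF // (subsetP SX _ vS).
rewrite (eq_bigr (fun=> 1 - r)); last by move=> v /andP[_ vS]; rewrite (negbTE vS) /= ir.
rewrite prodr_const -cardsDS //; congr (_ ^+ _); apply: eq_card => v.
by rewrite unfold_in /= !inE andbC.
Qed.

Lemma bexp_blocks_nonempty (r : R) (l : seq Bl) : uniq l ->
  bexp (fun _ : V => r) (fun A => (all (fun b => [exists v, (blk v == b) && (v \in A)]) l)%:R) =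
  (1 - (1 - r) ^+ nb) ^+ size l.
Proof.
elim: l => [_|b l IH /= /andP[bl /IH {}IH]]; first by rewrite /= bexp_cst.
rewrite exprS -IH -/(bexp _ _).
have -> : 1 - (1 - r) ^+ nb = bexp (fun _ : V => r) (fun A => [exists v, (blk v == b) && (v \in A)]%:R).
  rewrite (eq_bexp _ (G := fun A => 1 - [disjoint A & [set v | blk v == b]]%:R)).
    by rewrite bexpB bexp_cst bexp_avoid prodr_const card_blk.
  move=> A; case: existsP => [[v /andP[vb vA]]|nv].
    suff /negbTE -> : ~~ [disjoint A & [set v | blk v == b]] by rewrite subr0.
    by apply/pred0Pn; exists v; rewrite /= vA inE.
  suff -> : [disjoint A & [set v | blk v == b]] by rewrite subrr.
  apply/pred0P => v /=; apply/negP => /andP[vA]; rewrite inE => vb.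
  by apply: nv; exists v; rewrite vb.
rewrite -(@bexp_indep _ _ _ [set v | blk v == b]).
- by apply: eq_bexp => A; rewrite -natrM mulnb.
- by move=> A; congr (_%:R); congr (nat_of_bool _); apply: eq_existsb => v; rewrite !inE;
    case: (blk v == b); rewrite ?andbT.
- move=> A; congr (_%:R); congr (nat_of_bool _); apply: eq_in_all => b' b'l.
  apply: eq_existsb => v; rewrite !inE; case: (eqVneq (blk v) b') => //= ->.
  by rewrite (_ : (b' == b) = false) ?andbT //; apply: contraNF bl => /eqP <-.
Qed.
End BlockBits.

Section Enhancement.
Variables (R : realFieldType) (V Bl : finType) (blk : V -> Bl) (reg : Bl -> {set Bl}).
Variables (F : V -> V -> R) (c0 s piA piB piD piW : R) (K T : {set V}) (nb kap : nat).

(** The situation in which [prod_compl_scale2] yields the definite gain [s * (1 - s) * (c0 * c0)].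
    Vertices of [K] are included because they need no neighbour, so the thinning of the edges costs
    them nothing. *)
Definition twice (v : V) (S : {set V}) : bool := (v \in K) ||
  [exists u in S, [exists w in S, [&& u != w, c0 <= F u v & c0 <= F w v]]].

Lemma twice_mono v (S S' : {set V}) : S \subset S' -> twice v S -> twice v S'.
Proof.
move=> /subsetP SS' /orP[vK|/existsP[u /andP[uS /existsP[w /andP[wS H]]]]]; rewrite /twice ?vK //.
apply/orP; right; apply/existsP; exists u; rewrite SS' //=.
by apply/existsP; exists w; rewrite SS'.
Qed.

Hypothesis F01 : forall u v, 0 <= F u v <= 1.
Hypothesis c01 : 0 < c0 <= 1.
Hypothesis s01 : 0 < s < 1.
Hypothesis blkK : forall v w, blk v = blk w -> v \in K -> w \in K.
Hypothesis card_blk : forall b, #|[set v | blk v == b]| = nb.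
Hypothesis reg_self : forall Q, Q \in reg Q.
Hypothesis card_reg : forall Q, (#|reg Q| <= kap)%N.
Hypothesis card_gER : forall b, (#|[set Q | b \in reg Q]| <= kap)%N.
(* A cluster vertex x that can see the block Q has a cluster neighbour; if every
   block around Q carries a special point, the specials of Q get infected. *)
Hypothesis trigger : forall Q x v (C W : {set V}), blk v = Q -> x \in C -> x \notin T ->
  0 < F x v -> (x \in K \/ exists2 z, z \in C & (z != x) && (0 < F z x)) ->
  (forall b, b \in reg Q -> exists2 w, w \in W & blk w = b) ->
  (forall w, w \in W -> twice w C -> w \in C) ->
  forall w, w \in W -> blk w = Q -> w \in C.
Hypothesis piA01 : 0 <= piA <= 1.
Hypothesis piB01 : 0 <= piB <= 1.
Hypothesis piD01 : 0 <= piD <= 1.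
Hypothesis piW01 : 0 <= piW <= 1.
(** The budget. Regular occupation [s * piB] and an independent extra [piD] together cover [piA];
    being special for one of at most [kap] blocks is paid by the gain at vertices satisfying
    [twice]; an extra is less likely than a special combined with a won lottery, that is, with a
    special in every other block of the region. *)
Hypothesis le_piA : piA <= 1 - (1 - s * piB) * (1 - piD).
Hypothesis le_piW : kap%:R * piW <= s * piB * (1 - s) * (c0 * c0).
Hypothesis le_piD : piD <= (1 - (1 - piW) ^+ nb) ^+ kap * piW * (1 - piW) ^+ nb.

Local Notation J := ((V + V * V) + (V + Bl * V))%type.
Implicit Types (A B : {set J}) (C S : {set V}) (l : seq Bl).

(** The coordinates are, in order: regular occupation, directed edges, extra occupation, and
    specials of [v] for the lottery of the block [Q]. Specials carry the index [Q] so that the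
    lotteries of different blocks are independent. *)
Definition eprob (j : J) : R :=
  match j with
  | inl (inl _) => s * piB | inl (inr uv) => F uv.1 uv.2
  | inr (inl _) => piD | inr (inr _) => piW
  end.

Let rg A v : bool := inl (inl v) \in A.
(** Requiring [0 < F u v] discards edges that are open with probability 0, so that [trigger] can be
    applied to every edge in use. *)
Let ed A u v : bool := (0 < F u v) && (inl (inr (u, v)) \in A).
Let db A v : bool := inr (inl v) \in A.
Let wb A Q v : bool := (inr (inr (Q, v)) \in A) && (blk v \in reg Q).
Let en A v S : bool := (v \in K) || [exists u in S, ed A u v].

(** The blocks of [l] have already exchanged their extra occupations for specials. At [[::]] the
    extras compensate for the factor [s] in the occupation; at the full list only specials are
    left. *)
Definition hybrid l A v S : bool :=
  en A v S && (rg A v || db A v && (blk v \notin l)) ||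
  [exists Q, [&& Q \in l, wb A Q v & twice v S]].

Lemma eprob_prob : is_prob eprob.
Proof.
have /andP[s0 s1] := s01; have /andP[b0 b1] := piB01.
move=> [[v|[u v]]|[v|[Q v]]] /=; [|exact: F01|exact: piD01|exact: piW01].
by rewrite mulr_ge0 ?(ltW s0) //= mulr_ile1 // ltW.
Qed.

Let en_mono A v S S' : S \subset S' -> en A v S -> en A v S'.
Proof.
move=> SS' /orP[vK|/existsP[u /andP[uS uv]]]; rewrite /en ?vK //.
by apply/orP; right; apply/existsP; exists u; rewrite (subsetP SS').
Qed.

Lemma monosys_hybrid l A : monosys (hybrid l A).
Proof.
move=> v S S' SS' /orP[/andP[e o]|/existsP[Q /and3P[Ql wQ t]]]; apply/orP.
  by left; rewrite (en_mono SS' e).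
by right; apply/existsP; exists Q; rewrite Ql wQ (twice_mono SS' t).
Qed.

Section Step.
Variables (Q : Bl) (l : seq Bl).
Hypothesis Ql : Q \notin l.

Let Qs := [set v | blk v == Q].
Let Dq B := [set v in Qs | inr (inl v) \in B].
Let Wq B := [set v in Qs | inr (inr (Q, v)) \in B].
Let Wall B := [set v | wb B Q v].
Let good B := [forall b in reg Q :\ Q, [exists v, (blk v == b) && (inr (inr (Q, v)) \in B)]].

(** The comparison holds pattern by pattern: a nonempty set [S] is less likely as the set of extras
    of [Q] than as its set of specials together with [good]. The empty set is excluded because only
    a positive power of [piD] can pay for [good]. *)
Lemma compare_lottery (phi : {set V} -> R) : (forall S, 0 <= phi S) ->
  bexp eprob (fun B => (Dq B != set0)%:R * phi (Dq B)) <=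
  bexp eprob (fun B => (good B && (Wq B != set0))%:R * phi (Wq B)).
Proof.
move=> phi0.
have iD : injective (fun v => inr (inl v) : J) by move=> ? ? [].
have iW : injective (fun v => inr (inr (Q, v)) : J) by move=> ? ? [].
have expand (X : {set J} -> {set V}) (G : {set J} -> R) : (forall B, X B \subset Qs) ->
   bexp eprob (fun B => G B * (X B != set0)%:R * phi (X B)) =
   \sum_(S : {set V} | (S \subset Qs) && (S != set0)) phi S * bexp eprob (fun B => G B * (X B == S)%:R).
  move=> XQ; under [RHS]eq_bigr => S _ do rewrite -bexpZ.
  rewrite -bexp_sum; apply: eq_bexp => B.
  have [X0|X0] := eqVneq (X B) set0.
    rewrite mulr0 mul0r big1 // => S /andP[_ S0].
    by rewrite X0 (_ : (set0 == S) = false) ?mulr0 // eq_sym; apply/negbTE.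
  rewrite (bigD1 (X B)) ?XQ //= eqxx big1 ?addr0 => [|S /andP[_]]; first by rewrite !mulr1 mulrC.
  by rewrite eq_sym => /negbTE ->; rewrite !mulr0.
rewrite (eq_bexp _ (G := fun B => 1 * (Dq B != set0)%:R * phi (Dq B))); last by move=> B; rewrite mul1r.
rewrite [leRHS](eq_bexp _ (G := fun B => (good B)%:R * (Wq B != set0)%:R * phi (Wq B))); last first.
  by move=> B; rewrite -mulnb natrM.
rewrite !expand; last 2 first.
- by move=> B; apply/subsetP => v; rewrite !inE => /andP[].
- by move=> B; apply/subsetP => v; rewrite !inE => /andP[].
apply: ler_sum => S /andP[SQ S0]; apply: ler_wpM2l => //.
rewrite (eq_bexp _ (G := fun B => (Dq B == S)%:R)); last by move=> B; rewrite mul1r.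
rewrite (bexp_fiber (r := piD) iD) // (@bexp_indep _ _ _ [set inr (inr (Q, v)) | v in ~: Qs]); last 2 first.
- move=> B; congr (_%:R); congr (nat_of_bool _); apply: eq_forallb => b.
  rewrite !inE; case: (boolP (b == Q)) => //= bQ; congr (_ ==> _); apply: eq_existsb => v.
  case: (eqVneq (blk v) b) => //= vb; rewrite in_setI; apply/esym/andb_idr => _.
  by apply: imset_f; rewrite !inE vb.
- move=> B; congr (_%:R); congr (nat_of_bool _); congr (_ == _); apply/setP => v.
  rewrite !inE; case: (boolP (blk v == Q)) => //= vQ; rewrite andb_idr // => _.
  by apply/imsetP => -[w]; rewrite !inE => wQ [vw]; rewrite vw (negbTE wQ) in vQ.
rewrite (bexp_fiber (r := piW) iW) // card_blk.
have /andP[W0 W1] := piW01; have /andP[D0 D1] := piD01.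
have w1 : 0 <= 1 - piW <= 1 by rewrite subr_ge0 gerBl W0 W1.
have /andP[w10 w11] := w1.
have n0 : 0 <= 1 - (1 - piW) ^+ nb <= 1.
  by rewrite subr_ge0 gerBl exprn_ge0 // exprn_ile1.
have /andP[n00 n01] := n0.
have leD := le_piD; set eta := 1 - (1 - piW) ^+ nb in n0 n00 n01 leD *.
have Sn : (#|S| <= nb)%N by rewrite -(card_blk Q) subset_leq_card.
have S1 : (0 < #|S|)%N by rewrite card_gt0.
have goodE : eta ^+ kap <= bexp eprob (fun B => (good B)%:R).
  have -> : bexp eprob (fun B => (good B)%:R) = eta ^+ size (enum (reg Q :\ Q)).
    rewrite -(bexp_blocks_nonempty card_blk piW (enum_uniq _)).
    rewrite -(bexp_marginal iW eprob (fun A : {set V} => (all (fun b => [exists v, (blk v == b) && (v \in A)]) _)%:R)).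
    apply: eq_bexp => B; congr (_%:R); congr (nat_of_bool _).
    apply/forallP/allP => H b; [rewrite mem_enum => bR|].
      by have := H b; rewrite bR /= => /existsP[v H']; apply/existsP; exists v; rewrite inE.
    apply/implyP => bR; have := H b; rewrite mem_enum bR => /(_ isT)/existsP[v].
    by rewrite inE => H'; apply/existsP; exists v.
  apply: ler_wiXn2l => //; rewrite -cardE; apply: leq_trans (card_reg Q).
  by apply: subset_leq_card; exact: subsetDl.
have e0 : 0 <= eta ^+ kap <= 1 by rewrite exprn_ge0 // exprn_ile1.
have /andP[e00 e01] := e0.
apply: le_trans (ler_wpM2r _ goodE); last by rewrite mulr_ge0 // exprn_ge0.
apply: (@le_trans _ _ (piD ^+ #|S|)).
  by rewrite ler_piMr ?exprn_ge0 // exprn_ile1 ?subr_ge0 // gerBl.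
have q0 : 0 <= (1 - piW) ^+ nb <= 1 by rewrite exprn_ge0 // exprn_ile1.
have /andP[q00 q01] := q0.
(* As [S] is nonempty, the powers [#|S|] of [eta ^+ kap] and of [(1 - piW) ^+ nb] are at most their
   first powers. *)
apply: (@le_trans _ _ ((eta ^+ kap * piW * (1 - piW) ^+ nb) ^+ #|S|)).
  by apply: lerXn2r => //; rewrite nnegrE // !mulr_ge0.
rewrite !exprMn -mulrA; apply: ler_pM; rewrite ?mulr_ge0 ?exprn_ge0 //.
  by rewrite -[leRHS]expr1; apply: ler_wiXn2l.
apply: ler_wpM2l; first by rewrite exprn_ge0.
apply: (@le_trans _ _ ((1 - piW) ^+ nb)); first by rewrite -[leRHS]expr1; apply: ler_wiXn2l.
by apply: ler_wiXn2l => //; exact: leq_subr.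
Qed.

Let P : {set J} := [set j | match j with
  inr (inl v) => blk v == Q | inr (inr qv) => qv.1 == Q | _ => false end].
(** The common part of [hybrid l] and [hybrid (Q :: l)]: the extras of the block [Q] and the
    specials of its lottery are switched off. *)
Let base A v S : bool := en A v S && (rg A v || db A v && (blk v \notin Q :: l)) ||
  [exists Q', [&& Q' \in l, wb A Q' v & twice v S]].

Let monosys_base A : monosys (base A).
Proof.
move=> v S S' SS' /orP[/andP[e o]|/existsP[Q' /and3P[Ql' wQ t]]]; apply/orP.
  by left; rewrite (en_mono SS' e).
by right; apply/existsP; exists Q'; rewrite Ql' wQ (twice_mono SS' t).
Qed.

Lemma hybrid_step :
  bexp eprob (fun A => (hits T (hybrid l A))%:R) <=
  bexp eprob (fun A => (hits T (hybrid (Q :: l) A))%:R).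
Proof.
rewrite (bexp_resample _ (~: P)) [leRHS](bexp_resample _ (~: P)) setCK.
apply: le_bexp => [|A]; first exact: eprob_prob.
pose X B := A :&: ~: P :|: B :&: P.
have Xin B j : (j \in X B) = if j \in P then j \in B else j \in A.
  by rewrite in_setU !in_setI in_setC; case: (j \in P); rewrite ?andbF ?andbT ?orbF.
have enX B v S : en (X B) v S = en A v S.
  by rewrite /en; congr (_ || _); apply: eq_existsb => u; rewrite /ed Xin inE.
have rgX B v : rg (X B) v = rg A v by rewrite /rg Xin inE.
have dbX B v : db (X B) v = if blk v == Q then inr (inl v) \in B else db A v.
  by rewrite /db Xin inE.
have wbX B Q' v : wb (X B) Q' v = if Q' == Q then wb B Q v else wb A Q' v.
  by rewrite /wb Xin inE /=; case: eqP => // ->.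
have exl B v S : [exists Q', [&& Q' \in l, wb (X B) Q' v & twice v S]] =
    [exists Q', [&& Q' \in l, wb A Q' v & twice v S]].
  apply: eq_existsb => Q'; case: (boolP (Q' \in l)) => //= Ql'; rewrite wbX.
  by rewrite (_ : (Q' == Q) = false) //; apply: contraNF Ql => /eqP <-.
have hybL B v S : hybrid l (X B) v S = base A v S || (v \in Dq B) && en A v S.
  rewrite /hybrid /base enX rgX dbX exl !inE negb_or.
  case: (eqVneq (blk v) Q) => [->|] /=; last by rewrite orbF.
  rewrite Ql andbT andbF orbF; set E := [exists _, _].
  by case: (en _ _ _); case: (rg _ _); case: (_ \in B); case: E.
have hybR B v S : hybrid (Q :: l) (X B) v S = base A v S || (v \in Wall B) && twice v S.
  rewrite /hybrid /base enX rgX dbX !inE negb_or.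
  have -> : [exists Q', [&& Q' \in Q :: l, wb (X B) Q' v & twice v S]] =
     [exists Q', [&& Q' \in l, wb A Q' v & twice v S]] || wb B Q v && twice v S.
    rewrite -(exl B); apply/existsP/orP => [[Q']|[/existsP[Q' /and3P[h1 h2 h3]]|h]].
    - rewrite inE => /and3P[/orP[/eqP->|Ql'] w t].
        by right; rewrite t andbT; move: w; rewrite wbX eqxx.
      by left; apply/existsP; exists Q'; rewrite Ql' w t.
    - by exists Q'; rewrite inE h1 h2 h3 orbT.
    - by exists Q; rewrite inE eqxx wbX eqxx.
  rewrite orbA; congr (_ || _ || _); congr (_ && (_ || _)).
  by case: (eqVneq (blk v) Q); rewrite ?andbF.
pose C0 := active (base A).
pose H0 := hits T (base A).
pose plus S' v S := base A v S || (v \in S').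
have plusm S' : monosys (plus S').
  by move=> v S S1 SS; rewrite /plus => /orP[/(monosys_base SS) ->|->]; rewrite ?orbT.
pose HS S' := hits T (plus S').
have H0S S' : H0 -> HS S'.
  by apply: hits_mono => // v S; rewrite /plus => ->.
pose trg := [exists v, (blk v == Q) && en A v C0].
have DQ B v : v \in Dq B -> blk v == Q by rewrite !inE => /andP[].
have f1 B : hits T (hybrid l (X B)) -> H0 || [&& trg, Dq B != set0 & HS (Dq B)].
  move=> h; have [//|nH0] := boolP H0; rewrite orFb.
  have sub : active (hybrid l (X B)) \subset active (plus (Dq B)).
    apply: active_mono => //; first exact: monosys_hybrid.
    by move=> v S; rewrite hybL /plus => /orP[->//|/andP[->]]; rewrite orbT.
  have hHS : HS (Dq B) by apply: contraNN h; apply: disjointWl.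
  have [/existsP[v /andP[vD ev]]|ntrg] := boolP [exists v in Dq B, en A v C0]; last first.
    case/negP: nH0; apply: contraNN h; apply: disjointWl.
    apply: active_min; first exact: monosys_hybrid.
    move=> v; rewrite hybL => /orP[|/andP[vD ev]]; first by rewrite -/C0 activeE.
    by case/existsP: ntrg; exists v; rewrite vD.
  rewrite hHS andbT; apply/andP; split.
    by apply/existsP; exists v; rewrite ev (DQ _ _ vD).
  by apply/set0Pn; exists v.
have f2 B : trg -> good B -> Wq B != set0 -> HS (Wq B) -> ~~ H0 ->
    hits T (hybrid (Q :: l) (X B)).
  move=> tr gB WB hW nH0.
  set C := active (hybrid (Q :: l) (X B)).
  have Cm := @monosys_hybrid (Q :: l) (X B).
  have C0C : C0 \subset C.
    by apply: active_mono => // v S; rewrite hybR => ->.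
  have WC v : v \in Wq B -> v \in C.
    move=> vW; have vQ : blk v = Q by move: vW; rewrite !inE => /andP[/eqP].
    have vWall : v \in Wall B.
      by move: vW; rewrite !inE /wb => /andP[/eqP -> ->] /=; exact: reg_self.
    case/existsP: tr => x' /andP[/eqP x'Q /orP[x'K|/existsP[x /andP[xC0 /andP[Fx _]]]]].
      have vK : v \in K by apply: blkK x'K; rewrite x'Q vQ.
      by rewrite activeE // hybR vWall /twice vK orbT.
    apply: (@trigger Q x x' C (Wall B)) => //.
    - exact: (subsetP C0C).
    - by apply: contraNN nH0 => xT; apply/pred0Pn; exists x; rewrite /= xC0.
    (* The neighbour demanded by [trigger]: whichever rule activated [x], it used another cluster
       vertex, unless [x] lies in [K]. *)
    - have := active_parent (@monosys_base A) xC0; rewrite -/C0.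
      have par (D : {set V}) : D \subset C0 :\ x -> en A x D ->
          x \in K \/ exists2 z, z \in C & (z != x) && (0 < F z x).
        move=> /subsetP DC /orP[->|/existsP[z /andP[/DC zD /andP[Fz _]]]]; first by left.
        by right; move: zD; rewrite !inE => /andP[zx /(subsetP C0C) zC]; exists z; rewrite ?zx.
      case/orP => [/andP[/par + _]|/existsP[Q' /and3P[_ _ /orP[->|]]]]; first exact.
        by left.
      case/existsP=> u /andP[uC /existsP[w /andP[_ /and3P[_ cu _]]]]; right.
      move: uC; rewrite !inE => /andP[ux /(subsetP C0C) uC]; exists u => //.
      by rewrite ux /=; apply: lt_le_trans cu; case/andP: c01.
    - move=> b; have [->|bQ] := eqVneq b Q.
        by move=> _; exists v.
      move=> bR; have /forallP/(_ b) := gB; rewrite !inE bQ bR /= => /existsP[w /andP[/eqP wb' wB]].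
      by exists w => //; rewrite !inE /wb wB wb' bR.
    - by move=> w wW tw; rewrite activeE // hybR wW tw orbT.
  apply: contraNN hW; apply: disjointWl; apply: active_min => // v /orP[bv|/WC//].
  by rewrite activeE // hybR bv.
have f3 B : H0 -> hits T (hybrid (Q :: l) (X B)).
  by apply: hits_mono => //; [exact: monosys_hybrid|move=> v S; rewrite hybR => ->].
have [H0T|H0F] := boolP H0.
  by apply: le_bexp => [|B]; [exact: eprob_prob|rewrite (f3 B H0T) lern1 leq_b1].
have [trT|trF] := boolP trg; last first.
  apply: (@le_trans _ _ 0); last by apply: bexp_ge0 => // ?; exact: eprob_prob.
  rewrite -(bexp_cst eprob 0); apply: le_bexp => [|B]; first exact: eprob_prob.
  have := f1 B; rewrite (negbTE H0F) (negbTE trF) /=; case: (hits _ _) => // /(_ isT) //.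
apply: (@le_trans _ _ (bexp eprob (fun B => (Dq B != set0)%:R * (HS (Dq B))%:R))).
  apply: le_bexp => [|B]; first exact: eprob_prob.
  rewrite -natrM mulnb; apply: le_natbool => /f1; rewrite (negbTE H0F) orFb.
  by case/and3P => _ -> ->.
apply: le_trans (compare_lottery (phi := fun S => (HS S)%:R) _) _; first by move=> S; rewrite ler0n.
apply: le_bexp => [|B]; first exact: eprob_prob.
rewrite -natrM mulnb; apply: le_natbool => /andP[/andP[gB WB] hW].
exact: f2.
Qed.

End Step.

Lemma hybrid_all l : uniq l ->
  bexp eprob (fun A => (hits T (hybrid [::] A))%:R) <=
  bexp eprob (fun A => (hits T (hybrid l A))%:R).
Proof.
elim: l => [//|Q l IH /= /andP[Ql /IH {}IH]].
exact: le_trans IH (hybrid_step Ql).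
Qed.

Local Notation JC := ((V + V * V) + J)%type.

Let vert (j : JC) : V := match j with
  | inl (inl v) => v | inl (inr uv) => uv.2
  | inr (inl (inl v)) => v | inr (inl (inr uv)) => uv.2
  | inr (inr (inl v)) => v | inr (inr (inr qv)) => qv.2 end.
(** Every coordinate, edges included, is owned by the vertex that it may activate. *)
Let part v : {set JC} := [set j | vert j == v].
Let cprob (p : R) (G : V -> V -> R) (j : JC) : R :=
  match j with inl j => gprob p G j | inr j => eprob j end.
Let asys (A : {set JC}) := gsys K (occ_of (inl @^-1: A)) (dir (inl @^-1: A)).
Let esys l (A : {set JC}) := hybrid l (inr @^-1: A).

Let part_disj u v : u != v -> [disjoint part u & part v].
Proof.
move=> uv; rewrite -setI_eq0; apply/eqP/setP => j; rewrite !inE.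
by apply/negbTE/negP => /andP[/eqP->]; rewrite (negbTE uv).
Qed.

Let asys_part (A : {set JC}) v S : asys A v S = asys (A :&: part v) v S.
Proof.
rewrite /asys /gsys /occ_of /dir !inE /= eqxx andbT; congr (_ && (_ || _)).
by apply: eq_existsb => u; rewrite !inE /= eqxx andbT.
Qed.

Let esys_part l (A : {set JC}) v S : esys l A v S = esys l (A :&: part v) v S.
Proof.
rewrite /esys /hybrid /en /rg /db /wb /ed !inE /= !eqxx !andbT; congr ((_ || _) && _ || _).
  by apply: eq_existsb => u; rewrite !inE /= eqxx andbT.
by apply: eq_existsb => Q; rewrite !inE /= eqxx andbT.
Qed.

Let asys_exp p G (f : (V -> {set V} -> bool) -> R) :
  bexp (cprob p G) (fun A : {set JC} => f (asys A)) =
  bexp (gprob p G) (fun A : {set (V + V * V)} => f (gsys K (occ_of A) (dir A))).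
Proof.
by rewrite /asys (bexp_marginal (@inl_inj _ _) _ (fun A : {set (V + V * V)} => f (gsys K (occ_of A) (dir A)))).
Qed.

Let esys_exp p G l (f : (V -> {set V} -> bool) -> R) :
  bexp (cprob p G) (fun A : {set JC} => f (esys l A)) = bexp eprob (fun A => f (hybrid l A)).
Proof. by rewrite /esys (bexp_marginal (@inr_inj _ _) _ (fun A => f (hybrid l A))). Qed.

Let cprob_prob p G : is_prob (gprob p G) -> is_prob (cprob p G).
Proof. by move=> pG [j|j]; [exact: pG|exact: eprob_prob]. Qed.

Let en_exp v S : bexp eprob (fun A => (en A v S)%:R) =
  if v \in K then 1 else 1 - \prod_(u in S) (1 - F u v).
Proof.
rewrite /en; case: ifP => vK; first by rewrite bexp_cst.
have ii : injective (fun u : V => inl (inr (u, v)) : J) by move=> ? ? [].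
pose S' := [set u in S | 0 < F u v].
rewrite (eq_bexp _ (G := fun A => 1 - [disjoint A & [set inl (inr (u, v)) | u in S']]%:R)).
  rewrite bexpB bexp_cst bexp_avoid; congr (_ - _).
  rewrite big_imset /=; last by move=> ? ? _ _; exact: ii.
  rewrite [RHS](bigID (fun u => 0 < F u v)) /= [X in _ = _ * X]big1 ?mulr1.
    by apply: eq_bigl => u; rewrite inE.
  move=> u /andP[_]; have /andP[F0 _] := F01 u v.
  by rewrite -leNgt => F0'; rewrite (@le_anti _ _ (F u v) 0) ?subr0 // F0 F0'.
move=> A; rewrite orFb; case: existsP => [[u /and3P[uS Fu uA]]|nu].
  suff /negbTE -> : ~~ [disjoint A & [set inl (inr (u, v)) | u in S']] by rewrite subr0.
  by apply/pred0Pn; exists (inl (inr (u, v))); rewrite /= uA imset_f // inE uS.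
suff -> : [disjoint A & [set inl (inr (u, v)) | u in S']] by rewrite subrr.
apply/pred0P => j /=; apply/negP => /andP[jA /imsetP[u]]; rewrite inE => /andP[uS Fu] ju.
by apply: nu; exists u; rewrite uS /ed Fu -ju.
Qed.

Let en_itv v S : 0 <= bexp eprob (fun A => (en A v S)%:R) <= 1.
Proof.
apply/andP; split; first by apply: bexp_ge0 => [|A]; [exact: eprob_prob|exact: ler0n].
rewrite -[leRHS](bexp_cst eprob); apply: le_bexp => [|A]; first exact: eprob_prob.
by rewrite lern1 leq_b1.
Qed.

Lemma hybrid_nil_prob v S : bexp eprob (fun A => (hybrid [::] A v S)%:R) =
  (1 - (1 - s * piB) * (1 - piD)) * bexp eprob (fun A => (en A v S)%:R).
Proof.
pose P2 : {set J} := [set inl (inl v); inr (inl v)].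
rewrite (eq_bexp _ (G := fun A => (1 - [disjoint A & P2]%:R) * (en A v S)%:R)).
  rewrite (@bexp_indep _ _ _ P2).
  - by rewrite bexpB bexp_cst bexp_avoid big_setU1 ?inE //= big_set1.
  - by move=> A; congr (1 - (nat_of_bool _)%:R); rewrite -!setI_eq0 -setIA setIid.
  - move=> A; congr ((nat_of_bool _)%:R); rewrite /en; congr (_ || _).
    by apply: eq_existsb => u; rewrite /ed !inE /= andbT.
move=> A; rewrite /hybrid /=.
have -> : [exists Q : Bl, [&& Q \in [::], wb A Q v & twice v S]] = false.
  by apply/negbTE/negP => /existsP[Q].
rewrite orbF andbT.
have -> : [disjoint A & P2] = ~~ (rg A v || db A v).
  apply/pred0P/norP => [H|[nr nd] j /=].
    have := H (inl (inl v)); have := H (inr (inl v)); rewrite /= /P2 !inE !eqxx !andbT.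
    by rewrite /rg /db => -> ->.
  apply/negP => /andP[jA]; rewrite /P2 !inE => /orP[]/eqP ej; rewrite ej in jA.
    by rewrite /rg jA in nr.
  by rewrite /db jA in nd.
by case: (en _ _ _); case: (rg _ _ || _); rewrite /= ?subrr ?subr0 ?mulr1 ?mulr0.
Qed.

(** A union bound: either the regular occupation and an edge, or one of the at most [kap] lotteries
    in which [v] takes part. *)
Lemma hybrid_all_prob v S : bexp eprob (fun A => (hybrid (enum Bl) A v S)%:R) <=
  s * piB * bexp eprob (fun A => (en A v S)%:R) + (twice v S)%:R * (kap%:R * piW).
Proof.
have ePP := eprob_prob.
pose r1 : J := inl (inl v).
have -> : s * piB * bexp eprob (fun A => (en A v S)%:R) =
    bexp eprob (fun A => (r1 \in A)%:R * (en A v S)%:R).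
  rewrite (@bexp_indep _ _ _ [set r1]) ?bexp_mem //.
  - by move=> A; rewrite !inE eqxx andbT.
  - move=> A; congr ((nat_of_bool _)%:R); rewrite /en; congr (_ || _).
    by apply: eq_existsb => u; rewrite /ed !inE /= andbT.
pose Qv := [set Q | blk v \in reg Q].
apply: (@le_trans _ _ (bexp eprob (fun A => (r1 \in A)%:R * (en A v S)%:R +
    (twice v S)%:R * \sum_(Q in Qv) (inr (inr (Q, v)) \in A)%:R))).
  apply: le_bexp => // A.
  have [/orP[/andP[e o]|/existsP[Q /and3P[_ /andP[wA wR] t]]]|] := boolP (hybrid _ _ _ _); last first.
  - by move=> _; rewrite addr_ge0 ?mulr_ge0 ?ler0n ?sumr_ge0 // => *; exact: ler0n.
  - rewrite t mul1r (bigD1 Q) ?inE //= wA addrCA lerDl.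
    by rewrite addr_ge0 ?mulr_ge0 ?ler0n ?sumr_ge0 // => *; exact: ler0n.
  - have -> : r1 \in A by move: o; rewrite mem_enum andbF orbF.
    rewrite e mulr1 lerDl mulr_ge0 ?ler0n ?sumr_ge0 // => *; exact: ler0n.
rewrite bexpD lerD2l bexpZ ler_wpM2l ?ler0n // bexp_sum.
rewrite (eq_bigr (fun=> piW)); last by move=> Q _; rewrite bexp_mem.
rewrite sumr_const -[leLHS]mulr_natl ler_wpM2r ?ler_nat ?card_gER //.
by case/andP: piW01.
Qed.

(** The outer two of three comparisons are made vertex by vertex on the disjoint sum of both
    coordinate sets, where [le_piA] and [le_piW] are spent; the middle one is [hybrid_all]. *)
Theorem enhancement :
  bexp (gprob piA F) (fun A : {set (V + V * V)} => (hits T (gsys K (occ_of A) (dir A)))%:R) <=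
  bexp (gprob piB (fun u v => s * F u v)) (fun A : {set (V + V * V)} => (hits T (gsys K (occ_of A) (dir A)))%:R).
Proof.
have /andP[s0 s1] := s01; have /andP[b0 b1] := piB01; have /andP[k0 k1] := c01.
have sF u v : 0 <= s * F u v <= 1.
  by have /andP[? ?] := F01 u v; rewrite mulr_ge0 ?(ltW s0) //= mulr_ile1 // ltW.
have PA : is_prob (gprob piA F) by move=> [v|[u v]] /=.
have PB : is_prob (gprob piB (fun u v => s * F u v)) by move=> [v|[u v]] /=.
have em l (A : {set JC}) : monosys (esys l A) by exact: monosys_hybrid.
have am (A : {set JC}) : monosys (asys A) by exact: monosys_gsys.
apply: (@le_trans _ _ (bexp eprob (fun A => (hits T (hybrid [::] A))%:R))).
  rewrite -(asys_exp piA F (fun a => (hits T a)%:R)) -(esys_exp piA F [::] (fun a => (hits T a)%:R)).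
  apply: (@hits_domination _ _ _ _ _ (cprob_prob PA) asys (esys [::]) part) => // v S.
  rewrite (asys_exp piA F (fun a => (a v S)%:R)) (esys_exp piA F [::] (fun a => (a v S)%:R)).
  rewrite gsys_prob hybrid_nil_prob -en_exp; apply: ler_wpM2r le_piA.
  by case/andP: (en_itv v S).
apply: le_trans (hybrid_all (enum_uniq Bl)) _.
rewrite -(asys_exp piB (fun u v => s * F u v) (fun a => (hits T a)%:R)).
rewrite -(esys_exp piB (fun u v => s * F u v) (enum Bl) (fun a => (hits T a)%:R)).
apply: (@hits_domination _ _ _ _ _ (cprob_prob PB) (esys (enum Bl)) asys part) => // v S.
rewrite (asys_exp piB _ (fun a => (a v S)%:R)) (esys_exp piB _ _ (fun a => (a v S)%:R)).
apply: le_trans (hybrid_all_prob v S) _; rewrite gsys_prob en_exp.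
have c2 : 0 <= c0 * c0 <= 1 by rewrite mulr_ge0 ?(ltW k0) //= mulr_ile1 // ltW.
have /andP[c20 c21] := c2.
case: ifP => vK.
  (* On [K] the full [piB] is available, and it exceeds [s * piB] by at least the cost of the
     specials. *)
  rewrite /twice vK /= mul1r !mulr1.
  have : s * piB * (1 - s) * (c0 * c0) <= 1 * piB * (1 - s) * 1.
    apply: ler_pM => //; first by rewrite !mulr_ge0 ?subr_ge0 // ltW.
    by rewrite !ler_wpM2r ?subr_ge0 ?(ltW s1).
  have := le_piW; lra.
have s01' : 0 <= s <= 1 by rewrite !ltW.
have F01' i : 0 <= F i v <= 1 by exact: F01.
have [/orP[|/existsP[u /andP[uS /existsP[w /andP[wS /and3P[uw cu cw]]]]]]|_] := boolP (twice v S).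
- by rewrite vK.
- have H := prod_compl_scale2 F01' s01' uS wS uw.
  have cc : c0 * c0 <= F u v * F w v by rewrite ler_pM // ltW.
  rewrite mul1r; set p := \prod_(i in _) (1 - F _ _) in H *; set q := \prod_(i in _) _ in H *.
  have M : piB * (q + s * (1 - s) * (F u v * F w v)) <= piB * (1 - s + s * p) by rewrite ler_wpM2l.
  have N : piB * (s * (1 - s)) * (c0 * c0) <= piB * (s * (1 - s)) * (F u v * F w v).
    by rewrite ler_wpM2l // !mulr_ge0 ?subr_ge0 // ltW.
  have := le_piW; nra.
- have H := prod_compl_scale S F01' s01'; rewrite mul0r addr0.
  set p := \prod_(i in _) (1 - F _ _) in H *; set q := \prod_(i in _) _ in H *.
  have M : piB * q <= piB * (1 - s + s * p) by rewrite ler_wpM2l.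
  nra.
Qed.
End Enhancement.

(** * Percolation on a grid of cells *)

(** The distance between [a] and [b]; one of the two truncated differences is 0. *)
Definition dn (a b : nat) : nat := (a - b + (b - a))%N.

Lemma dnC a b : dn a b = dn b a. Proof. by rewrite /dn addnC. Qed.

Lemma dn_div_lt b i j k : (0 < b)%N -> (dn (i %/ b) (j %/ b) <= k)%N -> (dn i j < k.+1 * b)%N.
Proof.
move=> b0; rewrite /dn => H.
have hi := divn_eq i b; have hj := divn_eq j b.
have mi := ltn_pmod i b0; have mj := ltn_pmod j b0.
set p := (i %/ b)%N in H hi; set q := (j %/ b)%N in H hj.
set r := (i %% b)%N in hi mi; set t := (j %% b)%N in hj mj.
rewrite hi hj {hi hj}.
have h1 : (p * b <= (q + k) * b)%N by rewrite leq_mul2r; lia.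
have h2 : (q * b <= (p + k) * b)%N by rewrite leq_mul2r; lia.
rewrite mulnDl in h1; rewrite mulnDl in h2; rewrite mulSn; lia.
Qed.

Lemma dn_div_le b i j k : (0 < b)%N -> (dn i j <= k * b)%N -> (dn (i %/ b) (j %/ b) <= k)%N.
Proof.
move=> b0 H.
have aux x y : (x <= k * b + y)%N -> (x %/ b <= k + y %/ b)%N.
  by move=> h; rewrite -divnMDl // leq_div2r.
have := aux i j; have := aux j i; move: H; rewrite /dn; lia.
Qed.

Lemma dn_half z x c : (dn z x <= c -> dn (z + x)./2 x <= c)%N.
Proof. by rewrite /dn; lia. Qed.

Lemma dn_half_near z x w b : (0 < b)%N -> (dn w (z + x)./2 <= 2 * b)%N ->
  (dn z w <= (dn z x)./2 + 4 * b)%N /\ (dn x w <= (dn z x)./2 + 4 * b)%N.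
Proof. by rewrite /dn; lia. Qed.

Section Grid.
Variables (R : realFieldType) (N0 b k l m : nat) (F0 : nat -> nat -> R) (c0 : R).

Definition side := ((2 * N0) * b)%N.
Definition cell := ('I_side * 'I_side)%type.
Definition block := ('I_(2 * N0) * 'I_(2 * N0))%type.

Lemma block_lt (i : 'I_side) : (i %/ b < 2 * N0)%N.
Proof.
case: i => i /=; rewrite /side; case: (posnP b) => [->|b0]; first by rewrite muln0.
by rewrite ltn_divLR.
Qed.

Definition blk (v : cell) : block := (Ordinal (block_lt v.1), Ordinal (block_lt v.2)).
Definition mid_band (r : nat) (p : nat) : bool := (N0 - r <= p < N0 + r)%N.
Definition start : {set cell} := [set v : cell | mid_band k (v.1 %/ b) && mid_band k (v.2 %/ b)].
Definition target : {set cell} := [set v : cell | ~~ (mid_band l (v.1 %/ b) && mid_band l (v.2 %/ b))].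
Definition gF (u v : cell) : R := F0 (dn u.1 v.1) (dn u.2 v.2).

Lemma gF_sym u v : gF u v = gF v u. Proof. by rewrite /gF !(dnC u.1) !(dnC u.2). Qed.

(** The infection starts at a midpoint up to [m] blocks away from [x], itself up to [m] blocks away
    from [Q]; the 3 leaves room for the neighbouring blocks visited on the way. *)
Definition rad := (2 * m + 3)%N.
Definition region (Q : block) : {set block} := [set B : block | (dn B.1 Q.1 <= rad) && (dn B.2 Q.2 <= rad)]%N.

Hypothesis b_gt0 : (0 < b)%N.

Lemma card_block (B : block) : #|[set v | blk v == B]| = (b * b)%N.
Proof.
have lt (p : 'I_(2 * N0)) (r : 'I_b) : (p * b + r < side)%N.
  case: p r => p hp [r hr] /=; rewrite /side.
  apply: (@leq_trans (p.+1 * b)); first by rewrite mulSn; lia.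
  by rewrite leq_mul2r hp orbT.
pose f (r : 'I_b * 'I_b) : cell := (Ordinal (lt B.1 r.1), Ordinal (lt B.2 r.2)).
have finj : injective f.
  move=> [r1 r2] [t1 t2] [e1 e2]; congr (_, _); apply: val_inj => /=; lia.
have -> : [set v | blk v == B] = f @: [set: 'I_b * 'I_b].
  apply/setP => -[i j]; rewrite inE; apply/eqP/imsetP => [e|[[r1 r2] _ e]].
    exists (Ordinal (ltn_pmod i b_gt0), Ordinal (ltn_pmod j b_gt0)); first by rewrite inE.
    rewrite /f -e /=; congr (_, _); apply: val_inj => /=; exact: divn_eq.
  move: e; rewrite /f /= => -[-> ->]; rewrite [RHS]surjective_pairing /blk /=.
  by congr (_, _); apply: val_inj => /=; rewrite divnMDl // divn_small ?addn0.
by rewrite card_imset // cardsT card_prod !card_ord.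
Qed.

Lemma card_region (Q : block) : (#|region Q| <= (2 * rad).+1 ^ 2)%N.
Proof.
have lt (p q : 'I_(2 * N0)) : (dn p q <= rad -> p + rad - q < (2 * rad).+1)%N by rewrite /dn; lia.
pose g (B : block) : 'I_(2 * rad).+1 * 'I_(2 * rad).+1 := (inord (B.1 + rad - Q.1), inord (B.2 + rad - Q.2)).
have ginj : {in region Q &, injective g}.
  move=> [p q] [p' q']; rewrite !inE /= => /andP[h1 h2] /andP[h3 h4] [e1 e2].
  have := congr1 val e1; have := congr1 val e2; rewrite /= !inordK ?lt // => e4 e3.
  by congr (_, _); apply: val_inj => /=; move: h1 h2 h3 h4; rewrite /dn; lia.
rewrite -(card_in_imset ginj); apply: leq_trans (max_card _) _.
by rewrite card_prod !card_ord.
Qed.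

Hypothesis k_gt0 : (0 < k)%N.
Hypothesis kN : (k <= N0)%N.
Hypothesis lN : (l + m + rad < N0)%N.
Hypothesis F0_mono : forall x x' y y', (x <= x')%N -> (y <= y')%N -> F0 x' y' <= F0 x y.
Hypothesis F0_range : forall x y, 0 < F0 x y -> (x <= m * b)%N /\ (y <= m * b)%N.
Hypothesis F0_mid : forall x y, 0 < F0 x y -> c0 <= F0 (x./2 + 4 * b)%N (y./2 + 4 * b)%N.

(** A cluster vertex [x] and its cluster neighbour [z] both see the blocks around their midpoint
    with probability at least [c0], so all specials of these nine blocks satisfy [twice]. From then
    on, specials in two adjacent blocks infect all specials nearby, and the infected square moves
    block by block to [Q]. If [x] is in [start], the specials of [start] begin the infection. *)
Lemma grid_trigger (Q : block) (x v : cell) (C W : {set cell}) :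
  blk v = Q -> x \in C -> x \notin target -> 0 < gF x v ->
  (x \in start \/ exists2 z, z \in C & (z != x) && (0 < gF z x)) ->
  (forall B, B \in region Q -> exists2 w, w \in W & blk w = B) ->
  (forall w, w \in W -> twice gF c0 start w C -> w \in C) ->
  forall w, w \in W -> blk w = Q -> w \in C.
Proof.
move=> vQ xC xT Fxv par Wreg WC.
have [/(dn_div_le b_gt0) h1 /(dn_div_le b_gt0) h2] := F0_range Fxv.
move Eq1: (v.1 %/ b)%N h1 => q1 h1; move Eq2: (v.2 %/ b)%N h2 => q2 h2.
move Ex1: (x.1 %/ b)%N h1 => x1 h1; move Ex2: (x.2 %/ b)%N h2 => x2 h2.
have xin : mid_band l x1 && mid_band l x2 by move: xT; rewrite inE negbK Ex1 Ex2.
(* The bond from [x] to [v] has positive probability, hence so has [F0 0 0], and [F0_mid] at the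
   offset 0 gives [c0] for all offsets up to [4 * b]. *)
have near0 y y' : (y <= 4 * b)%N -> (y' <= 4 * b)%N -> c0 <= F0 y y'.
  move=> hy hy'; apply: le_trans (F0_mono hy hy'); apply: (@F0_mid 0%N 0%N).
  exact: lt_le_trans Fxv (F0_mono (leq0n _) (leq0n _)).
have spec p q : (dn p q1 <= rad)%N -> (dn q q2 <= rad)%N ->
    exists w, [/\ w \in W, (w.1 %/ b)%N = p & (w.2 %/ b)%N = q].
  move=> hp hq.
  have bp : (p < 2 * N0)%N by move: xin lN hp h1; clear; rewrite /mid_band /dn; lia.
  have bq : (q < 2 * N0)%N by move: xin lN hq h2; clear; rewrite /mid_band /dn; lia.
  have [|w wW [<- <-]] := Wreg (Ordinal bp, Ordinal bq); last by exists w.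
  by rewrite inE -vQ /= Eq1 Eq2 hp hq.
pose Pb p q := forall w, w \in W -> (w.1 %/ b)%N = p -> (w.2 %/ b)%N = q -> w \in C.
have two u1 u2 w : u1 \in C -> u2 \in C -> u1 != u2 -> c0 <= gF u1 w -> c0 <= gF u2 w ->
    twice gF c0 start w C.
  move=> c1 c2 ne f1 f2; apply/orP; right; apply/existsP; exists u1; rewrite c1 /=.
  by apply/existsP; exists u2; rewrite c2 ne f1 f2.
have nearF (u w : cell) : (dn (u.1 %/ b) (w.1 %/ b) <= 3)%N -> (dn (u.2 %/ b) (w.2 %/ b) <= 3)%N ->
    c0 <= gF u w.
  by move=> /(dn_div_lt b_gt0)/ltnW a1 /(dn_div_lt b_gt0)/ltnW a2; apply: near0.
(* two specials of horizontally adjacent blocks infect all specials nearby *)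
have infect p p' q r t u1 u2 : u1 \in C -> u2 \in C -> (u1.1 %/ b)%N = p -> (u1.2 %/ b)%N = q ->
   (u2.1 %/ b)%N = p' -> (u2.2 %/ b)%N = q -> p <> p' -> (dn p p' <= 1)%N ->
   (dn r p <= 2)%N -> (dn t q <= 2)%N -> Pb r t.
  move=> c1 c2 e1 e2 e3 e4 ne dp dr dt w wW w1 w2; apply: WC => //; apply: (two u1 u2) => //.
  - by apply: contra_notN ne => /eqP e; rewrite -e1 -e3 e.
  - by apply: nearF; rewrite ?e1 ?e2 ?w1 ?w2; move: dr dt; clear; rewrite /dn; lia.
  - by apply: nearF; rewrite ?e3 ?e4 ?w1 ?w2; move: dp dr dt; clear; rewrite /dn; lia.
pose P9 p q := forall r t, (dn r p <= 1)%N -> (dn t q <= 1)%N -> Pb r t.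
(* The bound [rad.-1] keeps the 3 by 3 square around [(p, q)] inside the region, where every block
   is known to hold a special. *)
have base : exists p q, [/\ (dn p q1 <= rad.-1)%N, (dn q q2 <= rad.-1)%N & P9 p q].
  case: par => [xK|[z zC /andP[zx Fzx]]].
    have xK' : mid_band k x1 && mid_band k x2 by move: xK; rewrite inE Ex1 Ex2.
    have [x1' [x1'K ne dx]] : exists p, [/\ mid_band k p, x1 <> p & (dn x1 p <= 1)%N].
      case: (ltnP x1 N0) => hx; [exists x1.+1|exists x1.-1];
        by move: xK' hx k_gt0 kN; clear; rewrite /mid_band /dn; split; lia.
    exists x1, x2; split; [by move: h1; clear; rewrite /rad; lia|by move: h2; clear; rewrite /rad; lia|].
    have [u1 [uW1 e1 e2]] : exists w, [/\ w \in W, (w.1 %/ b)%N = x1 & (w.2 %/ b)%N = x2].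
      by apply: spec; move: h1 h2; clear; rewrite /rad; lia.
    have [u2 [uW2 e3 e4]] : exists w, [/\ w \in W, (w.1 %/ b)%N = x1' & (w.2 %/ b)%N = x2].
      by apply: spec; move: dx h1 h2; clear; rewrite /rad /dn; lia.
    have uC u : u \in W -> u \in start -> u \in C.
      by move=> uW us; apply: WC => //; rewrite /twice us.
    have u1C : u1 \in C by apply: uC => //; rewrite inE e1 e2.
    have u2C : u2 \in C.
      by apply: uC => //; rewrite inE e3 e4 x1'K /=; case/andP: xK'.
    by move=> r t hr ht; apply: (infect x1 x1' x2 r t u1 u2) => //; move: hr ht; clear; lia.
  have [r1 r2] := F0_range Fzx.
  pose i1 := ((z.1 + x.1)./2)%N; pose i2 := ((z.2 + x.2)./2)%N.
  exists (i1 %/ b)%N, (i2 %/ b)%N.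
  have d1 : (dn (i1 %/ b) x1 <= m)%N.
    by rewrite -Ex1; apply: dn_div_le => //; exact: dn_half.
  have d2 : (dn (i2 %/ b) x2 <= m)%N.
    by rewrite -Ex2; apply: dn_div_le => //; exact: dn_half.
  split; [by move: d1 h1; clear; rewrite /rad /dn; lia|by move: d2 h2; clear; rewrite /rad /dn; lia|].
  move=> r t hr ht w wW wr wt; apply: WC => //.
  rewrite -wr in hr; rewrite -wt in ht.
  have /ltnW a1 := dn_div_lt b_gt0 hr; have /ltnW a2 := dn_div_lt b_gt0 ht.
  have mid := F0_mid Fzx.
  have [n1 n1'] := dn_half_near b_gt0 a1; have [n2 n2'] := dn_half_near b_gt0 a2.
  by apply: (two z x) => //; apply: le_trans mid (F0_mono _ _).
have step p q p' q' : (dn p q1 <= rad.-1)%N -> (dn q q2 <= rad.-1)%N -> P9 p q ->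
    (dn p' p <= 1)%N -> (dn q' q <= 1)%N -> P9 p' q'.
  move=> hp hq P dp dq r t hr ht.
  (* A horizontal neighbour of [p], chosen so as not to leave the region around [Q]. *)
  pose p2 := if (q1 < p)%N then p.-1 else p.+1.
  have hp2 : (dn p2 q1 <= rad)%N /\ p <> p2 /\ (dn p p2 <= 1)%N.
    by move: hp; rewrite /p2; clear; rewrite /dn /rad; case: ifP; lia.
  case: hp2 => hp2 [ne dp2].
  have [u1 [uW1 e1 e2]] : exists w, [/\ w \in W, (w.1 %/ b)%N = p & (w.2 %/ b)%N = q].
    by apply: spec; move: hp hq; clear; rewrite /rad; lia.
  have [u2 [uW2 e3 e4]] : exists w, [/\ w \in W, (w.1 %/ b)%N = p2 & (w.2 %/ b)%N = q].
    by apply: spec => //; move: hq; clear; rewrite /rad; lia.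
  have u1C : u1 \in C by apply: (P p q) => //; clear; rewrite /dn; lia.
  have u2C : u2 \in C by apply: (P p2 q) => //; move: dp2; clear; rewrite /dn; lia.
  by apply: (infect p p2 q r t u1 u2) => //; move: dp dq hr ht; clear; rewrite /dn; lia.
have walk d : forall p q, (dn p q1 <= d)%N -> (dn q q2 <= d)%N ->
    (dn p q1 <= rad.-1)%N -> (dn q q2 <= rad.-1)%N -> P9 p q -> P9 q1 q2.
  elim: d => [|d IH] p' q' dp dq rp rq Ppq.
    by have [-> ->] : q1 = p' /\ q2 = q' by move: dp dq; clear; rewrite /dn; lia.
  pose mv y z := (if (y < z) then y.+1 else if (z < y) then y.-1 else y)%N.
  have mv1 y z : (dn y z <= d.+1 -> dn (mv y z) z <= d)%N.
    by rewrite /mv; clear; rewrite /dn; case: ifP; [|case: ifP]; lia.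
  have mv2 y z e : (dn y z <= e -> dn (mv y z) z <= e)%N.
    by rewrite /mv; clear; rewrite /dn; case: ifP; [|case: ifP]; lia.
  have mv3 y z : (dn (mv y z) y <= 1)%N.
    by rewrite /mv; clear; rewrite /dn; case: ifP; [|case: ifP]; lia.
  apply: (IH (mv p' q1) (mv q' q2)); rewrite ?mv1 ?mv2 //.
  by apply: step Ppq _ _ => //.
case: base => p [q [hp hq P9pq]].
move=> w wW wQ; have := walk _ _ _ (leq_addr _ _) (leq_addl _ _) hp hq P9pq.
move=> /(_ q1 q2); apply; rewrite ?/dn ?subnn //.
- by move/(congr1 (fun B : block => val B.1)): wQ; rewrite -vQ /= Eq1.
- by move/(congr1 (fun B : block => val B.2)): wQ; rewrite -vQ /= Eq2.
Qed.

Lemma blk_start v w : blk v = blk w -> v \in start -> w \in start.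
Proof. by move=> [e1 e2]; rewrite !inE e1 e2. Qed.

Theorem grid_enhancement (s piA piB piD piW : R) :
  (forall x y, 0 <= F0 x y <= 1) -> 0 < c0 <= 1 -> 0 < s < 1 ->
  0 <= piA <= 1 -> 0 <= piB <= 1 -> 0 <= piD <= 1 -> 0 <= piW <= 1 ->
  piA <= 1 - (1 - s * piB) * (1 - piD) ->
  ((2 * rad).+1 ^ 2)%:R * piW <= s * piB * (1 - s) * (c0 * c0) ->
  piD <= (1 - (1 - piW) ^+ (b * b)) ^+ ((2 * rad).+1 ^ 2) * piW * (1 - piW) ^+ (b * b) ->
  bexp (gprob piA gF) (fun A => (hits target (gsys start (occ_of A) (und A)))%:R) <=
  bexp (gprob piB (fun u v => s * gF u v))
    (fun A => (hits target (gsys start (occ_of A) (und A)))%:R).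
Proof.
move=> F01 c01 s01 A01 B01 D01 W01 hA hW hD.
have sF u v : 0 <= s * gF u v <= 1.
  have /andP[s0 s1] := s01; have /andP[f0 f1] := F01 (dn u.1 v.1) (dn u.2 v.2).
  by rewrite mulr_ge0 ?(ltW s0) //= mulr_ile1 // ltW.
have PA : is_prob (gprob piA gF) by move=> [v|[u v]] /=; last exact: F01.
have PB : is_prob (gprob piB (fun u v => s * gF u v)) by move=> [v|[u v]] /=.
rewrite !undirected_directed //; [|by move=> u v; rewrite gF_sym|exact: gF_sym].
apply: (@enhancement _ _ _ blk region gF c0 s piA piB piD piW start target (b * b)
  ((2 * rad).+1 ^ 2)) => //.
- by move=> u v; exact: F01.
- exact: blk_start.
- exact: card_block.
- by move=> Q; rewrite inE /dn !subnn.
- exact: card_region.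
- move=> B; apply: leq_trans (card_region B); apply/eq_leq/eq_card => Q.
  by rewrite !inE ![dn Q.1 _]dnC ![dn Q.2 _]dnC.
- exact: grid_trigger.
Qed.

End Grid.

(** * First-moment bound for small densities *)

Section Subcritical.
Variables (R : realFieldType) (V : finType) (K T : {set V}) (pi : R) (F : V -> V -> R).
Hypothesis PF : is_prob (gprob pi F).
Local Notation E := (bexp (gprob pi F)).
Implicit Types A : {set (V + V * V)}.
Let sys A := gsys K (occ_of A) (dir A).
Let reach v := E (fun A => (v \in active (sys A))%:R).

Let sysm A : monosys (sys A). Proof. exact: monosys_gsys. Qed.

(** By [active_force], the activation of [v] is decided by the cluster built without [v], which is
    independent of the coordinates entering [v]. A union bound over the last edge then gives the
    recursion of a branching process. *)
Let reach_rec v : reach v <= (v \in K)%:R * pi + \sum_u reach u * (pi * F u v).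
Proof.
pose C0 A := active (force (sys A) v false).
have vA A : (v \in active (sys A)) = sys A v (C0 A).
  rewrite (active_force v (@sysm A)) -/(C0 A); case: ifP => h.
    by rewrite activeE ?/force ?eqxx //; exact: monosys_force.
  by rewrite activeE ?/force ?eqxx //; exact: monosys_force.
have C0A A : C0 A \subset active (sys A).
  apply: active_mono => //; first exact: monosys_force.
  by move=> u S; rewrite /force; case: eqP.
have pi0 : 0 <= pi by have /andP[] := PF (inl v).
have F0 u : 0 <= F u v by have /andP[] := PF (inr (u, v)).
apply: (@le_trans _ _ (E (fun A => (v \in K)%:R * (inl v \in A)%:R +
   \sum_u (inl v \in A)%:R * (inr (u, v) \in A)%:R * (u \in C0 A)%:R))).
  apply: le_bexp => // A; rewrite vA /sys /gsys /occ_of.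
  have nn : 0 <= \sum_u (inl v \in A)%:R * (inr (u, v) \in A)%:R * (u \in C0 A)%:R :> R.
    by apply: sumr_ge0 => u _; rewrite !mulr_ge0 ?ler0n.
  move: nn; case: (inl v \in A) => /= nn; last by rewrite mulr0 add0r.
  rewrite mulr1; case: (boolP (v \in K)) => /= vK; first by rewrite lerDl.
  rewrite add0r; case: existsP => [[u /andP[uC uv]]|//].
  rewrite (bigD1 u) //= uC (_ : inr (u, v) \in A) // !mulr1 lerDl.
  by apply: sumr_ge0 => w _; rewrite !mulr_ge0 ?ler0n.
rewrite bexpD bexpZ bexp_mem lerD2l bexp_sum; apply: ler_sum => u _.
pose P : {set (V + V * V)} := [set inl v; inr (u, v)].
have C0P A : C0 A = C0 (A :&: ~: [set j | match j with inl w => w == v | inr uw => uw.2 == v end]).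
  apply: eq_active => w S; rewrite /force; case: eqP => // /eqP wv.
  rewrite /sys /gsys /occ_of !inE wv andbT; congr (_ && (_ || _)).
  by apply: eq_existsb => x; rewrite /dir !inE /= wv andbT.
rewrite (@bexp_indep _ _ _ [set j | match j with inl w => w == v | inr uw => uw.2 == v end]); last 2 first.
- by move=> A; rewrite !inE /= eqxx !andbT.
- by move=> A; rewrite -C0P.
rewrite (@bexp_indep _ _ _ [set inl v]) ?bexp_mem /=; last 2 first.
- by move=> A; rewrite !inE eqxx andbT.
- by move=> A; rewrite !inE andbT.
rewrite mulrC ler_wpM2r ?mulr_ge0 //; apply: le_bexp => // A; apply: le_natbool.
exact: (subsetP (C0A A)).
Qed.

(** The expected weight [Z] of the reached vertices bounds the probability of a hit and satisfies
    [Z <= sigma + theta * Z]. All sums are finite, so this can be solved for [Z]. *)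
Lemma subcritical_bound (psi : V -> R) (theta sigma : R) : theta < 1 ->
  (forall v, 0 <= psi v) -> (forall v, v \in T -> 1 <= psi v) ->
  (forall u, \sum_v pi * F u v * psi v <= theta * psi u) ->
  \sum_(v in K) pi * psi v <= sigma ->
  E (fun A => (hits T (gsys K (occ_of A) (dir A)))%:R) <= sigma / (1 - theta).
Proof.
move=> th1 psi0 psiT psiF psiK.
have reach0 v : 0 <= reach v by apply: bexp_ge0 => // A; exact: ler0n.
pose Z := \sum_v reach v * psi v.
have hitZ : E (fun A => (hits T (gsys K (occ_of A) (dir A)))%:R) <= Z.
  apply: (@le_trans _ _ (E (fun A => \sum_v (v \in active (sys A))%:R * psi v))).
    apply: le_bexp => // A.
    have nn (P : pred V) : 0 <= \sum_(v | P v) (v \in active (sys A))%:R * psi v.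
      by apply: sumr_ge0 => v _; rewrite mulr_ge0 ?ler0n.
    have [/pred0Pn[v /= /andP[va vT]]|_] := boolP (hits _ _); last exact: nn.
    rewrite (bigD1 v) //= va mul1r; apply: le_trans (psiT v vT) _.
    by rewrite lerDl; exact: nn.
  rewrite bexp_sum /Z; apply: ler_sum => v _; by rewrite bexpZr.
have ZE : Z <= sigma + theta * Z.
  apply: (@le_trans _ _ (\sum_v ((v \in K)%:R * pi + \sum_u reach u * (pi * F u v)) * psi v)).
    by apply: ler_sum => v _; rewrite ler_wpM2r // reach_rec.
  under eq_bigr => v _ do rewrite mulrDl.
  rewrite big_split /=; apply: lerD.
    apply: le_trans psiK; rewrite [leRHS]big_mkcond /=; apply: ler_sum => v _.
    by case: ifP; rewrite ?mul1r ?mul0r.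
  under eq_bigr => v _ do rewrite mulr_suml.
  rewrite exchange_big /= /Z mulr_sumr; apply: ler_sum => u _.
  under eq_bigr => v _ do rewrite -mulrA.
  by rewrite -mulr_sumr mulrCA ler_wpM2l.
apply: le_trans hitZ _; rewrite ler_pdivlMr ?subr_gt0 //; lra.
Qed.
End Subcritical.

Section LatticeSums.
Variable R : realFieldType.

(** Each distance occurs at most twice, once on either side of [i]. *)
Lemma sum_dn_le n (i : nat) (g : nat -> R) : (i < n)%N -> (forall a, 0 <= g a) ->
  \sum_(j < n) g (dn i j) <= 2 * \sum_(a < n) g a.
Proof.
move=> iN g0.
have tail p : (p <= n)%N -> \sum_(a < p) g a <= \sum_(a < n) g a.
  move=> pn; rewrite -!(big_mkord xpredT) (big_cat_nat _ pn) //= lerDl.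
  by apply: sumr_ge0.
rewrite -(big_mkord xpredT (fun j => g (dn i j))) (@big_cat_nat _ _ _ i) //=; last exact: ltnW.
rewrite mulr_natl mulr2n; apply: lerD.
  rewrite big_nat_rev /= add0n; apply: le_trans (tail i.+1 iN).
  rewrite -(big_mkord xpredT) [leRHS]big_nat_recl //= -{3}[i]subn0.
  apply: (@le_trans _ _ (\sum_(0 <= j < i) g j.+1)); last by rewrite lerDr.
  rewrite !big_nat; apply: ler_sum => j /andP[_ ji]; rewrite le_eqVlt; apply/orP; left.
  by apply/eqP; congr g; rewrite /dn; lia.
rewrite -{1}[i]add0n big_addn; apply: le_trans (tail (n - i)%N (leq_subr _ _)).
rewrite -(big_mkord xpredT); apply: ler_sum => j _; rewrite le_eqVlt; apply/orP; left.
by apply/eqP; congr g; rewrite /dn; lia.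
Qed.

Lemma sum_dn2_le n (u : 'I_n * 'I_n) (G : nat -> nat -> R) : (forall x y, 0 <= G x y) ->
  \sum_(v : 'I_n * 'I_n) G (dn u.1 v.1) (dn u.2 v.2) <= 4 * \sum_(x < n) \sum_(y < n) G x y.
Proof.
move=> G0; rewrite -(pair_bigA _ (fun i j : 'I_n => G (dn u.1 i) (dn u.2 j))) /=.
apply: (@le_trans _ _ (\sum_(i < n) 2 * \sum_(y < n) G (dn u.1 i) y)).
  by apply: ler_sum => i _; apply: (@sum_dn_le n u.2 (G (dn u.1 i))).
rewrite -mulr_sumr (_ : 4 = 2 * 2 :> R); last by ring.
rewrite -mulrA ler_wpM2l //.
by apply: (@sum_dn_le n u.1 (fun x => \sum_(y < n) G x y)) => // x; apply: sumr_ge0.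
Qed.
End LatticeSums.

Section GridSubcritical.
Variables (R : realFieldType) (N0 b k l m : nat) (F0 : nat -> nat -> R) (pi alpha mu z : R).
Hypothesis b_gt0 : (0 < b)%N.
Hypothesis F01 : forall x y, 0 <= F0 x y <= 1.
Hypothesis F0_range : forall x y, 0 < F0 x y -> (x <= m * b)%N /\ (y <= m * b)%N.
Hypothesis pi01 : 0 <= pi <= 1.
Hypothesis piE : pi * (b * b)%:R <= alpha.
Hypothesis z1 : 1 <= z.
Hypothesis zmu : z ^+ (2 * m) * mu < 1.
Hypothesis sumF : 4 * \sum_(x < side N0 b) \sum_(y < side N0 b) pi * F0 x y <= mu.

Lemma card_start : (#|start N0 b k| <= (2 * k) ^ 2 * (b * b))%N.
Proof.
have band : (#|[set i : 'I_(side N0 b) | mid_band N0 k (i %/ b)]| <= 2 * k * b)%N.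
  rewrite cardE -(size_map val) -[leqRHS](size_iota ((N0 - k) * b)); apply: uniq_leq_size.
    by rewrite map_inj_uniq ?enum_uniq //; exact: val_inj.
  move=> x /mapP[i]; rewrite mem_enum inE /mid_band => /andP[h1 h2] ->.
  rewrite mem_iota -mulnDl; move: h1 h2; rewrite leq_divRL // ltn_divLR // => -> /leq_trans; apply.
  by rewrite leq_mul2r; lia.
have -> : start N0 b k = setX [set i : 'I_(side N0 b) | mid_band N0 k (i %/ b)] [set i : 'I_(side N0 b) | mid_band N0 k (i %/ b)].
  by apply/setP => v; rewrite !inE.
by rewrite cardsX; apply: leq_trans (leq_mul band band) _; rewrite -mulnn; lia.
Qed.

(** The weight is [z] to the power of the block distance from the centre, normalized to be at least
    1 on the target. An edge spans at most [m] blocks in either coordinate, whence the loss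
    [z ^+ (2 * m)] that the slack in [mu < 1] has to absorb. *)
Lemma grid_subcritical :
  bexp (gprob pi (@gF R N0 b F0)) (fun A =>
     (hits (target N0 b l) (gsys (start N0 b k) (occ_of A) (und A)))%:R) <=
  (2 * k)%:R ^+ 2 * alpha * z ^+ (2 * k) / z ^+ l / (1 - z ^+ (2 * m) * mu).
Proof.
have z0 : 0 < z by apply: lt_le_trans z1.
have /andP[pi0 pi1] := pi01.
have FP : is_prob (gprob pi (@gF R N0 b F0)) by move=> [v|[u v]] /=; last exact: F01.
rewrite undirected_directed //; last exact: gF_sym.
pose D (v : cell N0 b) := (dn (v.1 %/ b) N0 + dn (v.2 %/ b) N0)%N.
pose psi v := z ^+ (D v) / z ^+ l.
have zl0 : 0 < z ^+ l by rewrite exprn_gt0.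
apply: (@subcritical_bound _ _ _ _ _ _ FP psi) => //.
- by move=> v; rewrite mulr_ge0 // ?invr_ge0 exprn_ge0 ?ltW.
- move=> v vT; rewrite ler_pdivlMr // mul1r; apply: ler_weXn2l => //.
  move: vT; rewrite inE /mid_band /D; move: (v.1 %/ b)%N (v.2 %/ b)%N.
  by clear; rewrite /dn; lia.
- move=> u; apply: (@le_trans _ _ (\sum_v pi * @gF R N0 b F0 u v * (z ^+ (2 * m) * psi u))).
    apply: ler_sum => v _.
    have /andP[f0 _] := F01 (dn u.1 v.1) (dn u.2 v.2).
    have [->|fn] := eqVneq (@gF R N0 b F0 u v) 0; first by rewrite mulr0 !mul0r.
    apply: ler_wpM2l; first by rewrite mulr_ge0.
    have fp : 0 < F0 (dn u.1 v.1) (dn u.2 v.2) by rewrite lt_def f0 andbT.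
    rewrite /psi mulrA -exprD; apply: ler_wpM2r; first by rewrite invr_ge0 ltW.
    apply: ler_weXn2l => //; have [/(dn_div_le b_gt0) + /(dn_div_le b_gt0)] := F0_range fp.
    rewrite /D; move: (u.1 %/ b)%N (u.2 %/ b)%N (v.1 %/ b)%N (v.2 %/ b)%N.
    by clear; rewrite /dn; lia.
  rewrite -mulr_suml mulrA; apply: ler_wpM2r.
    by rewrite mulr_ge0 // ?invr_ge0 exprn_ge0 ?ltW.
  rewrite mulrC; apply: ler_wpM2l; first by rewrite exprn_ge0 // ltW.
  apply: le_trans sumF; rewrite -mulr_sumr.
  under [X in 4 * X]eq_bigr => x _ do rewrite -mulr_sumr.
  rewrite -mulr_sumr mulrCA; apply: ler_wpM2l => //.
  by apply: (@sum_dn2_le R _ u) => x y; case/andP: (F01 x y).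
- apply: (@le_trans _ _ (\sum_(v in start N0 b k) pi * (z ^+ (2 * k) / z ^+ l))).
    apply: ler_sum => v vK; apply: ler_wpM2l => //; apply: ler_wpM2r; first by rewrite invr_ge0 ltW.
    apply: ler_weXn2l => //; move: vK; rewrite inE /mid_band /D; move: (v.1 %/ b)%N (v.2 %/ b)%N.
    by clear; rewrite /dn; lia.
  rewrite sumr_const -[leLHS]mulr_natr -[leRHS]mulrA; set w := z ^+ (2 * k) / _.
  have w0 : 0 <= w by rewrite mulr_ge0 // ?invr_ge0 exprn_ge0 ?ltW.
  rewrite mulrAC; apply: ler_wpM2r => //.
  apply: (@le_trans _ _ (pi * ((2 * k) ^ 2 * (b * b))%:R)).
    by apply: ler_wpM2l => //; rewrite ler_nat card_start.
  by rewrite natrM natrX mulrCA ler_wpM2l ?exprn_ge0 ?ler0n.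
Qed.
End GridSubcritical.

(** * Multiscale argument for site percolation *)

Section Hierarchy.
Variable occ : nat -> nat -> bool.
Local Open Scope nat_scope.

(* Multiscale goodness: a block of side 3^(j+1) is good when at most one of its
   nine sub-blocks of side 3^j is bad. *)
Fixpoint good j p q : bool := match j with
  | 0 => occ p q
  | j'.+1 => \sum_(a < 3) \sum_(c < 3) ~~ good j' (3 * p + a) (3 * q + c) <= 1
  end.

Lemma good_exception j p q : good j.+1 p q -> exists x y, forall a c, a < 3 -> c < 3 ->
  (a, c) <> (x, y) -> good j (3 * p + a) (3 * q + c).
Proof.
rewrite /= pair_bigA /= => le1.
case: (pickP (fun ac : 'I_3 * 'I_3 => ~~ good j (3 * p + ac.1) (3 * q + ac.2))) => [[x y] /= bxy|nb].
  exists x, y => a c a3 c3 ne; apply/negPn/negP => bac.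
  move: le1; rewrite (bigD1 (x, y)) //= bxy (bigD1 (Ordinal a3, Ordinal c3)) /=.
    by rewrite bac.
  by apply/eqP => -[ea ec]; apply: ne; rewrite -ea -ec.
exists 3, 3 => a c a3 c3 _; have := nb (Ordinal a3, Ordinal c3); by move=> /= /negbFE.
Qed.

Variable A : nat -> nat -> Prop.
Hypothesis A_step : forall p q p' q', occ p q -> A p q -> dn p p' <= 1 -> dn q q' <= 1 -> A p' q'.

(** With [A] read as being reached by the cluster, a block is reached when all its good sub-blocks
    are, recursively. Bad sub-blocks are exempt, since nothing is known to connect them. *)
Fixpoint main j p q : Prop := match j with
  | 0 => A p q
  | j'.+1 => forall a c, a < 3 -> c < 3 -> good j' (3 * p + a) (3 * q + c) ->
               main j' (3 * p + a) (3 * q + c)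
  end.

Definition adjacent p q p' q' := dn p p' + dn q q' == 1.

(** Rows and columns avoiding the exceptional position [(x, y)] are entirely good, and [(a2, c2)] is
    a crossing of two of them. Every good position communicates with this crossing; the exceptional
    one, if good, does so through a neighbour. *)
Lemma three_by_three (g X : nat -> nat -> Prop) x y a0 c0 a1 c1 :
  (forall a c, a < 3 -> c < 3 -> (a, c) <> (x, y) -> g a c) ->
  (forall a c a' c', a < 3 -> c < 3 -> a' < 3 -> c' < 3 -> adjacent a c a' c' ->
     g a c -> g a' c' -> X a c -> X a' c') ->
  a0 < 3 -> c0 < 3 -> a1 < 3 -> c1 < 3 -> g a0 c0 -> g a1 c1 ->
  X a0 c0 -> X a1 c1.
Proof.
move=> gxy XS a03 c03 a13 c13 g0 g1 X0.
have row a c c' : a < 3 -> c < 3 -> c' < 3 -> a <> x -> X a c -> X a c'.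
  move=> a3 c3 c3' ax.
  have st d d' : d < 3 -> d' < 3 -> dn d d' = 1 -> X a d -> X a d'.
    move=> d3 d3' dd; apply: XS => //; [by rewrite /adjacent /dn subnn -/(dn d d') dd| |];
    by apply: gxy => // -[].
  move=> Xc; have X1 : X a 1.
    by case: c c3 Xc => [|[|[|//]]] // _; apply: st.
  by case: c' c3' => [|[|[|//]]] // _; apply: (st 1).
have col c a a' : c < 3 -> a < 3 -> a' < 3 -> c <> y -> X a c -> X a' c.
  move=> c3 a3 a3' cy.
  have st d d' : d < 3 -> d' < 3 -> dn d d' = 1 -> X d c -> X d' c.
    move=> d3 d3' dd; apply: XS => //; [by rewrite /adjacent /dn subnn addn0 -/(dn d d') dd| |];
    by apply: gxy => // -[].
  move=> Xc; have X1 : X 1 c.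
    by case: a a3 Xc => [|[|[|//]]] // _; apply: st.
  by case: a' a3' => [|[|[|//]]] // _; apply: (st 1).
pose a2 := if x == 0 then 1 else 0. pose c2 := if y == 0 then 1 else 0.
have [a23 a2x] : a2 < 3 /\ a2 <> x by rewrite /a2; case: eqP; lia.
have [c23 c2y] : c2 < 3 /\ c2 <> y by rewrite /c2; case: eqP; lia.
have bad_free a c : a < 3 -> c < 3 -> g a c -> (a = x /\ c = y) \/ a <> x \/ c <> y.
  by move=> *; lia.
have X2 : X a2 c2.
  case: (bad_free _ _ a03 c03 g0) => [[ea ec]|[nx|ny]].
  - have nb : (dn a0 a2 = 1 \/ dn a0 a2 = 2) by rewrite /dn; move: a2x; rewrite -ea; lia.
    pose a' := if a0 == 1 then 0 else 1.
    have h' : a' < 3 /\ a' <> x /\ dn a0 a' = 1 by rewrite /a' /dn -ea; case: eqP; lia.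
    case: h' => h3 [hx hd]; apply: (col c2 a') => //; apply: (row a' c0) => //.
    apply: (XS a0 c0) => //; first by rewrite /adjacent hd /dn subnn.
    by apply: gxy => // -[].
  - by apply: (col c2 a0) => //; apply: (row a0 c0).
  - by apply: (row a2 c0) => //; apply: (col c0 a0).
case: (bad_free _ _ a13 c13 g1) => [[ea ec]|[nx|ny]].
- pose a' := if a1 == 1 then 0 else 1.
  have h' : a' < 3 /\ a' <> x /\ dn a' a1 = 1 by rewrite /a' /dn -ea; case: eqP; lia.
  case: h' => h3 [hx hd]; apply: (XS a' c1) => //; first by rewrite /adjacent hd /dn subnn.
    by apply: gxy => // -[].
  by apply: (row a' c2) => //; apply: (col c2 a2).
- by apply: (row a1 c2) => //; apply: (col c2 a2).
- by apply: (col c1 a2) => //; apply: (row a2 c2).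
Qed.

(** Along the common side of two blocks there are three pairs of facing sub-blocks. The two
    exceptions spoil at most two pairs, so a good pair remains to transmit the cluster. *)
Lemma main_adjacent j : forall p q p' q', adjacent p q p' q' ->
  good j p q -> good j p' q' -> main j p q -> main j p' q'.
Proof.
elim: j => [p q p' q' adj o _ m|j IH p q p' q' adj G G' M].
  by apply: A_step o m _ _; move: adj; rewrite /adjacent /dn; lia.
have [x [y Gxy]] := good_exception G; have [x' [y' Gxy']] := good_exception G'.
have inner p0 q0 x0 y0 a0 c0 a1 c1 : (forall a c, a < 3 -> c < 3 -> (a, c) <> (x0, y0) ->
    good j (3 * p0 + a) (3 * q0 + c)) -> a0 < 3 -> c0 < 3 -> a1 < 3 -> c1 < 3 ->
    good j (3 * p0 + a0) (3 * q0 + c0) -> good j (3 * p0 + a1) (3 * q0 + c1) ->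
    main j (3 * p0 + a0) (3 * q0 + c0) -> main j (3 * p0 + a1) (3 * q0 + c1).
  move=> H; apply: (@three_by_three (fun a c => good j (3 * p0 + a) (3 * q0 + c))
    (fun a c => main j (3 * p0 + a) (3 * q0 + c)) x0 y0) => //.
  by move=> a c a' c' a3 c3 a3' c3' ad; apply: IH; move: ad; rewrite /adjacent /dn; lia.
have [a0 [c0 [a1 [c1 [h1 h2 h3 h4]]]]] : exists a0 c0 a1 c1,
  [/\ [/\ a0 < 3, c0 < 3, a1 < 3 & c1 < 3],
      adjacent (3 * p + a0) (3 * q + c0) (3 * p' + a1) (3 * q' + c1),
      good j (3 * p + a0) (3 * q + c0) & good j (3 * p' + a1) (3 * q' + c1)].
  have [] : [\/ p' = p.+1 /\ q' = q, p = p'.+1 /\ q' = q | q' = q.+1 /\ p' = p \/ q = q'.+1 /\ p' = p].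
  - move: adj; rewrite /adjacent /dn => /eqP H.
    have : (p' = p.+1 /\ q' = q) \/ (p = p'.+1 /\ q' = q) \/ (q' = q.+1 /\ p' = p \/ q = q'.+1 /\ p' = p) by lia.
    by case=> [|[|]] *; [constructor 1|constructor 2|constructor 3].
  - move=> [ep eq]; have [t [t3 ty ty']] : exists t, [/\ t < 3, t <> y & t <> y'].
      by case: (eqVneq y 0) (eqVneq y' 0) => ? [] ?; [exists 1|exists (if y' == 1 then 2 else 1)
         |exists (if y == 1 then 2 else 1)|exists 0]; split=> //; try case: ifP => /eqP; lia.
    exists 2, t, 0, t; split; rewrite ?ep ?eq //; first by rewrite /adjacent /dn; lia.
      by apply: Gxy => // -[].
    by rewrite -ep -eq; apply: Gxy' => // -[].
  - move=> [ep eq]; have [t [t3 ty ty']] : exists t, [/\ t < 3, t <> y & t <> y'].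
      by case: (eqVneq y 0) (eqVneq y' 0) => ? [] ?; [exists 1|exists (if y' == 1 then 2 else 1)
         |exists (if y == 1 then 2 else 1)|exists 0]; split=> //; try case: ifP => /eqP; lia.
    exists 0, t, 2, t; split; rewrite ?ep ?eq //; first by rewrite /adjacent /dn; lia.
      by rewrite -ep; apply: Gxy => // -[].
    by rewrite -eq; apply: Gxy' => // -[].
  - have [t [t3 tx tx']] : exists t, [/\ t < 3, t <> x & t <> x'].
      by case: (eqVneq x 0) (eqVneq x' 0) => ? [] ?; [exists 1|exists (if x' == 1 then 2 else 1)
         |exists (if x == 1 then 2 else 1)|exists 0]; split=> //; try case: ifP => /eqP; lia.
    case=> -[eq ep].
      exists t, 2, t, 0; split; rewrite ?ep ?eq //; first by rewrite /adjacent /dn; lia.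
        by apply: Gxy => // -[].
      by rewrite -ep -eq; apply: Gxy' => // -[].
    exists t, 0, t, 2; split; rewrite ?ep ?eq //; first by rewrite /adjacent /dn; lia.
      by rewrite -eq; apply: Gxy => // -[].
    by rewrite -ep; apply: Gxy' => // -[].
case: h1 => a03 c03 a13 c13 a c a3 c3 gac.
apply: (inner p' q' x' y' a1 c1) => //.
by apply: (IH (3 * p + a0) (3 * q + c0)) => //; apply: M.
Qed.

Lemma main_inner j p q a0 c0 a1 c1 : good j.+1 p q -> a0 < 3 -> c0 < 3 -> a1 < 3 -> c1 < 3 ->
  good j (3 * p + a0) (3 * q + c0) -> good j (3 * p + a1) (3 * q + c1) ->
  main j (3 * p + a0) (3 * q + c0) -> main j (3 * p + a1) (3 * q + c1).
Proof.
move=> /good_exception[x [y H]].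
apply: (@three_by_three (fun a c => good j (3 * p + a) (3 * q + c))
    (fun a c => main j (3 * p + a) (3 * q + c)) x y) => //.
by move=> a c a' c' a3 c3 a3' c3' ad; apply: main_adjacent; move: ad; rewrite /adjacent /dn; lia.
Qed.

Lemma main_witness j : forall p q, good j p q -> main j p q -> exists p' q',
  [/\ occ p' q', A p' q', p * 3 ^ j <= p' & q * 3 ^ j <= q'].
Proof.
elim: j => [|j IH] p q G M; first by exists p, q; rewrite !muln1.
have [x [y H]] := good_exception G.
have [a [c [a3 c3 ne]]] : exists a c, [/\ a < 3, c < 3 & (a, c) <> (x, y)].
  by exists (if x == 0 then 1 else 0), 0; case: eqP => [->|]; split=> //; case; lia.
have g := H a c a3 c3 ne.
have [p' [q' [o A' hp hq]]] := IH _ _ g (M a c a3 c3 g).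
exists p', q'; split=> //.
  by apply: leq_trans hp; rewrite expnS mulnA leq_mul2r; lia.
by apply: leq_trans hq; rewrite expnS mulnA leq_mul2r; lia.
Qed.

(** The reached set is carried up the increasing blocks at the origin. In the largest one, some good
    sub-block other than the corner one contains a reached site, and any such sub-block is at
    distance [3 ^ (j0 + d)] at least. *)
Lemma hierarchy_escape j0 d : (forall p q, p < 3 ^ j0 -> q < 3 ^ j0 -> A p q) ->
  (forall i, i <= d.+1 -> good (j0 + i) 0 0) ->
  exists p q, [/\ occ p q, A p q & (3 ^ (j0 + d) <= p) || (3 ^ (j0 + d) <= q)].
Proof.
move=> A0 G.
have M0 : main j0 0 0.
  have gen j : forall p q, (forall p' q', p * 3 ^ j <= p' < p.+1 * 3 ^ j ->
     q * 3 ^ j <= q' < q.+1 * 3 ^ j -> A p' q') -> main j p q.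
    elim: j => [|j IH] p q H; first by apply: H; rewrite expn0 !muln1 leqnn ltnSn.
    move=> a c a3 c3 _; apply: IH => p' q' hp hq; apply: H; rewrite expnS; nia.
  by apply: gen => p q; rewrite !mul0n !mul1n /=; exact: A0.
have M i : i <= d.+1 -> main (j0 + i) 0 0.
  elim: i => [|i IH] hi; first by rewrite addn0.
  rewrite addnS => a c a3 c3 gac.
  have G1 := G i.+1 hi; rewrite addnS in G1.
  apply: (main_inner (a0 := 0) (c0 := 0) G1) => //; rewrite ?muln0 ?addn0.
    by apply: G; exact: ltnW.
  by apply: IH; exact: ltnW.
have G1 := G d.+1 (leqnn _); have M1 := M d.+1 (leqnn _); rewrite addnS in G1 M1.
have [x [y H]] := good_exception G1.
have [a [c [a3 c3 ne nz]]] : exists a c, [/\ a < 3, c < 3, (a, c) <> (x, y) & (0 < a) || (0 < c)].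
  case: (eqVneq x 1) => [->|nx]; first by exists 2, 0.
  by exists 1, 0; split=> // -[e _]; rewrite -e in nx.
have g := H a c a3 c3 ne.
have [p [q [o Apq hp hq]]] := main_witness g (M1 a c a3 c3 g).
exists p, q; split=> //; case/orP: nz => h; apply/orP; [left|right].
  by apply: leq_trans hp; rewrite leq_pmull // muln0.
by apply: leq_trans hq; rewrite leq_pmull // muln0.
Qed.
End Hierarchy.

Lemma good_local occ occ' j : forall p q,
  (forall p' q', p * 3 ^ j <= p' < p.+1 * 3 ^ j -> q * 3 ^ j <= q' < q.+1 * 3 ^ j ->
     occ p' q' = occ' p' q')%N -> good occ j p q = good occ' j p q.
Proof.
elim: j => [|j IH] p q H /=; first by apply: H; rewrite expn0 !muln1 leqnn ltnSn.
congr (_ <= _)%N; apply: eq_bigr => -[a a3] _; apply: eq_bigr => -[c c3] _ /=.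
congr (nat_of_bool (~~ _)); apply: IH => p' q' hp hq; apply: H; rewrite expnS; nia.
Qed.

Section GridSupercritical.
Variables (R : realFieldType) (N0 b k l : nat).
Hypothesis b_gt0 : (0 < b)%N.
Local Notation V := (cell N0 b).
Implicit Types A : {set V}.

(** Only the quadrant of blocks beyond [N0] in both coordinates is used: the hierarchy is indexed by
    naturals and grows from its corner. *)
Definition occb A p q : bool := [exists v in A, (v.1 %/ b == N0 + p)%N && (v.2 %/ b == N0 + q)%N].
Definition near_cells (u v : V) : bool := (dn (u.1 %/ b) (v.1 %/ b) <= 1)%N && (dn (u.2 %/ b) (v.2 %/ b) <= 1)%N.

Lemma good_sites_hit A j0 d : (3 ^ j0 <= k)%N -> (l <= 3 ^ (j0 + d))%N ->
  (forall i, (i <= d.+1)%N -> good (occb A) (j0 + i) 0 0) ->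
  hits (target N0 b l) (gsys (start N0 b k) (mem A) near_cells).
Proof.
move=> jk ld G; set sys := gsys _ _ _; have sm : monosys sys by exact: monosys_gsys.
pose B p q := forall v : V, v \in A -> (v.1 %/ b)%N = (N0 + p)%N -> (v.2 %/ b)%N = (N0 + q)%N ->
  v \in active sys.
have step p q p' q' : occb A p q -> B p q -> (dn p p' <= 1)%N -> (dn q q' <= 1)%N -> B p' q'.
  move=> /existsP[u /and3P[uA /eqP u1 /eqP u2]] Bpq dp dq v vA v1 v2.
  rewrite activeE // /sys /gsys /= vA; apply/orP; right; apply/existsP; exists u.
  rewrite (Bpq u) //= /near_cells u1 u2 v1 v2; move: dp dq; clear; rewrite /dn; lia.
have B0 p q : (p < 3 ^ j0)%N -> (q < 3 ^ j0)%N -> B p q.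
  move=> hp hq v vA v1 v2; rewrite activeE // /sys /gsys /= vA; apply/orP; left.
  rewrite inE v1 v2 /mid_band; move: hp hq jk; move: (3 ^ j0)%N; clear; lia.
have [p [q [/existsP[v /and3P[vA /eqP v1 /eqP v2]] Bpq pq]]] := hierarchy_escape step B0 G.
apply/pred0Pn; exists v; rewrite /= (Bpq v) // inE v1 v2 /mid_band.
move: pq ld; move: (3 ^ (j0 + d))%N; clear; lia.
Qed.

Variable rho : R.
Hypothesis rho01 : 0 <= rho <= 1.
Local Notation E := (bexp (fun _ : V => rho)).
Let rP : is_prob (fun _ : V => rho). Proof. by move=> ?. Qed.

Lemma occb_prob p q : (p < N0)%N -> (q < N0)%N ->
  E (fun A => (~~ occb A p q)%:R) = (1 - rho) ^+ (b * b).
Proof.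
move=> pN qN.
have p2 : (N0 + p < 2 * N0)%N by lia.
have q2 : (N0 + q < 2 * N0)%N by lia.
pose Q : block N0 := (Ordinal p2, Ordinal q2).
rewrite -(card_block b_gt0 Q) -prodr_const -bexp_avoid; apply: eq_bexp => A.
congr (_%:R); congr (nat_of_bool _); apply/existsPn/pred0P => [H v /=|H v].
  apply/negbTE/negP => /andP[vA]; rewrite inE => /eqP[e1 e2].
  by have := H v; rewrite vA e1 e2 !eqxx.
apply/negP => /and3P[vA /eqP e1 /eqP e2]; have := H v.
rewrite /= vA inE /= => /negbT/negP; apply; apply/eqP.
by congr (_, _); apply: val_inj.
Qed.

Let zone j p q : {set V} := [set v : V | (N0 + p * 3 ^ j <= v.1 %/ b < N0 + p.+1 * 3 ^ j)%N &&
  (N0 + q * 3 ^ j <= v.2 %/ b < N0 + q.+1 * 3 ^ j)%N].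

Let good_zone j p q A (P : {set V}) : zone j p q \subset P ->
  good (occb A) j p q = good (occb (A :&: P)) j p q.
Proof.
move=> /subsetP ZP; apply: good_local => p' q' hp hq; apply: eq_existsb => v; rewrite inE.
case: (boolP ((v.1 %/ b == N0 + p') && (v.2 %/ b == N0 + q'))%N); rewrite ?andbF // => /andP[/eqP e1 /eqP e2].
by rewrite (ZP v) ?andbT // inE e1 e2; move: hp hq; clear; move: (3 ^ j)%N => t; lia.
Qed.

(** A bad block has two bad sub-blocks among nine, and distinct sub-blocks are independent. Counting
    at most 81 ordered pairs, the bad probability at one scale is at most 81 times the square of the
    previous one; the factor 81 in the statement turns this into a pure squaring. *)
Lemma bad_prob j : forall p q, (p.+1 * 3 ^ j <= N0)%N -> (q.+1 * 3 ^ j <= N0)%N ->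
  81 * E (fun A => (~~ good (occb A) j p q)%:R) <= (81 * (1 - rho) ^+ (b * b)) ^+ (2 ^ j).
Proof.
elim: j => [|j IH] p q hp hq; first by rewrite expr1 /= occb_prob //; lia.
set x := 81 * _ in IH *.
have bad0 p' q' : 0 <= E (fun A => (~~ good (occb A) j p' q')%:R).
  by apply: bexp_ge0 => // A; exact: ler0n.
pose bd (i : 'I_3 * 'I_3) A : R := (~~ good (occb A) j (3 * p + i.1) (3 * q + i.2))%:R.
have bdle (i : 'I_3 * 'I_3) : E (bd i) <= x ^+ (2 ^ j) / 81.
  rewrite ler_pdivlMr // mulrC; apply: IH.
    by move: hp; rewrite expnS; case: i => -[a a3] c /=; nia.
  by move: hq; rewrite expnS; case: i => a [c c3] /=; nia.
have ind (i i' : 'I_3 * 'I_3) : i != i' -> E (fun A => bd i A * bd i' A) = E (bd i) * E (bd i').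
  move=> ne; apply: (@bexp_indep _ _ _ (zone j (3 * p + i.1) (3 * q + i.2))) => A; rewrite /bd.
    by rewrite -good_zone.
  rewrite -good_zone //; apply/subsetP => v; rewrite !inE.
  have : (nat_of_ord i.1 != i'.1) || (nat_of_ord i.2 != i'.2).
    by move: ne; case: i i' => a c [a' c']; rewrite xpair_eqE negb_and.
  move: (v.1 %/ b)%N (v.2 %/ b)%N (nat_of_ord i.1) (nat_of_ord i.2) (nat_of_ord i'.1) (nat_of_ord i'.2).
  move: (3 ^ j)%N (3 * p)%N (3 * q)%N; clear => t P Q v1 v2 a c a' c' ne /andP[h1 h2].
  by apply/negP => /andP[g1 g2]; case/orP: ne => ne; nia.
have le2 A : (~~ good (occb A) j.+1 p q)%:R <= \sum_i \sum_(i' | i != i') bd i A * bd i' A :> R.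
  have nn i : 0 <= \sum_(i' | i != i') bd i A * bd i' A.
    by apply: sumr_ge0 => i' _; rewrite mulr_ge0 // ler0n.
  have [g|ng] := boolP (good _ _ _ _); first by apply: sumr_ge0 => i _; exact: nn.
  have [i [i' [ne bi bi']]] : exists i i' : 'I_3 * 'I_3, [/\ i != i', bd i A = 1 & bd i' A = 1].
    move: ng; rewrite /= pair_bigA /= -ltnNge => ng.
    have [i bi|nb] := pickP (fun i : 'I_3 * 'I_3 => ~~ good (occb A) j (3 * p + i.1) (3 * q + i.2)); last first.
      by move: ng; rewrite big1 // => i _; rewrite nb.
    have [i' /andP[ne bi']|nb] := pickP (fun i' => (i != i') && ~~ good (occb A) j (3 * p + i'.1) (3 * q + i'.2)).
      by exists i, i'; rewrite /bd bi bi'.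
    move: ng; rewrite (bigD1 i) //= bi big1 // => i' ne; have := nb i'.
    by rewrite eq_sym ne /= => ->.
  rewrite (bigD1 i) //= (bigD1 i') //= bi bi' mulr1 -addrA lerDl addr_ge0 ?sumr_ge0 //.
  by move=> i2 _; rewrite mulr_ge0 ?ler0n.
have y0 : 0 <= x ^+ (2 ^ j) / 81.
  by apply: le_trans (bdle (ord0, ord0)); apply: bad0.
apply: (@le_trans _ _ (81 * (\sum_(i : 'I_3 * 'I_3) \sum_(i' : 'I_3 * 'I_3) (x ^+ (2 ^ j) / 81) ^+ 2))).
  apply: ler_wpM2l => //; apply: le_trans (le_bexp rP le2) _.
  rewrite bexp_sum; apply: ler_sum => i _; rewrite bexp_sum [leRHS](bigID (fun i' => i != i')) /= -[leLHS]addr0.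
  apply: lerD; last by apply: sumr_ge0 => i' _; rewrite exprn_ge0.
  apply: ler_sum => i' ne; rewrite ind // expr2; apply: ler_pM => //; exact: bad0.
rewrite !sumr_const card_prod !card_ord expnS mulnC exprM -mulrnA -[X in 81 * X]mulr_natl.
set y := x ^+ (2 ^ j); rewrite le_eqVlt; apply/orP; left; apply/eqP.
by rewrite (_ : (3 * 3 * (3 * 3))%N = 81%N) // expr_div_n; field.
Qed.

(** The probabilities that the corner block is bad at the scales from [j0] on are dominated by a
    geometric series of sum [2^-1 ^+ j0]. *)
Lemma site_percolation j0 d : 81 * (1 - rho) ^+ (b * b) <= 2^-1 ->
  (3 ^ j0 <= k)%N -> (l <= 3 ^ (j0 + d))%N -> (3 ^ (j0 + d).+1 <= N0)%N ->
  1 - 2^-1 ^+ j0 <= E (fun A => (hits (target N0 b l) (gsys (start N0 b k) (mem A) near_cells))%:R).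
Proof.
move=> x2 jk ld dN.
have h0 : 0 <= 2^-1 :> R by rewrite invr_ge0.
have x0 : 0 <= 81 * (1 - rho) ^+ (b * b).
  by rewrite mulr_ge0 // exprn_ge0 // subr_ge0; case/andP: rho01.
have badle i : (i <= d.+1)%N -> E (fun A => (~~ good (occb A) (j0 + i) 0 0)%:R) <= 2^-1 ^+ (j0 + i).+1.
  move=> hi; have H : (1 * 3 ^ (j0 + i) <= N0)%N.
    by rewrite mul1n; apply: leq_trans dN; rewrite leq_exp2l // -addnS leq_add2l.
  have := bad_prob H H; set e := E _ => He.
  have e0 : 0 <= e by apply: bexp_ge0 => // A; exact: ler0n.
  apply: (@le_trans _ _ (81 * e)); first by rewrite ler_peMl // ler1n.
  apply: le_trans He _; apply: (@le_trans _ _ (2^-1 ^+ (2 ^ (j0 + i)))).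
    by apply: lerXn2r; rewrite ?nnegrE.
  by apply: ler_wiXn2l => //; [rewrite invf_le1 ?ler1n|exact: ltn_expl].
have pt A : 1 - \sum_(i < d.+2) (~~ good (occb A) (j0 + i) 0 0)%:R <=
    (hits (target N0 b l) (gsys (start N0 b k) (mem A) near_cells))%:R :> R.
  have [|nh] := boolP (hits _ _); first by rewrite gerBl sumr_ge0 // => *; exact: ler0n.
  have [i ngi|ag] := pickP (fun i : 'I_d.+2 => ~~ good (occb A) (j0 + i) 0 0).
    rewrite (bigD1 i) //= ngi subr_le0 lerDl sumr_ge0 // => *; exact: ler0n.
  case/negP: nh; apply: (good_sites_hit jk ld) => i hi.
  by have /negbFE := ag (Ordinal (hi : (i < d.+2)%N)).
apply: le_trans (le_bexp rP pt); rewrite bexpB bexp_cst bexp_sum lerD2l lerN2.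
apply: (@le_trans _ _ (\sum_(i < d.+2) 2^-1 ^+ (j0 + i).+1)).
  by apply: ler_sum => -[i hi] _; exact: badle.
have : \sum_(i < d.+2) 2^-1 ^+ (j0 + i).+1 = 2^-1 ^+ j0 * (1 - 2^-1 ^+ d.+2) :> R.
  elim: (d.+2) => [|n IH]; first by rewrite big_ord0 expr0 subrr mulr0.
  rewrite big_ord_recr /= IH -addnS exprD -mulrDr; congr (_ * _); rewrite exprS; lra.
move=> ->; rewrite ler_piMr ?exprn_ge0 // gerBl exprn_ge0 //.
Qed.

(** In the graph, a vertex with a cluster vertex in its own or a neighbouring block activates with
    probability at least [pi * c]. Site percolation of that density is therefore dominated vertex by
    vertex. *)
Lemma grid_supercritical (F0 : nat -> nat -> R) (pi c : R) j0 d :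
  (forall x y, 0 <= F0 x y <= 1) -> 0 <= pi <= 1 -> 0 <= c <= 1 -> rho = pi * c ->
  (forall x y, (x <= 2 * b)%N -> (y <= 2 * b)%N -> c <= F0 x y) ->
  81 * (1 - rho) ^+ (b * b) <= 2^-1 ->
  (3 ^ j0 <= k)%N -> (l <= 3 ^ (j0 + d))%N -> (3 ^ (j0 + d).+1 <= N0)%N ->
  1 - 2^-1 ^+ j0 <= bexp (gprob pi (@gF R N0 b F0)) (fun A : {set (V + V * V)} =>
     (hits (target N0 b l) (gsys (start N0 b k) (occ_of A) (und A)))%:R).
Proof.
move=> F01 pi01 c01 rhoE Fc h1 h2 h3 h4.
have /andP[pi0 pi1] := pi01; have /andP[c0 c1] := c01.
apply: le_trans (site_percolation h1 h2 h3 h4) _.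
have FP : is_prob (gprob pi (@gF R N0 b F0)) by move=> [v|[u v]] /=; last exact: F01.
rewrite undirected_directed //; last exact: gF_sym.
set T := target _ _ _; set K := start _ _ _.
pose cp (j : V + (V + V * V)) : R := match j with inl _ => rho | inr j => gprob pi (@gF R N0 b F0) j end.
have cpP : is_prob cp by move=> [v|j] /=; [exact: rho01|exact: FP].
pose a (A : {set (V + (V + V * V))}) := gsys K (mem (inl @^-1: A : {set V})) near_cells.
pose a' (A : {set (V + (V + V * V))}) := gsys K (occ_of (inr @^-1: A)) (dir (inr @^-1: A)).
have aE (f : (V -> {set V} -> bool) -> R) :
    bexp cp (fun A : {set (V + (V + V * V))} => f (a A)) = E (fun A => f (gsys K (mem A) near_cells)).
  by rewrite /a (bexp_marginal (@inl_inj _ _) cp (fun A => f (gsys K (mem A) near_cells))).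
have a'E (f : (V -> {set V} -> bool) -> R) :
    bexp cp (fun A : {set (V + (V + V * V))} => f (a' A)) = bexp (gprob pi (@gF R N0 b F0)) (fun A : {set (V + V * V)} => f (gsys K (occ_of A) (dir A))).
  by rewrite /a' (bexp_marginal (@inr_inj _ _) cp (fun A : {set (V + V * V)} => f (gsys K (occ_of A) (dir A)))).
rewrite -(aE (fun s => (hits T s)%:R)) -(a'E (fun s => (hits T s)%:R)).
pose P (v : V) : {set (V + (V + V * V))} := [set j | match j with
   inl w => w == v | inr (inl w) => w == v | inr (inr uw) => uw.2 == v end].
apply: (@hits_domination _ _ _ _ _ cpP a a' P) => //.
- by move=> ?; exact: monosys_gsys.
- by move=> ?; exact: monosys_gsys.
- move=> u v uv; apply/pred0P => j /=; apply/negP; rewrite !inE.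
  by case: j => [w|[w|[x w]]] /= /andP[/eqP -> /eqP vw]; rewrite vw eqxx in uv.
- by move=> A v S; rewrite /a /gsys /= !inE eqxx andbT.
- move=> A v S; rewrite /a' /gsys /occ_of !inE eqxx andbT; congr (_ && (_ || _)).
  by apply: eq_existsb => u; rewrite /dir !inE /= eqxx andbT.
move=> v S; rewrite (aE (fun s => (s v S)%:R)) (a'E (fun s => (s v S)%:R)) gsys_prob.
rewrite (eq_bexp _ (G := fun A => (v \in A)%:R * ((v \in K) || [exists u in S, near_cells u v])%:R)); last first.
  by move=> A; rewrite /gsys /= -natrM mulnb.
rewrite bexpZr bexp_mem rhoE -mulrA ler_wpM2l //; case: (v \in K) => /=; first by rewrite mulr1.
have F01' u : 0 <= @gF R N0 b F0 u v <= 1 by exact: F01.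
case: existsP => [[u /andP[uS /andP[n1 n2]]]|_]; last first.
  by rewrite mulr0 subr_ge0; case/andP: (prod_compl_itv S F01').
rewrite mulr1 lerBrDr -lerBrDl (bigD1 u) //=.
apply: (@le_trans _ _ (1 - @gF R N0 b F0 u v)).
  apply: ler_piMr; first by rewrite subr_ge0; case/andP: (F01' u).
  rewrite (eq_bigl (mem (S :\ u))) => [|w]; last by rewrite !inE andbC.
  by case/andP: (prod_compl_itv (S :\ u) F01').
rewrite lerD2l lerN2; apply: Fc.
  by move/(dn_div_lt b_gt0)/ltnW: n1.
by move/(dn_div_lt b_gt0)/ltnW: n2.
Qed.
End GridSupercritical.

Section SetOf.
Variables (R : realFieldType) (J : finType).

Definition setof (p : pred J) : {set J} := [set j | p j].

Lemma in_setof p j : (j \in setof p) = p j. Proof. by rewrite inE. Qed.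

Lemma bexp_coords (rho : J -> R) (J0 : {set J}) (F : {set J} -> R) :
  (forall A, F A = F (A :&: J0)) ->
  bexp rho F = \sum_(A : {set J} | A \subset J0)
    F A * \prod_(j in J0) (if j \in A then rho j else 1 - rho j).
Proof.
move=> FJ; rewrite (eq_bexp _ (G := fun A => \sum_(B : {set J} | B \subset J0) F B * (A :&: J0 == B :&: J0)%:R)).
  rewrite bexp_sum; apply: eq_bigr => B BJ; by rewrite bexpZ bexp_cylinder.
move=> A; rewrite (bigD1 (A :&: J0)) ?subsetIr //= -FJ -setIA setIid eqxx mulr1 big1 ?addr0 // => B /andP[BJ ne].
by rewrite (setIidPl BJ) eq_sym (negbTE ne) mulr0.
Qed.
End SetOf.

Section Loops.
Variables (V : finType) (K T : {set V}).

(** A loop could only activate a vertex that is already active. Loops are dropped because a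
    realization specifies the law of the variables of distinct indices only. *)
Lemma hits_loopless occ (e : rel V) :
  hits T (gsys K occ (fun u v => (u != v) && e u v)) = hits T (gsys K occ e).
Proof.
rewrite /hits; suff -> : active (gsys K occ (fun u v => (u != v) && e u v)) = active (gsys K occ e) by [].
have m e' : monosys (gsys K occ e') by exact: monosys_gsys.
apply/eqP; rewrite eqEsubset; apply/andP; split.
  by apply: active_mono => // v S; apply: gsys_le => // u w /andP[].
apply: active_min => // v /andP[ov /orP[vK|/existsP[u /andP[uC uv]]]]; rewrite activeE //.
  by rewrite /gsys ov vK.
have [uv'|ne] := eqVneq u v; first by rewrite -activeE // -uv'.
by rewrite /gsys ov; apply/orP; right; apply/existsP; exists u; rewrite uC ne.
Qed.

Lemma eq_gsys occ occ' (e e' : rel V) : occ =1 occ' -> e =2 e' -> gsys K occ e =2 gsys K occ' e'.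
Proof.
move=> oo ee v S; rewrite /gsys oo; congr (_ && (_ || _)).
by apply: eq_existsb => u; rewrite ee.
Qed.
End Loops.

From mathcomp Require Import all_classical all_reals all_analysis.
From mathcomp Require Import measurable_realfun.
Import numFieldNormedType.Exports.
Local Open Scope classical_set_scope.
Local Open Scope ring_scope.

(** * Bits of a realization *)

Section ProbBits.
Context {R : realType} {d : measure_display} {Omega : measurableType d} (P : probability Omega R).

Lemma fsetI_all_measurable (J : finType) (p : pred J) (Ev : J -> set Omega) :
  (forall j, measurable (Ev j)) -> measurable [set w | forall j, p j -> Ev j w].
Proof.
move=> mE; have -> : [set w | forall j, p j -> Ev j w] = \bigcap_(j in [set j | p j]) Ev j.
  by apply/seteqP; split=> w H j; exact: H.
by apply: fin_bigcap_measurable => //; exact: finite_finset.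
Qed.

Lemma prob_le1 (A : set Omega) : (P A <= 1)%E -> (P A < +oo)%E.
Proof. by move=> h; apply: le_lt_trans h _; rewrite ltry. Qed.

Lemma prob_diff (A B : set Omega) : measurable A -> measurable B ->
  P (A `&` ~` B) = (P A - P (A `&` B))%E.
Proof.
move=> mA mB; rewrite -setDE measureD //.
by apply: prob_le1; exact: probability_le1.
Qed.

Lemma measurable_mem_seq (T : eqType) (f : Omega -> T) (s : seq T) :
  (forall x, x \in s -> measurable [set w | f w = x]) -> measurable [set w | f w \in s].
Proof.
elim: s => [|x s IH] ms.
  by rewrite (_ : [set w | _] = set0); [exact: measurable0|apply/seteqP; split].
rewrite (_ : [set w | _] = [set w | f w = x] `|` [set w | f w \in s]).
  apply: measurableU; first by apply: ms; rewrite inE eqxx.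
  by apply: IH => y ys; apply: ms; rewrite inE ys orbT.
apply/seteqP; split=> w /=; rewrite inE; first by move=> /orP[/eqP|]; [left|right].
by move=> [->|->]; rewrite ?eqxx ?orbT.
Qed.

Lemma prob_mem_seq (T : eqType) (f : Omega -> T) (s : seq T) : uniq s ->
  (forall x, x \in s -> measurable [set w | f w = x]) ->
  P [set w | f w \in s] = (\sum_(x <- s) P [set w | f w = x])%E.
Proof.
elim: s => [_ _|x s IH /= /andP[xs us] ms].
  by rewrite big_nil (_ : [set w | _] = set0) ?measure0 //; apply/seteqP; split.
have ms' y : y \in s -> measurable [set w | f w = y] by move=> ys; apply: ms; rewrite inE ys orbT.
rewrite big_cons -IH // -measureU //; first last.
- by apply/seteqP; split=> // w [/= ->]; apply/negP.
- exact: measurable_mem_seq.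
- by apply: ms; rewrite inE eqxx.
congr (P _); apply/seteqP; split=> w /=; rewrite inE; first by move=> /orP[/eqP|]; [left|right].
by move=> [->|->]; rewrite ?eqxx ?orbT.
Qed.

Variables (J : finType) (J0 : {set J}) (Ev : J -> set Omega) (rho : J -> R).
Hypothesis mEv : forall j, measurable (Ev j).
Hypothesis prodEv : forall S : {set J}, S \subset J0 ->
  P [set w | forall j, j \in S -> Ev j w] = (\prod_(j in S) rho j)%:E.

Definition pat (a : pred J) j : set Omega := if a j then Ev j else ~` Ev j.

(** Inclusion-exclusion, one index at a time: a complemented event contributes the probability
    without it minus the probability with it. The product formula for intersections thus gives full
    independence. *)
Lemma prob_pattern (a : pred J) (s : seq J) : forall S : {set J}, S \subset J0 ->
  uniq s -> {subset s <= J0} -> (forall j, j \in s -> j \notin S) ->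
  P ([set w | forall j, j \in S -> Ev j w] `&` [set w | forall j, j \in s -> pat a j w]) =
  (\prod_(j in S) rho j * \prod_(j <- s) (if a j then rho j else 1 - rho j))%:E.
Proof.
have mpat j : measurable (pat a j).
  by rewrite /pat; case: ifP => _; [exact: mEv|exact: measurableC].
elim: s => [|j s IH] S SJ /=.
  move=> _ _ _; rewrite big_nil mulr1 -prodEv //; congr (P _).
  by apply/seteqP; split=> [w []//|w H]; split.
move=> /andP[js us] sJ sS.
have sJ' : {subset s <= J0} by move=> i si; apply: sJ; rewrite inE si orbT.
have sS' i : i \in s -> i \notin S by move=> si; apply: sS; rewrite inE si orbT.
have jS : j \notin S by apply: sS; rewrite inE eqxx.
have jJ : j \in J0 by apply: sJ; rewrite inE eqxx.
pose B := [set w | forall i, i \in S -> Ev i w] `&` [set w | forall i, i \in s -> pat a i w].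
have BEv : P (B `&` Ev j) = (\prod_(i in S) rho i * rho j * \prod_(i <- s) (if a i then rho i else 1 - rho i))%:E.
  have := IH (j |: S)%SET; rewrite big_setU1 //= [rho j * _]mulrC => <- //.
  - congr (P _); apply/seteqP; split=> [w [[H1 H2] H3]|w [H1 H2]].
      split=> // i; rewrite !inE => /orP[/eqP->//|]; exact: H1.
    split; last by apply: H1; rewrite !inE eqxx.
    by split=> // i iS; apply: H1; rewrite !inE iS orbT.
  - by apply/fintype.subsetP => i; rewrite !inE => /orP[/eqP->//|]; apply: (fintype.subsetP SJ).
  - move=> i si; rewrite !inE negb_or sS' // andbT; apply: contraNneq js => <-.
    exact: si.
rewrite big_cons; have [aj|naj] := boolP (a j).
  transitivity (P (B `&` Ev j)); last by rewrite BEv mulrA.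
  congr (P _); apply/seteqP; split=> [w [H1 H2]|w [[H1 H2] H3]].
    split; first by split=> // i si; apply: H2; rewrite inE si orbT.
    by have := H2 j; rewrite /pat aj inE eqxx => /(_ isT).
  by split=> // i; rewrite inE => /orP[/eqP->|/H2//]; rewrite /pat aj.
transitivity (P (B `&` ~` Ev j)).
  congr (P _); apply/seteqP; split=> [w [H1 H2]|w [[H1 H2] H3]].
    split; first by split=> // i si; apply: H2; rewrite inE si orbT.
    by have := H2 j; rewrite /pat (negbTE naj) inE eqxx => /(_ isT).
  by split=> // i; rewrite inE => /orP[/eqP->|/H2//]; rewrite /pat (negbTE naj).
rewrite prob_diff //; last first.
  by apply: measurableI; [exact: fsetI_all_measurable|exact: (@fsetI_all_measurable _ (mem s))].
rewrite BEv /B IH // -EFinB; congr (_%:E); ring.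
Qed.

Variable fl : pred J.
(** For cells the product formula is available for emptiness, whereas the bits record occupation;
    [fl] marks the events to be complemented. *)
Definition flip_ev j : set Omega := if fl j then ~` Ev j else Ev j.
Definition flip_prob j : R := if fl j then 1 - rho j else rho j.

Lemma prob_bits (F : {set J} -> bool) : (forall A, F A = F (A :&: J0)%SET) ->
  P [set w | F (setof (fun j => (j \in J0) && `[< flip_ev j w >]))] =
  (bexp flip_prob (fun A => (F A)%:R))%:E.
Proof.
move=> FJ; rewrite (@bexp_coords _ _ _ J0); last by move=> A; rewrite FJ.
pose bits w := setof (fun j => (j \in J0) && `[< flip_ev j w >]).
have mf j : measurable (flip_ev j).
  by rewrite /flip_ev; case: ifP => _; [exact: measurableC|exact: mEv].
pose G (A : {set J}) := [set w | bits w = A].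
have GE (A : {set J}) : A \subset J0 -> G A = [set w | forall j, j \in (finset.set0 : {set J}) -> Ev j w] `&`
    [set w | forall j, j \in enum J0 -> pat (fun j => (j \in A) (+) fl j) j w].
  move=> AJ; apply/seteqP; split=> w.
    move=> bA; split=> [j|j]; first by rewrite inE.
    rewrite mem_enum => jJ; have : (j \in bits w) = (j \in A) by rewrite bA.
    rewrite in_setof jJ /= /pat /flip_ev => <-.
    by case: (fl j); case: asboolP => //= ne; apply: contrapT.
  move=> [_ H]; apply/setP => j; rewrite in_setof.
  have [jJ|jJ] := boolP (j \in J0); last first.
    by apply/esym/negbTE; apply: contraNN jJ; exact: (fintype.subsetP AJ).
  have := H j; rewrite mem_enum => /(_ jJ); rewrite /pat /flip_ev /=.
  by case: (fl j); case: (j \in A) => //= h; apply/asboolP.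
have mG (A : {set J}) : A \subset J0 -> measurable (G A).
  move=> AJ; rewrite GE //; apply: measurableI; first exact: fsetI_all_measurable.
  apply: (@fsetI_all_measurable _ (mem (enum J0))) => j.
  by rewrite /pat; case: ifP => _; [exact: mEv|exact: measurableC].
have PG (A : {set J}) : A \subset J0 -> P (G A) = (\prod_(j in J0) (if j \in A then flip_prob j else 1 - flip_prob j))%:E.
  move=> AJ; rewrite GE // prob_pattern ?finset.sub0set ?enum_uniq //.
  - rewrite big_set0 mul1r big_enum /=; congr (_%:E); apply: eq_bigr => j _.
    rewrite /flip_prob; case: (j \in A); case: (fl j) => //=; ring.
  - by move=> j; rewrite mem_enum.
  - by move=> j _; rewrite inE.
pose s := [seq A : {set J} <- enum {set J} | (A \subset J0) && F A].
have sP (A : {set J}) : (A \in s) = (A \subset J0) && F A by rewrite mem_filter mem_enum andbT.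
have bJ w : bits w \subset J0 by apply/fintype.subsetP => j; rewrite in_setof => /andP[].
rewrite (_ : [set w | _] = [set w | bits w \in s]); last first.
  by apply/seteqP; split=> w /=; rewrite sP bJ.
rewrite prob_mem_seq; [|by apply: filter_uniq; exact: enum_uniq|]; last by move=> A; rewrite sP => /andP[AJ _]; exact: mG.
rewrite big_filter big_enum_cond /=.
rewrite (eq_bigr (fun A : {set J} => (\prod_(j in J0) (if j \in A then flip_prob j else 1 - flip_prob j))%:E)); last first.
  by move=> A /andP[AJ _]; exact: PG.
rewrite sumEFin; congr (_%:E); rewrite [LHS]big_mkcondr /=; apply: eq_bigr => A _.
by case: (F A); rewrite ?mul1r ?mul0r.
Qed.
End ProbBits.

Section Realization.
Context {R : realType} (lam : R) (g : R -> R) {d : measure_display}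
  {Omega : measurableType d} (P : probability Omega R)
  (X : Omega -> nat -> R * R) (U : Omega -> nat -> nat -> R).
Hypothesis H : RCM_realization lam g P X U.

Let mX n : measurable_fun setT (fun w => X w n). Proof. by case: H. Qed.
Let mU a b : measurable_fun setT (fun w => U w a b). Proof. by case: H. Qed.

Lemma measurable_allX (D : nat -> set (R * R)) : (forall n, measurable (D n)) ->
  measurable [set w | forall n, D n (X w n)].
Proof.
move=> mD; rewrite (_ : [set w | _] = \bigcap_n ((fun w => X w n) @^-1` D n)).
  by apply: bigcapT_measurable => n; rewrite -[_ @^-1` _]setTI; apply: mX.
by apply/seteqP; split=> w h n; [move=> _|]; exact: h.
Qed.

Lemma measurable_U_le a b t : measurable [set w | U w a b <= t].
Proof.
rewrite (_ : [set w | _] = (fun w => U w a b) @^-1` `]-oo, t]).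
  by rewrite -[_ @^-1` _]setTI; apply: mU => //; exact: measurable_itv.
by apply/seteqP; split=> w /=; rewrite in_itv.
Qed.

Lemma measurable_edges (E : seq (nat * nat * R)) :
  measurable [set w | forall e, e \in E -> U w e.1.1 e.1.2 <= e.2].
Proof.
elim: E => [|e E IH].
  by rewrite (_ : [set w | _] = setT) //; apply/seteqP; split.
rewrite (_ : [set w | _] = [set w | U w e.1.1 e.1.2 <= e.2] `&`
   [set w | forall e, e \in E -> U w e.1.1 e.1.2 <= e.2]).
  by apply: measurableI => //; exact: measurable_U_le.
apply/seteqP; split=> w /= h.
  split; first by apply: h; rewrite inE eqxx.
  by move=> e' h'; apply: h; rewrite inE h' orbT.
by move=> e'; rewrite inE => /orP[/eqP->|]; case: h => // h1 h2; exact: h2.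
Qed.

(** A realization states independence for finitely many points. Continuity from above extends it to
    conditions on all points at once, which is needed because the emptiness of a cell involves the
    whole enumeration. *)
Lemma XU_indep (D : nat -> set (R * R)) (E : seq (nat * nat * R)) :
  (forall n, measurable (D n)) -> uniq (map fst E) ->
  (forall e, e \in E -> (e.1.1 < e.1.2)%N /\ 0 <= e.2 <= 1) ->
  P ([set w | forall n, D n (X w n)] `&` [set w | forall e, e \in E -> U w e.1.1 e.1.2 <= e.2]) =
  (P [set w | forall n, D n (X w n)] * (\prod_(e <- E) e.2)%:E)%E.
Proof.
move=> mD uE E01; case: H => _ _ _ _ indep.
pose C := [set w | forall e, e \in E -> U w e.1.1 e.1.2 <= e.2].
have mC : measurable C by exact: measurable_edges.
pose F m := [set w | forall n, (n < m)%N -> D n (X w n)].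
have FE m : F m = [set w | forall nD, nD \in [seq (n, D n) | n <- iota 0 m] -> nD.2 (X w nD.1)].
  apply/seteqP; split=> w h.
    by move=> nD /mapP[n]; rewrite mem_iota /= => nm ->; exact: h.
  by move=> n nm; have := h (n, D n); apply; apply/mapP; exists n; rewrite // mem_iota.
have mF m : measurable (F m).
  rewrite (_ : F m = [set w | forall n, (if (n < m)%N then D n else setT) (X w n)]).
    by apply: (@measurable_allX (fun n => if (n < m)%N then D n else setT)) => n; case: ifP.
  apply/seteqP; split=> w h n; first by case: ifP => // nm; exact: h.
  by move=> nm; have := h n; rewrite nm.
have FC m : P (F m `&` C) = (P (F m) * (\prod_(e <- E) e.2)%:E)%E.
  by rewrite FE; apply: indep => // nD /mapP[n _ ->]; exact: mD.
have Fdec : {homo F : n m / (n <= m)%N >-> (m <= n)%O}.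
  by move=> n m nm; apply/subsetPset => w h i /leq_trans; move/(_ _ nm); exact: h.
have capF : \bigcap_n F n = [set w | forall n, D n (X w n)].
  apply/seteqP; split=> w h; first by move=> n; apply: (h n.+1 I).
  by move=> n _ i _; exact: h.
have cF : (P \o F) x @[x --> \oo] --> P [set w | forall n, D n (X w n)].
  rewrite -capF; apply: nonincreasing_cvg_mu => //.
    by apply: prob_le1; exact: probability_le1.
  by rewrite capF; exact: measurable_allX.
have cFC : (P \o (fun m => F m `&` C)) x @[x --> \oo] --> P ([set w | forall n, D n (X w n)] `&` C).
  have -> : [set w | forall n, D n (X w n)] `&` C = \bigcap_n (F n `&` C).
    rewrite -capF; apply/seteqP; split=> w; first by move=> [h c] n _; split=> //; exact: h.
    by move=> h; split=> [n _|]; [have [] := h n I|have [] := h 0%N I].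
  apply: nonincreasing_cvg_mu => //.
  - by apply: prob_le1; apply: probability_le1; exact: measurableI.
  - by move=> m; exact: measurableI.
  - by apply: bigcapT_measurable => m; exact: measurableI.
  - by move=> n m nm; apply/subsetPset; apply: setSI; apply/subsetPset; exact: Fdec.
have : (P \o (fun m => F m `&` C)) x @[x --> \oo] --> (P [set w | forall n, D n (X w n)] * (\prod_(e <- E) e.2)%:E)%E.
  rewrite (_ : P \o _ = fun m => ((P (F m)) * (\prod_(e <- E) e.2)%:E)%E); last exact/funext.
  by apply: cvgeZr.
exact: (cvg_unique (@ereal_hausdorff R) cFC).
Qed.

End Realization.

Lemma prob_pickle (R : realType) (d : measure_display) (Omega : measurableType d)
  (P : probability Omega R) (T : countType) (f : Omega -> T) (W : set Omega) :
  (forall x, measurable [set w | f w = x]) -> measurable W ->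
  P W = (\sum_(0 <= n <oo) P (W `&` [set w | pickle (f w) = n]))%E.
Proof.
move=> mf mW.
have mn n : measurable [set w | pickle (f w) = n].
  case: (pselect (exists x : T, pickle x = n)) => [[x xn]|nx].
    rewrite (_ : [set w | _] = [set w | f w = x]) //; apply/seteqP; split=> w /=.
      by rewrite -xn => /(pcan_inj pickleK).
    by move=> ->.
  rewrite (_ : [set w | _] = set0) //; apply/seteqP; split=> // w /= fn.
  by apply: nx; exists (f w).
have -> : (\sum_(0 <= n <oo) P (W `&` [set w | pickle (f w) = n]))%E =
   (\sum_(0 <= n <oo | n \in setT) P (W `&` [set w | pickle (f w) = n]))%E.
  by apply: eq_eseriesl => n; rewrite in_setT.
rewrite -measure_bigcup.
- congr (P _); apply/seteqP; split=> w; last by move=> [n _ []].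
  by move=> Ww; exists (pickle (f w)).
- by move=> n _; exact: measurableI.
- by move=> i j _ _ [w [[_ <-] [_ <-]]].
Qed.

Section Cells.
Context {R : realType} (lam : R) (g : R -> R) {d : measure_display}
  {Omega : measurableType d} (P : probability Omega R)
  (X : Omega -> nat -> R * R) (U : Omega -> nat -> nat -> R).
Hypothesis H : RCM_realization lam g P X U.
Variables (V : finType) (Bx : V -> set (R * R)) (al : R).
Hypothesis mB : forall v, measurable (Bx v).
Hypothesis disjB : forall u v x, Bx u x -> Bx v x -> u = v.
Hypothesis areaB : forall v, area (Bx v) = al%:E.

Definition occupied w v : bool := `[< exists n, Bx v (X w n) >].

Definition label w v : nat :=
  match pselect (exists n, `[< Bx v (X w n) >]) with
  | left h => ex_minn h
  | right _ => 0%N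
  end.

(* Empty cells get pairwise distinct labels beyond those of the occupied cells,
   so that the representatives of all cells are distinct. *)
Definition rep w v : nat :=
  if occupied w v then label w v else ((\sum_(u : V) label w u).+1 + enum_rank v)%N.

Lemma labelP w v : occupied w v ->
  Bx v (X w (label w v)) /\ forall n, Bx v (X w n) -> (label w v <= n)%N.
Proof.
move=> /asboolP[n0 hn0]; rewrite /label; case: pselect => [h|nh]; last first.
  by exfalso; apply: nh; exists n0; apply/asboolP.
case: ex_minnP => n /asboolP hn nmin; split=> // k hk.
by apply: nmin; apply/asboolP.
Qed.

Lemma rep_inj w : injective (rep w).
Proof.
have le u : (label w u <= \sum_(v : V) label w v)%N by rewrite (bigD1 u) //= leq_addr.
move=> u v; rewrite /rep; case: ifP => ou; case: ifP => ov.
- move=> e; have [Bu _] := labelP ou; have [Bv _] := labelP ov.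
  by rewrite e in Bu; exact: disjB Bu Bv.
- by have := le u; move: (enum_rank v : nat) => r h1 h2; lia.
- by have := le v; move: (enum_rank u : nat) => r h1 h2; lia.
- by move=> /addnI /ord_inj /enum_rank_inj.
Qed.

(** What has to be known of the points in order to tell which variable [U] belongs to which pair of
    cells. It has countably many values, so conditioning on it is a summation. *)
Definition code w : {ffun V -> nat} * {set V} := ([ffun v => rep w v], setof (occupied w)).

(** Fixing the code amounts to one constraint on each point separately, which is the form that
    [XU_indep] accepts. *)
Definition code_dom (c : {ffun V -> nat} * {set V}) (n : nat) : set (R * R) :=
  [set x | forall v, if v \in c.2 then ((n < c.1 v)%N -> ~ Bx v x) /\ (n = c.1 v -> Bx v x)
                     else ~ Bx v x].

(** Only attained codes are considered: the representatives of empty cells are functions of the rest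
    of the code, so an arbitrary [c] may be inconsistent. *)
Lemma code_domE c : (exists w0, code w0 = c) ->
  [set w | code w = c] = [set w | forall n, code_dom c n (X w n)].
Proof.
move=> [w0 cw0]; apply/seteqP; split=> w.
  move=> /= cw n v; have [ov|nov] := boolP (v \in c.2).
    move: ov; rewrite -cw in_setof /= ffunE /rep => ov; rewrite ov.
    have [h1 h2] := labelP ov; split; first by move=> hn /h2; rewrite leqNgt hn.
    by move=> ->.
  have no : ~ exists n, Bx v (X w n) by apply/asboolPn; move: nov; rewrite -cw in_setof.
  by move=> Bv; apply: no; exists n.
move=> h.
have oE v : occupied w v = (v \in c.2).
  have [vc|vc] := boolP (v \in c.2).
    apply/asboolP; exists (c.1 v); have := h (c.1 v) v; rewrite vc => -[_]; exact.
  apply/asboolP => -[n Bn]; have := h n v; by rewrite (negbTE vc).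
have lab0 w' v : ~~ occupied w' v -> label w' v = 0%N.
  move=> /asboolPn no; rewrite /label; case: pselect => // h'; exfalso; apply: no.
  by case: h' => n /asboolP hn; exists n.
have o0 v : occupied w0 v = (v \in c.2) by rewrite -cw0 in_setof.
have labE v : label w v = label w0 v.
  have [vc|vc] := boolP (v \in c.2); last by rewrite !lab0 ?oE ?o0.
  have ow : occupied w v by rewrite oE. have ow0 : occupied w0 v by rewrite o0.
  have cl : c.1 v = label w0 v by rewrite -cw0 /= ffunE /rep ow0.
  have [hw1 hw2] := labelP ow; apply/eqP; rewrite eqn_leq; apply/andP; split.
    by apply: hw2; have := h (label w0 v) v; rewrite vc cl => -[_]; exact.
  rewrite leqNgt; apply/negP => lt; have := h (label w v) v; rewrite vc cl => -[/(_ lt)].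
  by [].
rewrite /= -cw0 /code; congr (_, _).
  by apply/ffunP => v; rewrite !ffunE /rep oE o0 labE; under eq_bigr do rewrite labE.
by apply/setP => v; rewrite !in_setof oE o0.
Qed.

Lemma measurable_code_dom c n : measurable (code_dom c n).
Proof.
rewrite (_ : code_dom c n = \bigcap_(v in [set: V]) (if v \in c.2 then
   if (n < c.1 v)%N then ~` Bx v else if n == c.1 v then Bx v else setT else ~` Bx v)).
  apply: fin_bigcap_measurable => [|v _]; first exact: finite_finset.
  by case: ifP => _; [case: ifP => _; [exact: measurableC|case: ifP => _]|exact: measurableC].
apply/seteqP; split=> x h v.
  move=> _; have := h v; case: ifP => // _ [h1 h2].
  by case: ifP => [/h1//|_]; case: ifP => // /eqP /h2.
have := h v I; case: ifP => // _; case: ifP => [lt nB|nlt].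
  by split=> // e; rewrite e ltnn in lt.
by case: eqP => // ne Bv; split.
Qed.

Lemma measurable_code c : measurable [set w | code w = c].
Proof.
case: (pselect (exists w0, code w0 = c)) => [h|nh].
  by rewrite code_domE //; apply: (measurable_allX H) => n; exact: measurable_code_dom.
rewrite (_ : [set w | _] = set0) //; apply/seteqP; split=> // w /= e.
by apply: nh; exists w.
Qed.

Lemma measurable_by_code (W : set Omega) (Wc : {ffun V -> nat} * {set V} -> set Omega) :
  (forall c, measurable (Wc c)) -> (forall w, W w <-> Wc (code w) w) -> measurable W.
Proof.
move=> mW WE.
rewrite (_ : W = \bigcup_n (match unpickle n with Some c => [set w | code w = c] `&` Wc c | None => set0 end)).
  apply: bigcupT_measurable => n; case: unpickle => // c; apply: measurableI => //.
  exact: measurable_code.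
apply/seteqP; split=> w.
  by move=> /WE h; exists (pickle (code w)) => //; rewrite pickleK.
by move=> [n _]; case: unpickle => // c [/= <-] /WE.
Qed.

Lemma measurable_unoccupied v : measurable [set w | ~~ occupied w v].
Proof.
apply: (@measurable_by_code _ (fun c => if v \in c.2 then set0 else setT)) => [c|w].
  by case: ifP.
by rewrite /= in_setof; case: (occupied w v).
Qed.

Variable t : V -> V -> R.
Hypothesis t01 : forall u v, 0 <= t u v <= 1.

Definition edge_open w u v : bool :=
  (U w (minn (rep w u) (rep w v)) (maxn (rep w u) (rep w v)) <= t u v).

Lemma measurable_edge_open u v : measurable [set w | edge_open w u v].
Proof.
apply: (@measurable_by_code _ (fun c => [set w | U w (minn (c.1 u) (c.1 v)) (maxn (c.1 u) (c.1 v)) <= t u v])) => [c|w].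
  exact: (measurable_U_le H).
by rewrite /= !ffunE.
Qed.

Lemma unoccupied_prob (S : {set V}) :
  P [set w | forall v, v \in S -> ~~ occupied w v] = (\prod_(v in S) expR (- (lam * al)))%:E.
Proof.
case: H => _ _ _ pois _.
have areaf i : (area (Bx (enum_val (i : 'I_#|S|))) < +oo)%E by rewrite areaB ltry.
have dj (i j : 'I_#|S|) : i != j -> Bx (enum_val i) `&` Bx (enum_val j) = set0.
  move=> ij; apply/seteqP; split=> // x [h1 h2]; case/negP: ij; apply/eqP.
  by apply: enum_val_inj; exact: disjB h1 h2.
have := pois #|S| (fun i => Bx (enum_val i)) (fun=> 0%N) (fun i => mB _) areaf dj.
rewrite (_ : \bigcap_(i in _) _ = [set w | forall v, v \in S -> ~~ occupied w v]).
  move=> ->; congr (_%:E); rewrite [RHS]big_enum_val /=; apply: eq_bigr => i _.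
  by rewrite /poisson_mass areaB /= expr0 fact0 divr1 mul1r.
apply/seteqP; split=> w h.
  move=> v vS; apply/asboolPn => -[n Bn].
  have [s [_ /size0nil s0 hs]] := h (enum_rank_in vS v) I.
  by have := hs n; rewrite s0 enum_rankK_in // => -[/(_ Bn)].
move=> i _; exists [::]; split=> // n; split=> // Bn.
by have /asboolPn := h _ (enum_valP i); case; exists n.
Qed.

(** Summation over the values of the code. For a known code, the edges of [E] are conditions on
    distinct variables [U], because [rep] is injective and each pair is listed in one order only;
    these variables are independent of the points. *)
Lemma unocc_edges_prob (S : {set V}) (E : {set V * V}) :
  (forall uv, uv \in E -> (enum_rank uv.1 < enum_rank uv.2)%N) ->
  P ([set w | forall v, v \in S -> ~~ occupied w v] `&`
     [set w | forall uv, uv \in E -> edge_open w uv.1 uv.2]) =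
  (\prod_(v in S) expR (- (lam * al)) * \prod_(uv in E) t uv.1 uv.2)%:E.
Proof.
move=> rE; rewrite EFinM -unoccupied_prob.
set W1 := [set w | forall v, _]; set W2 := [set w | forall uv, _].
have mW1 : measurable W1.
  apply: (@fsetI_all_measurable _ _ _ (mem S)) => v; exact: measurable_unoccupied.
have mW2 : measurable W2.
  apply: (@fsetI_all_measurable _ _ _ (mem E) (fun uv => [set w | edge_open w uv.1 uv.2])) => uv.
  exact: measurable_edge_open.
have mcode := measurable_code.
rewrite (prob_pickle P mcode (measurableI _ _ mW1 mW2)) (prob_pickle P mcode mW1).
rewrite muleC -nneseriesZl; last by move=> n _; exact: measure_ge0.
apply: eq_eseriesr => n _; rewrite muleC.
(* Emptiness is a function of the code, so on each of its values [W1] holds everywhere or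
   nowhere. *)
case: (pselect (exists2 w0, W1 w0 & pickle (code w0) = n)) => [[w0 W10 wn]|nw]; last first.
  rewrite (_ : W1 `&` W2 `&` _ = set0); last first.
    by apply/seteqP; split=> // w [[h1 _] h2]; apply: nw; exists w.
  rewrite (_ : W1 `&` _ = set0) ?measure0 ?mul0e //.
  by apply/seteqP; split=> // w [h1 h2]; apply: nw; exists w.
have [c cE] : exists c, code w0 = c by exists (code w0).
have pE : [set w | pickle (code w) = n] = [set w | code w = c].
  apply/seteqP; split=> w /=; last by move=> ->; rewrite -cE.
  by rewrite -wn -cE => /(pcan_inj pickleK).
have cW1 w : code w = c -> W1 w.
  move=> e v vS; have := W10 v vS; rewrite /= -!(in_setof (occupied _)).
  by rewrite -cE in e; have [_ ->] := e.
have e1 : W1 `&` [set w | pickle (code w) = n] = [set w | forall m, code_dom c m (X w m)].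
  rewrite -code_domE; last by exists w0.
  rewrite pE; apply/seteqP; split=> [w []//|w h]; split=> //; exact: cW1.
pose El := [seq ((minn (c.1 uv.1) (c.1 uv.2), maxn (c.1 uv.1) (c.1 uv.2)), t uv.1 uv.2) | uv <- enum E].
have e2 : W1 `&` W2 `&` [set w | pickle (code w) = n] =
   [set w | forall m, code_dom c m (X w m)] `&` [set w | forall e, e \in El -> U w e.1.1 e.1.2 <= e.2].
  rewrite -setIA [W2 `&` _]setIC setIA e1; apply/seteqP; split=> w [h1 h2]; split=> //.
    move=> e /mapP[uv]; rewrite mem_enum => uvE -> /=; have := h2 uv uvE.
    have := h1; rewrite -[X in X w]code_domE; last by exists w0.
    move=> /= <-; by rewrite /edge_open !ffunE.
  move=> uv uvE; rewrite /= /edge_open.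
  have := h1; rewrite -[X in X w]code_domE; last by exists w0.
  move=> /= cw; have := h2 ((minn (c.1 uv.1) (c.1 uv.2), maxn (c.1 uv.1) (c.1 uv.2)), t uv.1 uv.2).
  rewrite -cw /= !ffunE; apply; apply/mapP; exists uv; rewrite ?mem_enum // -cw /= !ffunE.
  by [].
have cinj : injective c.1 by move=> u v; rewrite -cE !ffunE; exact: rep_inj.
rewrite e2 e1 (XU_indep H); first last.
- move=> e /mapP[uv]; rewrite mem_enum => uvE -> /=; split; last exact: t01.
  have : c.1 uv.1 != c.1 uv.2.
    by rewrite (inj_eq cinj); apply: contraTneq (rE _ uvE) => ->; rewrite ltnn.
  by move: (c.1 uv.1) (c.1 uv.2); clear; lia.
- rewrite -map_comp map_inj_in_uniq ?enum_uniq // => -[u v] [u' v']; rewrite !mem_enum => uvE uvE' /= [e3 e4].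
  have r1 := rE _ uvE; have r2 := rE _ uvE'; rewrite /= in r1 r2.
  have [[a1 a2]|[a1 a2]] : (c.1 u = c.1 u' /\ c.1 v = c.1 v') \/ (c.1 u = c.1 v' /\ c.1 v = c.1 u').
    by move: e3 e4; move: (c.1 u) (c.1 v) (c.1 u') (c.1 v'); clear; lia.
  + by rewrite (cinj _ _ a1) (cinj _ _ a2).
  + by move: r1 r2; rewrite (cinj _ _ a1) (cinj _ _ a2) => /ltn_trans h /h; rewrite ltnn.
- by move=> m; exact: measurable_code_dom.
by rewrite big_map big_enum.
Qed.
End Cells.

Section CellBits.
Context {R : realType} (lam : R) (g : R -> R) {d : measure_display}
  {Omega : measurableType d} (P : probability Omega R)
  (X : Omega -> nat -> R * R) (U : Omega -> nat -> nat -> R).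
Hypothesis H : RCM_realization lam g P X U.
Variables (V : finType) (Bx : V -> set (R * R)) (al : R).
Hypothesis mB : forall v, measurable (Bx v).
Hypothesis disjB : forall u v x, Bx u x -> Bx v x -> u = v.
Hypothesis areaB : forall v, area (Bx v) = al%:E.
Variable t : V -> V -> R.
Hypothesis t01 : forall u v, 0 <= t u v <= 1.
Hypothesis tsym : forall u v, t u v = t v u.

(** A pair of cells carries a single variable [U]. The coordinates of decreasing pairs are cut off;
    once loops are dropped, [und] does not read them. *)
Definition ordered_bits : {set (V + V * V)} :=
  setof (fun j => match j with inl _ => true | inr uv => (enum_rank uv.1 < enum_rank uv.2)%N end).

Definition graph_bits w : {set (V + V * V)} :=
  setof (fun j => (j \in ordered_bits) &&
    match j with inl v => occupied X Bx w v | inr uv => edge_open X U Bx t w uv.1 uv.2 end).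

Lemma edge_openC w u v : edge_open X U Bx t w u v = edge_open X U Bx t w v u.
Proof. by rewrite /edge_open minnC maxnC tsym. Qed.

Lemma und_bits w u v : u != v -> und (graph_bits w) u v = edge_open X U Bx t w u v.
Proof.
move=> uv; rewrite /und; case: ltngtP => r.
- by rewrite in_setof /ordered_bits in_setof r.
- by rewrite in_setof /ordered_bits in_setof r /= edge_openC.
- by move/ord_inj/enum_rank_inj: r uv => ->; rewrite eqxx.
Qed.

Lemma measurable_bits (F : {set (V + V * V)} -> bool) : measurable [set w | F (graph_bits w)].
Proof.
have mb (A : {set (V + V * V)}) : measurable [set w | graph_bits w = A].
  rewrite (_ : [set w | _] = [set w | forall j, xpredT j -> ((j \in graph_bits w) = (j \in A))]).
    apply: (@fsetI_all_measurable _ _ _ xpredT (fun j => [set w | (j \in graph_bits w) = (j \in A)])) => j.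
    have mj : measurable [set w | j \in graph_bits w].
      rewrite (_ : [set w | _] = if j \in ordered_bits then match j with
        inl v => ~` [set w | ~~ occupied X Bx w v] | inr uv => [set w | edge_open X U Bx t w uv.1 uv.2] end else set0).
        case: ifP => // _; case: j => [v|uv]; last exact: (measurable_edge_open H).
        by apply: measurableC; exact: (measurable_unoccupied H).
      have gE w : (j \in graph_bits w) = (j \in ordered_bits) && match j with
        inl v => occupied X Bx w v | inr uv => edge_open X U Bx t w uv.1 uv.2 end by rewrite in_setof.
      apply/seteqP; split=> w /=; rewrite gE; case: ifP => //= _; case: j {gE} => [v|uv] //=.
        by move=> ->.
      by move/negP; rewrite negbK.
    case: (j \in A); first by [].
    rewrite (_ : [set w | _] = ~` [set w | j \in graph_bits w]); first exact: measurableC.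
    by apply/seteqP; split=> w /=; [move=> ->|move/negP/negbTE].
  apply/seteqP; split=> w /=; first by move=> -> j.
  by move=> h; apply/setP => j; exact: h.
rewrite (_ : [set w | _] = [set w | graph_bits w \in [seq A <- enum {set (V + V * V)} | F A]]).
  by apply: measurable_mem_seq => A _; exact: mb.
by apply/seteqP; split=> w /=; rewrite mem_filter mem_enum andbT.
Qed.

Lemma graph_bits_prob (F : {set (V + V * V)} -> bool) :
  (forall A, F A = F (A :&: ordered_bits)%SET) ->
  P [set w | F (graph_bits w)] =
  (bexp (gprob (1 - expR (- (lam * al))) t) (fun A => (F A)%:R))%:E.
Proof.
move=> FJ.
pose Ev (j : V + V * V) : set Omega := match j with
  inl v => [set w | ~~ occupied X Bx w v] | inr uv => [set w | edge_open X U Bx t w uv.1 uv.2] end.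
pose rho (j : V + V * V) : R := match j with inl v => expR (- (lam * al)) | inr uv => t uv.1 uv.2 end.
pose fl (j : V + V * V) := match j with inl v => true | inr uv => false end.
have mEv j : measurable (Ev j).
  by case: j => [v|uv]; [exact: (measurable_unoccupied H)|exact: (measurable_edge_open H)].
have prodEv (S : {set (V + V * V)}) : S \subset ordered_bits ->
    P [set w | forall j, j \in S -> Ev j w] = (\prod_(j in S) rho j)%:E.
  move=> /fintype.subsetP SJ.
  rewrite (_ : [set w | _] = [set w | forall v, v \in inl @^-1: S -> ~~ occupied X Bx w v] `&`
     [set w | forall uv, uv \in inr @^-1: S -> edge_open X U Bx t w uv.1 uv.2]).
    rewrite (unocc_edges_prob H mB disjB areaB t01); last first.
      by move=> uv; rewrite inE => /SJ; rewrite in_setof.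
    congr (_%:E); rewrite [RHS]big_mkcond big_sumType /=; congr (_ * _).
      by rewrite big_mkcond; apply: eq_bigr => v _; rewrite inE.
    by rewrite big_mkcond; apply: eq_bigr => v _; rewrite inE.
  apply/seteqP; split=> w.
    by move=> h; split=> [v|uv]; rewrite inE => /h.
  by move=> [h1 h2] [v|uv] jS; [apply: h1|apply: h2]; rewrite inE.
have := prob_bits mEv prodEv fl FJ.
rewrite (_ : flip_prob _ _ = gprob (1 - expR (- (lam * al))) t); last first.
  by apply/funext => -[v|uv].
move=> <-; congr (P _); apply/seteqP; split=> w /=.
  rewrite (_ : graph_bits w = setof (fun j => (j \in ordered_bits) && `[< flip_ev Ev fl j w >])) //.
  apply/setP => -[v|uv]; rewrite !in_setof; congr (_ && _); rewrite /flip_ev /=.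
    by apply/idP/asboolP => [->//|/negP]; rewrite negbK.
  by apply/idP/asboolP.
rewrite (_ : graph_bits w = setof (fun j => (j \in ordered_bits) && `[< flip_ev Ev fl j w >])) //.
apply/setP => -[v|uv]; rewrite !in_setof; congr (_ && _); rewrite /flip_ev /=.
  by apply/idP/asboolP => [->//|/negP]; rewrite negbK.
by apply/idP/asboolP.
Qed.

Definition cell_hits (K T : {set V}) w : bool :=
  hits T (gsys K (occupied X Bx w) (fun u v => (u != v) && edge_open X U Bx t w u v)).

Let hitF (K T : {set V}) (A : {set (V + V * V)}) :=
  hits T (gsys K (occ_of A) (fun u v => (u != v) && und A u v)).

Let cell_hitsE K T w : cell_hits K T w = hitF K T (graph_bits w).
Proof.
apply: eq_hits; apply: eq_gsys => [v|u v]; first by rewrite /occ_of in_setof /ordered_bits in_setof.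
by case: eqVneq => //= uv; rewrite und_bits.
Qed.

Lemma measurable_cell_hits K T : measurable [set w | cell_hits K T w].
Proof.
rewrite (_ : [set w | _] = [set w | hitF K T (graph_bits w)]); first exact: measurable_bits.
by apply/seteqP; split=> w /=; rewrite cell_hitsE.
Qed.

Lemma cell_hits_prob (K T : {set V}) : P [set w | cell_hits K T w] =
  (bexp (gprob (1 - expR (- (lam * al))) t) (fun A => (hits T (gsys K (occ_of A) (und A)))%:R))%:E.
Proof.
rewrite (_ : [set w | _] = [set w | hitF K T (graph_bits w)]); last first.
  by apply/seteqP; split=> w /=; rewrite cell_hitsE.
rewrite graph_bits_prob.
  by congr (_%:E); apply: eq_bexp => A; rewrite /hitF hits_loopless.
move=> A; apply: eq_hits; apply: eq_gsys => [v|u v].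
  by rewrite /occ_of finset.in_setI /ordered_bits in_setof andbT.
case: eqVneq => //= uv; rewrite /und !finset.in_setI /ordered_bits !in_setof /=.
case: ltngtP => r; rewrite ?andbT //.
by move/ord_inj/enum_rank_inj: r uv => ->; rewrite eqxx.
Qed.

Lemma pair_edge_prob u v : (enum_rank u < enum_rank v)%N ->
  P [set w | [&& occupied X Bx w u, occupied X Bx w v & edge_open X U Bx t w u v]] =
  ((1 - expR (- (lam * al))) ^+ 2 * t u v)%:E.
Proof.
move=> uv; pose F (A : {set (V + V * V)}) := [&& inl u \in A, inl v \in A & inr (u, v) \in A].
rewrite (_ : [set w | _] = [set w | F (graph_bits w)]); last first.
  by apply/seteqP; split=> w /=; rewrite /F !in_setof uv.
rewrite graph_bits_prob; last by move=> A; rewrite /F !finset.in_setI /ordered_bits !in_setof uv !andbT.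
congr (_%:E); have uv' : u != v by apply: contraTneq uv => ->; rewrite ltnn.
rewrite (eq_bexp _ (G := fun A => (inl u \in A)%:R * ((inl v \in A)%:R * (inr (u, v) \in A)%:R))); last first.
  by move=> A; rewrite -!natrM !mulnb.
rewrite (@bexp_indep _ _ _ [set inl u]%SET); last 2 first.
- by move=> A; rewrite !inE eqxx andbT.
- by move=> A; rewrite !inE andbT (inj_eq inl_inj) eq_sym uv' andbT.
rewrite (@bexp_indep _ _ _ [set inl v]%SET); last 2 first.
- by move=> A; rewrite !inE eqxx andbT.
- by move=> A; rewrite !inE andbT.
by rewrite !bexp_mem /= expr2 mulrA.
Qed.
End CellBits.

(** * Comparison with the grid *)

Section GridCells.
Context {R : realType}.
Implicit Types (h x y : R) (i j : nat).

Definition axis h n0 i : interval R := `[h * (i%:R - n0%:R), h * (i.+1%:R - n0%:R)[.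

Lemma axisE h n0 i x : (x \in axis h n0 i) = (h * (i%:R - n0%:R) <= x < h * (i.+1%:R - n0%:R)).
Proof. by rewrite /axis in_itv. Qed.

Lemma axis_ge h n0 i x m : 0 < h -> x \in axis h n0 i -> (h * (m%:R - n0%:R) <= x) = (m <= i)%N.
Proof.
move=> h0; rewrite axisE => /andP[x1 x2]; apply/idP/idP => [hm|mi].
  have : h * (m%:R - n0%:R) < h * (i.+1%:R - n0%:R) by exact: le_lt_trans x2.
  by rewrite ltr_pM2l // ltrD2r ltr_nat.
by apply: le_trans x1; rewrite ler_pM2l // lerD2r ler_nat.
Qed.

Lemma axis_uniq h n0 i j x : 0 < h -> x \in axis h n0 i -> x \in axis h n0 j -> i = j.
Proof.
move=> h0 xi xj; apply/eqP; rewrite eqn_leq -(axis_ge _ h0 xj) -(axis_ge _ h0 xi).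
by move: xi xj; rewrite !axisE => /andP[-> _] /andP[-> _].
Qed.

Lemma axis_exists h n0 x : 0 < h -> - (h * n0%:R) <= x < h * n0%:R ->
  exists2 i, (i < 2 * n0)%N & x \in axis h n0 i.
Proof.
move=> h0 /andP[x1 x2]; pose y := x / h + n0%:R.
have y0 : 0 <= y.
  by rewrite -lerBlDr sub0r ler_pdivlMr // mulNr mulrC.
have /andP[t1 t2] := truncn_itv y0.
have xE : x = h * (y - n0%:R) by rewrite /y addrK mulrCA divff ?mulr1 // gt_eqF.
exists (Num.truncn y).
  rewrite -(ltr_nat R); apply: le_lt_trans t1 _; rewrite mul2n -addnn natrD /y ltrD2r.
  by rewrite ltr_pdivrMr // mulrC.
by rewrite axisE xE !ler_pM2l // ltr_pM2l // lerD2r ltrD2r t1 t2.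
Qed.

Lemma axis_dist h n0 i j x y : 0 < h -> x \in axis h n0 i -> y \in axis h n0 j ->
  h * (dn i j).-1%:R <= `|x - y| <= h * (dn i j).+1%:R.
Proof.
move=> h0.
wlog ij : i j x y / (i <= j)%N => [wl xi yj|].
  by case/orP: (leq_total i j) => ij; [apply: wl|rewrite distrC dnC; apply: wl].
rewrite !axisE => /andP[x1 x2] /andP[y1 y2].
have -> : dn i j = (j - i)%N by rewrite /dn (eqP (_ : i - j == 0)%N) // subn_eq0.
have e1 : (j - i).+1%:R = j.+1%:R - i%:R :> R by rewrite -subSn // natrB // ltnW.
apply/andP; split.
  case: (ltnP i j) => lt; last first.
    have -> : (j - i)%N = 0%N by apply/eqP; rewrite subn_eq0.
    by rewrite mulr0.
  have e2 : (j - i).-1%:R = j%:R - i.+1%:R :> R by rewrite -subnS natrB.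
  rewrite distrC; apply: le_trans (ler_norm _); rewrite e2.
  have -> : h * (j%:R - i.+1%:R) = h * (j%:R - n0%:R) - h * (i.+1%:R - n0%:R) by ring.
  by rewrite lerB // ltW.
rewrite e1; have -> : h * (j.+1%:R - i%:R) = h * (j.+1%:R - n0%:R) - h * (i%:R - n0%:R) by ring.
rewrite ler_norml; apply/andP; split; last first.
  have : h * (i.+1%:R - n0%:R) <= h * (j.+1%:R - n0%:R) by rewrite ler_pM2l // lerD2r ler_nat.
  have : h * (i%:R - n0%:R) <= h * (j%:R - n0%:R) by rewrite ler_pM2l // lerD2r ler_nat.
  lra.
by rewrite lerNl opprB lerB // ltW.
Qed.

Definition cbox h n0 (v : nat * nat) : set (R * R) := [set` axis h n0 v.1] `*` [set` axis h n0 v.2].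

Lemma measurable_cbox h n0 v : measurable (cbox h n0 v).
Proof. by apply: measurableX; exact: measurable_itv. Qed.

Lemma area_cbox h n0 v : 0 < h -> area (cbox h n0 v) = (h * h)%:E.
Proof.
move=> h0; rewrite /area /cbox product_measure1E; [|exact: measurable_itv|exact: measurable_itv].
have e i : lebesgue_measure [set` axis h n0 i] = h%:E.
  rewrite lebesgue_measure_itv /= lte_fin ltr_pM2l // ltrD2r ltr_nat ltnSn -EFinD.
  by congr (_%:E); rewrite -natr1; ring.
by rewrite EFinM; congr (_ * _)%E; exact: e.
Qed.

Definition box (r : R) : set (R * R) := [set x | (- r <= x.1 < r) && (- r <= x.2 < r)].

Definition rdist (a b : nat) : R := Num.sqrt (a%:R ^+ 2 + b%:R ^+ 2).

Lemma rdist_ge0 a b : 0 <= rdist a b. Proof. exact: sqrtr_ge0. Qed.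

Lemma cbox_dist h n0 (u v : nat * nat) (x y : R * R) : 0 < h -> cbox h n0 u x -> cbox h n0 v y ->
  h * rdist (dn u.1 v.1).-1 (dn u.2 v.2).-1 <= dist2 x y <=
  h * rdist (dn u.1 v.1).+1 (dn u.2 v.2).+1.
Proof.
move=> h0 [x1 x2] [y1 y2]; have /andP[a1 a2] := axis_dist h0 x1 y1.
have /andP[b1 b2] := axis_dist h0 x2 y2; rewrite /rdist /dist2.
have hs (a b : R) : h * Num.sqrt (a ^+ 2 + b ^+ 2) = Num.sqrt ((h * a) ^+ 2 + (h * b) ^+ 2).
  by rewrite !exprMn -mulrDr sqrtrM ?sqr_ge0 // sqrtr_sqr gtr0_norm.
rewrite !hs -(real_normK (num_real (x.1 - y.1))) -(real_normK (num_real (x.2 - y.2))).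
have nn (n : nat) : 0 <= h * n%:R by rewrite mulr_ge0 // ltW.
by apply/andP; split; apply: ler_wsqrtr; apply: lerD; apply: lerXn2r; rewrite ?nnegrE ?normr_ge0.
Qed.
End GridCells.

Section GridPaths.
Context {R : realType} {d : measure_display} {Omega : measurableType d}.
Variables (X : Omega -> nat -> R * R) (U : Omega -> nat -> nat -> R).
Variables (f : R -> R) (s tm : R) (N0 b : nat).
Hypothesis s_gt0 : 0 < s.
Hypothesis tm_gt0 : 0 < tm.
Hypothesis b_gt0 : (0 < b)%N.
Hypothesis f01 : forall r, 0 <= r -> 0 <= f r <= 1.
Hypothesis f_mono : forall x y, 0 <= x -> x <= y -> f y <= f x.
Local Notation V := (cell N0 b).

Definition mesh : R := tm / Num.sqrt s.
Definition gridbox (v : V) : set (R * R) := cbox mesh (N0 * b) (val v.1, val v.2).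
(** Offsets increased or decreased by one bound the distance of two points wherever they lie in
    their cells; as [f] is nonincreasing, the larger distance gives the lower bound. *)
Definition Flo (x y : nat) : R := s * f (tm * rdist x.+1 y.+1).
Definition Fhi (x y : nat) : R := s * f (tm * rdist x.-1 y.-1).

Lemma sqrt_s_gt0 : 0 < Num.sqrt s. Proof. by rewrite sqrtr_gt0. Qed.

Lemma mesh_gt0 : 0 < mesh. Proof. by rewrite divr_gt0 // sqrt_s_gt0. Qed.

Lemma sqrt_mesh : Num.sqrt s * mesh = tm.
Proof. by rewrite /mesh mulrCA divff ?mulr1 // gt_eqF // sqrt_s_gt0. Qed.

Lemma mesh_sqr : mesh * mesh = tm ^+ 2 / s.
Proof. by rewrite /mesh mulrACA -invfM -!expr2 sqr_sqrtr // ltW. Qed.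

Lemma gridbox_uniq u v x : gridbox u x -> gridbox v x -> u = v.
Proof.
move=> [u1 u2] [v1 v2]; rewrite [u]surjective_pairing [v]surjective_pairing.
by congr (_, _); apply: val_inj; [exact: (axis_uniq mesh_gt0 u1 v1)|exact: (axis_uniq mesh_gt0 u2 v2)].
Qed.

Lemma area_gridbox v : area (gridbox v) = (tm ^+ 2 / s)%:E.
Proof. by rewrite area_cbox ?mesh_gt0 // mesh_sqr. Qed.

Lemma gridbox_exists x : box (mesh * (N0 * b)%:R) x -> exists v, gridbox v x.
Proof.
move=> /andP[x1 x2].
have [i iN xi] := axis_exists mesh_gt0 x1; have [j jN xj] := axis_exists mesh_gt0 x2.
have iN' : (i < side N0 b)%N by rewrite /side -mulnA.
have jN' : (j < side N0 b)%N by rewrite /side -mulnA.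
by exists (Ordinal iN', Ordinal jN').
Qed.

Lemma Sscale_bounds u v x y : gridbox u x -> gridbox v y ->
  Flo (dn u.1 v.1) (dn u.2 v.2) <= Sscale s f (dist2 x y) <= Fhi (dn u.1 v.1) (dn u.2 v.2).
Proof.
move=> ux vy; have /andP[lo hi] := cbox_dist mesh_gt0 ux vy.
have ss := sqrt_s_gt0.
have e x' y' : tm * rdist x' y' = Num.sqrt s * (mesh * rdist x' y') by rewrite mulrA sqrt_mesh.
rewrite /Flo /Fhi /Sscale !e; apply/andP; split; apply: ler_wpM2l (ltW s_gt0) _ _ _; apply: f_mono.
- by rewrite mulr_ge0 //; exact: sqrtr_ge0.
- by rewrite ler_wpM2l ?sqrtr_ge0.
- by rewrite mulr_ge0 ?sqrtr_ge0 // mulr_ge0 ?rdist_ge0 // ltW // mesh_gt0.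
- by rewrite ler_wpM2l ?sqrtr_ge0.
Qed.

Lemma band_box (r : nat) (i : 'I_(side N0 b)) (x : R) : (r <= N0)%N ->
  x \in axis mesh (N0 * b) i ->
  mid_band N0 r (i %/ b) = (- (mesh * (r * b)%:R) <= x < mesh * (r * b)%:R).
Proof.
move=> rN xi; rewrite /mid_band leq_divRL // ltn_divLR //.
rewrite -(axis_ge _ mesh_gt0 xi) ltnNge -(axis_ge _ mesh_gt0 xi) -ltNge.
congr (_ && _).
  by rewrite mulnBl natrB ?leq_mul2r ?rN ?orbT // addrAC subrr sub0r mulrN.
by rewrite mulnDl natrD addrAC subrr add0r.
Qed.

Lemma start_box k v x : (k <= N0)%N -> gridbox v x ->
  (v \in start N0 b k) = ((- (mesh * (k * b)%:R) <= x.1 < mesh * (k * b)%:R) &&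
    (- (mesh * (k * b)%:R) <= x.2 < mesh * (k * b)%:R)).
Proof. by move=> kN [x1 x2]; rewrite inE (band_box kN x1) (band_box kN x2). Qed.

Lemma target_box l v x : (l <= N0)%N -> gridbox v x ->
  (v \in target N0 b l) = ~~ ((- (mesh * (l * b)%:R) <= x.1 < mesh * (l * b)%:R) &&
    (- (mesh * (l * b)%:R) <= x.2 < mesh * (l * b)%:R)).
Proof. by move=> lN [x1 x2]; rewrite inE (band_box lN x1) (band_box lN x2). Qed.

Local Notation adj w := (rcm_adj (Sscale s f) X U w).

Definition box_path w (r r' : R) : Prop := exists n p,
  [/\ path (adj w) n p, box r (X w n) & ~ box r' (X w (last n p))].

(** The laws of the variables are known for events [U <= t], while an edge requires a strict
    inequality. The factor [eta] makes up the difference, because a bond probability that is at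
    least a positive [U] is itself positive. *)
Lemma hits_box_path w k l eta : (k <= N0)%N -> (l <= N0)%N -> 0 < eta < 1 ->
  (forall a c, (a < c)%N -> 0 < U w a c) ->
  cell_hits X U gridbox (fun u v => eta * gF Flo u v) (start N0 b k) (target N0 b l) w ->
  box_path w (mesh * (k * b)%:R) (mesh * (l * b)%:R).
Proof.
move=> kN lN /andP[e0 e1] U0; rewrite /cell_hits; set sys := gsys _ _ _.
pose good v := `[< occupied X gridbox w v /\ exists n p, [/\ path (adj w) n p,
   box (mesh * (k * b)%:R) (X w n) & last n p = rep X gridbox w v] >].
have sub : active sys \subset setof good.
  apply: active_min; first exact: monosys_gsys.
  move=> v /andP[ov hv]; rewrite in_setof; apply/asboolP; split=> //.
  have rv : rep X gridbox w v = label X gridbox w v by rewrite /rep ov.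
  have [Bv _] := labelP ov.
  case/orP: hv => [vK|/existsP[u /and3P[]]].
    exists (rep X gridbox w v), [::]; split=> //; rewrite rv.
    by move: vK; rewrite (start_box kN Bv).
  rewrite in_setof => /asboolP[ou [n [p [np nK np']]]] uv euv.
  have ru : rep X gridbox w u = label X gridbox w u by rewrite /rep ou.
  have [Bu _] := labelP ou.
  exists n, (rcons p (rep X gridbox w v)); split=> //; last by rewrite last_rcons.
  have ne : rep X gridbox w u != rep X gridbox w v.
    by apply: contra uv => /eqP /(rep_inj gridbox_uniq) ->.
  rewrite rcons_path np np' /rcm_adj ne /=.
  move: euv; rewrite /edge_open; set y := U w _ _ => hy.
  have y0 : 0 < y by apply: U0; move: ne; move: (rep _ _ _ _) (rep _ _ _ _); clear; lia.
  have tp : 0 < gF Flo u v by rewrite -(pmulr_rgt0 _ e0); exact: lt_le_trans hy.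
  apply: le_lt_trans hy _; apply: (@lt_le_trans _ _ (gF Flo u v)); first by rewrite gtr_pMl.
  rewrite ru rv; have /andP[] := Sscale_bounds Bu Bv.
  by [].
move=> /pred0Pn[v /= /andP[va vT]].
have := fintype.subsetP sub _ va; rewrite in_setof => /asboolP[ov [n [p [np nK nv]]]].
have rv : rep X gridbox w v = label X gridbox w v by rewrite /rep ov.
have [Bv _] := labelP ov.
exists n, p; split=> //; rewrite nv rv; apply/negP.
by move: vT; rewrite (target_box lN Bv).
Qed.

(** This direction requires a configuration without accidents: at most one point per cell, so that
    [rep] finds the vertices of the path, and no edge whose status depends on positions inside the
    cells. The margin [m] keeps the first point outside the box [l] on the grid. *)
Lemma box_path_hits w k l m : (k <= N0)%N -> (l + m < N0)%N ->
  (forall r, 0 <= r -> 0 < f r -> r <= tm * (m * b)%:R) ->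
  (forall a c, (a < c)%N -> 0 < U w a c) ->
  (forall v n n', gridbox v (X w n) -> gridbox v (X w n') -> n = n') ->
  (forall u v, (enum_rank u < enum_rank v)%N -> occupied X gridbox w u -> occupied X gridbox w v ->
     edge_open X U gridbox (gF Fhi) w u v -> edge_open X U gridbox (gF Flo) w u v) ->
  box_path w (mesh * (k * b)%:R) (mesh * (l * b)%:R) ->
  cell_hits X U gridbox (gF Flo) (start N0 b k) (target N0 b l) w.
Proof.
move=> kN lN rng U0 one hilo [n [p [np nK npl]]].
have lN' : (l <= N0)%N by lia.
case: (boolP (cell_hits _ _ _ _ _ _ _)) => //; rewrite /cell_hits; set sys := gsys _ _ _ => nh; exfalso.
have sm : monosys sys by exact: monosys_gsys.
have noT v : v \in active sys -> v \notin target N0 b l.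
  by move=> va; apply: contra nh => vT; apply/pred0Pn; exists v; rewrite /= va.
have m0 := mesh_gt0.
have boxW r r' (x : R * R) : r <= r' -> box r x -> box r' x.
  move=> rr /andP[/andP[a1 a2] /andP[a3 a4]]; rewrite /box /=.
  by rewrite !(le_trans _ a1) ?(lt_le_trans a2) ?(le_trans _ a3) ?(lt_le_trans a4) // lerN2.
have repE v j : gridbox v (X w j) -> occupied X gridbox w v /\ rep X gridbox w v = j.
  move=> Bj; have ov : occupied X gridbox w v by apply/asboolP; exists j.
  by split=> //; rewrite /rep ov; have [B' _] := labelP ov; exact: one B' Bj.
have hilo' u v : u != v -> occupied X gridbox w u -> occupied X gridbox w v ->
     edge_open X U gridbox (gF Fhi) w u v -> edge_open X U gridbox (gF Flo) w u v.
  move=> uv ou ov; case: (ltngtP (enum_rank u) (enum_rank v)) => r; first exact: hilo.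
  - rewrite ![edge_open X U gridbox _ w u v]edge_openC; last 2 first.
      exact: gF_sym.
      exact: gF_sym.
    exact: hilo.
  - by move/ord_inj/enum_rank_inj: r uv => ->; rewrite eqxx.
suff [v va Bv] : exists2 v, v \in active sys & gridbox v (X w (last n p)).
  by have := noT v va; rewrite (target_box lN' Bv) negbK.
have [v0 va0 Bv0] : exists2 v, v \in active sys & gridbox v (X w n).
  have [v Bv] : exists v, gridbox v (X w n).
    apply: gridbox_exists; apply: boxW nK; rewrite ler_pM2l // ler_nat leq_mul2r.
    by rewrite kN orbT.
  exists v => //; have [ov _] := repE _ _ Bv.
  by rewrite activeE // /sys /gsys ov (start_box kN Bv) nK.
move: va0 Bv0 np; clear nK npl.
elim: p n v0 => [|y p IH] n v va Bv /=; first by exists v.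
move=> /andP[/andP[ny Uny] py].
have ab : (minn n y < maxn n y)%N by move: ny; clear; lia.
have gpos : 0 < Sscale s f (dist2 (X w n) (X w y)) by exact: lt_trans (U0 _ _ ab) Uny.
have dle : dist2 (X w n) (X w y) <= mesh * (m * b)%:R.
  have ss := sqrt_s_gt0.
  rewrite -(ler_pM2l ss) mulrA sqrt_mesh; apply: rng.
    by rewrite mulr_ge0 //; exact: sqrtr_ge0.
  by move: gpos; rewrite /Sscale pmulr_rgt0.
have [v' Bv'] : exists v', gridbox v' (X w y).
  apply: gridbox_exists.
  have := noT v va; rewrite (target_box lN' Bv) negbK => /andP[/andP[a1 a2] /andP[a3 a4]].
  have d1 : `|(X w n).1 - (X w y).1| <= mesh * (m * b)%:R.
    apply: le_trans dle; rewrite -sqrtr_sqr; apply: ler_wsqrtr.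
    by rewrite lerDl sqr_ge0.
  have d2 : `|(X w n).2 - (X w y).2| <= mesh * (m * b)%:R.
    apply: le_trans dle; rewrite -sqrtr_sqr; apply: ler_wsqrtr.
    by rewrite lerDr sqr_ge0.
  have lm : mesh * (l * b)%:R + mesh * (m * b)%:R <= mesh * (N0 * b)%:R.
    by rewrite -mulrDr -natrD -mulnDl ler_pM2l // ler_nat leq_mul2r ltnW ?orbT.
  move: d1 d2; rewrite !ler_norml => /andP[c1 c2] /andP[c3 c4].
  by rewrite /box /=; apply/andP; split; apply/andP; split; lra.
have [ov rv] := repE _ _ Bv; have [ov' rv'] := repE _ _ Bv'.
have vv : v != v' by apply: contra ny => /eqP e; rewrite -rv -rv' e.
apply: (IH y v') => //.
rewrite activeE // /sys /gsys ov' /=; apply/orP; right; apply/existsP; exists v; rewrite va vv /=.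
apply: hilo' => //; rewrite /edge_open rv rv'; apply: (le_trans (ltW Uny)).
by have /andP[] := Sscale_bounds Bv Bv'.
Qed.
End GridPaths.

(** * Infinite components and crossings of boxes *)

Section LimEvents.
Context {R : realType} {d : measure_display} {Omega : measurableType d} (P : probability Omega R).

Lemma prob_limsup_ge (W : nat -> set Omega) (v : \bar R) :
  (forall n, measurable (W n)) -> (forall n, v <= P (W n))%E ->
  (v <= P (\bigcap_m \bigcup_(n in [set n | m <= n]%N) W n))%E.
Proof.
move=> mW vW; pose F m := \bigcup_(n in [set n | m <= n]%N) W n.
have mF m : measurable (F m) by apply: bigcup_measurable => n _; exact: mW.
have cF : (P \o F) x @[x --> \oo] --> P (\bigcap_m F m).
  apply: nonincreasing_cvg_mu => //.
  - by apply: prob_le1; exact: probability_le1.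
  - exact: bigcapT_measurable.
  - move=> a b ab; apply/subsetPset => w [n /= bn Wn]; exists n => //=.
    exact: leq_trans bn.
apply: (cvge_ge _ cF).
  by apply: nearW => m; apply: le_trans (vW m) _; apply: le_measure; rewrite ?inE //;
    move=> w Ww; exists m => /=.
Qed.

Lemma prob_liminf_le (W : nat -> set Omega) (v : \bar R) :
  (forall n, measurable (W n)) -> (forall n, P (W n) <= v)%E ->
  (P (\bigcup_m \bigcap_(n in [set n | m <= n]%N) W n) <= v)%E.
Proof.
move=> mW vW; pose F m := \bigcap_(n in [set n | m <= n]%N) W n.
have mF m : measurable (F m) by apply: bigcap_measurable => [|n _]; [exists m => /=|exact: mW].
have cF : (P \o F) x @[x --> \oo] --> P (\bigcup_m F m).
  apply: nondecreasing_cvg_mu => //; first exact: bigcupT_measurable.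
  move=> a b ab; apply/subsetPset => w h n /= bn; apply: h => /=.
  exact: leq_trans bn.
apply: (cvge_le _ cF).
  by apply: nearW => m; apply: le_trans (vW m); apply: le_measure; rewrite ?inE //;
    move=> w h; apply: h => /=.
Qed.
End LimEvents.

Section Percolation.
Context {R : realType} (lam : R) (g : R -> R) {d : measure_display}
  {Omega : measurableType d} (P : probability Omega R)
  (X : Omega -> nat -> R * R) (U : Omega -> nat -> nat -> R).
Hypothesis H : RCM_realization lam g P X U.
Hypothesis lam_ge0 : 0 <= lam.

Lemma measurable_box (r : R) : measurable (box r).
Proof.
rewrite (_ : box r = [set` `[- r, r[] `*` [set` `[- r, r[]).
  by apply: measurableX; exact: measurable_itv.
by apply/seteqP; split=> x; rewrite /box /= !in_itv /= => /andP.
Qed.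

Lemma box_area_lty (r : R) : (area (box r) < +oo)%E.
Proof.
rewrite (_ : box r = [set` `[- r, r[] `*` [set` `[- r, r[]).
  rewrite /area product_measure1E; [|exact: measurable_itv|exact: measurable_itv].
  have e : (lebesgue_measure [set` `[- r, r[%R] : \bar R) \is a fin_num.
    by rewrite lebesgue_measure_itv /=; case: ifP.
  have -> : (((@lebesgue_measure R) [set` `[- r, r[%R]) * ((@lebesgue_measure R) [set` `[- r, r[%R]) < +oo)%E.
    by rewrite ltey_eq fin_numM.
  by [].
by apply/seteqP; split=> x; rewrite /box /= !in_itv /= => /andP.
Qed.

Lemma poisson_mass_sum (m : R) : 0 <= m -> (\sum_(0 <= c <oo) (poisson_mass m c)%:E = 1)%E.
Proof.
move=> m0.
apply/cvg_lim => //.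
rewrite (_ : (fun n => _) = EFin \o (fun n => series (exp_coeff m) n * expR (- m))); last first.
  apply/funext => n /=; rewrite sumEFin /series /= mulr_suml; congr (_%:E).
apply: cvg_EFin; first by apply: nearW => n; rewrite /=.
rewrite -[X in _ --> X](expRxMexpNx_1 m); apply: cvgMl.
exact: is_cvg_series_exp_coeff.
Qed.

Definition finite_boxes : set Omega := [set w | forall k : nat, exists s : seq nat,
  forall n, box k%:R (X w n) -> n \in s].

Lemma measurable_count (B : set (R * R)) c : measurable B -> measurable (count_is X B c).
Proof.
move=> mB; have [up upK] : exists up, pcancel (@pickle (seq nat)) up by exists unpickle; exact: pickleK.
rewrite (_ : count_is X B c = \bigcup_i (match up i with
  | Some s => if uniq s && (size s == c) then [set w | forall n, (if n \in s then B else ~` B) (X w n)] else set0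
  | None => set0 end)).
  apply: bigcupT_measurable => i; case: (up i) => // s; case: ifP => // _.
  by apply: (measurable_allX H (D := fun n => if n \in s then B else ~` B)) => n;
     case: ifP => // _; exact: measurableC.
apply/seteqP; split=> w.
  move=> [s [us ss hs]]; exists (pickle s) => //; rewrite upK us ss eqxx /= => n.
  by case: ifP => ns; have [h1 h2] := hs n; [exact: h2|move/h1; rewrite ns].
move=> [i _]; case: (up i) => // s; case: ifP => // /andP[us /eqP ss] h; exists s; split=> // n.
by have := h n; case: ifP.
Qed.

(** The events [count_is] describe finite counts only; that one of them occurs almost surely follows
    from the Poisson masses summing to 1. *)
Lemma ae_finite_boxes : P.-negligible (~` finite_boxes).
Proof.
have -> : ~` finite_boxes = \bigcup_k ~` [set w | exists s : seq nat, forall n, box k%:R (X w n) -> n \in s].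
  by rewrite -setC_bigcap; congr (~` _); apply/seteqP; split=> w h k; [move=> _|]; exact: h.
apply: negligible_bigcup => k.
exists (~` \bigcup_c count_is X (box k%:R) c); split.
- apply: measurableC; apply: bigcupT_measurable => c; apply: measurable_count; exact: measurable_box.
- have mU : measurable (\bigcup_c count_is X (box k%:R) c).
    by apply: bigcupT_measurable => c; apply: measurable_count; exact: measurable_box.
  apply: etrans (probability_setC P mU) _.
  rewrite measure_bigcup //; last 2 first.
  + by move=> c _; apply: measurable_count; exact: measurable_box.
  + move=> i j _ _ [w [[s [us <- hs]] [s' [us' <- hs']]]]; apply/perm_size/uniq_perm => // n.
    by apply/idP/idP => [/hs/hs'|/hs'/hs].
  rewrite (eq_eseriesl (Q := xpredT)); last by move=> c; rewrite in_setT.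
  rewrite (eq_eseriesr (g := fun c => (poisson_mass (lam * fine (area (box k%:R))) c)%:E)); last first.
    move=> c _; case: H => _ _ _ pois _.
    have := pois 1%N (fun=> box k%:R) (fun=> c) (fun=> measurable_box _) (fun=> box_area_lty _).
    rewrite big_ord1 => <-; last by move=> i j; rewrite !ord1 eqxx.
    by congr (P _); apply/seteqP; split=> w; [move=> h i _|move/(_ ord0 I)].
  rewrite poisson_mass_sum ?subee //.
  by rewrite mulr_ge0 // fine_ge0 // measure_ge0.
- apply: subsetC => w [c _ [s [_ _ hs]]]; exists s => n /hs; exact.
Qed.
End Percolation.

Section PercolationEvents.
Context {R : realType} (lam : R) {d : measure_display}
  {Omega : measurableType d} (P : probability Omega R)
  (X : Omega -> nat -> R * R) (U : Omega -> nat -> nat -> R) (f : R -> R) (s del : R).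
Hypothesis H : RCM_realization lam (Sscale s f) P X U.
Hypothesis lam_ge0 : 0 <= lam.
Hypothesis del_gt0 : 0 < del.
Local Notation bpath w k l := (box_path X U f s w (del * (k : nat)%:R) (del * (l : nat)%:R)).
Local Notation infc w := (has_infinite_component (Sscale s f) X U w).

Definition U_positive : set Omega := [set w | forall a c, (a < c)%N -> 0 < U w a c].

Lemma ae_U_positive : P.-negligible (~` U_positive).
Proof.
have -> : ~` U_positive = \bigcup_a \bigcup_c [set w | (a < c)%N /\ U w a c <= 0].
  apply/seteqP; split=> w.
    move=> h; apply: contrapT => nb; apply: h => a c ac; rewrite ltNge; apply/negP => Uac.
    by apply: nb; exists a => //; exists c.
  by move=> [a _ [c _ [/= ac Uac]]] /(_ a c ac); rewrite ltNge Uac.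
apply: negligible_bigcup => a; apply: negligible_bigcup => c.
case: (ltnP a c) => ac; last first.
  rewrite (_ : [set w | _] = set0); first exact: negligible_set0.
  by apply/seteqP; split=> // w [].
exists [set w | U w a c <= 0]; split.
- exact: (measurable_U_le H).
- case: H => _ _ _ _ /(_ [::] [:: (a, c, 0)]).
  rewrite big_seq1 mule0 => <- //; last by move=> e; rewrite inE => /eqP -> /=; rewrite ac lexx ler01.
  congr (P _); apply/seteqP; split=> w /=.
    by move=> h; split=> // e; rewrite inE => /eqP ->.
  by move=> [_ h]; apply: (h (a, c, 0)); rewrite inE eqxx.
- by move=> w [].
Qed.

Lemma box_exists (x : R * R) : exists k : nat, box (del * k%:R) x.
Proof.
pose r := (`|x.1| + `|x.2|) / del.
have r0 : 0 <= r by rewrite divr_ge0 ?addr_ge0 // ltW.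
exists (Num.truncn r).+1; have /andP[_ h] := truncn_itv r0.
move: h; rewrite ltr_pdivrMr // mulrC => h.
have n1 := ler_norm x.1; have n2 := ler_norm x.2.
have n3 := ler_norm (- x.1); have n4 := ler_norm (- x.2); rewrite normrN in n3; rewrite normrN in n4.
have p1 := normr_ge0 x.1; have p2 := normr_ge0 x.2.
by rewrite /box /=; apply/andP; split; apply/andP; split; lra.
Qed.

Lemma box_le (k k' : nat) (x : R * R) : (k <= k')%N -> box (del * k%:R) x -> box (del * k'%:R) x.
Proof.
move=> kk /andP[/andP[a1 a2] /andP[a3 a4]].
have h : del * k%:R <= del * k'%:R by rewrite ler_pM2l // ler_nat.
by rewrite /box /=; apply/andP; split; apply/andP; split; lra.
Qed.

Lemma finite_boxes_del w (k : nat) : finite_boxes X w ->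
  exists r : seq nat, forall n, box (del * k%:R) (X w n) -> n \in r.
Proof.
have dk0 : 0 <= del * k%:R by rewrite mulr_ge0 // ltW.
have /andP[_ h] := truncn_itv dk0; set K := (Num.truncn _).+1 in h.
move=> /(_ K)[r hr]; exists r => n bn; apply: hr.
move: bn => /andP[/andP[a1 a2] /andP[a3 a4]].
by rewrite /box /=; apply/andP; split; apply/andP; split; lra.
Qed.

(** Finitely many points lie in the box [k]. If all their components were finite, one box would
    contain them all, contrary to the existence of paths leaving every box. *)
Lemma infinite_of_paths w (k : nat) : finite_boxes X w ->
  (forall L : nat, exists2 l, (L <= l)%N & bpath w k l) -> infc w.
Proof.
move=> fb hp; apply: contrapT => ninf.
have [r hr] := finite_boxes_del k fb.
have fin n : finite_set [set m | exists p, path (rcm_adj (Sscale s f) X U w) n p /\ last n p = m].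
  by apply: contrapT => nf; apply: ninf; exists n.
have [L hL] : exists L : nat, forall n m, n \in r ->
    (exists p, path (rcm_adj (Sscale s f) X U w) n p /\ last n p = m) -> box (del * L%:R) (X w m).
  elim: r {hr} => [|n r [L hL]]; first by exists 0%N.
  have /finite_seqP[q hq] := fin n.
  have [L' hL'] : exists L' : nat, forall m, m \in q -> box (del * L'%:R) (X w m).
    elim: q {hq} => [|m q [L' hL']]; first by exists 0%N.
    have [L2 h2] := box_exists (X w m); exists (maxn L' L2) => m'; rewrite inE => /orP[/eqP ->|/hL'].
      exact: box_le (leq_maxr _ _) h2.
    exact: box_le (leq_maxl _ _).
  exists (maxn L L') => n' m; rewrite inE => /orP[/eqP -> hm|n'r hm].
    apply: box_le (leq_maxr _ _) _; apply: hL'.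
    have : [set m | exists p, path (rcm_adj (Sscale s f) X U w) n p /\ last n p = m] m by [].
    by rewrite hq.
  exact: box_le (leq_maxl _ _) (hL _ _ n'r hm).
have [l Ll [n [p [np nk nl]]]] := hp L.
apply: nl; apply: box_le Ll _; apply: (hL n) => //; first exact: hr.
by exists p.
Qed.

Lemma paths_of_infinite w : finite_boxes X w -> infc w ->
  exists k0 : nat, forall k l : nat, (k0 <= k)%N -> bpath w k l.
Proof.
move=> fb [n ninf]; have [k0 hk0] := box_exists (X w n).
exists k0 => k l kk; have [r hr] := finite_boxes_del l fb.
apply: contrapT => nb; apply: ninf.
apply: (@sub_finite_set _ _ [set` r]); last exact: finite_seq.
move=> m [p [np lp]] /=; apply: hr; apply: contrapT => nbm; apply: nb.
by exists n, p; split=> //; [exact: box_le hk0|rewrite lp].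
Qed.

Definition regular w := U_positive w /\ finite_boxes X w.

Lemma ae_regular : P.-negligible (~` regular).
Proof.
rewrite (_ : ~` regular = ~` U_positive `|` ~` finite_boxes X).
  by apply: negligibleU; [exact: ae_U_positive|exact: (ae_finite_boxes H)].
by rewrite -setCI.
Qed.

(** The upper limit of the events over [l] still has probability at least [1 - e] and provides paths
    leaving every box from a fixed one; then [e] runs through a sequence tending to 0. The
    measurable [W] inside the path event spares the measurability of the latter. *)
Lemma percolation_criterion :
  (forall e : R, 0 < e -> exists k : nat, forall l : nat, exists W : set Omega,
    [/\ measurable W, ((1 - e)%:E <= P W)%E & forall w, W w -> regular w -> bpath w k l]) ->
  {ae P, forall w, infc w}.
Proof.
move=> hyp; have [N [mN N0 subN]] := ae_regular.
pose e (j : nat) : R := j.+1%:R^-1.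
have e0 j : 0 < e j by rewrite invr_gt0.
have /choice[G hG] : forall j, exists G : set Omega, [/\ measurable G, ((1 - e j)%:E <= P G)%E &
    forall w, G w -> regular w -> infc w].
  move=> j; have [k hk] := hyp (e j) (e0 j); have [W hW] := choice hk.
  exists (\bigcap_m \bigcup_(n in [set n | m <= n]%N) W n); split.
  - apply: bigcapT_measurable => m; apply: bigcup_measurable => n _; by case: (hW n).
  - by apply: prob_limsup_ge => n; case: (hW n).
  - move=> w Gw rw; have [_ fb] := rw; apply: (@infinite_of_paths w k fb) => L.
    by have [l Ll Wl] := Gw L I; exists l => //; case: (hW l) => _ _; exact.
have mcap : measurable (\bigcap_j ~` G j).
  by apply: bigcapT_measurable => j; apply: measurableC; case: (hG j).
have zero : P (\bigcap_j ~` G j) = 0%E.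
  apply/eqP; rewrite eq_le measure_ge0 andbT; apply/lee_addgt0Pr => x x0; rewrite add0e.
  have [j ej] : exists j, e j <= x.
    exists (Num.truncn x^-1); rewrite /e invf_ple ?posrE // ltW //.
    have xi0 : 0 <= x^-1 by rewrite invr_ge0 ltW.
    by have /andP[_] := truncn_itv xi0.
  have [mG PG _] := hG j.
  apply: (@le_trans _ _ (P (~` G j))).
    by apply: le_measure; rewrite ?inE //; [exact: measurableC|move=> w; apply].
  have -> : P (~` G j) = (1 - P (G j))%E by exact: probability_setC.
  rewrite leeBlDr; last by apply: fin_num_measure.
  apply: (@le_trans _ _ (x%:E + (1 - e j)%:E)%E); last by rewrite leeD2l.
  by rewrite -EFinD lee_fin; lra.
exists (N `|` \bigcap_j ~` G j); split; first exact: measurableU.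
- by rewrite measureU0.
- move=> w /= ninf; case: (pselect (regular w)) => [rw|nr]; last by left; apply: subN.
  by right=> j _ Gj; apply: ninf; case: (hG j) => _ _; apply.
Qed.

(** One [k] must serve all [l]. Otherwise each [k] has a measurable [W k] of probability at most
    [1 - e] that covers some path event; by [paths_of_infinite] almost every outcome lies in the
    lower limit of these sets, whose probability is at most [1 - e]. *)
Lemma percolation_consequence (e : R) : {ae P, forall w, infc w} -> 0 < e ->
  exists2 k : nat, (0 < k)%N & forall (l : nat) (W : set Omega), measurable W ->
    (forall w, regular w -> bpath w k l -> W w) -> ((1 - e)%:E <= P W)%E.
Proof.
move=> [M [mM M0 subM]] e0; have [N [mN N0 subN]] := ae_regular.
apply: contrapT => nk.
have /choice[W hW] : forall k, exists W : set Omega, [/\ measurable W, (P W <= (1 - e)%:E)%E &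
    exists l, forall w, regular w -> bpath w k.+1 l -> W w].
  move=> k; apply: contrapT => nW; apply: nk; exists k.+1 => // l W mW hW.
  rewrite leNgt; apply/negP => PW; apply: nW; exists W; split=> //; first exact: ltW.
  by exists l.
have mW k : measurable (W k) by case: (hW k).
have PW k : (P (W k) <= (1 - e)%:E)%E by case: (hW k).
have := prob_liminf_le mW PW; set L := \bigcup_m _ => PL.
have mL : measurable L.
  by apply: bigcupT_measurable => m; apply: bigcap_measurable => [|n _]; [exists m => /=|exact: mW].
have : (P setT <= P (L `|` (M `|` N)))%E.
  apply: le_measure; rewrite ?inE //; first by apply: measurableU => //; exact: measurableU.
  move=> w _; case: (pselect (regular w)) => [rw|nr]; last by right; right; apply: subN.
  case: (pselect (infc w)) => [iw|ni]; last by right; left; apply: subM.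
  left; have [_ fb] := rw; have [k0 hk0] := paths_of_infinite fb iw.
  exists k0 => // n /= kn; have [_ _ [l hl]] := hW n; apply: hl => //.
  by apply: hk0; exact: leq_trans kn _.
have MN0 : P (M `|` N) = 0%E by rewrite measureU0.
rewrite probability_setT measureU0 //; last exact: measurableU.
by move=> /le_trans/(_ PL); rewrite lee_fin; lra.
Qed.
End PercolationEvents.

(** * Errors of the discretization *)

Section Telescope.
Context {R : realType}.
Variables (G : nat -> nat -> R) (n : nat).
Hypothesis G01 : forall x y, 0 <= G x y <= 1.

Lemma sum_shift_down (a : nat -> R) : (forall x, 0 <= a x <= 1) ->
  \sum_(x < n) a x.-1 <= 1 + \sum_(x < n) a x.
Proof.
move=> a01; case: n => [|p]; first by rewrite !big_ord0 addr0.
rewrite big_ord_recl /= [X in _ <= _ + X]big_ord_recr /=.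
rewrite (eq_bigr (fun i : 'I_p => a i)); last by move=> i _.
have /andP[_ h1] := a01 0%N; have /andP[h2 _] := a01 p; lra.
Qed.

Lemma sum_shift_up (a : nat -> R) : (forall x, 0 <= a x <= 1) ->
  \sum_(x < n) a x <= 1 + \sum_(x < n) a x.+1.
Proof.
move=> a01; case: n => [|p]; first by rewrite !big_ord0 addr0.
rewrite big_ord_recl /= [X in _ <= _ + X]big_ord_recr /=.
have -> : \sum_(i < p) a (lift ord0 i) = \sum_(i < p) a i.+1 by apply: eq_bigr => i _.
have /andP[_ h1] := a01 0%N; have /andP[h2 _] := a01 p.+1; lra.
Qed.

(** The difference of the two shifted sums reduces to boundary terms, of order [n] instead of
    [n ^ 2]. No continuity of [f] is involved, so jumps of [f] are allowed. *)
Lemma sum_telescope : \sum_(x < n) \sum_(y < n) (G x.-1 y.-1 - G x.+1 y.+1) <= 4 * n%:R.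
Proof.
have S1 : \sum_(x < n) \sum_(y < n) G x.-1 y.-1 <= 2 * n%:R + \sum_(x < n) \sum_(y < n) G x y.
  apply: (@le_trans _ _ (\sum_(x < n) (1 + \sum_(y < n) G x.-1 y))).
    by apply: ler_sum => x _; apply: sum_shift_down.
  rewrite big_split /= sumr_const card_ord -mulr_natl mulr1 [leLHS]addrC exchange_big /=.
  apply: (@le_trans _ _ (\sum_(y < n) (1 + \sum_(x < n) G x y) + n%:R)).
    by rewrite lerD2r; apply: ler_sum => y _; apply: (@sum_shift_down (G^~ y)).
  by rewrite big_split /= sumr_const card_ord -mulr_natl mulr1 [X in _ <= _ + X]exchange_big /=; lra.
have S2 : \sum_(x < n) \sum_(y < n) G x y <= 2 * n%:R + \sum_(x < n) \sum_(y < n) G x.+1 y.+1.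
  apply: (@le_trans _ _ (\sum_(x < n) (1 + \sum_(y < n) G x y.+1))).
    by apply: ler_sum => x _; apply: sum_shift_up.
  rewrite big_split /= sumr_const card_ord -mulr_natl mulr1 [leLHS]addrC exchange_big /=.
  apply: (@le_trans _ _ (\sum_(y < n) (1 + \sum_(x < n) G x.+1 y.+1) + n%:R)).
    by rewrite lerD2r; apply: ler_sum => y _; apply: (@sum_shift_up (G^~ y.+1)).
  by rewrite big_split /= sumr_const card_ord -mulr_natl mulr1 [X in _ <= _ + X]exchange_big /=; lra.
under eq_bigr => x _ do rewrite sumrB.
rewrite sumrB; lra.
Qed.
End Telescope.

Section UpperHits.
Context {R : realType} (lam : R) {d : measure_display}
  {Omega : measurableType d} (P : probability Omega R)
  (X : Omega -> nat -> R * R) (U : Omega -> nat -> nat -> R) (f : R -> R) (s del : R).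
Hypothesis H : RCM_realization lam (Sscale s f) P X U.
Hypothesis lam_ge0 : 0 <= lam.
Hypothesis del_gt0 : 0 < del.
Hypothesis s01 : 0 < s <= 1.
Hypothesis f01 : forall r : R, 0 <= r -> 0 <= f r <= 1.
Hypothesis f_mono : forall x y : R, 0 <= x -> x <= y -> f y <= f x.
Variables (N0 b : nat).
Hypothesis b_gt0 : (0 < b)%N.
Local Notation tm := (del / b%:R).
Local Notation V := (cell N0 b).
Local Notation Bx := (@gridbox R s tm N0 b).
Local Notation Fl := (Flo f s tm).
Local Notation Fh := (Fhi f s tm).
Let s_gt0 : 0 < s. Proof. by case/andP: s01. Qed.
Let s_le1 : s <= 1. Proof. by case/andP: s01. Qed.
Let tm_gt0 : 0 < tm. Proof. by rewrite divr_gt0 // ltr0n. Qed.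
Let al : R := tm ^+ 2 / s.
Let pi : R := 1 - expR (- (lam * al)).

Lemma F01 x y : 0 <= s * f (tm * rdist x y) <= 1.
Proof.
have /andP[f0 f1] : 0 <= f (tm * rdist x y) <= 1.
  by apply: f01; rewrite mulr_ge0 ?rdist_ge0 // ltW.
by rewrite mulr_ge0 ?(ltW s_gt0) //= mulr_ile1 // ltW.
Qed.

Let mB v : measurable (Bx v). Proof. exact: measurable_cbox. Qed.
Let disjB u v x : Bx u x -> Bx v x -> u = v. Proof. exact: gridbox_uniq. Qed.
Let areaB v : area (Bx v) = al%:E. Proof. exact: area_gridbox. Qed.
Let lal0 : 0 <= lam * al.
Proof. by rewrite mulr_ge0 // divr_ge0 ?sqr_ge0 // ltW. Qed.

Lemma occ_prob_le : 0 <= pi <= lam * al.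
Proof.
rewrite /pi; apply/andP; split; first by rewrite subr_ge0 -expR0 ler_expR oppr_le0.
by have := expR_ge1Dx (- (lam * al)); lra.
Qed.

Definition crowded (v : V) : set Omega := ~` (count_is X (Bx v) 0 `|` count_is X (Bx v) 1).

Lemma count_prob v c : P (count_is X (Bx v) c) = (poisson_mass (lam * al) c)%:E.
Proof.
case: H => _ _ _ pois _.
have := pois 1%N (fun=> Bx v) (fun=> c) (fun=> mB _).
rewrite areaB => /(_ (fun=> ltry _)); rewrite big_ord1 /= => <-; last by move=> i j; rewrite !ord1 eqxx.
by congr (P _); apply/seteqP; split=> w; [move=> h i _|move/(_ ord0 I)].
Qed.

Lemma measurable_crowded v : measurable (crowded v).
Proof.
by apply: measurableC; apply: measurableU; apply: (measurable_count H).
Qed.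

Lemma crowded_prob v : (P (crowded v) <= ((lam * al) ^+ 2)%:E)%E.
Proof.
have m c : measurable (count_is X (Bx v) c) by exact: (measurable_count H).
have -> : P (crowded v) = (1 - P (count_is X (Bx v) 0 `|` count_is X (Bx v) 1))%E.
  by apply: probability_setC; exact: measurableU.
have -> : P (count_is X (Bx v) 0 `|` count_is X (Bx v) 1) =
    ((poisson_mass (lam * al) 0)%:E + (poisson_mass (lam * al) 1)%:E)%E.
  rewrite -!(count_prob v); apply: measureU => //.
  apply/seteqP; split=> // w [[q [_ /size0nil q0 hq]] [q' [_ sq' hq']]].
  case: q' sq' hq' => // n q' _ hq'; have := hq n; rewrite q0 => -[h _].
  by have := h ((hq' n).2 (mem_head _ _)).
rewrite -EFinD -[leLHS]/((1 - (poisson_mass (lam * al) 0 + poisson_mass (lam * al) 1))%:E) lee_fin /poisson_mass expr0 expr1.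
have := expR_ge1Dx (- (lam * al)); have := lal0; set x := lam * al => x0 hx.
have : (1 + x) * (1 - x) <= (1 + x) * expR (- x) by rewrite ler_wpM2l //; lra.
by rewrite /= ?divr1; nra.
Qed.

Definition ambiguous (u v : V) : set Omega :=
  [set w | [&& occupied X Bx w u, occupied X Bx w v & edge_open X U Bx (gF Fh) w u v]] `\`
  [set w | [&& occupied X Bx w u, occupied X Bx w v & edge_open X U Bx (gF Fl) w u v]].

Let Fl01 (u v : V) : 0 <= gF Fl u v <= 1. Proof. exact: F01. Qed.
Let Fh01 (u v : V) : 0 <= gF Fh u v <= 1. Proof. exact: F01. Qed.

Let m_pair (t : V -> V -> R) u v :
  measurable [set w | [&& occupied X Bx w u, occupied X Bx w v & edge_open X U Bx t w u v]].
Proof.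
rewrite (_ : [set w | _] = ~` [set w | ~~ occupied X Bx w u] `&` (~` [set w | ~~ occupied X Bx w v] `&`
  [set w | edge_open X U Bx t w u v])).
  apply: measurableI; first by apply: measurableC; exact: (measurable_unoccupied H mB).
  apply: measurableI; first by apply: measurableC; exact: (measurable_unoccupied H mB).
  exact: (measurable_edge_open H mB).
apply/seteqP; split=> w /=; first by move=> /and3P[-> -> ->].
by move=> [/negP + [/negP + ->]]; rewrite !negbK => -> ->.
Qed.

Lemma Flo_le_Fhi0 x y : Fl x y <= Fh x y.
Proof.
rewrite /Flo /Fhi ler_wpM2l ?(ltW s_gt0) //; apply: f_mono.
  by rewrite mulr_ge0 ?rdist_ge0 // ltW.
rewrite ler_wpM2l ?(ltW tm_gt0) // /rdist; apply: ler_wsqrtr.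
have h2 (a : nat) : (a.-1%:R : R) ^+ 2 <= a.+1%:R ^+ 2.
  by rewrite lerXn2r ?nnegrE ?ler0n // ler_nat; lia.
exact: lerD.
Qed.

Lemma Flo_le_Fhi (u v : V) : gF Fl u v <= gF Fh u v. Proof. exact: Flo_le_Fhi0. Qed.

Lemma measurable_ambiguous u v : measurable (ambiguous u v).
Proof. by apply: measurableD; exact: m_pair. Qed.

Lemma ambiguous_prob u v : (enum_rank u < enum_rank v)%N ->
  P (ambiguous u v) = (pi ^+ 2 * (gF Fh u v - gF Fl u v))%:E.
Proof.
move=> uv.
pose A t := [set w | [&& occupied X Bx w u, occupied X Bx w v & edge_open X U Bx t w u v]].
have -> : P (ambiguous u v) = (P (A (gF Fh)) - P (A (gF Fl)))%E.
  rewrite -[X in (_ - P X)%E](setIidr (_ : A (gF Fl) `<=` A (gF Fh))).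
    apply: measureD; rewrite ?/A //; apply: prob_le1; apply: probability_le1; exact: m_pair.
  move=> w /and3P[ou ov h]; rewrite /A /= ou ov /=; exact: le_trans h (Flo_le_Fhi _ _).
rewrite (pair_edge_prob H mB disjB areaB Fh01 uv) (pair_edge_prob H mB disjB areaB Fl01 uv).
by rewrite -EFinB -mulrBr.
Qed.

Definition bad_event : set Omega :=
  (\big[setU/set0]_(v : V) crowded v) `|`
  (\big[setU/set0]_(uv : V * V | (enum_rank uv.1 < enum_rank uv.2)%N) ambiguous uv.1 uv.2).

Lemma measurable_bad_event : measurable bad_event.
Proof.
apply: measurableU; apply: bigsetU_measurable => *.
  exact: measurable_crowded.
exact: measurable_ambiguous.
Qed.

Lemma prob_bigsetU_le (I : finType) (p : pred I) (E : I -> set Omega) :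
  (forall i, measurable (E i)) ->
  (P (\big[setU/set0]_(i | p i) E i) <= \sum_(i | p i) P (E i))%E.
Proof.
move=> mE; elim: (index_enum I) => [|i r IH]; first by rewrite !big_nil measure0.
rewrite !big_cons; case: ifP => // _; apply: le_trans (measureU2 _ _ _) _ => //.
  by apply: bigsetU_measurable => *.
by rewrite leeD2l.
Qed.

(** With [n] of order [b] cells per side and occupation probability of order [b ^ -2], crowded cells
    contribute [n ^ 2 * b ^ -4], and ambiguous pairs [n ^ 2 * b ^ -4 * n], which is of order
    [1 / b]. The constant is [132 = 4 * 33], as [1 / b + 32 * N0] is at most [33 * N0]. *)
Lemma prob_bad_event : (P bad_event <= (132 * N0%:R ^+ 3 * (lam * (del ^+ 2 / s)) ^+ 2 / b%:R)%:E)%E.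
Proof.
have [N00|N00] := posnP N0.
  have V0 (v : V) : False by case: v => -[i]; rewrite /side N00.
  rewrite /bad_event !big1; last 2 first.
  - by move=> uv; case: (V0 uv.1).
  - by move=> v; case: (V0 v).
  by rewrite setU0 measure0 lee_fin !mulr_ge0 ?exprn_ge0 ?invr_ge0 ?divr_ge0 ?sqr_ge0 // ltW.
have /andP[pi0 pil] := occ_prob_le.
set c := lam * (del ^+ 2 / s).
have c0 : 0 <= c by rewrite mulr_ge0 // divr_ge0 ?sqr_ge0 // ltW.
have b0 : 0 < b%:R :> R by rewrite ltr0n.
have lalE : lam * al = c / b%:R ^+ 2.
  by rewrite /al /c expr_div_n; field; rewrite !gt_eqF.
pose n : R := (side N0 b)%:R.
have nE : n = 2 * N0%:R * b%:R by rewrite /n /side !natrM.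
have cardV : #|{: V}| = (side N0 b * side N0 b)%N by rewrite card_prod card_ord.
apply: (@le_trans _ _ ((\sum_(v : V) (lam * al) ^+ 2)%:E +
   (\sum_(u : V) \sum_(v : V) pi ^+ 2 * (gF Fh u v - gF Fl u v))%:E)%E).
  apply: le_trans (measureU2 _ _ _) _.
  - by apply: bigsetU_measurable => *; exact: measurable_crowded.
  - by apply: bigsetU_measurable => *; exact: measurable_ambiguous.
  apply: leeD.
    apply: le_trans (prob_bigsetU_le _ _) _; first by move=> v; exact: measurable_crowded.
    by rewrite -sumEFin; apply: lee_sum => v _; exact: crowded_prob.
  apply: le_trans (prob_bigsetU_le _ _) _; first by move=> uv; exact: measurable_ambiguous.
  rewrite (eq_bigr (fun uv : V * V => (pi ^+ 2 * (gF Fh uv.1 uv.2 - gF Fl uv.1 uv.2))%:E)); last first.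
    by move=> uv r; exact: ambiguous_prob.
  rewrite sumEFin lee_fin pair_bigA /= [leLHS]big_mkcond /=; apply: ler_sum => uv _.
  case: ifP => // _; rewrite mulr_ge0 ?sqr_ge0 // subr_ge0.
  exact: Flo_le_Fhi.
have G0 x y : 0 <= Fh x y - Fl x y by rewrite subr_ge0; exact: Flo_le_Fhi0.
rewrite -EFinD lee_fin sumr_const cardV -[X in X + _]mulr_natl natrM -/n.
apply: (@le_trans _ _ (n * n * (lam * al) ^+ 2 + n * n * ((lam * al) ^+ 2 * (16 * n)))).
  rewrite lerD2l.
  apply: (@le_trans _ _ (\sum_(u : V) (lam * al) ^+ 2 * (16 * n))); last first.
    by rewrite sumr_const cardV -[leLHS]mulr_natl natrM -/n.
  apply: ler_sum => u _; rewrite -mulr_sumr; apply: ler_pM; rewrite ?sqr_ge0 //.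
  - by apply: sumr_ge0 => v _; rewrite /gF.
  - by rewrite lerXn2r ?nnegrE.
  - apply: le_trans (@sum_dn2_le R _ u (fun x y => Fh x y - Fl x y) G0) _.
    rewrite (_ : 16 * n = 4 * (4 * n)); last by ring.
    rewrite ler_wpM2l //.
    by apply: (@sum_telescope R (fun x y => s * f (tm * rdist x y))) => x y; exact: F01.
have N1 : 1 <= N0%:R :> R by rewrite ler1n.
have b1 : 1 <= b%:R :> R by rewrite ler1n.
rewrite lalE nE; set N := N0%:R in N1 *; set B := b%:R in b1 b0 *.
have -> : 2 * N * B * (2 * N * B) * (c / B ^+ 2) ^+ 2 + 2 * N * B * (2 * N * B) * ((c / B ^+ 2) ^+ 2 * (16 * (2 * N * B))) =
  4 * N ^+ 2 * c ^+ 2 * (B^-1 + 32 * N) / B.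
  by field; rewrite gt_eqF.
rewrite ler_pM2r ?invr_gt0 //.
have Bi : B^-1 <= 1 by rewrite invf_le1.
have -> : 132 * N ^+ 3 * c ^+ 2 = 4 * N ^+ 2 * c ^+ 2 * (33 * N) by ring.
apply: ler_wpM2l; last by lra.
by apply: mulr_ge0; [apply: mulr_ge0|]; rewrite ?sqr_ge0.
Qed.

Lemma upper_hits k l m : (k <= N0)%N -> (l + m < N0)%N ->
  (forall r : R, 0 <= r -> 0 < f r -> r <= del * m%:R) ->
  exists W : set Omega, [/\ measurable W,
    (forall w, regular X U w -> box_path X U f s w (del / Num.sqrt s * k%:R) (del / Num.sqrt s * l%:R) -> W w) &
    (P W <= (bexp (gprob pi (@gF R N0 b Fl)) (fun A =>
        (hits (target N0 b l) (gsys (start N0 b k) (occ_of A) (und A)))%:R) +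
      132 * N0%:R ^+ 3 * (lam * (del ^+ 2 / s)) ^+ 2 / b%:R)%:E)%E].
Proof.
move=> kN lN rng.
have b0 : b%:R != 0 :> R by rewrite gt_eqF // ltr0n.
exists ([set w | cell_hits X U Bx (gF Fl) (start N0 b k) (target N0 b l) w] `|` bad_event); split.
- apply: measurableU; last exact: measurable_bad_event.
  by apply: (measurable_cell_hits H mB); exact: gF_sym.
- move=> w [Up _] bp; case: (pselect (bad_event w)) => nb; [by right|left].
  have mE (j : nat) : del / Num.sqrt s * j%:R = mesh s tm * (j * b)%:R.
    by rewrite /mesh natrM; field; rewrite b0 gt_eqF // sqrtr_gt0.
  rewrite !mE in bp.
  apply: (box_path_hits s_gt0 tm_gt0 b_gt0 f_mono kN lN _ Up _ _ bp).
  + by move=> r r0 fr; rewrite natrM mulrCA divfK // mulrC; exact: rng.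
  + move=> v n n' Bn Bn'; apply: contrapT => nn; apply: nb; left.
    rewrite (bigD1 v) //=; left => -[[q [_ /size0nil q0 hq]]|[q [_ sq hq]]].
      by have := (hq n).1 Bn; rewrite q0.
    case: q sq hq => [//|a [|//]] _ hq; apply: nn.
    by have := (hq n).1 Bn; have := (hq n').1 Bn'; rewrite !inE => /eqP -> /eqP ->.
  + move=> u v uv ou ov eh; apply: contrapT => el; apply: nb; right.
    rewrite (bigD1 (u, v)) //=; left; split; first by rewrite /= ou ov eh.
    by move=> /and3P[_ _].
- apply: le_trans (measureU2 _ _ _) _.
  + by apply: (measurable_cell_hits H mB); exact: gF_sym.
  + exact: measurable_bad_event.
  rewrite EFinD; apply: leeD; last exact: prob_bad_event.
  by have <- := cell_hits_prob H mB disjB areaB Fl01 (@gF_sym _ _ _ _) (start N0 b k) (target N0 b l).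
Qed.

End UpperHits.

(** * Verification of the grid hypotheses for [f] *)

Section Transfer.
Context {R : realType}.
Variables (f : R -> R) (del : R) (m : nat).
Hypothesis del_gt0 : 0 < del.
Hypothesis f01 : forall r : R, 0 <= r -> 0 <= f r <= 1.
Hypothesis f_mono : forall x y : R, 0 <= x -> x <= y -> f y <= f x.
Hypothesis f_range : forall r : R, 0 <= r -> 0 < f r -> r <= del * m%:R.
Hypothesis f_pos : 0 < f (30 * del).
Hypothesis m40 : m = 40%N.

Definition realizable (lam : R) := forall g : R -> R, exists (d : measure_display) (Omega : measurableType d)
  (P : probability Omega R) (X : Omega -> nat -> R * R) (U : Omega -> nat -> nat -> R),
  RCM_realization lam g P X U.

Lemma rdist_mono (x x' y y' : nat) : (x <= x')%N -> (y <= y')%N -> rdist x y <= rdist x' y' :> R.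
Proof.
move=> xx yy; rewrite /rdist; apply: ler_wsqrtr; apply: lerD;
by rewrite lerXn2r ?nnegrE ?ler0n // ler_nat.
Qed.

Lemma le_rdist (x y : nat) : (x%:R <= rdist x y :> R) /\ (y%:R <= rdist x y :> R).
Proof.
split; rewrite /rdist -{1}[_%:R]ger0_norm ?ler0n // -sqrtr_sqr; apply: ler_wsqrtr.
  by rewrite lerDl sqr_ge0.
by rewrite lerDr sqr_ge0.
Qed.

(** The triangle inequality, with 2 in place of the square root of 2. *)
Lemma sqrt_shift (x y e : R) : 0 <= x -> 0 <= y -> 0 <= e ->
  Num.sqrt ((x + e) ^+ 2 + (y + e) ^+ 2) <= Num.sqrt (x ^+ 2 + y ^+ 2) + 2 * e.
Proof.
move=> x0 y0 e0; set S := Num.sqrt (x ^+ 2 + y ^+ 2).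
have S0 : 0 <= S by exact: sqrtr_ge0.
have S2 : S ^+ 2 = x ^+ 2 + y ^+ 2 by rewrite sqr_sqrtr // addr_ge0 ?sqr_ge0.
have xS : x <= S.
  by rewrite /S -{1}[x]ger0_norm // -sqrtr_sqr; apply: ler_wsqrtr; rewrite lerDl sqr_ge0.
have yS : y <= S.
  by rewrite /S -{1}[y]ger0_norm // -sqrtr_sqr; apply: ler_wsqrtr; rewrite lerDr sqr_ge0.
have r0 : 0 <= S + 2 * e by rewrite addr_ge0 // mulr_ge0.
rewrite -[leRHS]ger0_norm // -sqrtr_sqr; apply: ler_wsqrtr.
have : (x + y) * e <= (S + S) * e by rewrite ler_wpM2r // lerD.
have : 0 <= e * e by rewrite mulr_ge0.
by move=> h1 h2; rewrite !sqrrD S2; lra.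
Qed.

Section Grid.
Variables (s : R) (b : nat).
Hypothesis s01 : 0 < s <= 1.
Hypothesis b_gt0 : (0 < b)%N.
Local Notation tm := (del / b%:R).
Let bR : 0 < b%:R :> R. Proof. by rewrite ltr0n. Qed.
Let tm0 : 0 < tm. Proof. by rewrite divr_gt0. Qed.
Let s_gt0 : 0 < s. Proof. by case/andP: s01. Qed.

Lemma Flo_mono x x' y y' : (x <= x')%N -> (y <= y')%N -> Flo f s tm x' y' <= Flo f s tm x y.
Proof.
move=> xx yy; rewrite /Flo ler_wpM2l ?(ltW s_gt0) //; apply: f_mono.
  by rewrite mulr_ge0 ?rdist_ge0 // ltW.
by rewrite ler_wpM2l ?(ltW tm0) //; apply: rdist_mono.
Qed.

Lemma Flo_pos x y : 0 < Flo f s tm x y -> tm * rdist x.+1 y.+1 <= del * m%:R.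
Proof.
rewrite /Flo pmulr_rgt0 // => fp; apply: f_range => //.
by rewrite mulr_ge0 ?rdist_ge0 // ltW.
Qed.

Lemma Flo_range x y : 0 < Flo f s tm x y -> (x <= m * b)%N /\ (y <= m * b)%N.
Proof.
move=> /Flo_pos h; have [h1 h2] := le_rdist x.+1 y.+1.
have aux (z : nat) : z.+1%:R <= rdist x.+1 y.+1 :> R -> (z <= m * b)%N.
  move=> hz; rewrite -(ler_nat R) natrM.
  have : tm * z.+1%:R <= del * m%:R by apply: le_trans h; rewrite ler_wpM2l // ltW.
  rewrite mulrAC ler_pdivrMr // -mulrA ler_pM2l // => hh.
  by apply: le_trans hh; rewrite ler_nat.
by split; apply: aux.
Qed.

Lemma Flo_ge x y : tm * rdist x.+1 y.+1 <= 30 * del -> s * f (30 * del) <= Flo f s tm x y.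
Proof.
move=> h; rewrite /Flo ler_wpM2l ?(ltW s_gt0) //; apply: f_mono => //.
by rewrite mulr_ge0 ?rdist_ge0 // ltW.
Qed.

(** A bond of positive probability spans at most [40 * del]. Half of it is [20 * del], and shifting
    both coordinates by [4 * b + 1] steps of size [del / b] adds at most [2 * (5 * del)]. This is
    the origin of [30 * del]. *)
Lemma Flo_mid x y : 0 < Flo f s tm x y ->
  s * f (30 * del) <= Flo f s tm (x./2 + 4 * b)%N (y./2 + 4 * b)%N.
Proof.
move=> /Flo_pos h; apply: Flo_ge.
have b1 : 1 <= b%:R :> R by rewrite ler1n.
pose e : R := (4 * b).+1%:R.
have half (z : nat) : (z./2 + 4 * b).+1%:R <= z.+1%:R / 2 + e :> R.
  rewrite -addnS natrD lerD2r ler_pdivlMr // -natrM ler_nat; lia.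
have hs : rdist (x./2 + 4 * b).+1 (y./2 + 4 * b).+1 <= rdist x.+1 y.+1 / 2 + 2 * e.
  apply: (@le_trans _ _ (Num.sqrt ((x.+1%:R / 2 + e) ^+ 2 + (y.+1%:R / 2 + e) ^+ 2))).
    rewrite /rdist; apply: ler_wsqrtr; apply: lerD; rewrite lerXn2r ?nnegrE ?ler0n //;
    by rewrite addr_ge0 ?divr_ge0 ?ler0n.
  apply: le_trans (sqrt_shift _ _ _) _; rewrite ?divr_ge0 ?ler0n //.
  rewrite lerD2r /rdist !expr_div_n -mulrDl sqrtrM ?addr_ge0 ?sqr_ge0 //.
  by rewrite sqrtrV // sqrtr_sqr ger0_norm.
have tme : tm * e <= 5 * del.
  rewrite /e -natr1 natrM mulrAC ler_pdivrMr // -mulrA mulrCA ler_pM2l //.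
  lra.
have : tm * rdist (x./2 + 4 * b).+1 (y./2 + 4 * b).+1 <= tm * (rdist x.+1 y.+1 / 2 + 2 * e).
  by rewrite ler_wpM2l // ltW.
by move: h; rewrite m40; lra.
Qed.

Lemma Flo_near x y : (x <= 2 * b)%N -> (y <= 2 * b)%N -> s * f (30 * del) <= Flo f s tm x y.
Proof.
move=> hx hy; apply: Flo_ge.
have b1 : 1 <= b%:R :> R by rewrite ler1n.
apply: (@le_trans _ _ (tm * rdist (0 + (2 * b).+1) (0 + (2 * b).+1))).
  by rewrite ler_wpM2l ?(ltW tm0) //; apply: rdist_mono; rewrite add0n ltnS.
have := @sqrt_shift 0 0 (2 * b).+1%:R (lexx _) (lexx _) (ler0n _ _).
rewrite expr0n /= addr0 sqrtr0 add0r => hs.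
rewrite !add0n; apply: (@le_trans _ _ (tm * (2 * (2 * b).+1%:R))).
  by rewrite ler_wpM2l ?(ltW tm0) // /rdist; rewrite !add0r in hs.
have -> : (2 * b).+1%:R = 2 * b%:R + 1 :> R by rewrite -natr1 natrM.
rewrite mulrAC ler_pdivrMr // [30 * del]mulrC -mulrA ler_pM2l //; lra.
Qed.
End Grid.

Section Lower.
Context (lam : R) {d : measure_display} {Omega : measurableType d} (P : probability Omega R)
  (X : Omega -> nat -> R * R) (U : Omega -> nat -> nat -> R) (s eta : R) (N0 b : nat).
Hypothesis H : RCM_realization lam (Sscale s f) P X U.
Hypothesis s01 : 0 < s <= 1.
Hypothesis eta01 : 0 < eta < 1.
Hypothesis b_gt0 : (0 < b)%N.
Local Notation tm := (del / b%:R).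

Lemma lower_hits k l : (k <= N0)%N -> (l <= N0)%N -> exists W : set Omega, [/\ measurable W,
    P W = (bexp (gprob (1 - expR (- (lam * (tm ^+ 2 / s)))) (fun u v => eta * @gF R N0 b (Flo f s tm) u v))
      (fun A => (hits (target N0 b l) (gsys (start N0 b k) (occ_of A) (und A)))%:R))%:E &
    forall w, W w -> regular X U w ->
      box_path X U f s w (del / Num.sqrt s * k%:R) (del / Num.sqrt s * l%:R)].
Proof.
move=> kN lN; have /andP[s0 s1] := s01; have /andP[e0 e1] := eta01.
have bR : b%:R != 0 :> R by rewrite gt_eqF // ltr0n.
have tm0 : 0 < tm by rewrite divr_gt0 // ltr0n.
have t01 (u v : cell N0 b) : 0 <= eta * gF (Flo f s tm) u v <= 1.
  have /andP[h0 h1] := F01 del_gt0 s01 f01 b_gt0 (dn u.1 v.1).+1 (dn u.2 v.2).+1.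
  by rewrite mulr_ge0 ?(ltW e0) //= mulr_ile1 // ltW.
have sy (u v : cell N0 b) : eta * gF (Flo f s tm) u v = eta * gF (Flo f s tm) v u by rewrite gF_sym.
have mB (v : cell N0 b) : measurable (@gridbox R s tm N0 b v) by exact: measurable_cbox.
exists [set w | cell_hits X U (@gridbox R s tm N0 b) (fun u v => eta * gF (Flo f s tm) u v) (start N0 b k) (target N0 b l) w].
split.
- exact: (measurable_cell_hits H mB sy).
- apply: (cell_hits_prob H mB _ _ t01 sy); first by move=> u v x; exact: gridbox_uniq.
  by move=> v; exact: area_gridbox.
- move=> w h [Up _].
  have mE (j : nat) : del / Num.sqrt s * j%:R = mesh s tm * (j * b)%:R.
    by rewrite /mesh natrM; field; rewrite bR gt_eqF // sqrtr_gt0.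
  by rewrite !mE; apply: (hits_box_path s0 tm0 b_gt0 f_mono kN lN eta01 Up h).
Qed.
End Lower.
End Transfer.

(** * Monotonicity in the scaling parameter *)

Lemma geometric_small {R : realType} (y e : R) : 0 <= y < 1 -> 0 < e ->
  exists n : nat, forall k, (n <= k)%N -> y ^+ k <= e.
Proof.
move=> /andP[y0 y1] e0.
have : (fun n => y ^+ n) @ \oo --> (0 : R) by apply: cvg_expr; rewrite ger0_norm.
move=> /cvgrPdist_le/(_ e e0)[n _ hn]; exists n => k nk.
by have := hn k nk; rewrite sub0r normrN ger0_norm ?exprn_ge0.
Qed.

Section Transfer.
Context {R : realType}.
Variables (f : R -> R) (del : R) (m : nat).
Hypothesis del_gt0 : 0 < del.
Hypothesis f01 : forall r : R, 0 <= r -> 0 <= f r <= 1.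
Hypothesis f_mono : forall x y : R, 0 <= x -> x <= y -> f y <= f x.
Hypothesis f_range : forall r : R, 0 <= r -> 0 < f r -> r <= del * m%:R.
Hypothesis f_pos : 0 < f (30 * del).
Hypothesis m40 : m = 40%N.

Definition occ_prob (lam s : R) (b : nat) : R := 1 - expR (- (lam * ((del / b%:R) ^+ 2 / s))).

Lemma occ_prob01 lam s b : 0 <= lam -> 0 < s -> 0 <= occ_prob lam s b <= 1.
Proof.
move=> l0 s0; rewrite /occ_prob subr_ge0 gerBl expR_ge0 andbT -expR0 ler_expR oppr_le0.
by rewrite mulr_ge0 // divr_ge0 ?sqr_ge0 // ltW.
Qed.

Lemma occ_prob_bounds lam s b x : 0 <= lam -> 0 < s -> (0 < b)%N ->
  x = lam * (del ^+ 2 / s) / b%:R ^+ 2 -> x * (1 - x) <= occ_prob lam s b <= x.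
Proof.
move=> l0 s0 b0 xE.
have bR : b%:R != 0 :> R by rewrite gt_eqF // ltr0n.
have -> : occ_prob lam s b = 1 - expR (- x).
  by congr (1 - expR (- _)); rewrite xE expr_div_n; field; rewrite bR gt_eqF.
have x0 : 0 <= x by rewrite xE !mulr_ge0 ?divr_ge0 ?sqr_ge0 ?invr_ge0 ?exprn_ge0 // ltW.
have h1 := expR_ge1Dx (- x); have h2 := expR_ge1Dx x.
have h3 : expR (- x) <= (1 + x)^-1.
  by rewrite expRN lef_pV2 ?posrE ?expR_gt0 //; lra.
have h4 : (1 + x)^-1 <= 1 - x + x ^+ 2.
  rewrite invf_ple ?posrE; [|lra|]; last by have := sqr_ge0 (x - 2^-1); lra.
  have d0 : 0 < 1 - x + x ^+ 2 by have := sqr_ge0 (x - 2^-1); rewrite sqrrB; lra.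
  rewrite -[leLHS]mul1r ler_pdivrMr //.
  have : 0 <= x ^+ 3 by rewrite exprn_ge0.
  by rewrite !exprS expr0; lra.
by rewrite mulrBr mulr1 -expr2; apply/andP; split; lra.
Qed.

Definition kap : R := ((2 * rad m).+1 ^ 2)%:R.

(** On the grid the bond probabilities for [p] are [p / q] times those for [q], and [eta] is given
    up in [lower_hits], whence the ratio [s]. The conditions are the budget of
    [grid_enhancement]. *)
Definition enhanceable (lam lam' p q eta : R) (b : nat) : Prop :=
  let s := eta * (p / q) in let c0 := q * f (30 * del) in
  exists piD piW, [/\ 0 <= piD <= 1, 0 <= piW <= 1,
    occ_prob lam q b <= 1 - (1 - s * occ_prob lam' p b) * (1 - piD),
    kap * piW <= s * occ_prob lam' p b * (1 - s) * (c0 * c0) &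
    piD <= (1 - (1 - piW) ^+ (b * b)) ^+ ((2 * rad m).+1 ^ 2) * piW * (1 - piW) ^+ (b * b)].

(** The order of the choices matters: [k] comes from percolation at [q] with half of the error, then
    [l] is arbitrary, and only then is [b] taken so large that the discretization error, whose
    constant depends on [l], stays below the other half. *)
Lemma percolates_transfer lam lam' p q eta : 0 <= lam -> 0 <= lam' -> 0 < p -> p < q -> q <= 1 ->
  0 < eta < 1 -> realizable lam ->
  (forall B0 : nat, exists2 b, (B0 < b)%N & enhanceable lam lam' p q eta b) ->
  percolates lam (Sscale q f) -> percolates lam' (Sscale p f).
Proof.
move=> l0 l0' p0 pq q1 eta01 rex enh perc d Omega P X U H.
have q0 : 0 < q by exact: lt_trans pq.
have q01 : 0 < q <= 1 by rewrite q0.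
have p01 : 0 < p <= 1 by rewrite p0 /= ltW // (lt_le_trans pq).
have /andP[e0 e1] := eta01.
have dq0 (s : R) : 0 < s -> 0 < del / Num.sqrt s by move=> ?; rewrite divr_gt0 // sqrtr_gt0.
apply: (percolation_criterion H l0' (dq0 p p0)) => e ep.
have [dA [OA [PA [XA [UA HA]]]]] := rex (Sscale q f).
have e2 : 0 < e / 2 by rewrite divr_gt0.
have [k k0 hk] := percolation_consequence HA l0 (dq0 q q0) (perc _ _ _ _ _ HA) e2.
exists k => l.
pose N0 := (k + l + m + rad m).+1.
pose C : R := 132 * N0%:R ^+ 3 * (lam * (del ^+ 2 / q)) ^+ 2.
have C0 : 0 <= C.
  by rewrite /C; apply: mulr_ge0; [apply: mulr_ge0; rewrite ?exprn_ge0 ?ler0n|exact: sqr_ge0].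
have Ce0 : 0 <= C / (e / 2) by rewrite divr_ge0 // ltW.
have [b Bb [piD [piW [D01 W01 hA hW hD]]]] := enh (Num.truncn (C / (e / 2))).
have b0 : (0 < b)%N by exact: leq_ltn_trans Bb.
have bR : 0 < b%:R :> R by rewrite ltr0n.
have err : C / b%:R <= e / 2.
  rewrite ler_pdivrMr // mulrC -ler_pdivrMr //.
  have /andP[_ h] := truncn_itv Ce0; apply: ltW; apply: lt_le_trans h _.
  by rewrite ler_nat.
have kN : (k <= N0)%N by rewrite /N0; clear; lia.
have lN : (l <= N0)%N by rewrite /N0; clear; lia.
have lmN : (l + m < N0)%N by rewrite /N0; clear; lia.
have lmrN : (l + m + rad m < N0)%N by rewrite /N0; clear; lia.
have [WA [mWA bWA PWA]] := upper_hits HA l0 del_gt0 q01 f01 f_mono b0 kN lmN f_range.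
have hi := hk l WA mWA bWA.
have [WB [mWB PWB bWB]] := lower_hits del_gt0 f01 f_mono H p01 eta01 b0 kN lN.
exists WB; split=> //; rewrite PWB lee_fin.
have := le_trans hi PWA; rewrite lee_fin => lowA.
apply: (@le_trans _ _ (bexp (gprob (occ_prob lam q b) (@gF R N0 b (Flo f q (del / b%:R)))) (fun A =>
   (hits (target N0 b l) (gsys (start N0 b k) (occ_of A) (und A)))%:R))).
  by rewrite /occ_prob; move: lowA err; rewrite -/C; set Z := bexp _ _; lra.
(* The same [del / b] serves [p] and [q], whose grids differ only by the size of the cells in the
   plane. *)
have -> : (fun u v : cell N0 b => eta * gF (Flo f p (del / b%:R)) u v) =
   (fun u v : cell N0 b => eta * (p / q) * gF (Flo f q (del / b%:R)) u v).
  apply/funext => u; apply/funext => v; rewrite /gF /Flo.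
  by field; rewrite gt_eqF.
have pq1 : p / q < 1 by rewrite ltr_pdivrMr // mul1r.
have pq0 : 0 < p / q by rewrite divr_gt0.
have f30 : 0 <= 30 * del by rewrite mulr_ge0 // ltW.
have /andP[fp0 fp1] := f01 f30.
apply: (@grid_enhancement R N0 b k l m (Flo f q (del / b%:R)) (q * f (30 * del)) b0 k0 kN lmrN
   _ _ _ _ _ _ piD piW) => //.
- exact: (Flo_mono del_gt0 f_mono q01 b0).
- exact: (Flo_range del_gt0 f_range q01 b0).
- exact: (Flo_mid del_gt0 f_mono f_range f_pos m40 q01 b0).
- by move=> x y; exact: (F01 del_gt0 q01 f01 b0).
- by rewrite mulr_gt0 //= mulr_ile1 // ltW.
- by rewrite mulr_gt0 //= (lt_trans _ pq1) // gtr_pMl.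
- exact: occ_prob01.
- exact: occ_prob01.
Qed.

(** It shows that the infimum defining the critical intensity is over a nonempty set. At one point
    per cell on average, a cell is occupied with probability at least [1 / 2], and blocks of
    sufficiently many cells make the site percolation of blocks as dense as required. *)
Lemma percolates_large s : 0 < s -> s <= 1 -> exists2 lam, 0 < lam & percolates lam (Sscale s f).
Proof.
move=> s0 s1; have s01 : 0 < s <= 1 by rewrite s0.
have eta01 : 0 < (2^-1 : R) < 1 by rewrite invr_gt0 ltr0n /= invf_lt1 // ltr1n.
have f30 : 0 <= 30 * del by rewrite mulr_ge0 // ltW.
have /andP[fp0 fp1] := f01 f30.
pose c : R := 2^-1 * (s * f (30 * del)).
have c0 : 0 < c by rewrite !mulr_gt0 // invr_gt0.
have c1 : c <= 1.
  by apply: mulr_ile1; rewrite ?mulr_ge0 ?invr_ge0 ?(ltW s0) ?invf_le1 ?ler1n // mulr_ile1 // ltW.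
have [b b0 hb] : exists2 b, (0 < b)%N & 81 * (1 - 2^-1 * c) ^+ (b * b) <= 2^-1.
  pose y := 1 - 2^-1 * c.
  have y0 : 0 <= y by rewrite /y; lra.
  have y1 : y < 1 by rewrite /y; lra.
  have [|n hn] := @geometric_small R y (2^-1 / 81) (introT andP (conj y0 y1)).
    by rewrite divr_gt0 // invr_gt0.
  exists n.+1 => //; have := hn (n.+1 * n.+1)%N; rewrite ler_pdivlMr // mulrC; apply.
  by clear; lia.
have bR : 0 < b%:R :> R by rewrite ltr0n.
pose al : R := (del / b%:R) ^+ 2 / s.
have al0 : 0 < al by rewrite divr_gt0 // exprn_gt0 // divr_gt0.
exists (al^-1); first by rewrite invr_gt0.
move=> d Omega P X U H.
have l0 : 0 <= al^-1 by rewrite invr_ge0 ltW.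
have dq0 : 0 < del / Num.sqrt s by rewrite divr_gt0 // sqrtr_gt0.
apply: (percolation_criterion H l0 dq0) => e ep.
pose pi := occ_prob al^-1 s b.
have pi01 : 0 <= pi <= 1 by exact: occ_prob01.
have /andP[pi0 pi1] := pi01.
have pih : 2^-1 <= pi.
  rewrite /pi /occ_prob -/al mulVf ?gt_eqF //.
  have := expR_ge1Dx (1 : R) => h; rewrite expRN.
  have : (expR 1)^-1 <= 2^-1 :> R by rewrite lef_pV2 ?posrE ?expR_gt0 //; lra.
  by lra.
have [j0 hj] : exists j0 : nat, 2^-1 ^+ j0 <= e.
  have [|n hn] := @geometric_small R 2^-1 e _ ep; last by exists n; exact: hn.
  by rewrite invr_ge0 ler0n /= invf_lt1 // ltr1n.
exists (3 ^ j0)%N => l; pose N0 := (3 ^ (j0 + l).+1)%N.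
have kN : (3 ^ j0 <= N0)%N by rewrite /N0 leq_exp2l //; clear; lia.
have l3 : (l <= 3 ^ (j0 + l))%N.
  apply: (@leq_trans (3 ^ l)); first by rewrite ltnW // ltn_expl.
  by rewrite leq_exp2l // leq_addl.
have lN : (l <= N0)%N by apply: leq_trans l3 _; rewrite /N0 leq_exp2l.
have [W [mW PW bW]] := lower_hits del_gt0 f01 f_mono H s01 eta01 b0 kN lN.
exists W; split=> //; rewrite PW lee_fin.
apply: (@le_trans _ _ (1 - 2^-1 ^+ j0)); first by rewrite lerD2l lerN2.
have rho01 : 0 <= pi * c <= 1 by rewrite mulr_ge0 ?(ltW c0) //= mulr_ile1 // ltW.
have Fs : (fun u v : cell N0 b => 2^-1 * gF (Flo f s (del / b%:R)) u v) =
   (@gF R N0 b (fun x y => 2^-1 * Flo f s (del / b%:R) x y)) by [].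
rewrite Fs.
apply: (@grid_supercritical R N0 b (3 ^ j0) l b0 (pi * c) rho01 _ pi c j0 l) => //.
- move=> x y; have /andP[h0 h1] := F01 del_gt0 s01 f01 b0 x.+1 y.+1.
  by rewrite mulr_ge0 ?invr_ge0 //= mulr_ile1 ?invr_ge0 // invf_le1 ?ler1n.
- by rewrite (ltW c0).
- move=> x y hx hy; rewrite /c ler_wpM2l ?invr_ge0 //.
  exact: (Flo_near del_gt0 f_mono s01 b0).
- have hc : 2^-1 * c <= pi * c by rewrite ler_wpM2r // ltW.
  have /andP[_ r1] := rho01.
  apply: le_trans hb; apply: ler_wpM2l => //; apply: lerXn2r; rewrite ?nnegrE; lra.
Qed.
End Transfer.

(** * Choice of the parameters as the mesh vanishes *)

Section Params.
Context {R : realType}.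
Variables (f : R -> R) (del : R) (m : nat).
Hypothesis del_gt0 : 0 < del.
Hypothesis f01 : forall r : R, 0 <= r -> 0 <= f r <= 1.
Hypothesis f_mono : forall x y : R, 0 <= x -> x <= y -> f y <= f x.
Hypothesis f_range : forall r : R, 0 <= r -> 0 < f r -> r <= del * m%:R.
Hypothesis f_pos : 0 < f (30 * del).
Hypothesis m40 : m = 40%N.

Lemma bernoulli_ineq (x : R) n : 0 <= x <= 1 -> 1 - n%:R * x <= (1 - x) ^+ n.
Proof.
move=> /andP[x0 x1]; elim: n => [|n IH]; first by rewrite mul0r subr0 expr0.
rewrite exprS -natr1.
have y0 : 0 <= 1 - x by lra.
have h := ler_wpM2l y0 IH; apply: le_trans h.
have : 0 <= n%:R * (x * x) by rewrite !mulr_ge0 ?ler0n.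
by lra.
Qed.

Lemma sum4_le (x u d y : R) : 0 <= x -> 0 <= u -> 0 <= d -> 2 * x + u + d + 1 <= y ->
  [/\ 2 * x <= y, u <= y, d <= y & 1 <= y].
Proof. by move=> *; split; lra. Qed.

Local Notation K := ((2 * rad m).+1 ^ 2)%N.

(** A lower bound, free of [b], for [b * b] times the right side of the condition on [piD] when
    [piW = om / (b * b)]; it uses that [(1 - om / (b * b)) ^+ (b * b)] lies between [1 - om] and
    [expR (- om)]. *)
Definition lottery (om : R) : R := (1 - expR (- om)) ^+ K * om * (1 - om).

Lemma lottery_gt0 om : 0 < om < 1 -> 0 < lottery om.
Proof.
move=> /andP[ o0 o1]; rewrite /lottery !mulr_gt0 ?subr_gt0 // exprn_gt0 // subr_gt0.
by rewrite -expR0 ltr_expR oppr_lt0.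
Qed.

(** All probabilities of occupation are of order [1 / (b * b)]. After multiplication by [b * b] the
    conditions become inequalities between intensities, up to corrections that a large [b] makes
    smaller than the strict gap. *)
Lemma enhanceable_large (lam lam' p q eta om : R) : 0 <= lam -> 0 < lam' -> 0 < p -> p < q -> q <= 1 ->
  0 < eta < 1 -> 0 < om <= 2^-1 ->
  kap m * om <= eta * lam' * (del ^+ 2 / q) / 2 * (1 - eta * (p / q)) *
    ((q * f (30 * del)) * (q * f (30 * del))) ->
  lam * (del ^+ 2 / q) < eta * lam' * (del ^+ 2 / q) + lottery om ->
  forall B0 : nat, exists2 b, (B0 < b)%N & enhanceable f del m lam lam' p q eta b.
Proof.
move=> l0 l0' p0 pq q1 /andP[e0 e1] /andP[ o0 o1] hkap gap B0.
have q0 : 0 < q by exact: lt_trans pq.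
set s := eta * (p / q) in hkap; set c2 := (q * _) * _ in hkap.
set y := del ^+ 2 / q in hkap gap; set dd := lottery om in gap.
have om1 : 0 < om < 1 by rewrite o0 /=; lra.
have dd0 : 0 < dd by exact: lottery_gt0.
have y0 : 0 < y by rewrite divr_gt0 // exprn_gt0.
pose xB := lam' * (del ^+ 2 / p).
have xB0 : 0 < xB by rewrite mulr_gt0 // divr_gt0 // exprn_gt0.
have sx : s * xB = eta * lam' * y by rewrite /s /xB /y; field; rewrite !gt_eqF.
set a := eta * lam' * y in sx hkap gap *.
have a0 : 0 < a by rewrite /a mulr_gt0 // mulr_gt0.
pose g := a + dd - lam * y; have g0 : 0 < g by rewrite /g; lra.
(* The summands ensure in turn that [xB / be] is at most [1 / 2], that the second-order corrections
   stay below the gap [g], and that [piD] and [piW] are probabilities. *)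
pose M := 2 * xB + a * (xB + dd) / g + dd + 1.
have M0 : 0 <= M.
  have h1 : 0 <= a * (xB + dd) / g by rewrite divr_ge0 ?(ltW g0) // mulr_ge0 ?(ltW a0) // addr_ge0 // ltW.
  by rewrite /M; move: h1 xB0 dd0; clear; lra.
pose b := (maxn B0 (Num.truncn M)).+1.
exists b; first by rewrite /b ltnS leq_maxl.
have b0 : (0 < b)%N by [].
have bM : M <= b%:R.
  have /andP[_ h] := truncn_itv M0; apply: le_trans (ltW h) _.
  by rewrite ler_nat /b ltnS leq_maxr.
have b1 : 1 <= b%:R :> R by rewrite ler1n.
pose be : R := b%:R ^+ 2.
have beb : b%:R <= be by rewrite /be expr2 ler_peMr.
have be0 : 0 < be by apply: lt_le_trans beb; rewrite ltr0n.
have fr0 : 0 <= a * (xB + dd) / g by rewrite divr_ge0 ?(ltW g0) // mulr_ge0 ?(ltW a0) // addr_ge0 // ltW.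
have beM : M <= be by exact: le_trans beb.
have [be2 beg' bed be1] := sum4_le (ltW xB0) fr0 (ltW dd0) beM.
have beg : a * (xB + dd) <= g * be by rewrite [leRHS]mulrC -ler_pdivrMr.
have piBb := @occ_prob_bounds R del del_gt0 lam' p b (xB / be) (ltW l0') p0 b0 erefl.
have piAb := @occ_prob_bounds R del del_gt0 lam q b (lam * y / be) l0 q0 b0 erefl.
set pB := occ_prob del lam' p b in piBb *; set pA := occ_prob del lam q b in piAb *.
have /andP[B1 B2] := piBb; have /andP[_ A2] := piAb.
have s0 : 0 < s by rewrite !mulr_gt0 // invr_gt0.
have pq1 : p / q < 1 by rewrite ltr_pdivrMr // mul1r.
have s1 : s < 1 by rewrite (lt_trans _ pq1) // /s gtr_pMl // divr_gt0.
have bi0 : 0 < be^-1 by rewrite invr_gt0.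
have sB1 : a / be * (1 - xB / be) <= s * pB.
  have := ler_wpM2l (ltW s0) B1; rewrite -sx.
  by have -> : s * (xB / be * (1 - xB / be)) = s * xB / be * (1 - xB / be) by ring.
have sB2 : s * pB <= a / be by rewrite -sx -mulrA ler_wpM2l // ltW.
have xbe : xB / be <= 2^-1 by rewrite ler_pdivrMr //; lra.
exists (dd / be), (om / be); split.
- by rewrite divr_ge0 ?(ltW dd0) ?(ltW be0) //= ler_pdivrMr // mul1r.
- by rewrite divr_ge0 ?(ltW o0) ?(ltW be0) //= ler_pdivrMr // mul1r; lra.
- apply: le_trans A2 _.
  have h : s * pB * (dd / be) <= a / be * (dd / be) by rewrite ler_wpM2r // divr_ge0 // ltW.
  have key : lam * y / be <= a / be * (1 - xB / be) + dd / be - a / be * (dd / be).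
    have -> : a / be * (1 - xB / be) + dd / be - a / be * (dd / be) =
       (a + dd - a * (xB + dd) / be) / be by field; rewrite gt_eqF.
    rewrite ler_pM2r //.
    have : a * (xB + dd) / be <= g by rewrite ler_pdivrMr.
    by rewrite /g; lra.
  rewrite -/s -/pB (_ : 1 - _ = s * pB + dd / be - s * pB * (dd / be)); last by ring.
  by apply: le_trans key _; apply: lerB h; rewrite lerD2r.
- rewrite -/s -/pB -/c2 mulrA ler_pdivrMr //; apply: le_trans hkap _.
  have h : a / be * 2^-1 <= s * pB.
    by apply: le_trans sB1; rewrite ler_wpM2l ?divr_ge0 ?(ltW a0) ?(ltW be0) //; lra.
  have c20 : 0 <= c2 by rewrite /c2 -expr2 sqr_ge0.
  have := ler_wpM2r (mulr_ge0 (_ : 0 <= 1 - s) c20) h; rewrite subr_ge0 => /(_ (ltW s1)) h2.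
  have := ler_wpM2r (ltW be0) h2.
  have -> : a / be * 2^-1 * ((1 - s) * c2) * be = a / 2 * (1 - s) * c2 by field; rewrite gt_eqF.
  by rewrite !mulrA.
- have w01 : 0 <= om / be <= 1.
    by rewrite divr_ge0 ?(ltW o0) ?(ltW be0) //= ler_pdivrMr // mul1r; lra.
  have /andP[w0 w1] := w01.
  have bbE : (b * b)%:R = be :> R by rewrite /be natrM expr2.
  have low : 1 - om <= (1 - om / be) ^+ (b * b).
    have := bernoulli_ineq (b * b) w01; by rewrite bbE mulrC divfK // gt_eqF.
  have up : (1 - om / be) ^+ (b * b) <= expR (- om).
    apply: (@le_trans _ _ (expR (- (om / be)) ^+ (b * b))).
      apply: lerXn2r; rewrite ?nnegrE ?expR_ge0 ?subr_ge0 //; exact: expR_ge1Dx.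
    by rewrite -expRM_natl bbE mulrN [be * _]mulrC divfK // gt_eqF.
  rewrite /dd /lottery; move: K => k.
  rewrite -!mulrA [(1 - om) / be]mulrC [om * _]mulrA !mulrA.
  have e10 : 0 <= 1 - expR (- om).
    by rewrite subr_ge0 -expR0 ler_expR oppr_le0 ltW.
  rewrite -[X in X * (1 - om)]mulrA -[X in _ <= X * _]mulrA.
  have om0 : 0 <= 1 - om by rewrite subr_ge0; case/andP: om1 => _ /ltW.
  apply: ler_pM; [by rewrite mulr_ge0 // exprn_ge0|by []| |by []].
  have h : 1 - expR (- om) <= 1 - (1 - om / be) ^+ (b * b) by rewrite lerD2l lerN2.
  apply: ler_wpM2r => //; apply: lerXn2r; rewrite ?nnegrE //; exact: le_trans h.
Qed.
End Params.

(** * Consequences for the percolating intensities *)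

Section Critical.
Context {R : realType}.
Variables (f : R -> R) (del : R) (m : nat).
Hypothesis del_gt0 : 0 < del.
Hypothesis f01 : forall r : R, 0 <= r -> 0 <= f r <= 1.
Hypothesis f_mono : forall x y : R, 0 <= x -> x <= y -> f y <= f x.
Hypothesis f_range : forall r : R, 0 <= r -> 0 < f r -> r <= del * m%:R.

(** Percolation would give crossings of probability at least [1 / 2] for some [k] and all [l]. The
    first-moment bound decays with [l] and the discretization error with [b], and each is brought
    below [1 / 8]. As [L] bounds the lattice sums for every mesh, all [s] are treated alike. *)
Lemma not_percolates (L lam s : R) :
  (forall (tm : R) (n : nat), 0 < tm ->
     4 * \sum_(x < n) \sum_(y < n) tm ^+ 2 * f (tm * rdist x.+1 y.+1) <= L) ->
  0 <= lam -> lam * L < 1 -> 0 < s -> s <= 1 -> realizable lam -> ~ percolates lam (Sscale s f).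
Proof.
move=> hL l0 lL s0 s1 rex perc.
have aux (u v : R) : 1 - 2^-1 <= u + v -> u <= 8^-1 -> v <= 8^-1 -> False by lra.
have s01 : 0 < s <= 1 by rewrite s0.
have L0 : 0 <= L by have := hL 1 0%N ltr01; rewrite big_ord0 mulr0.
pose mu := lam * L.
have mu0 : 0 <= mu by rewrite mulr_ge0.
have mu1 : mu < 1 by [].
(* Chosen so that the Bernoulli inequality gives [mu < (1 - x) ^+ n]; then [z], the inverse of
   [1 - x], exceeds 1 and still satisfies [z ^+ n * mu < 1]. *)
pose n := (2 * m)%N; pose x : R := (1 - mu) / (2 * n.+1%:R).
have n0 : 0 < n.+1%:R :> R by rewrite ltr0n.
have x0 : 0 < x by rewrite divr_gt0 ?subr_gt0 // mulr_gt0.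
have nx : n.+1%:R * x = (1 - mu) / 2 by rewrite /x; field; rewrite gt_eqF.
have xle : x <= (1 - mu) / 2 by rewrite -nx ler_peMl ?ler1n // ltW.
have x1 : x < 1 by move: xle mu0; clear; lra.
have y0 : 0 < 1 - x by rewrite subr_gt0.
have bern : mu < (1 - x) ^+ n.
  have x01 : 0 <= x <= 1 by rewrite !ltW.
  apply: lt_le_trans (bernoulli_ineq n x01).
  move: nx; rewrite -natr1 mulrDl mul1r; move: (n%:R * x) x0 mu1; clear => ? ? ? ?; lra.
pose z := (1 - x)^-1.
have z0 : 0 < z by rewrite invr_gt0.
have z1 : 1 <= z by rewrite invf_ge1 // gerBl ltW.
have zmu : z ^+ n * mu < 1 by rewrite exprVn mulrC ltr_pdivrMr ?mul1r // exprn_gt0.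
have [dA [OA [PA [XA [UA HA]]]]] := rex (Sscale s f).
have ds0 : 0 < del / Num.sqrt s by rewrite divr_gt0 // sqrtr_gt0.
have e0 : 0 < 2^-1 :> R by rewrite invr_gt0.
have [k k0 hk] := percolation_consequence HA l0 ds0 (perc _ _ _ _ _ HA) e0.
pose al := lam * (del ^+ 2 / s).
have al0 : 0 <= al by rewrite mulr_ge0 // divr_ge0 ?sqr_ge0 // ltW.
pose C0 := (2 * k)%:R ^+ 2 * al * z ^+ (2 * k) / (1 - z ^+ n * mu).
have C00 : 0 <= C0.
  rewrite /C0 divr_ge0 ?subr_ge0 ?(ltW zmu) // mulr_ge0 ?exprn_ge0 ?(ltW z0) //.
  by rewrite mulr_ge0 // exprn_ge0.
have e8 : 0 < 8^-1 / (C0 + 1) by rewrite divr_gt0 ?invr_gt0 // ltr_wpDl.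
have [|l hl] := @geometric_small R (1 - x) _ _ e8.
  by rewrite (ltW y0) /= gtrBl.
have small : (2 * k)%:R ^+ 2 * al * z ^+ (2 * k) / z ^+ l / (1 - z ^+ n * mu) <= 8^-1.
  have -> : (2 * k)%:R ^+ 2 * al * z ^+ (2 * k) / z ^+ l / (1 - z ^+ n * mu) = C0 * (1 - x) ^+ l.
    by rewrite /C0 /z !exprVn invrK mulrAC.
  have := ler_wpM2l C00 (hl l (leqnn _)) => /le_trans; apply.
  rewrite mulrCA ger_pMr ?invr_gt0 // ler_pdivrMr ?mul1r; first by rewrite lerDl.
  by rewrite ltr_wpDl.
pose N0 := (k + l + m).+1.
pose C : R := 132 * N0%:R ^+ 3 * (lam * (del ^+ 2 / s)) ^+ 2.
have Cp : 0 <= C.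
  by rewrite /C; apply: mulr_ge0; [apply: mulr_ge0; rewrite ?exprn_ge0 ?ler0n|exact: sqr_ge0].
have C8 : 0 <= C * 8 by rewrite mulr_ge0.
pose b := (Num.truncn (C * 8)).+1.
have b0 : (0 < b)%N by [].
have bR : 0 < b%:R :> R by rewrite ltr0n.
have err : C / b%:R <= 8^-1.
  rewrite ler_pdivrMr // mulrC ler_pdivlMr //.
  by have /andP[_ /ltW] := truncn_itv C8.
have kN : (k <= N0)%N by rewrite /N0; clear; lia.
have lmN : (l + m < N0)%N by rewrite /N0; clear; lia.
have [W [mW bW PW]] := upper_hits HA l0 del_gt0 s01 f01 f_mono b0 kN lmN f_range.
have hi := le_trans (hk l W mW bW) PW; rewrite lee_fin in hi.
pose pi := occ_prob del lam s b.
have pi01 : 0 <= pi <= 1 by exact: occ_prob01.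
have /andP[pi0 pi1] := pi01.
have /andP[_ piu] := @occ_prob_bounds R del del_gt0 lam s b _ l0 s0 b0 erefl.
rewrite -/pi in piu.
have tm0 : 0 < del / b%:R by rewrite divr_gt0.
have piE : pi * (b * b)%:R <= al by rewrite natrM -expr2 -ler_pdivlMr ?exprn_gt0.
have sumF : 4 * \sum_(i < side N0 b) \sum_(j < side N0 b) pi * Flo f s (del / b%:R) i j <= mu.
  apply: (@le_trans _ _ (lam * (4 * \sum_(i < side N0 b) \sum_(j < side N0 b)
     (del / b%:R) ^+ 2 * f (del / b%:R * rdist i.+1 j.+1)))); last by rewrite ler_wpM2l // hL.
  rewrite mulrCA ler_wpM2l // mulr_sumr; apply: ler_sum => i _; rewrite mulr_sumr; apply: ler_sum => j _.
  rewrite /Flo mulrA mulrA; apply: ler_wpM2r.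
    by case/andP: (f01 (mulr_ge0 (ltW tm0) (@rdist_ge0 R i.+1 j.+1))).
  rewrite -ler_pdivlMr //; apply: le_trans piu _; rewrite le_eqVlt; apply/orP; left; apply/eqP.
  by field; rewrite !gt_eqF.
have FF : forall i j, 0 <= Flo f s (del / b%:R) i j <= 1.
  by move=> i j; exact: (F01 del_gt0 s01 f01 b0).
have Fr := Flo_range del_gt0 f_range s01 b0.
have := @grid_subcritical R N0 b k l m _ pi al mu z b0 FF Fr pi01 piE z1 zmu sumF.
by move/le_trans/(_ small) => fin; exact: (aux _ _ hi fin err).
Qed.

Hypothesis f_pos : 0 < f (30 * del).
Hypothesis m40 : m = 40%N.

(** The lottery yields an amount [dd] determined by [lam0], not by the percolating [lam] that
    approximates it. Hence [lam] can be taken so close to [lam0], and [eta] so close to 1, that some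
    [lam'] below [lam0] is within reach. *)
Lemma percolates_strict (lam0 p q : R) : 0 < lam0 -> 0 < p -> p < q -> q <= 1 ->
  (forall lam : R, 0 < lam -> realizable lam) ->
  (forall e : R, 0 < e -> exists2 lam, lam0 <= lam < lam0 + e & percolates lam (Sscale q f)) ->
  exists2 lam', 0 < lam' < lam0 & percolates lam' (Sscale p f).
Proof.
move=> l0 p0 pq q1 rex app.
have aux (a b c d : R) : 2^-1 * (a / 2) * b <= c * d * b -> a * b / 8 <= c * d * b / 2 by lra.
have aux' (a b c d t y : R) : a * y < (b + c) * y -> 0 <= t * c * y -> t * b * y <= d / 8 ->
  c * y <= d / 8 -> 0 < d -> a * y < (1 - t) * (b - c) * y + d by lra.
have q0 : 0 < q by exact: lt_trans pq.
pose y := del ^+ 2 / q; have y0 : 0 < y by rewrite divr_gt0 // exprn_gt0.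
pose c2 := q * f (30 * del) * (q * f (30 * del)).
have c20 : 0 < c2 by rewrite !mulr_gt0.
have pq1 : p / q < 1 by rewrite ltr_pdivrMr // mul1r.
have k0 : 0 < kap m :> R by rewrite /kap ltr0n expn_gt0.
(* A lower bound for what the specials may cost, valid when [lam' >= lam0 / 2] and [eta >= 1 / 2];
   with the halving in [enhanceable_large] this makes the 8. *)
pose B := lam0 * y / 8 * (1 - p / q) * c2.
have B0 : 0 < B by rewrite mulr_gt0 // mulr_gt0 ?subr_gt0 // divr_gt0 // mulr_gt0.
pose om := Num.min 2^-1 (B / kap m).
have o01 : 0 < om <= 2^-1 by rewrite /om lt_min ge_min lexx invr_gt0 divr_gt0 // ltr0n.
have okap : kap m * om <= B by rewrite mulrC -ler_pdivlMr // /om ge_min lexx orbT.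
pose dd := lottery m om.
have dd0 : 0 < dd.
  apply: lottery_gt0; case/andP: o01 => -> /= h; apply: le_lt_trans h _.
  by rewrite invf_lt1 // ltr1n.
(* The defect [t] of [eta], and [ep], used both above and below [lam0], cause three losses of at
   most [dd / 8] each. *)
pose t := Num.min 2^-1 (dd / (8 * y * lam0)).
have yl : 0 < 8 * y * lam0 by rewrite mulr_gt0 // mulr_gt0 // ltr0n.
have t01 : 0 < t <= 2^-1 by rewrite /t lt_min ge_min lexx invr_gt0 divr_gt0 // ltr0n.
have tdd : t * lam0 * y <= dd / 8.
  have : t <= dd / (8 * y * lam0) by rewrite /t ge_min lexx orbT.
  by rewrite ler_pdivlMr // => h; rewrite ler_pdivlMr //; apply: le_trans h; rewrite le_eqVlt; apply/orP; left; apply/eqP; ring.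
pose ep := Num.min (lam0 / 2) (dd / (8 * y)).
have ep0 : 0 < ep by rewrite /ep lt_min !divr_gt0 // mulr_gt0 // ltr0n.
have ep2 : ep <= lam0 / 2 by rewrite /ep ge_min lexx.
have epd : ep * y <= dd / 8.
  have : ep <= dd / (8 * y) by rewrite /ep ge_min lexx orbT.
  rewrite ler_pdivlMr; last by rewrite mulr_gt0 // ltr0n.
  move=> h; rewrite ler_pdivlMr //; apply: le_trans h; rewrite le_eqVlt; apply/orP; left; apply/eqP; ring.
have [lam /andP[h1 h2] perc] := app ep ep0.
exists (lam0 - ep); first by rewrite gtrBl ep0 subr_gt0 andbT; move: ep2 l0; clear; lra.
have lp : 0 < lam by exact: lt_le_trans h1.
have lp' : 0 < lam0 - ep by move: ep2 l0; clear; lra.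
case/andP: t01 => t0 t2.
have eta01 : 0 < 1 - t < 1 by move: t0 t2; clear => *; apply/andP; split; lra.
apply: (percolates_transfer del_gt0 f01 f_mono f_range f_pos m40 (ltW lp) (ltW lp') p0 pq q1 eta01 (rex _ lp) _ perc).
have /andP[et0 et1] := eta01.
apply: (enhanceable_large del_gt0 (ltW lp) lp' p0 pq q1 eta01 o01).
  apply: le_trans okap _; rewrite -/y -/c2 /B ler_pM2r //.
  have pq0 : 0 < p / q by rewrite divr_gt0.
  apply: ler_pM; rewrite ?subr_ge0 ?(ltW pq1) //.
  - by rewrite divr_ge0 // mulr_ge0 ?ltW.
  - have : 2^-1 * (lam0 / 2) <= (1 - t) * (lam0 - ep).
      by apply: ler_pM; rewrite ?invr_ge0 ?divr_ge0 ?(ltW l0) //; move: t2 ep2; clear; lra.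
    move=> /(ler_wpM2r (ltW y0)); exact: aux.
  - by rewrite lerD2l lerN2 ger_pMl // ltW.
rewrite -/y -/dd.
have h3 : lam * y < (lam0 + ep) * y by rewrite ltr_pM2r.
have h4 : 0 <= t * ep * y by rewrite mulr_ge0 ?(ltW y0) // mulr_ge0 // ltW.
exact: aux' h3 h4 tdd epd dd0.
Qed.
End Critical.

(** * Independent uniform variables from the digits of one *)

Section Rays.
Context {R : realType}.

Lemma eq_measure_rays (m1 m2 : {measure set (measurableTypeR R) -> \bar R}) : (m1 setT < +oo)%E ->
  (forall x : R, m1 `]x, +oo[%classic = m2 `]x, +oo[%classic) ->
  forall A : set (measurableTypeR R), measurable A -> m1 A = m2 A.
Proof.
move=> fin h A mA.
apply: (@measure_unique _ R (measurableTypeR R) (@RGenOInfty.G R) (fun n => `](- n%:R), +oo[%classic)) => //.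
- exact: RGenOInfty.measurableE.
- move=> _ _ [x ->] [y ->]; exists (Num.max x y); rewrite predeqE => z /=.
  by rewrite !in_itv /= !andbT gt_max; split=> [[-> ->]|/andP].
- by move=> n; eexists.
- rewrite predeqE => x; split=> // _; exists (Num.truncn `|x|).+1 => //=.
  rewrite in_itv /= andbT ltrNl; apply: le_lt_trans (truncnS_gt _).
  by rewrite -normrN; exact: ler_norm.
- by move=> _ [x ->].
- move=> n; apply: le_lt_trans fin; apply: le_measure; rewrite ?inE //.
Qed.

(** Extends an identity from rays to Borel sets while a second event [D] is kept fixed. Applied to
    each factor in turn, it passes from joint tails to independence. *)
Lemma eq_pushforward_rays {d} {T : measurableType d} (P : probability T R) (h : T -> measurableTypeR R)
    (D : set T) (m : {measure set (measurableTypeR R) -> \bar R}) : measurable_fun setT h -> measurable D ->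
  (forall x : R, P (h @^-1` `]x, +oo[ `&` D) = m `]x, +oo[%classic) ->
  forall A : set (measurableTypeR R), measurable A -> P (h @^-1` A `&` D) = m A.
Proof.
move=> mh mD hx A mA.
pose M := measure_function_pushforward__canonical__measure_function_Measure (mrestr P mD) mh.
apply: (@eq_measure_rays M) => //.
change (P (h @^-1` setT `&` D) < +oo)%E; rewrite preimage_setT setTI.
by apply: le_lt_trans (probability_le1 _ mD) _; rewrite ltry.
Qed.
End Rays.

Section Digits.
Context {R : realType}.
Implicit Types (w x : R) (n m k : nat).

(** The uniform law on [[0, 1)] is carried by the whole line, so that [splitting] maps the
    probability space to itself and can be iterated. *)
Definition unif : set (measurableTypeR R) -> \bar R := mrestr lebesgue_measure (measurable_itv `[(0:R), 1[).
HB.instance Definition _ := Measure.on unif.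

Lemma unifE (A : set R) : unif A = lebesgue_measure (A `&` `[0, 1[%classic).
Proof. by []. Qed.

Lemma unif_setT : unif setT = 1%E.
Proof. by rewrite unifE setTI lebesgue_measure_itv /= lte_fin ltr01 oppr0 adde0. Qed.
HB.instance Definition _ := Measure_isProbability.Build _ _ _ unif unif_setT.

Lemma measurable_truncn (N : nat) (p : pred nat) :
  measurable [set w : R | p (Num.truncn (N%:R * w))].
Proof.
rewrite (_ : [set w : R | _] = \bigcup_(m in [set m | p m]) [set w | Num.truncn (N%:R * w) = m]).
  apply: bigcup_measurable => m _.
  have mf : measurable_fun setT (fun w : R => N%:R * w) by exact: measurable_funM.
  (* [truncn] is 0 on negative reals, so the fibre over 0 is the whole ray below 1. *)
  rewrite (_ : [set w | _] = ((fun w : R => N%:R * w) @^-1` (if m is 0%N then `]-oo, 1[%classic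
      else `[m%:R, m.+1%:R[%classic))).
    by rewrite -[X in measurable X]setTI; apply: mf => //; case: m.
  rewrite predeqE => w /=; set y := N%:R * w.
  have [y0|y0] := leP 0 y.
    split=> [/eqP|h].
      rewrite truncn_eq //; case: m => [|m] /=; rewrite in_itv //=.
      by move=> /andP[_ ->].
    apply/eqP; rewrite truncn_eq //; case: m h => [|m] /=; rewrite in_itv //= => ->.
    by rewrite y0.
  have -> : Num.truncn y = 0%N.
    by apply/eqP; rewrite -leqn0 leqNgt truncn_gt0 -ltNge; apply: lt_trans y0 _.
  case: m => [|m] /=; rewrite in_itv /=; first by rewrite (lt_trans y0).
  by split=> // /andP[h]; have := lt_le_trans y0 (le_trans (ler0n _ _) h); rewrite ltxx.
rewrite predeqE => w; split=> [h|[m pm /= ->]//]; by exists (Num.truncn (N%:R * w)).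
Qed.

Lemma unif_truncn (N : nat) (p : pred nat) : (0 < N)%N ->
  unif [set w : R | p (Num.truncn (N%:R * w))] = (#|[set m : 'I_N | p m]|%SET%:R / N%:R)%:E.
Proof.
move=> N0; have NR : 0 < N%:R :> R by rewrite ltr0n.
pose I (m : 'I_N) : set R := `[m%:R / N%:R, m.+1%:R / N%:R[%classic.
have IE (m : 'I_N) w : I m w = (m%:R <= N%:R * w < m.+1%:R) :> Prop.
  by rewrite /I /= in_itv /= ler_pdivrMr // ltr_pdivlMr // mulrC.
have -> : unif [set w : R | p (Num.truncn (N%:R * w))] =
    lebesgue_measure (\big[setU/set0]_(m < N | p m) I m).
  rewrite unifE; congr (lebesgue_measure _); rewrite -bigcup_seq_cond /= predeqE => w.
  split.
    move=> [/= pw]; rewrite in_itv /= => /andP[w0 w1].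
    have y0 : 0 <= N%:R * w by rewrite mulr_ge0 // ltW.
    have lt : (Num.truncn (N%:R * w) < N)%N by rewrite truncn_lt_nat // gtr_pMr.
    exists (Ordinal lt); [by rewrite /= mem_index_enum|rewrite IE /=; exact: truncn_itv].
  move=> [m /= /andP[_ pm]]; rewrite IE => h; have mE := truncn_def h.
  rewrite mE; split=> //=; case/andP: h => h1 h2; rewrite in_itv /=.
  rewrite -(pmulr_rge0 _ NR) (le_trans _ h1) ?ler0n //= -(ltr_pM2l NR) mulr1.
  by apply: lt_le_trans h2 _; rewrite ler_nat.
have lebI (m : 'I_N) : lebesgue_measure (I m) = (N%:R^-1)%:E.
  rewrite /I lebesgue_measure_itv /= lte_fin ltr_pM2r ?invr_gt0 // ltr_nat ltnSn.
  by rewrite -EFinB -mulrBl -natrB // subSnn mul1r.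
rewrite measure_bigsetU_ord_cond //; last first.
- apply/trivIsetP => i j _ _ ij; rewrite predeqE => w; split=> //= -[].
  rewrite !IE => /truncn_def h1 /truncn_def; rewrite h1 => h2.
  by move/eqP: ij; apply; exact: val_inj.
- by move=> i _; exact: measurable_itv.
rewrite (eq_bigr (fun=> (N%:R^-1)%:E)); last by move=> m _; exact: lebI.
rewrite sumEFin sumr_const -[_ *+ _]mulr_natl; congr ((_%:R / _)%:E).
by rewrite cardsE.
Qed.

(** Takes one binary digit from each base-4 digit of [m]: the high one for [k = 2], the low one for
    [k = 1]. *)
Fixpoint digits (k n m : nat) : nat :=
  if n is n'.+1 then (2 * digits k n' (m %/ 4) + (m %/ k) %% 2)%N else 0%N.

Lemma digits_lt k n m : (digits k n m < 2 ^ n)%N.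
Proof.
elim: n m => //= n IH m; have := IH (m %/ 4)%N; rewrite expnS.
have : ((m %/ k) %% 2 < 2)%N by rewrite ltn_mod.
by move: (digits _ _ _) (_ %% 2)%N (2 ^ n)%N; clear; lia.
Qed.

Lemma digits_inj n m m' : (m < 4 ^ n)%N -> (m' < 4 ^ n)%N ->
  digits 2 n m = digits 2 n m' -> digits 1 n m = digits 1 n m' -> m = m'.
Proof.
elim: n m m' => [|n IH] m m' /=; first by rewrite expn0 !ltnS !leqn0 => /eqP-> /eqP->.
rewrite expnS !divn1 => hm hm'.
have hq : (m %/ 4 < 4 ^ n)%N by rewrite ltn_divLR // mulnC.
have hq' : (m' %/ 4 < 4 ^ n)%N by rewrite ltn_divLR // mulnC.
move: (IH _ _ hq hq'); move: (digits 2 n _) (digits 2 n _) (digits 1 n _) (digits 1 n _) => a b c d.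
move=> H h1 h2.
have [ab cd r1 r2] : [/\ a = b, c = d, (m %/ 2) %% 2 = (m' %/ 2) %% 2 & m %% 2 = m' %% 2]%N.
  by move: h1 h2; clear; split; lia.
by have := H (esym ab) (esym cd); move: r1 r2; clear; lia.
Qed.

Definition digit_frac (k n : nat) w : R :=
  (digits k n (Num.truncn ((4 ^ n)%:R * w)))%:R / (2 ^ n)%:R.

(** Truncations at successive scales are compatible, so passing from [n] to [n.+1] only appends a
    digit. *)
Lemma truncn_div4 (y : R) : (Num.truncn (4 * y) %/ 4)%N = Num.truncn y.
Proof.
have [y0|y0] := leP 0 y; last first.
  have z (u : R) : u < 0 -> Num.truncn u = 0%N.
    by move=> u0; apply/eqP; rewrite -leqn0 leqNgt truncn_gt0 -ltNge; apply: lt_trans u0 _.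
  by rewrite !z // pmulr_rlt0.
have y40 : 0 <= 4 * y by rewrite mulr_ge0.
apply/esym/truncn_def; have /andP[h1 h2] := truncn_itv y40; move: h1 h2; set t := Num.truncn _ => h1 h2.
have := divn_eq t 4; have := ltn_mod t 4; move: (t %/ 4)%N (t %% 4)%N => a r /= r4 tE.
have e1 : 4 * a%:R <= t%:R :> R by rewrite -natrM ler_nat tE; clear; lia.
have e2 : t.+1%:R <= 4 * a.+1%:R :> R by rewrite -natrM ler_nat tE; move: r4; clear; lia.
by apply/andP; split; lra.
Qed.

Lemma digit_frac_mono k w : {homo digit_frac k ^~ w : n m / (n <= m)%N >-> n <= m}.
Proof.
apply/nondecreasing_seqP => n; rewrite /digit_frac /=.
have -> : (4 ^ n.+1)%:R * w = 4 * ((4 ^ n)%:R * w) :> R by rewrite expnS natrM mulrA.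
rewrite truncn_div4 expnS natrM invfM [leRHS]mulrA ler_pM2r ?invr_gt0 ?ltr0n ?expn_gt0 //.
by rewrite ler_pdivlMr // -natrM ler_nat mulnC leq_addr.
Qed.

Lemma digit_frac01 k n w : 0 <= digit_frac k n w <= 1.
Proof.
have p0 : 0 < (2 ^ n)%:R :> R by rewrite ltr0n expn_gt0.
by rewrite /digit_frac divr_ge0 //= ler_pdivrMr // mul1r ler_nat ltnW // digits_lt.
Qed.

(** The number made of every second binary digit of [w]. As a supremum of partial expansions it
    turns [x < splitting k w] into a countable union of events on finitely many digits. *)
Definition splitting k w : R := sup (range (digit_frac k ^~ w)).

Lemma has_sup_splitting k w : has_sup (range (digit_frac k ^~ w)).
Proof.
split; first by exists (digit_frac k 0 w); exists 0%N.
by exists 1 => _ [n _ <-]; case/andP: (digit_frac01 k n w).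
Qed.

Lemma splitting_gt k x w : (x < splitting k w) <-> exists n, x < digit_frac k n w.
Proof.
split; first by move=> /(sup_gt (has_sup_splitting k w).1)[_ [n _ <-] h]; exists n.
move=> [n h]; apply: lt_le_trans h _; apply: ub_le_sup; first by case: (has_sup_splitting k w).
by exists n.
Qed.

Lemma splitting01 k w : 0 <= splitting k w <= 1.
Proof.
apply/andP; split.
  have /andP[h _] := digit_frac01 k 0 w; apply: le_trans h _.
  by apply: ub_le_sup; [case: (has_sup_splitting k w)|exists 0%N].
apply: ge_sup; first by case: (has_sup_splitting k w).
by move=> _ [n _ <-]; case/andP: (digit_frac01 k n w).
Qed.

Lemma measurable_digit_gt k n x : measurable [set w : R | x < digit_frac k n w].
Proof.
exact: (measurable_truncn (4 ^ n) (fun m => x < (digits k n m)%:R / (2 ^ n)%:R)).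
Qed.

Lemma measurable_splitting k : measurable_fun setT (splitting k : measurableTypeR R -> measurableTypeR R).
Proof.
apply: (measurability _ (RGenOInfty.measurableE R)) => // _ [_ [x ->] <-].
rewrite setTI (_ : _ @^-1` _ = \bigcup_n [set w : R | x < digit_frac k n w]).
  by apply: bigcupT_measurable => n; exact: measurable_digit_gt.
rewrite predeqE => w /=; rewrite in_itv /= andbT.
split=> [/splitting_gt[n h]|[n _ h]]; first by exists n.
by apply/splitting_gt; exists n.
Qed.

Lemma lebesgue_ray (a t : R) :
  lebesgue_measure (`]t, +oo[ `&` `[a, a + 1[) = (Num.min 1 (Num.max 0 (1 - (t - a))))%:E.
Proof.
have [x1|x1] := leP (a + 1) t.
  rewrite (_ : _ `&` _ = set0) ?measure0.
    by congr EFin; rewrite max_l ?min_r //; lra.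
  rewrite predeqE => w; split=> //= -[]; rewrite !in_itv /= andbT => h /andP[_ h'].
  by have := lt_trans h (lt_le_trans h' x1); rewrite ltxx.
have [x0|x0] := leP a t.
  rewrite (_ : _ `&` _ = `]t, (a + 1)[%classic).
    by rewrite lebesgue_measure_itv /= lte_fin x1 -EFinB max_r ?min_r; [congr EFin; ring|lra|lra].
  rewrite predeqE => w /=; rewrite !in_itv /= andbT.
  split=> [[-> /andP[]]//|/andP[h ->]]; split=> //; by rewrite (ltW (le_lt_trans x0 h)).
rewrite (_ : _ `&` _ = `[a, (a + 1)[%classic).
  by rewrite lebesgue_measure_itv /= lte_fin ltrDl ltr01 -EFinB max_r ?min_l; [congr EFin; ring|lra|lra].
rewrite predeqE => w /=; rewrite !in_itv /= andbT; split=> [[]//|h]; split=> //.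
by case/andP: h => h _; exact: lt_le_trans h.
Qed.

Lemma unif_gt x : unif `]x, +oo[%classic = (Num.min 1 (Num.max 0 (1 - x)))%:E.
Proof. by have := lebesgue_ray 0 x; rewrite add0r subr0. Qed.

Definition count_gt n x : R := (#|[set a : 'I_(2 ^ n) | x < a%:R / (2 ^ n)%:R]|%SET%:R / (2 ^ n)%:R).

(** Base-4 words of length [n] are in bijection with pairs of binary words of length [n], so the
    number of favourable words factorizes. *)
Lemma unif_digit_gt n x y :
  unif ([set w : R | x < digit_frac 2 n w] `&` [set w : R | y < digit_frac 1 n w]) =
  (count_gt n x * count_gt n y)%:E.
Proof.
have := unif_truncn (fun m => (x < (digits 2 n m)%:R / (2 ^ n)%:R) && (y < (digits 1 n m)%:R / (2 ^ n)%:R))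
  (_ : 0 < 4 ^ n)%N; rewrite expn_gt0 => /(_ isT).
have -> : [set w : R | (x < (digits 2 n (Num.truncn ((4 ^ n)%:R * w)))%:R / (2 ^ n)%:R) &&
   (y < (digits 1 n (Num.truncn ((4 ^ n)%:R * w)))%:R / (2 ^ n)%:R)] =
   [set w : R | x < digit_frac 2 n w] `&` [set w : R | y < digit_frac 1 n w].
  by rewrite predeqE => w /=; split=> /andP.
move=> ->; congr EFin; rewrite /count_gt.
pose h (m : 'I_(4 ^ n)) : 'I_(2 ^ n) * 'I_(2 ^ n) :=
  (Ordinal (digits_lt 2 n m), Ordinal (digits_lt 1 n m)).
have hinj : injective h.
  by move=> m m' [h1 h2]; apply: val_inj; exact: (@digits_inj n m m' (ltn_ord _) (ltn_ord _) h1 h2).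
have hb : bijective h.
  apply: inj_card_bij hinj _; rewrite card_prod !card_ord.
  by rewrite -expnD addnn -mul2n expnM.
pose S (z : R) : {set 'I_(2 ^ n)} := [set a : 'I_(2 ^ n) | z < a%:R / (2 ^ n)%:R]%SET.
have := on_card_preimset (onW_bij (finset.setX (S x) (S y)) hb); rewrite cardsX => hc.
transitivity (#|h @^-1: finset.setX (S x) (S y)|%:R / (4 ^ n)%:R : R).
  by congr (_%:R / _); apply: eq_card => m; rewrite !inE.
rewrite hc -/(S x) -/(S y).
have -> : (4 ^ n)%:R = (2 ^ n)%:R * (2 ^ n)%:R :> R by rewrite -natrM -expnMn.
by rewrite natrM; field; rewrite pnatr_eq0 -lt0n expn_gt0.
Qed.

Lemma count_gt_bounds n x (t := Num.min 1 (Num.max 0 (1 - x)) : R) :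
  t - (2 ^ n)%:R^-1 <= count_gt n x <= t.
Proof.
set N := (2 ^ n)%N; have N0 : 0 < N%:R :> R by rewrite ltr0n expn_gt0.
have Ni0 : 0 < N%:R^-1 :> R by rewrite invr_gt0.
pose A : {set 'I_N} := [set a : 'I_N | x < a%:R / N%:R]%SET.
rewrite /count_gt -/N -/A.
have [x1|x1] := leP 1 x.
  have -> : t = 0 by rewrite /t max_l ?subr_le0 // min_r.
  have -> : A = finset.set0.
    apply/setP => a; rewrite !inE; apply/negbTE; rewrite -leNgt.
    by apply: le_trans x1; rewrite ler_pdivrMr // mul1r ler_nat ltnW.
  by rewrite finset.cards0 mul0r lexx andbT sub0r oppr_le0 ltW.
have [x0|x0] := leP 0 x; last first.
  have -> : t = 1 by rewrite /t max_r ?min_l //; lra.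
  have -> : A = finset.setT.
    by apply/setP => a; rewrite !inE; apply: lt_le_trans x0 _; rewrite divr_ge0.
  by rewrite cardsT card_ord divff ?gt_eqF // lexx andbT gerBl ltW.
have -> : t = 1 - x by rewrite /t max_r ?subr_ge0 ?(ltW x1) // min_r // gerBl.
have Nx0 : 0 <= N%:R * x by rewrite mulr_ge0 // ltW.
have /andP[k1 k2] := truncn_itv Nx0; move: k1 k2; set k := Num.truncn _ => k1 k2.
have kN : (k < N)%N by rewrite truncn_lt_nat // gtr_pMr.
have -> : #|A| = (N - k.+1)%N.
  have -> : A = [set a : 'I_N | (k < a)%N]%SET.
    apply/setP => a; rewrite !inE ltr_pdivlMr // mulrC.
    have [ka|ak] := ltnP k a; first by apply: lt_le_trans k2 _; rewrite ler_nat.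
    by apply/negbTE; rewrite -leNgt; apply: le_trans k1; rewrite ler_nat.
  rewrite -[N in LHS]/N cardE -(size_map val) -[RHS](size_iota k.+1); apply/eqP.
  rewrite -uniq_size_uniq ?iota_uniq //; first by rewrite (map_inj_uniq val_inj) enum_uniq.
  move=> a; rewrite mem_iota subnKC //; apply/idP/idP.
    move=> /andP[ka aN]; apply/mapP; exists (Ordinal aN) => //.
    by rewrite mem_enum inE.
  by move=> /mapP[b]; rewrite mem_enum inE => kb ->; rewrite kb ltn_ord.
rewrite natrB // mulrBl divff ?gt_eqF //.
have e1 : k%:R / N%:R <= x by rewrite ler_pdivrMr // mulrC.
have e2 : x < k.+1%:R / N%:R by rewrite ltr_pdivlMr // mulrC.
by move: e2; rewrite -natr1 mulrDl mul1r => e2; apply/andP; split; lra.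
Qed.

Lemma splitting_joint_gt x y :
  unif (splitting 2 @^-1` `]x, +oo[ `&` splitting 1 @^-1` `]y, +oo[) =
  (unif `]x, +oo[%classic * unif `]y, +oo[%classic)%E.
Proof.
pose F n := [set w : R | x < digit_frac 2 n w] `&` [set w : R | y < digit_frac 1 n w].
have FE : splitting 2 @^-1` `]x, +oo[ `&` splitting 1 @^-1` `]y, +oo[ = \bigcup_n F n.
  rewrite predeqE => w /=; rewrite !in_itv /= !andbT; split.
    move=> [/splitting_gt[n hn] /splitting_gt[m hm]]; exists (maxn n m) => //; split=> /=.
      by apply: lt_le_trans hn _; apply: digit_frac_mono; exact: leq_maxl.
    by apply: lt_le_trans hm _; apply: digit_frac_mono; exact: leq_maxr.
  by move=> [n _ [h1 h2]]; split; apply/splitting_gt; exists n.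
have mF n : measurable (F n) by apply: measurableI; exact: measurable_digit_gt.
have c1 : unif \o F @ \oo --> unif (\bigcup_n F n).
  apply: nondecreasing_cvg_mu => //; first exact: bigcupT_measurable.
  move=> n m nm; apply/subsetPset => w [/= h1 h2].
  by split=> /=; [apply: lt_le_trans h1 _|apply: lt_le_trans h2 _]; exact: digit_frac_mono.
rewrite FE !unif_gt -EFinM; set tx := Num.min 1 _; set ty := Num.min 1 _.
have cg z : count_gt n z @[n --> \oo] --> Num.min 1 (Num.max 0 (1 - z)).
  set t := Num.min 1 _.
  have c0 : t - (2 ^ n)%:R^-1 @[n --> \oo] --> t.
    rewrite -[X in _ --> X]subr0; apply: cvgB; first exact: cvg_cst.
    have : (fun n => (2^-1 : R) ^+ n) @ \oo --> (0 : R).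
      by apply: cvg_expr; rewrite ger0_norm ?invr_ge0 // invf_lt1 // ltr1n.
    by apply: cvg_trans; apply: near_eq_cvg; apply: nearW => n; rewrite natrX exprVn.
  apply: (squeeze_cvgr _ c0 (cvg_cst _)).
  by apply: nearW => n; exact: count_gt_bounds.
have c2 : unif \o F @ \oo --> (tx * ty)%:E.
  rewrite (_ : unif \o F = fun n => (count_gt n x * count_gt n y)%:E).
    by apply: cvg_EFin; [exact: nearW|apply: cvgM; exact: cg].
  by apply/funext => n; exact: unif_digit_gt.
exact: cvg_unique c1 c2.
Qed.

Lemma splitting_indep (A B : set (measurableTypeR R)) : measurable A -> measurable B ->
  unif (splitting 2 @^-1` A `&` splitting 1 @^-1` B) = (unif A * unif B)%E.
Proof.
move=> mA mB.
have ms k (C : set (measurableTypeR R)) : measurable C -> measurable (splitting k @^-1` C).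
  by move=> mC; rewrite -[X in measurable X]setTI; exact: measurable_splitting.
have fin C : measurable C -> unif C \is a fin_num by move=> mC; exact: fin_num_measure.
have unif_ge0 C : (0 <= unif C)%E by exact: measure_ge0.
have unif_scale C D : measurable D ->
    (unif C * unif D = mscale (NngNum (fine_ge0 (unif_ge0 D))) unif C)%E.
  by move=> mD; rewrite /mscale /= muleC fineK // fin.
have step1 y : unif (splitting 2 @^-1` A `&` splitting 1 @^-1` `]y, +oo[) =
    (unif A * unif `]y, +oo[%classic)%E.
  have mD := ms 1%N _ (measurable_itv `]y, +oo[).
  pose m : {measure set (measurableTypeR R) -> \bar R} := mscale (NngNum (fine_ge0 (unif_ge0 `]y, +oo[%classic))) unif.
  rewrite unif_scale //.
  apply: (@eq_pushforward_rays R _ _ unif (splitting 2) _ m (measurable_splitting 2) mD) => //.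
  by move=> x; apply: etrans (splitting_joint_gt x y) _; exact: unif_scale.
pose m : {measure set (measurableTypeR R) -> \bar R} := mscale (NngNum (fine_ge0 (unif_ge0 A))) unif.
rewrite muleC unif_scale // setIC.
apply: (@eq_pushforward_rays R _ _ unif (splitting 1) _ m (measurable_splitting 1) (ms _ _ mA)) => //.
move=> x; rewrite setIC; apply: etrans (step1 x) _; rewrite muleC; exact: unif_scale.
Qed.
End Digits.

(** * Construction of the Poisson process *)

Lemma measure_disjoint_fin {d} {T : measurableType d} {R : realType} (P : {measure set T -> \bar R})
    (I : finType) (p : pred I) (E : I -> set T) :
  (forall i, measurable (E i)) -> (forall i j w, E i w -> E j w -> i = j) ->
  P [set w | exists2 i, p i & E i w] = (\sum_(i | p i) P (E i))%E.
Proof.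
move=> mE dE.
have sE r w : (\big[setU/set0]_(i <- r | p i) E i) w <-> exists i, [/\ i \in r, p i & E i w].
  rewrite -bigcup_seq_cond; split=> [[i /andP[ir pi] Ei]|[i [ir pi Ei]]]; exists i => //=.
  by rewrite ir.
have -> : [set w | exists2 i, p i & E i w] = \big[setU/set0]_(i <- index_enum I | p i) E i.
  rewrite predeqE => w; split=> [[i pi Ei]|/sE[i [_ pi Ei]]]; last by exists i.
  by apply/sE; exists i; rewrite mem_index_enum.
elim: (index_enum I) (index_enum_uniq I) => [_|i r IH /= /andP[ir /IH{}IH]].
  by rewrite !big_nil measure0.
have mr : measurable (\big[setU/set0]_(i <- r | p i) E i) by apply: bigsetU_measurable => *.
have dr : E i `&` \big[setU/set0]_(i <- r | p i) E i = set0.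
  rewrite predeqE => w; split=> // -[Ei /sE[j [jr _ Ej]]].
  by move: ir; rewrite (dE i j w Ei Ej) jr.
rewrite !big_cons; case: ifP => // pi; rewrite -IH; exact: measureU.
Qed.

Section Seeds.
Context {R : realType}.
Local Notation T := (measurableTypeR R).
Local Notation mu := (@unif R).
Local Notation p1 := (@splitting R 2 : T -> T).
Local Notation p2 := (@splitting R 1 : T -> T).

Lemma measurable_preim k (A : set T) : measurable A -> measurable ((@splitting R k : T -> T) @^-1` A).
Proof. by move=> mA; rewrite -[X in measurable X]setTI; exact: measurable_splitting. Qed.

Lemma unif_p1 (A : set T) : measurable A -> mu (p1 @^-1` A) = mu A.
Proof.
move=> mA; have := splitting_indep mA (measurableT : measurable [set: T]).
by rewrite preimage_setT setIT unif_setT mule1.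
Qed.

Lemma unif_p2 (A : set T) : measurable A -> mu (p2 @^-1` A) = mu A.
Proof.
move=> mA; have := splitting_indep (measurableT : measurable [set: T]) mA.
by rewrite preimage_setT setTI unif_setT mul1e.
Qed.

Lemma unif_p12 (A B : set T) (x y : R) : measurable A -> measurable B ->
  mu A = x%:E -> mu B = y%:E -> mu [set w | A (p1 w) /\ B (p2 w)] = (x * y)%:E.
Proof. by move=> mA mB ax ay; rewrite EFinM -ax -ay; exact: splitting_indep. Qed.

Lemma measurable_p12 (A B : set T) : measurable A -> measurable B ->
  measurable [set w : T | A (p1 w) /\ B (p2 w)].
Proof. by move=> mA mB; apply: measurableI; exact: measurable_preim. Qed.

Definition pcdf (l : R) (n : nat) : R := \sum_(k < n) poisson_mass l k.

Section PoissonNumber.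
Variable l : R.
Hypothesis l_ge0 : 0 <= l.

Lemma poisson_mass_ge0 n : 0 <= poisson_mass l n.
Proof. by rewrite /poisson_mass mulr_ge0 ?expR_ge0 // divr_ge0 ?exprn_ge0. Qed.

Lemma pcdf_mono : {homo pcdf l : n m / (n <= m)%N >-> n <= m}.
Proof.
apply/nondecreasing_seqP => n; rewrite /pcdf big_ord_recr /= lerDl.
exact: poisson_mass_ge0.
Qed.

Lemma cvg_pcdf : pcdf l n @[n --> \oo] --> (1 : R).
Proof.
rewrite (_ : pcdf l = fun n => series (exp_coeff l) n * expR (- l)).
  rewrite -[X in _ --> X](expRxMexpNx_1 l); apply: cvgMl; exact: is_cvg_series_exp_coeff.
apply/funext => n; rewrite /pcdf /series /= mulr_suml big_mkord.
by apply: eq_bigr => k _.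
Qed.

Lemma pcdf_le1 n : pcdf l n <= 1.
Proof.
rewrite -[leRHS](cvg_lim _ cvg_pcdf) //; apply: nondecreasing_cvgn_le; first exact: pcdf_mono.
by apply/cvg_ex; exists 1; exact: cvg_pcdf.
Qed.

Lemma pcdf_gt (w : R) : w < 1 -> exists i, w < pcdf l i.+1.
Proof.
move=> w1; apply: contrapT => nex.
have : 1 <= w.
  rewrite -[leLHS](cvg_lim _ cvg_pcdf) //; apply: limr_le; first by apply/cvg_ex; exists 1; exact: cvg_pcdf.
  apply: nearW => n; apply: le_trans (pcdf_mono (leqnSn n)) _.
  by rewrite leNgt; apply/negP => h; apply: nex; exists n.
by rewrite leNgt w1.
Qed.

(** The quantile function of the Poisson law, applied to a uniform seed. The default value concerns
    seeds [w >= 1] only, which [unif] does not charge. *)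
Definition pnum (w : T) : nat :=
  if pselect (exists i, (w : R) < pcdf l i.+1) is left h then ex_minn h else 0%N.

Lemma pnumS_eq n (w : R) : pnum w = n.+1 <-> pcdf l n.+1 <= w < pcdf l n.+2.
Proof.
rewrite /pnum; case: pselect => [h|nh].
  case: ex_minnP => m hm mmin; split=> [mE|/andP[h1 h2]].
    rewrite mE in hm; rewrite hm andbT leNgt; apply/negP => hn.
    by have := mmin _ hn; rewrite mE ltnn.
  apply/eqP; rewrite eqn_leq mmin // ltnNge; apply/negP => mn.
  have := lt_le_trans hm (le_trans (pcdf_mono (_ : m.+1 <= n.+1)%N) h1).
  by rewrite ltxx ltnS => /(_ mn).
by split=> // /andP[_ h]; case: nh; exists n.+1.
Qed.

Lemma pnum_itv n (w : R) : 0 <= w < 1 -> (pnum w == n) = (pcdf l n <= w < pcdf l n.+1).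
Proof.
move=> /andP[w0 w1]; case: n => [|n]; last by apply/eqP/idP => /pnumS_eq.
rewrite {1}/pcdf big_ord0 w0 /= /pnum; case: pselect => [h|nh]; last by case: nh; exact: pcdf_gt.
case: ex_minnP => m hm mmin; apply/eqP/idP => [<-//|h0].
by apply/eqP; rewrite -leqn0 mmin.
Qed.

Lemma measurable_pnum n : measurable [set w : T | pnum w = n].
Proof.
have mS k : measurable [set w : T | pnum w = k.+1].
  rewrite (_ : [set w | _] = `[pcdf l k.+1, pcdf l k.+2[%classic) //.
  rewrite predeqE => w /=; rewrite in_itv /=; exact: pnumS_eq.
case: n => [|n]; last exact: mS.
rewrite (_ : [set w | _] = ~` \bigcup_k [set w : T | pnum w = k.+1]).
  by apply: measurableC; apply: bigcupT_measurable.
rewrite predeqE => w /=; split=> [h [k _] /=|h]; first by rewrite h.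
by case E: (pnum w) => [//|k]; case: h; exists k.
Qed.

Lemma unif_pnum n : mu [set w : T | pnum w = n] = (poisson_mass l n)%:E.
Proof.
have h0 : 0 <= pcdf l n by apply: sumr_ge0 => k _; exact: poisson_mass_ge0.
rewrite unifE (_ : _ `&` _ = `[pcdf l n, pcdf l n.+1[%classic).
  rewrite lebesgue_measure_itv /= lte_fin -EFinB.
  have -> : pcdf l n.+1 = pcdf l n + poisson_mass l n by rewrite /pcdf big_ord_recr.
  rewrite ltrDl addrAC subrr add0r; have := poisson_mass_ge0 n; rewrite le_eqVlt => /orP[/eqP<-|->//].
  by rewrite ltxx.
rewrite predeqE => w /=; rewrite !in_itv /=; split.
  by move=> [/eqP h w01]; rewrite -pnum_itv.
move=> /andP[h1 h2]; have w01 : 0 <= w < 1.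
  by rewrite (le_trans h0 h1) (lt_le_trans h2 (pcdf_le1 _)).
by split=> //; apply/eqP; rewrite pnum_itv // h1.
Qed.
End PoissonNumber.

Section Points.
Variable Psi : T -> R * R.
Hypothesis mPsi : measurable_fun setT Psi.

(** The points [Psi (p1 (iter j p2 v))] are independent, since each step spends one half of the
    digits and keeps the other half for the later points. *)
Definition nb (B : set (R * R)) (n : nat) (v : T) : nat :=
  \sum_(j < n) `[< B (Psi (p1 (iter j p2 v))) >].

Lemma nbS B n v : nb B n.+1 v = (`[< B (Psi (p1 v)) >] + nb B n (p2 v))%N.
Proof.
rewrite /nb big_ord_recl /=; congr (_ + _)%N; apply: eq_bigr => j _.
by rewrite -iterSr.
Qed.

Definition law (B : set (R * R)) : R := fine (mu (Psi @^-1` B)).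

Lemma measurable_Psi B : measurable B -> measurable (Psi @^-1` B).
Proof. by move=> mB; rewrite -[X in measurable X]setTI; exact: mPsi. Qed.

Lemma lawE B : measurable B -> mu (Psi @^-1` B) = (law B)%:E.
Proof. by move=> mB; rewrite fineK // fin_num_measure //; exact: measurable_Psi. Qed.

Lemma law_ge0 B : 0 <= law B.
Proof. by rewrite fine_ge0 // measure_ge0. Qed.

Section Partition.
Variables (K : nat) (B : 'I_K -> set (R * R)).
Hypothesis mB : forall i, measurable (B i).
Hypothesis dB : forall i j x, B i x -> B j x -> i = j.
Hypothesis cB : forall x, exists i, B i x.

Lemma law_sum : \sum_(i < K) law (B i) = 1.
Proof.
apply: EFin_inj; rewrite -sumEFin -unif_setT.
rewrite (eq_bigr (fun i => mu (Psi @^-1` B i))); last by move=> i _; rewrite lawE.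
rewrite -(measure_disjoint_fin [the {measure set T -> \bar R} of mu] xpredT).
- by congr (mu _); rewrite predeqE => w; split=> // _; have [i Bi] := cB (Psi w); exists i.
- by move=> i; exact: measurable_Psi.
- by move=> i j w; exact: dB.
Qed.

Lemma nb_sum n v : (\sum_(i < K) nb (B i) n v)%N = n.
Proof.
rewrite /nb exchange_big /= (eq_bigr (fun=> 1%N)) ?sum1_card ?card_ord // => j _.
have [i Bi] := cB (Psi (p1 (iter j p2 v))).
rewrite (bigD1 i) //= big1 ?addn0; first by rewrite asboolT.
by move=> k ki; rewrite asboolF // => Bk; move/eqP: ki; apply; exact: dB Bk Bi.
Qed.

(** The recursion of multinomial probabilities, according to the set [i] that receives the first
    point. *)
Lemma multinomial_step (a : 'I_K -> R) (c : 'I_K -> nat) n : (\sum_(i < K) c i = n.+1)%N ->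
  \sum_(i < K | (0 < c i)%N) a i * (n`!%:R * \prod_(j < K) (a j ^+ (c j - (j == i)) / (c j - (j == i))`!%:R)) =
  n.+1`!%:R * \prod_(j < K) (a j ^+ c j / (c j)`!%:R).
Proof.
move=> cE; set Q := \prod_(j < K) (a j ^+ c j / _).
have -> : n.+1`!%:R * Q = \sum_(i < K) n`!%:R * Q * (c i)%:R.
  by rewrite -mulr_sumr -natr_sum cE factS natrM; ring.
rewrite [RHS](bigID (fun i => (0 < c i)%N)) /= [X in _ = _ + X]big1 ?addr0; last first.
  by move=> i; rewrite -eqn0Ngt => /eqP->; rewrite mulr0.
apply: eq_bigr => i ci; rewrite mulrCA -mulrA; congr (_ * _).
rewrite /Q (bigD1 i) //= [X in _ = X * _](bigD1 i) //= eqxx subn1.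
rewrite (eq_bigr (fun j => a j ^+ c j / (c j)`!%:R)); last by move=> j /negbTE->; rewrite subn0.
case: (c i) ci => // m _; rewrite /= exprS factS natrM.
have h1 : m.+1%:R != 0 :> R by rewrite pnatr_eq0.
have h2 : m`!%:R != 0 :> R by rewrite pnatr_eq0 -lt0n fact_gt0.
move: (m.+1%:R : R) (m`!%:R : R) (a i ^+ m) (\prod_(_ < _ | _) _) h1 h2 => x y z t x0 y0.
by field; rewrite ?x0 ?y0.
Qed.

Lemma measurable_nb n (c : 'I_K -> nat) : measurable [set v : T | forall i, nb (B i) n v = c i] /\
  ((\sum_(i < K) c i)%N = n ->
   mu [set v : T | forall i, nb (B i) n v = c i] =
   (n`!%:R * \prod_(i < K) (law (B i) ^+ c i / (c i)`!%:R))%:E).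
Proof.
elim: n c => [|n IH] c.
  have nb0 B0 v : nb B0 0 v = 0%N by rewrite /nb big_ord0.
  case: (pselect (forall i, c i = 0%N)) => [c0|nc0].
    rewrite (_ : [set v | _] = setT); last first.
      by rewrite predeqE => v; split=> // _ i; rewrite nb0 c0.
    split=> // _; rewrite unif_setT fact0 mul1r big1 // => i _.
    by rewrite c0 expr0 fact0 divr1.
  rewrite (_ : [set v | _] = set0); last first.
    by rewrite predeqE => v; split=> // h; apply: nc0 => i; rewrite -h nb0.
  split=> // s0; case: nc0 => i; apply/eqP; rewrite -leqn0 -s0.
  by rewrite (bigD1 i) //= leq_addr.
pose E (i : 'I_K) : set T := [set v | (Psi @^-1` B i) (p1 v) /\
  [set u | forall j, nb (B j) n u = (c j - (j == i))%N] (p2 v)].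
have setE : [set v : T | forall i, nb (B i) n.+1 v = c i] = [set v | exists2 i, (0 < c i)%N & E i v].
  rewrite predeqE => v; split.
    move=> h; have [i Bi] := cB (Psi (p1 v)); exists i.
      by rewrite -h nbS asboolT.
    split=> // j; rewrite -h nbS; have [->|ji] := eqVneq j i.
      by rewrite asboolT //= addKn.
    rewrite asboolF ?subn0 // => Bj; move/eqP: ji; apply; exact: dB Bj Bi.
  move=> [i ci [/= Bi h]] j; rewrite nbS h; have [->|ji] := eqVneq j i.
    by rewrite asboolT //= subnKC.
  rewrite asboolF ?subn0 // => Bj; move/eqP: ji; apply; exact: dB Bj Bi.
have mE i : measurable (E i).
  by apply: measurable_p12; [exact: measurable_Psi|case: (IH (fun j => (c j - (j == i))%N))].
split.
  rewrite setE (_ : [set v | _] = \bigcup_(i in [set i | (0 < c i)%N]) E i).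
    by apply: fin_bigcup_measurable => // ; exact: finite_finset.
  by rewrite predeqE.
move=> cE; rewrite setE (measure_disjoint_fin [the {measure set T -> \bar R} of mu]) //; last first.
  by move=> i j w [Bi _] [Bj _]; exact: dB Bi Bj.
rewrite -multinomial_step // -sumEFin; apply: eq_bigr => i ci.
have [m1 h1] := IH (fun j => (c j - (j == i))%N).
apply: unif_p12 => //; [exact: measurable_Psi|exact: lawE|].
apply: h1; apply/eqP; rewrite -eqSS -cE (bigD1 i) //= [X in _ == X](bigD1 i) //= eqxx subn1.
rewrite (eq_bigr c); last by move=> j /negbTE->; rewrite subn0.
by rewrite -addSn prednK.
Qed.

Variable l : R.
Hypothesis l_ge0 : 0 <= l.

(** Colouring a Poisson number of independent points: the factorial of the multinomial law cancels
    that of the Poisson law, and the exponential splits because the laws of the parts add up to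
    1. *)
Lemma cell_partition (c : 'I_K -> nat) :
  let E := [set w : T | forall i, nb (B i) (pnum l (p1 w)) (p2 w) = c i] in
  measurable E /\ mu E = (\prod_(i < K) poisson_mass (l * law (B i)) (c i))%:E.
Proof.
move=> E; pose n := (\sum_(i < K) c i)%N.
have [m1 h1] := measurable_nb n c.
have -> : E = [set w | [set u | pnum l u = n] (p1 w) /\ [set v : T | forall i, nb (B i) n v = c i] (p2 w)].
  rewrite predeqE => w; split=> [h|[/= h1' h2] i]; last by rewrite h1' h2.
  have e : pnum l (p1 w) = n by rewrite -(nb_sum (pnum l (p1 w)) (p2 w)) /n; apply: eq_bigr => i _.
  by split=> //= i; rewrite -e h.
split; first by apply: measurable_p12 => //; exact: measurable_pnum.
rewrite (unif_p12 _ m1 (unif_pnum l_ge0 n) (h1 erefl)); last exact: measurable_pnum.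
congr EFin; rewrite /poisson_mass.
have -> : \prod_(i < K) ((l * law (B i)) ^+ c i / (c i)`!%:R * expR (- (l * law (B i)))) =
  l ^+ n * expR (- l) * \prod_(i < K) (law (B i) ^+ c i / (c i)`!%:R).
  have -> : expR (- l) = \prod_(i < K) expR (- (l * law (B i))).
    by rewrite -expR_sum; congr expR; rewrite sumrN -mulr_sumr law_sum mulr1.
  rewrite /n expr_sum -!big_split /=; apply: eq_bigr => i _; rewrite exprMn; ring.
by field; rewrite pnatr_eq0 -lt0n fact_gt0.
Qed.
End Partition.

Definition cell_count (l : R) (B : set (R * R)) (w : T) : nat := nb B (pnum l (p1 w)) (p2 w).

(** The sets are completed to a partition by the complement [B0] of their union, and the count in
    [B0] is summed out. *)
Lemma cell_law (l : R) (k : nat) (B : 'I_k -> set (R * R)) (c : 'I_k -> nat) : 0 <= l ->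
  (forall i, measurable (B i)) -> (forall i j x, B i x -> B j x -> i = j) ->
  let E := [set w : T | forall i, cell_count l (B i) w = c i] in
  measurable E /\ mu E = (\prod_(i < k) poisson_mass (l * law (B i)) (c i))%:E.
Proof.
move=> l0 mB dB E.
pose B0 := ~` [set x | exists i, B i x].
have mB0 : measurable B0.
  apply: measurableC; rewrite (_ : [set x | _] = \bigcup_(i in [set: 'I_k]) B i).
    by apply: fin_bigcup_measurable => //; exact: finite_finset.
  by rewrite predeqE => x; split=> [[i]|[i _]] Bi; exists i.
pose B' (i : 'I_k.+1) := oapp B B0 (unlift ord0 i).
pose c' c0 (i : 'I_k.+1) := oapp c c0 (unlift ord0 i).
have mB' i : measurable (B' i) by rewrite /B'; case: unlift => //= j.
have dB' i j x : B' i x -> B' j x -> i = j.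
  rewrite /B'; case: (unliftP ord0 i) => [i'|] ->; case: (unliftP ord0 j) => [j'|] -> //=.
  - by move=> Bi Bj; congr lift; exact: dB Bi Bj.
  - by move=> Bi; case; exists i'.
  - by move=> h Bj; case: h; exists j'.
have cB' x : exists i, B' i x.
  case: (pselect (exists i, B i x)) => [[i Bi]|h]; last by exists ord0; rewrite /B' unlift_none.
  by exists (lift ord0 i); rewrite /B' liftK.
pose F c0 := [set w : T | forall i, nb (B' i) (pnum l (p1 w)) (p2 w) = c' c0 i].
have EF : E = \bigcup_c0 F c0.
  rewrite predeqE => w; split=> [h|[c0 _ h] i].
    exists (nb B0 (pnum l (p1 w)) (p2 w)) => // i; rewrite /B' /c'.
    by case: (unliftP ord0 i) => [j|] _ //=; exact: h.
  by have := h (lift ord0 i); rewrite /B' /c' liftK.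
have FP c0 := @cell_partition k.+1 B' mB' dB' cB' l l0 (c' c0).
have mF c0 : measurable (F c0) by case: (FP c0).
split; first by rewrite EF; exact: bigcupT_measurable.
rewrite EF.
have tF : trivIset setT F.
  apply/trivIsetP => i j _ _ ij; rewrite predeqE => w; split=> // -[/(_ ord0) + /(_ ord0)].
  by rewrite /c' unlift_none /= => -> /eqP; rewrite (negbTE ij).
have -> : mu (\bigcup_c0 F c0) = (\sum_(0 <= c0 <oo) mu (F c0))%E.
  by apply: (measure_semi_bigcup [the {measure set T -> \bar R} of mu]) => //; exact: bigcupT_measurable.
set Q := \prod_(i < k) _.
have Q0 : 0 <= Q by apply: prodr_ge0 => i _; apply: poisson_mass_ge0; rewrite mulr_ge0 // law_ge0.
have x0 : 0 <= l * law B0 by rewrite mulr_ge0 // law_ge0.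
rewrite (eq_eseriesr (g := fun c0 => (Q%:E * (poisson_mass (l * law B0) c0)%:E)%E)).
  by rewrite nneseriesZl ?poisson_mass_sum ?mule1 // => i _; rewrite lee_fin poisson_mass_ge0.
move=> c0 _; have [_ ->] := FP c0; rewrite -EFinM; congr EFin.
rewrite big_ord_recl mulrC /B' /c' unlift_none /=; congr (_ * _).
by apply: eq_bigr => i _; rewrite liftK.
Qed.
End Points.

End Seeds.

(** * Superposition of countably many Poisson processes *)

Section Superposition.
Context {R : realType}.
Local Notation T := (measurableTypeR R).
Local Notation mu := (@unif R).
Local Notation p1 := (@splitting R 2 : T -> T).
Local Notation p2 := (@splitting R 1 : T -> T).

Lemma poisson_conv (x y : R) c :
  \sum_(j < c.+1) poisson_mass x j * poisson_mass y (c - j) = poisson_mass (x + y) c.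
Proof.
rewrite /poisson_mass opprD expRD [x + y]addrC exprDn mulr_suml mulr_suml; apply: eq_bigr => j _.
have jc : (j <= c)%N by rewrite -ltnS.
have := bin_fact jc => /(congr1 (fun n : nat => n%:R : R)) /=; rewrite !natrM => bE.
have h1 : j`!%:R != 0 :> R by rewrite pnatr_eq0 -lt0n fact_gt0.
have h2 : (c - j)`!%:R != 0 :> R by rewrite pnatr_eq0 -lt0n fact_gt0.
have h3 : c`!%:R != 0 :> R by rewrite pnatr_eq0 -lt0n fact_gt0.
rewrite -[(_ * _) *+ _]mulr_natr.
have -> : 'C(c, j)%:R = c`!%:R / (j`!%:R * (c - j)`!%:R) :> R.
  by rewrite -bE mulfK // mulf_neq0.
move: (j`!%:R : R) ((c - j)`!%:R : R) (c`!%:R : R) h1 h2 h3 => u v z u0 v0 z0.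
by field; rewrite ?u0 ?v0 ?z0.
Qed.

Lemma cvg_prod_seq (I : Type) (r : seq I) (f : I -> nat -> R) (y : I -> R) :
  (forall i, f i n @[n --> \oo] --> y i) -> \prod_(i <- r) f i n @[n --> \oo] --> \prod_(i <- r) y i.
Proof.
move=> h; elim: r => [|i r IH].
  by rewrite big_nil; under eq_fun do rewrite big_nil; exact: cvg_cst.
by rewrite big_cons; under eq_fun do rewrite big_cons; exact: cvgM.
Qed.

Definition total (L : nat -> R) (PSI : nat -> T -> R * R) (M : nat) (B : set (R * R)) (w : T) : nat :=
  \sum_(c < M) cell_count (PSI c) (L c) B (p1 (iter c p2 w)).

(** The first cell draws its seed from one half of the digits and all later cells from the other, so
    their counts are independent and add up by [poisson_conv]; [f] ranges over the possible
    contributions of the first cell. *)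
Lemma total_law (k : nat) (B : 'I_k -> set (R * R)) M (L : nat -> R) (PSI : nat -> T -> R * R) (c : 'I_k -> nat) :
  (forall i, measurable (B i)) -> (forall i j x, B i x -> B j x -> i = j) ->
  (forall n, 0 <= L n) -> (forall n, measurable_fun setT (PSI n)) ->
  let E := [set w : T | forall i, total L PSI M (B i) w = c i] in
  measurable E /\ mu E = (\prod_(i < k) poisson_mass (\sum_(n < M) L n * law (PSI n) (B i)) (c i))%:E.
Proof.
move=> mB dB; elim: M L PSI c => [|M IH] L PSI c L0 mP E.
  have t0 B0 w : total L PSI 0 B0 w = 0%N by rewrite /total big_ord0.
  have pm0 n : poisson_mass (0 : R) n = (n == 0%N)%:R.
    by rewrite /poisson_mass oppr0 expR0 mulr1 expr0n; case: n => [|n]; rewrite ?divr1 ?mul0r.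
  under eq_bigr => i _ do rewrite big_ord0 pm0.
  case: (pselect (forall i, c i = 0%N)) => [c0|nc0].
    rewrite (_ : E = setT); last by rewrite predeqE => w; split=> // _ i; rewrite t0 c0.
    by split=> //; rewrite unif_setT big1 // => i _; rewrite c0.
  rewrite (_ : E = set0); last first.
    by rewrite predeqE => w; split=> // h; apply: nc0 => i; rewrite -h t0.
  split=> //; rewrite measure0; congr EFin.
  have [i ci] : exists i, c i != 0%N.
    by apply: contrapT => h; apply: nc0 => i; apply/eqP/negPn/negP => ci; apply: h; exists i.
  by rewrite (bigD1 i) //= (negbTE ci) mul0r.
have tS B0 w : total L PSI M.+1 B0 w =
    (cell_count (PSI 0%N) (L 0%N) B0 (p1 w) + total (fun n => L n.+1) (fun n => PSI n.+1) M B0 (p2 w))%N.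
  rewrite /total big_ord_recl; congr (_ + _)%N; apply: eq_bigr => j _.
  by rewrite -iterSr.
pose m := (\sum_(i < k) c i)%N.
have cm i : (c i <= m)%N by rewrite /m (bigD1 i) //= leq_addr.
pose A (f : {ffun 'I_k -> 'I_m.+1}) := [set w : T | forall i, cell_count (PSI 0%N) (L 0%N) (B i) w = f i].
pose A' (f : {ffun 'I_k -> 'I_m.+1}) := [set w : T | forall i,
  total (fun n => L n.+1) (fun n => PSI n.+1) M (B i) w = (c i - f i)%N].
pose F f : set T := [set w | A f (p1 w) /\ A' f (p2 w)].
have AP (f : {ffun 'I_k -> 'I_m.+1}) := @cell_law R (PSI 0%N) (mP 0%N) (L 0%N) k B (fun i => f i) (L0 0%N) mB dB.
have AP' (f : {ffun 'I_k -> 'I_m.+1}) := IH (fun n => L n.+1) (fun n => PSI n.+1) (fun i => (c i - f i)%N) (fun n => L0 n.+1) (fun n => mP n.+1).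
pose Q (i : 'I_k) (j : 'I_m.+1) := (j <= c i)%N.
have EF : E = [set w | exists2 f, f \in family Q & F f w].
  rewrite predeqE => w; split.
    move=> h.
    have hle i : (cell_count (PSI 0%N) (L 0%N) (B i) (p1 w) <= c i)%N by rewrite -h tS leq_addr.
    exists [ffun i => inord (cell_count (PSI 0%N) (L 0%N) (B i) (p1 w))].
      by apply/familyP => i; rewrite ffunE unfold_in /Q inordK // ltnS (leq_trans (hle i)).
    split=> i; rewrite ffunE inordK ?ltnS ?(leq_trans (hle i)) //.
    by rewrite -h tS addKn.
  move=> [f /familyP fQ [h1 h2]] i; rewrite tS h1 h2 subnKC //.
  by have := fQ i; rewrite unfold_in.
have mA f : measurable (A f) by case: (AP f).
have mA' f : measurable (A' f) by case: (AP' f).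
have mF f : measurable (F f) by apply: measurable_p12.
split.
  rewrite EF (_ : [set w | _] = \bigcup_(f in [set f | f \in family Q]) F f).
    by apply: fin_bigcup_measurable => //; exact: finite_finset.
  by rewrite predeqE.
rewrite EF (measure_disjoint_fin [the {measure set T -> \bar R} of mu]) //; last first.
  move=> f f' w [h _] [h' _]; apply/ffunP => i; apply: val_inj.
  by rewrite /= -(h i) -(h' i).
pose x i := L 0%N * law (PSI 0%N) (B i).
pose y i := \sum_(n < M) L n.+1 * law (PSI n.+1) (B i).
transitivity ((\prod_(i < k) \sum_(j < m.+1 | (j < (c i).+1)%N)
    (poisson_mass (x i) j * poisson_mass (y i) (c i - j)))%:E); last first.
  congr EFin; apply: eq_bigr => i _; rewrite [in RHS]big_ord_recl -poisson_conv.
  by rewrite (big_ord_widen m.+1 (fun j => poisson_mass _ j * poisson_mass _ (c i - j))) // ltnS.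
rewrite (bigA_distr_big_dep (fun i (j : 'I_m.+1) => (j < (c i).+1)%N)) -sumEFin.
apply: eq_bigr => f _; rewrite big_split /=.
by apply: unif_p12 => //; [case: (AP f)|case: (AP' f)].
Qed.

Lemma poisson_mass_cvg (x : nat -> R) (y : R) c : x n @[n --> \oo] --> y ->
  poisson_mass (x n) c @[n --> \oo] --> poisson_mass y c.
Proof.
move=> xy; rewrite /poisson_mass; apply: cvgM.
  apply: cvgM; last exact: cvg_cst.
  apply: (@cvg_comp _ _ _ x (fun t : R => t ^+ c) _ (nbhs y)) => //.
  exact: exprn_continuous.
apply: (@cvg_comp _ _ _ (fun n => - x n) expR _ (nbhs (- y))); first exact: cvgN.
exact: continuous_expR.
Qed.

Lemma total_mono L PSI B w : {homo total L PSI ^~ B ^~ w : m n / (m <= n)%N}.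
Proof.
move=> m n mn; rewrite /total -!(big_mkord xpredT (fun c => cell_count (PSI c) (L c) B (p1 (iter c p2 w)))).
by rewrite (@big_cat_nat _ _ _ m 0 n) //= leq_addr.
Qed.

(** The counts of the infinite superposition without infinite sums: partial counts are nondecreasing
    integers, so a finite limit means being constant from some rank on. *)
Definition eventually_total L PSI (k : nat) (B : 'I_k -> set (R * R)) (c : 'I_k -> nat) : set T :=
  [set w | exists M0, forall M, (M0 <= M)%N -> forall i, total L PSI M (B i) w = c i].

Lemma eventually_total_law (k : nat) (B : 'I_k -> set (R * R)) (L : nat -> R) (PSI : nat -> T -> R * R)
    (c : 'I_k -> nat) (y : 'I_k -> R) :
  (forall i, measurable (B i)) -> (forall i j x, B i x -> B j x -> i = j) ->
  (forall n, 0 <= L n) -> (forall n, measurable_fun setT (PSI n)) ->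
  (forall i, \sum_(n < M) L n * law (PSI n) (B i) @[M --> \oo] --> y i) ->
  measurable (eventually_total L PSI B c) /\
  mu (eventually_total L PSI B c) = (\prod_(i < k) poisson_mass (y i) (c i))%:E.
Proof.
move=> mB dB L0 mP cvy.
pose E M := [set w : T | forall i, total L PSI M (B i) w = c i].
have EP M := @total_law k B M L PSI c mB dB L0 mP.
have mE M : measurable (E M) by case: (EP M).
pose F := eventually_total L PSI B c.
have Finf : F = \bigcup_m \bigcap_(n in [set n | m <= n]%N) E n.
  rewrite predeqE => w; split; first by move=> [m h]; exists m => // n /= /h.
  by move=> [m _ h]; exists m => n /h.
have mF : measurable F.
  rewrite Finf; apply: bigcupT_measurable => m; apply: bigcap_measurable => [|n _]; last exact: mE.
  by exists m => /=.
split=> //.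
(* By monotonicity, counts that return infinitely often to the prescribed values never leave them in
   between. The upper limit of the events is thus contained in [F], which is their lower limit. *)
have Fsup n0 : (\bigcap_m \bigcup_(n in [set n | m <= n]%N) E (n0 + n)%N) `<=` F.
  move=> w h; have [m0 _ Em0] := h 0%N I; exists (n0 + m0)%N => M hM i.
  have [m1 /= Mm1 Em1] := h M I.
  apply/eqP; rewrite eqn_leq; apply/andP; split.
    by rewrite -(Em1 i); apply: total_mono; apply: leq_trans Mm1 _; rewrite leq_addl.
  by rewrite -(Em0 i); exact: total_mono.
set v := \prod_(i < k) _.
have cv : (\prod_(i < k) poisson_mass (\sum_(n < M) L n * law (PSI n) (B i)) (c i)) @[M --> \oo] --> v.
  by apply: cvg_prod_seq => i; exact: poisson_mass_cvg.
have near e : 0 < e -> exists n0, forall n, (n0 <= n)%N -> ((v - e)%:E <= mu (E n) <= (v + e)%:E)%E.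
  move=> e0; move/cvgrPdist_le: cv => /(_ e e0)[n0 _ hn]; exists n0 => n /hn.
  by have [_ ->] := EP n; rewrite !lee_fin ler_norml => /andP[h1 h2]; apply/andP; split; lra.
apply/eqP; rewrite eq_le; apply/andP; split; apply/lee_addgt0Pr => e e0.
  have [n0 hn] := near e e0.
  have mE' n : measurable (E (n0 + n)%N) by exact: mE.
  have := @prob_liminf_le _ _ _ [the probability T R of mu] (fun n => E (n0 + n)%N) (v + e)%:E mE'.
  rewrite -EFinD => hh; apply: le_trans (hh _); last first.
    by move=> n; have /andP[_] := hn (n0 + n)%N (leq_addr _ _).
  apply: le_measure; rewrite ?inE //.
    apply: bigcupT_measurable => m; apply: bigcap_measurable => [|n _]; last exact: mE'.
    by exists m => /=.
  by move=> w [m h]; exists m => // n /= mn i; apply: h; apply: leq_trans mn _; rewrite leq_addl.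
have [n0 hn] := near e e0.
have mE' n : measurable (E (n0 + n)%N) by exact: mE.
have := @prob_limsup_ge _ _ _ [the probability T R of mu] (fun n => E (n0 + n)%N) (v - e)%:E mE'.
move=> /(_ (fun n => proj1 (andP (hn (n0 + n)%N (leq_addr _ _))))) hh.
have : ((v - e)%:E <= mu F)%E.
  apply: le_trans hh _; apply: le_measure; rewrite ?inE //.
  apply: bigcapT_measurable => m; apply: bigcup_measurable => n _; exact: mE'.
rewrite -(fineK (fin_num_measure [the probability T R of mu] _ mF)) -EFinD !lee_fin; lra.
Qed.
End Superposition.

(** * Enumeration of the points by the natural numbers *)

Section Enumeration.
Variable p : pred nat.

Definition rank_of (j : nat) : nat := count p (iota 0 j).

Lemma rank_ofS j : rank_of j.+1 = (rank_of j + p j)%N.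
Proof. by rewrite /rank_of -addn1 iotaD count_cat /= addn0. Qed.

Lemma rank_of_mono : {homo rank_of : i j / (i <= j)%N}.
Proof. by apply: homo_leq leqnn leq_trans _ => j; rewrite rank_ofS leq_addr. Qed.

Lemma rank_of_inj i j : p i -> p j -> rank_of i = rank_of j -> i = j.
Proof.
wlog ij : i j / (i <= j)%N => [h|pi pj e].
  by case/orP: (leq_total i j) => ij pi pj e; [exact: h|apply/esym; exact: h].
apply/eqP; rewrite eqn_leq ij leqNgt; apply/negP => lt.
by have := rank_of_mono lt; rewrite rank_ofS pi -e addn1 ltnn.
Qed.

Definition enum_of (n : nat) : nat :=
  if pselect (exists j, p j && (rank_of j == n)) is left h then ex_minn h else 0%N.

Hypothesis p_inf : forall n, exists2 j, (n <= j)%N & p j.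

Lemma enum_ofP n : p (enum_of n) /\ rank_of (enum_of n) = n.
Proof.
suff ex : exists j, p j && (rank_of j == n).
  by rewrite /enum_of; case: pselect => // h; case: ex_minnP => j /andP[pj /eqP].
have [J hJ] : exists J, (n < rank_of J)%N.
  elim: n => [|n [J hJ]]; first have [j _ pj] := p_inf 0.
    by exists j.+1; rewrite rank_ofS pj addn1.
  have [j Jj pj] := p_inf J; exists j.+1; rewrite rank_ofS pj addn1 ltnS.
  exact: leq_trans hJ (rank_of_mono Jj).
have hex : exists J, (n < rank_of J)%N by exists J.
case: (ex_minnP hex) => -[|j]; first by rewrite /rank_of.
rewrite rank_ofS => hj jmin; exists j.
have jn : (rank_of j <= n)%N by rewrite leqNgt; apply/negP => /jmin; rewrite ltnn.
by move: hj jn; case: (p j) => /=; rewrite ?addn0 ?addn1; [rewrite ltnS eqn_leq => -> ->|rewrite ltnNge => /negP].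
Qed.

Lemma enum_of_rank j : p j -> enum_of (rank_of j) = j.
Proof. by move=> pj; have [h1 h2] := enum_ofP (rank_of j); exact: rank_of_inj. Qed.

End Enumeration.


Section PairList.
Variables (num : nat -> nat) (b : nat -> nat -> bool).

(** Later [c] is a cell, [i] the rank of a point in it, and [b] tests membership in a set. A
    duplicate-free list is produced because [count_is] asks for one. *)
Fixpoint pairs (M : nat) : seq (nat * nat) :=
  if M is M'.+1 then pairs M' ++ [seq (M', i) | i <- [seq i <- iota 0 (num M') | b M' i]] else [::].

Lemma mem_pairs M x : (x \in pairs M) = [&& (x.1 < M)%N, (x.2 < num x.1)%N & b x.1 x.2].
Proof.
case: x => c i; elim: M => //= M IH; rewrite mem_cat IH /=.
have -> : ((c, i) \in [seq (M, i) | i <- [seq i <- iota 0 (num M) | b M i]]) =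
   [&& c == M, (i < num M)%N & b M i].
  apply/mapP/and3P => [[j]|[/eqP-> iN bi]].
    by rewrite mem_filter mem_iota add0n => /andP[bj jN] [-> ->].
  by exists i => //; rewrite mem_filter bi mem_iota.
rewrite ltnS [(c <= M)%N]leq_eqVlt; have [->|cM] := eqVneq c M; last by rewrite orbF.
by rewrite ltnn.
Qed.

Lemma uniq_pairs M : uniq (pairs M).
Proof.
elim: M => //= M IH; rewrite cat_uniq IH /=; apply/andP; split.
  apply/hasPn => _ /mapP[i _ ->]; rewrite mem_pairs /= ltnn //.
rewrite map_inj_uniq; first by rewrite filter_uniq // iota_uniq.
by move=> i j [].
Qed.

Lemma size_pairs M : size (pairs M) = (\sum_(c < M) \sum_(i < num c) b c i)%N.
Proof.
elim: M => [|M IH]; first by rewrite big_ord0.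
rewrite big_ord_recr /= size_cat size_map IH; congr (_ + _)%N.
rewrite size_filter -sum1_count big_mkcond /= -[in RHS](big_mkord xpredT (fun i => nat_of_bool (b M i))).
by rewrite /index_iota subn0; apply: eq_bigr => i _; case: (b M i).
Qed.

Lemma pairs_stable M0 c : (forall M, (M0 <= M)%N -> size (pairs M) = c) ->
  forall x, (x.2 < num x.1)%N -> b x.1 x.2 -> x \in pairs M0.
Proof.
move=> h x xn bx; apply/negPn/negP => xM0.
have : (size (x :: pairs M0) <= size (pairs (maxn M0 x.1.+1)))%N.
  apply: uniq_leq_size; first by rewrite /= xM0 uniq_pairs.
  move=> y; rewrite inE => /orP[/eqP->|]; rewrite !mem_pairs ?xn ?bx ?andbT ?leq_maxr //.
  by move=> /and3P[y1 -> ->]; rewrite (leq_trans y1) // leq_maxl.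
by rewrite /= !h ?leq_maxl // ltnn.
Qed.
End PairList.

Section Process.
Context {R : realType}.
Local Notation T := (measurableTypeR R).
Local Notation mu := (@unif R).
Local Notation p1 := (@splitting R 2 : T -> T).
Local Notation p2 := (@splitting R 1 : T -> T).

Lemma measurable_iter k n : measurable_fun setT (iter n (@splitting R k : T -> T)).
Proof.
elim: n => [|n IH]; first exact: measurable_id.
exact: (measurableT_comp (measurable_splitting k) IH).
Qed.

Lemma unif_iter n (A : set T) : measurable A -> mu (iter n p2 @^-1` A) = mu A.
Proof.
elim: n A => [|n IH] A mA //.
rewrite (_ : iter n.+1 p2 @^-1` A = iter n p2 @^-1` (p2 @^-1` A)) //.
by rewrite IH ?unif_p2 //; exact: measurable_preim.
Qed.

(** A coincidence puts both values into the same slice of length [1 / N], and [h1] falls into any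
    given slice with probability at most [1 / N], independently of [h2]. Only [h1] has to be
    uniform. *)
Lemma unif_diag (h1 : T -> T) (h2 : T -> T) : measurable_fun setT h1 -> measurable_fun setT h2 ->
  (forall A, measurable A -> mu (h1 @^-1` A) = mu A) -> (forall w, 0 <= (h1 w : R) <= 1) ->
  measurable [set w : T | h1 (p1 w) = h2 (p2 w)] /\ mu [set w : T | h1 (p1 w) = h2 (p2 w)] = 0%E.
Proof.
move=> m1 m2 h1mu h101.
have mD : measurable [set w : T | h1 (p1 w) = h2 (p2 w)].
  have mf : measurable_fun setT (fun w : T => (h1 (p1 w) : R) - h2 (p2 w)).
    apply: (@measurable_funB _ _ R).
      exact: (measurableT_comp m1 (measurable_splitting 2)).
    exact: (measurableT_comp m2 (measurable_splitting 1)).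
  have := mf measurableT [set (0 : R)] (measurable_set1 _); rewrite setTI; congr (measurable _).
  by rewrite predeqE => w /=; split=> [/eqP|->]; rewrite ?subrr // subr_eq0 => /eqP.
split=> //; apply/eqP; rewrite eq_le measure_ge0 andbT; apply/lee_addgt0Pr => e e0; rewrite add0e.
pose N := (Num.truncn e^-1).+1; have N0 : 0 < N%:R :> R by rewrite ltr0n.
have Ne : N%:R^-1 <= e by rewrite invf_ple ?posrE // ltW // truncnS_gt.
pose I (k : 'I_N.+1) : set T := [set x : T | Num.truncn (N%:R * (x : R)) == k].
have mI k : measurable (I k) by exact: (@measurable_truncn R N (fun m => m == k)).
have mhI (h : T -> T) k : measurable_fun setT h -> measurable (h @^-1` I k).
  by move=> mh; rewrite -[X in measurable X]setTI; exact: mh.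
have muI k : (mu (I k) <= (N%:R^-1)%:E)%E.
  rewrite (unif_truncn (fun m => m == k)) // lee_fin ler_pdivrMr // mulVf ?gt_eqF //.
  rewrite -[leRHS]/(1%:R) ler_nat -(cards1 (inord k : 'I_N)).
  apply: subset_leq_card; apply/fintype.subsetP => m; rewrite !inE => /eqP mk.
  by apply/eqP/val_inj; rewrite /= -mk inordK.
pose E (k : 'I_N.+1) : set T := [set w | (h1 @^-1` I k) (p1 w) /\ (h2 @^-1` I k) (p2 w)].
have mE k : measurable (E k) by apply: measurable_p12; exact: mhI.
have b k : exists y, [/\ 0 <= y, mu (h2 @^-1` I k) = y%:E & (mu (E k) <= (N%:R^-1 * y)%:E)%E].
  have fin (h : T -> T) : measurable_fun setT h -> mu (h @^-1` I k) \is a fin_num.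
    by move=> mh; rewrite fin_num_measure //; exact: mhI.
  exists (fine (mu (h2 @^-1` I k))); split; first by rewrite fine_ge0 // measure_ge0.
    by rewrite fineK // fin.
  rewrite (@unif_p12 R _ _ (fine (mu (h1 @^-1` I k))) (fine (mu (h2 @^-1` I k)))) ?fineK ?fin //; try exact: mhI.
  rewrite lee_fin ler_wpM2r ?fine_ge0 ?measure_ge0 //.
  by have := muI k; rewrite -(h1mu _ (mI k)) -[X in (X <= _)%E -> _]fineK ?fin // lee_fin.
have /choice[y hy] := b.
apply: (@le_trans _ _ (mu [set w | exists2 k, xpredT k & E k w])).
  apply: le_measure; rewrite ?inE //.
    rewrite (_ : [set w | _] = \bigcup_(k in setT) E k).
      by apply: fin_bigcup_measurable => //; exact: finite_finset.
    by rewrite predeqE => w; split=> [[k _ ?]|[k _ ?]]; exists k.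
  move=> w /= hw; have /andP[g0 g1] := h101 (p1 w).
  have lt : (Num.truncn (N%:R * (h1 (p1 w) : R)) < N.+1)%N.
    rewrite truncn_lt_nat ?mulr_ge0 ?(ltW N0) //; apply: (@le_lt_trans _ _ N%:R); last by rewrite ltr_nat.
    by rewrite ger_pMr.
  by exists (Ordinal lt) => //; split; rewrite /= /I /= -?hw.
rewrite (measure_disjoint_fin [the {measure set T -> \bar R} of mu]) //; last first.
  by move=> k k' w [/eqP h _] [/eqP h' _]; apply: val_inj; rewrite /= -h -h'.
apply: (@le_trans _ _ (\sum_(k < N.+1) (N%:R^-1 * y k)%:E)%E).
  by apply: lee_sum => k _; case: (hy k).
rewrite sumEFin -mulr_sumr lee_fin; apply: le_trans Ne; rewrite ger_pMr ?invr_gt0 //.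
rewrite -lee_fin -sumEFin (eq_bigr (fun k => mu (h2 @^-1` I k))); last by move=> k _; case: (hy k).
rewrite -(measure_disjoint_fin [the {measure set T -> \bar R} of mu] xpredT).
- apply: (@probability_le1 _ _ _ [the probability T R of mu]).
  rewrite (_ : [set w | _] = \bigcup_(k in setT) (h2 @^-1` I k)).
    by apply: fin_bigcup_measurable => [|k _]; [exact: finite_finset|exact: mhI].
  by rewrite predeqE => w; split=> [[k _ ?]|[k _ ?]]; exists k.
- by move=> k; exact: mhI.
- by move=> k k' w /eqP h /eqP h'; apply: val_inj; rewrite /= -h -h'.
Qed.
End Process.

Section Process.
Context {R : realType}.
Local Notation T := (measurableTypeR R).
Local Notation mu := (@unif R).
Local Notation p1 := (@splitting R 2 : T -> T).
Local Notation p2 := (@splitting R 1 : T -> T).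
Variables (lam : R) (L : nat -> R) (PSI : nat -> T -> R * R) (o : nat -> R).
Hypothesis L_ge0 : forall c, 0 <= L c.
Hypothesis L_le : forall c, L c <= lam.
Hypothesis mPSI : forall c, measurable_fun setT (PSI c).
(** The first coordinate is uniform up to an offset, which already separates distinct points almost
    surely. *)
Hypothesis PSI1 : forall c v, (PSI c v).1 = o c + (p1 v : R).
Hypothesis L_inf : forall K : R, exists M, K <= \sum_(c < M) L c.

Definition cell_seed c (w : T) : T := p1 (iter c p2 w).
Definition num c (w : T) : nat := pnum (L c) (p1 (cell_seed c w)).
Definition pt c i (w : T) : R * R := PSI c (p1 (iter i p2 (p2 (cell_seed c w)))).

Lemma totalE M B w : total L PSI M B w = (\sum_(c < M) \sum_(i < num c w) `[< B (pt c i w) >])%N.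
Proof. by []. Qed.

Lemma measurable_seed c : measurable_fun setT (cell_seed c).
Proof. exact: (measurableT_comp (measurable_splitting 2) (measurable_iter 1 c)). Qed.

Lemma measurable_num c n : measurable [set w : T | num c w = n].
Proof.
have mf := measurableT_comp (measurable_splitting 2) (measurable_seed c).
by have := mf measurableT _ (measurable_pnum (L_ge0 c) n); rewrite setTI.
Qed.

Lemma measurable_num_pred c (q : pred nat) : measurable [set w : T | q (num c w)].
Proof.
rewrite (_ : [set w | _] = \bigcup_(n in [set n | q n]) [set w : T | num c w = n]).
  by apply: bigcup_measurable => n _; exact: measurable_num.
by rewrite predeqE => w; split=> [h|[n qn /= ->]//]; exists (num c w).
Qed.

Lemma measurable_pt c i : measurable_fun setT (pt c i).
Proof.
have m1 := measurableT_comp (measurable_splitting 1) (measurable_seed c).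
have m2 := measurableT_comp (measurable_iter 1 i) m1.
have m3 := measurableT_comp (measurable_splitting 2) m2.
exact: (measurableT_comp (mPSI c) m3).
Qed.

Definition present (w : T) (j : nat) : bool :=
  if (pickle_inv j : option (nat * nat)) is Some x then (x.2 < num x.1 w)%N else false.

Definition ptj (w : T) (j : nat) : R * R :=
  if (pickle_inv j : option (nat * nat)) is Some x then pt x.1 x.2 w else (0, 0).

Lemma measurable_present j : measurable [set w : T | present w j].
Proof.
rewrite /present; case: (pickle_inv j) => [x|]; last first.
  by rewrite (_ : [set w | _] = set0) // predeqE.
exact: (measurable_num_pred x.1 (fun n => (x.2 < n)%N)).
Qed.

Lemma measurable_ptj j (A : set (R * R)) : measurable A -> measurable [set w : T | A (ptj w j)].
Proof.
move=> mA; rewrite /ptj; case: (pickle_inv j) => [x|].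
  by have := measurable_pt x.1 x.2 measurableT mA; rewrite setTI.
case: (pselect (A (0, 0))) => a.
  by rewrite (_ : [set w | _] = setT) // predeqE.
by rewrite (_ : [set w | _] = set0) // predeqE.
Qed.

Lemma measurable_rank j n : measurable [set w : T | rank_of (present w) j = n].
Proof.
elim: j n => [|j IH] n.
  rewrite /rank_of /=; case: n => [|n]; last by rewrite (_ : [set w | _] = set0) // predeqE.
  by rewrite (_ : [set w | _] = setT) // predeqE.
rewrite (_ : [set w | _] = ([set w : T | present w j] `&` [set w : T | (rank_of (present w) j).+1 = n]) `|`
   (~` [set w : T | present w j] `&` [set w : T | rank_of (present w) j = n])).
  have m1 := measurable_present j.
  have m2 : measurable [set w : T | (rank_of (present w) j).+1 = n].
    case: n => [|n]; first by rewrite (_ : [set w | _] = set0) // predeqE.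
    rewrite (_ : [set w | _] = [set w : T | rank_of (present w) j = n]) //.
    by rewrite predeqE => w; split=> [[]|/= ->].
  by apply: measurableU; apply: measurableI => //; exact: measurableC.
rewrite predeqE => w /=; rewrite rank_ofS; case: (present w j) => /=.
  by rewrite addn1; split=> [h|[[]//|[]//]]; left.
by rewrite addn0; split=> [h|[[]//|[]//]]; right.
Qed.

(** A realization enumerates its points by all naturals, so there must be infinitely many;
    infinitely many nonempty cells guarantee this. *)
Definition generic_inf (w : T) : Prop := forall n, exists2 c, (n <= c)%N & (0 < num c w)%N.
Definition generic_sep (w : T) : Prop :=
  forall a b : nat * nat, a != b -> (pt a.1 a.2 w).1 != (pt b.1 b.2 w).1.
Definition generic : set T := [set w | generic_inf w /\ generic_sep w].

(** Injectivity is demanded for every [w], not for almost every one, so an arbitrary injective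
    sequence is substituted on the exceptional null set. *)
Definition points (w : T) (n : nat) : R * R :=
  if `[< generic w >] then ptj w (enum_of (present w) n) else (n%:R, 0).

Lemma present_inf w : generic_inf w -> forall n, exists2 j, (n <= j)%N & present w j.
Proof.
move=> gi n; pose bad := [seq x.1 | x <- pmap (fun j => pickle_inv j : option (nat * nat)) (iota 0 n)].
have [c cb c0] := gi (\max_(x <- bad) x).+1.
exists (pickle (c, 0)%N); last by rewrite /present pickleK_inv.
rewrite leqNgt; apply/negP => h.
have : (c, 0)%N \in pmap (fun j => pickle_inv j : option (nat * nat)) (iota 0 n).
  by rewrite mem_pmap; apply/mapP; exists (pickle (c, 0)%N); rewrite ?mem_iota ?pickleK_inv.
move=> /(map_f fst) /= cbad; have : (c <= \max_(x <- bad) x)%N by exact: (@leq_bigmax_seq _ _ xpredT (fun x => x)).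
by move=> /(leq_trans cb); rewrite ltnn.
Qed.

Lemma ptj_pickle w x : ptj w (pickle x) = pt x.1 x.2 w.
Proof. by rewrite /ptj pickleK_inv. Qed.

Lemma present_pickle w j : present w j -> exists2 x : nat * nat, pickle x = j & (x.2 < num x.1 w)%N.
Proof.
rewrite /present; have := pickle_invK (T := (nat * nat)%type) j.
by case: (pickle_inv j) => // x /= <- h; exists x.
Qed.

Lemma points_pairs w : generic w -> exists Q : nat -> nat * nat,
  [/\ (forall n, ((Q n).2 < num (Q n).1 w)%N /\ points w n = pt (Q n).1 (Q n).2 w),
      (forall n, rank_of (present w) (pickle (Q n)) = n) &
      (forall x, (x.2 < num x.1 w)%N -> Q (rank_of (present w) (pickle x)) = x)].
Proof.
move=> gw; have [gi _] := gw; have pinf := present_inf gi.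
have q n : exists x : nat * nat, [/\ pickle x = enum_of (present w) n,
    (x.2 < num x.1 w)%N & points w n = pt x.1 x.2 w].
  have [/present_pickle[x xE xn] _] := enum_ofP pinf n; exists x; split=> //.
  by rewrite /points asboolT // -xE ptj_pickle.
have /choice[Q hQ] := q; exists Q; split.
- by move=> n; have [_ ? ?] := hQ n.
- by move=> n; have [-> _ _] := hQ n; have [] := enum_ofP pinf n.
- move=> x xn; have px : present w (pickle x) by rewrite /present pickleK_inv.
  have [h _ _] := hQ (rank_of (present w) (pickle x)).
  by apply: (pcan_inj (@pickleK (nat * nat)%type)); rewrite h enum_of_rank.
Qed.

Lemma count_points w B c : generic w ->
  count_is points B c w <-> exists M0, forall M, (M0 <= M)%N -> total L PSI M B w = c.
Proof.
move=> gw; have [Q [hQ Qr Qs]] := points_pairs gw.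
pose b c i := `[< B (pt c i w) >].
have szE M : size (pairs (num^~ w) b M) = total L PSI M B w by rewrite size_pairs totalE.
have Qinj : injective Q by move=> n n' e; rewrite -(Qr n) -(Qr n') e.
split.
  move=> [s [us ss hs]]; pose ps := map Q s.
  exists (\max_(x <- ps) x.1).+1 => M hM; rewrite -szE -ss -(size_map Q s).
  apply: perm_size; apply: uniq_perm; rewrite ?uniq_pairs ?map_inj_uniq //.
  move=> x; rewrite mem_pairs; apply/and3P/mapP.
    move=> [xM xn /asboolP bx]; exists (rank_of (present w) (pickle x)); last by rewrite Qs.
    by apply/hs; have [_ ->] := hQ (rank_of (present w) (pickle x)); rewrite Qs.
  move=> [n ns ->]; have [h1 h2] := hQ n; split=> //.
    apply: leq_trans hM; rewrite ltnS.
    exact: (@leq_bigmax_seq _ _ xpredT (fun x : nat * nat => x.1) _ (map_f Q ns) isT).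
  by apply/asboolP; rewrite -h2; apply/hs.
move=> [M0 h].
have hst := @pairs_stable (num^~ w) b M0 c (fun M hM => etrans (szE M) (h M hM)).
exists [seq rank_of (present w) (pickle x) | x <- pairs (num^~ w) b M0]; split.
- rewrite map_inj_in_uniq ?uniq_pairs // => x y; rewrite !mem_pairs => /and3P[_ xn _] /and3P[_ yn _] e.
  by rewrite -(Qs x xn) -(Qs y yn) e.
- by rewrite size_map szE h.
- move=> n; have [h1 h2] := hQ n; split.
    move=> Bn; apply/mapP; exists (Q n); last by rewrite Qr.
    by apply: hst => //; apply/asboolP; rewrite -h2.
  move=> /mapP[x]; rewrite mem_pairs => /and3P[_ xn /asboolP bx] ->.
  by have [_ ->] := hQ (rank_of (present w) (pickle x)); rewrite Qs.
Qed.

Lemma points_inj w : injective (points w).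
Proof.
case: (pselect (generic w)) => gw n n'; last first.
  by rewrite /points asboolF // => -[] /eqP; rewrite eqr_nat => /eqP.
have [Q [hQ Qr _]] := points_pairs gw; have [_ gs] := gw.
have [[_ ->] [_ ->]] := (hQ n, hQ n') => e.
rewrite -(Qr n) -(Qr n'); congr (rank_of _ (pickle _)).
by apply/eqP/negPn/negP => /gs; rewrite e eqxx.
Qed.

Definition preserving (h : T -> T) : Prop :=
  measurable_fun setT h /\ forall A, measurable A -> mu (h @^-1` A) = mu A.

Lemma preserving_comp h h' : preserving h -> preserving h' -> preserving (h \o h').
Proof.
move=> [mh ph] [mh' ph']; split; first exact: (measurableT_comp mh mh').
move=> A mA; rewrite comp_preimage ph' ?ph //.
by rewrite -[X in measurable X]setTI; exact: mh.
Qed.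

Lemma preserving_p1 : preserving p1.
Proof. by split; [exact: measurable_splitting|exact: unif_p1]. Qed.

Lemma preserving_p2 : preserving p2.
Proof. by split; [exact: measurable_splitting|exact: unif_p2]. Qed.

Lemma preserving_iter n : preserving (iter n p2).
Proof. by split; [exact: measurable_iter|exact: unif_iter]. Qed.

Definition collide (a b : nat * nat) : set T := [set w | (pt a.1 a.2 w).1 = (pt b.1 b.2 w).1].

Lemma measurable_collide a b : measurable (collide a b).
Proof.
have m1 := measurableT_comp measurable_fst (measurable_pt a.1 a.2).
have m2 := measurableT_comp measurable_fst (measurable_pt b.1 b.2).
have := (@measurable_funB _ _ R _ _ _ m1 m2) measurableT [set (0 : R)] (measurable_set1 _).
rewrite setTI; congr (measurable _).
by rewrite predeqE => w; rewrite /collide /=; split=> [/eqP|->]; [rewrite subr_eq0 => /eqP|rewrite subrr].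
Qed.

Lemma diag_preim (g h1 h2 : T -> T) : preserving g -> preserving h1 -> measurable_fun setT h2 ->
  (forall w, 0 <= (h1 w : R) <= 1) ->
  mu [set w : T | h1 (p1 (g w)) = h2 (p2 (g w))] = 0%E.
Proof.
move=> [mg pg] [m1 ph1] m2 h01; have [mD D0] := unif_diag m1 m2 ph1 h01.
by have := pg _ mD; rewrite D0.
Qed.

(** The two points are functions of independent halves of one intermediate seed: for different cells
    that of the earlier cell onwards, for a single cell that of the earlier point onwards. This seed
    is again uniform, so [unif_diag] applies to it. *)
Lemma collide_null_lt a b : ((a.1 < b.1) || ((a.1 == b.1) && (a.2 < b.2)))%N -> mu (collide a b) = 0%E.
Proof.
case: a b => c i [c' i'] /= /orP[lt|/andP[/eqP<- lt]].
  pose h1 : T -> T := p1 \o (p1 \o (iter i p2 \o p2)).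
  pose k : T -> T := p1 \o (p1 \o (iter i' p2 \o (p2 \o (p1 \o iter (c' - c.+1) p2)))).
  pose h2 : T -> T := fun v => (k v : R) + (o c' - o c).
  have ph1 : preserving h1.
    apply: preserving_comp preserving_p1 _; apply: preserving_comp preserving_p1 _.
    exact: preserving_comp (preserving_iter i) preserving_p2.
  have mk : measurable_fun setT k.
    have [] // : preserving k.
    do 2 (apply: preserving_comp preserving_p1 _); apply: preserving_comp (preserving_iter i') _.
    apply: preserving_comp preserving_p2 _; exact: preserving_comp preserving_p1 (preserving_iter _).
  have m2 : measurable_fun setT h2 by apply: (@measurable_funD _ _ R) => //; exact: measurable_cst.
  rewrite -[RHS](diag_preim (preserving_iter c) ph1 m2 (fun w => splitting01 _ _)); congr (mu _).
  rewrite predeqE => w; rewrite /collide /= !PSI1 /h2 /h1 /k /= /cell_seed.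
  have -> : iter c' p2 w = iter (c' - c.+1) p2 (p2 (iter c p2 w)).
    by rewrite -[p2 (iter c p2 w)]/(iter c.+1 p2 w) -iterD subnK.
  set x := splitting 2 _; set y := splitting 2 _; split=> h.
    by change (x = y + (o c' - o c)); lra.
  by have : x = y + (o c' - o c) := h; lra.
pose k : T -> T := p1 \o (p1 \o iter (i' - i.+1) p2).
have pk : preserving k.
  by do 2 (apply: preserving_comp preserving_p1 _); exact: preserving_iter.
pose g : T -> T := iter i p2 \o (p2 \o (p1 \o iter c p2)).
have pg : preserving g.
  apply: preserving_comp (preserving_iter i) _; apply: preserving_comp preserving_p2 _.
  exact: preserving_comp preserving_p1 (preserving_iter _).
rewrite -[RHS](diag_preim pg preserving_p1 pk.1 (fun w => splitting01 _ _)); congr (mu _).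
rewrite predeqE => w; rewrite /collide /= !PSI1 /k /g /= /cell_seed.
set u := p2 (p1 (iter c p2 w)).
have -> : iter i' p2 u = iter (i' - i.+1) p2 (p2 (iter i p2 u)).
  by rewrite -[p2 (iter i p2 u)]/(iter i.+1 p2 u) -iterD subnK.
by split=> [/addrI|->].
Qed.

Lemma collide_null a b : a != b -> mu (collide a b) = 0%E.
Proof.
move=> ab.
have [h|h] := boolP ((a.1 < b.1) || ((a.1 == b.1) && (a.2 < b.2)))%N; first exact: collide_null_lt.
rewrite (_ : collide a b = collide b a); last by rewrite predeqE => w; split=> /esym.
apply: collide_null_lt; case: a b ab h => [c i] [c' i'] /=; rewrite xpair_eqE /=.
by clear; lia.
Qed.

Lemma generic_null : measurable generic /\ mu (~` generic) = 0%E.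
Proof.
pose F (k k' : nat) : set T := if pickle_inv k is Some a then if pickle_inv k' is Some b then
  if a != b then collide a b else set0 else set0 else set0.
have F0 k k' : measurable (F k k') /\ mu (F k k') = 0%E.
  rewrite /F; case: (pickle_inv k) => [a|]; last by split; [exact: measurable0|rewrite measure0].
  case: (pickle_inv k') => [b|]; last by split; [exact: measurable0|rewrite measure0].
  have [ab|ab] := eqVneq a b; first by split; [exact: measurable0|rewrite measure0].
  by split; [exact: measurable_collide|exact: collide_null].
pose G (n : nat) : set T := \bigcap_(c in [set c | n <= c]%N) [set w : T | num c w = 0%N].
have mG n : measurable (G n).
  by apply: bigcap_measurable => [|c _]; [exists n => /=|exact: measurable_num].
have badE : ~` generic = (\bigcup_k \bigcup_k' F k k') `|` \bigcup_n G n.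
  rewrite predeqE => w; split.
    move=> ng; apply: contrapT => h; apply: ng; split.
      move=> n; apply: contrapT => hn; apply: h; right; exists n => // c /= nc.
      by apply/eqP; rewrite -leqn0 leqNgt; apply/negP => c0; apply: hn; exists c.
    move=> a b ab; apply/negP => /eqP e; apply: h; left.
    by exists (pickle a) => //; exists (pickle b) => //; rewrite /F !pickleK_inv ab.
  move=> [[k _ [k' _ Fk]]|[n _ h]] /= [gi gs].
    move: Fk; rewrite /F; case: (pickle_inv k) => // a; case: (pickle_inv k') => // b.
    by case: ifP => // ab /eqP; apply/negP; exact: gs.
  by have [c nc] := gi n; rewrite (h c nc).
have G0 n : mu (G n) = 0%E.
  apply/eqP; rewrite eq_le measure_ge0 andbT; apply/lee_addgt0Pr => e e0; rewrite add0e.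
  (* The first [n] cells account for at most [n * lam], so the next ones have total intensity at
     least the inverse of [e] and are all empty with probability at most [e]. *)
  have [M hM] := L_inf (n%:R * lam + e^-1).
  pose L' c := L (n + c)%N; pose PSI' c := PSI (n + c)%N.
  have [mE muE] := @total_law R 1 (fun=> setT) M L' PSI' (fun=> 0%N) (fun=> measurableT)
     (fun i j _ _ _ => etrans (ord1 i) (esym (ord1 j))) (fun c => L_ge0 _) (fun c => mPSI _).
  apply: (@le_trans _ _ (mu (iter n p2 @^-1` [set w : T | forall i : 'I_1, total L' PSI' M setT w = 0%N]))).
    apply: le_measure; rewrite ?inE //.
      by rewrite -[X in measurable X]setTI; apply: measurable_iter.
    move=> w hw i; rewrite /total big1 // => c _; rewrite /cell_count /nb.
    rewrite -iterD addnC; have := hw (n + c)%N (leq_addr _ _); rewrite /= /num /cell_seed => ->.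
    by rewrite big_ord0.
  rewrite unif_iter // muE big_ord1 lee_fin /poisson_mass expr0 fact0 divr1 mul1r.
  set x := \sum_(_ < M) _.
  have lawT c : law (PSI' c) setT = 1 by rewrite /law preimage_setT unif_setT.
  have xE : x = \sum_(c < M) L (n + c)%N by apply: eq_bigr => c _; rewrite lawT mulr1.
  have xge : e^-1 <= x.
    have s1 : \sum_(c < M) L c <= \sum_(c < n + M) L c.
      rewrite -!(big_mkord xpredT L) [leRHS](@big_cat_nat _ _ _ M) ?leq_addl //= lerDl.
      by apply: sumr_ge0 => c _.
    have s2 : \sum_(c < n + M) L c = \sum_(c < n) L c + x by rewrite big_split_ord /= xE.
    have s3 : \sum_(c < n) L c <= n%:R * lam.
      apply: (@le_trans _ _ (\sum_(c < n) lam)); first exact: ler_sum.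
      by rewrite sumr_const card_ord -[leLHS]mulr_natl.
    move: hM s1 s2 s3; move: (\sum_(c < M) _) (\sum_(c < n + M) _) (\sum_(c < n) _) (n%:R * lam) (e^-1).
    by clear => *; lra.
  have ei0 : 0 < e^-1 by rewrite invr_gt0.
  rewrite expRN invf_ple ?posrE ?expR_gt0 //; apply: le_trans (expR_ge1Dx x).
  by apply: le_trans xge _; rewrite lerDr.
have mB : measurable (~` generic).
  rewrite badE; apply: measurableU; last exact: bigcupT_measurable.
  by apply: bigcupT_measurable => k; apply: bigcupT_measurable => k'; case: (F0 k k').
split; first by rewrite -[generic]setCK; exact: measurableC.
pose m := [the {measure set T -> \bar R} of mu].
have neg A : measurable A -> mu A = 0%E -> m.-negligible A by move=> mA A0; exists A; split.
suff [N [mN N0 subN]] : m.-negligible (~` generic).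
  apply/eqP; rewrite eq_le measure_ge0 andbT -[X in (_ <= X)%E]N0.
  by apply: le_measure; rewrite ?inE.
rewrite badE; apply: negligibleU.
  apply: negligible_bigcup => k; apply: negligible_bigcup => k'.
  by have [? ?] := F0 k k'; exact: neg.
by apply: negligible_bigcup => n; exact: neg.
Qed.

Lemma measurable_points n : measurable_fun setT (fun w => points w n).
Proof.
move=> _ A mA; rewrite setTI.
have [mg _] := generic_null.
rewrite (_ : _ @^-1` A = (generic `&` \bigcup_j ([set w : T | present w j] `&`
    ([set w : T | rank_of (present w) j = n] `&` [set w : T | A (ptj w j)]))) `|`
    (~` generic `&` [set w : T | A (n%:R, 0)])).
  apply: measurableU; apply: measurableI => //.
  - apply: bigcupT_measurable => j; apply: measurableI; first exact: measurable_present.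
    by apply: measurableI; [exact: measurable_rank|exact: measurable_ptj].
  - exact: measurableC.
  - case: (pselect (A (n%:R, 0))) => a.
      by rewrite (_ : [set w | _] = setT) // predeqE.
    by rewrite (_ : [set w | _] = set0) // predeqE.
rewrite predeqE => w /=; rewrite /points; case: asboolP => gw; last first.
  by split=> [h|[[]//|[]//]]; right.
have pinf := present_inf gw.1; split.
  move=> h; left; split=> //; exists (enum_of (present w) n) => //.
  by have [h1 h2] := enum_ofP pinf n.
by move=> [[_ [j _ [pj [<- h]]]]|[]//]; rewrite enum_of_rank.
Qed.

Lemma mu_generic A : measurable A -> mu A = mu (A `&` generic).
Proof.
move=> mA; have [mg g0] := generic_null.
rewrite -[in LHS](setIT A) -(setUv generic) setIUr; apply: measureU0.
- exact: measurableI.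
- by apply: measurableI => //; exact: measurableC.
- apply/eqP; rewrite eq_le measure_ge0 andbT -g0.
  by apply: le_measure; rewrite ?inE //; [apply: measurableI => //; exact: measurableC|exact: measurableC].
Qed.

Lemma points_poisson (k : nat) (B : 'I_k -> set (R * R)) (c : 'I_k -> nat) (y : 'I_k -> R) :
  (forall i, measurable (B i)) -> (forall i j x, B i x -> B j x -> i = j) ->
  (forall i, \sum_(n < M) L n * law (PSI n) (B i) @[M --> \oo] --> y i) ->
  let E := [set w : T | forall i, count_is points (B i) (c i) w] in
  measurable E /\ mu E = (\prod_(i < k) poisson_mass (y i) (c i))%:E.
Proof.
move=> mB dB cy E; have [mV muV] := @eventually_total_law R k B L PSI c y mB dB L_ge0 mPSI cy.
set V := eventually_total _ _ _ _ in mV muV.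
have [mg _] := generic_null.
have EV : E `&` generic = V `&` generic.
  rewrite predeqE => w; split=> -[h gw]; split=> //.
    have /choice[m hm] : forall i, exists M0, forall M, (M0 <= M)%N -> total L PSI M (B i) w = c i.
      by move=> i; apply/(count_points (B i) (c i) gw).
    exists (\max_i m i)%N => M hM i; apply: hm; apply: leq_trans hM; exact: leq_bigmax.
  by move=> i; apply/(count_points (B i) (c i) gw); case: h => M0 h; exists M0 => M /h.
have mE : measurable E.
  rewrite -[E]setIT -(setUv generic) setIUr; apply: measurableU; first by rewrite EV; exact: measurableI.
  (* Off [generic] the sequence does not depend on [w], so the event there is everything or
     nothing. *)
  case: (pselect (forall i, count_is (fun (_ : unit) n => (n%:R, 0) : R * R) (B i) (c i) tt)) => h.
    rewrite (_ : _ `&` _ = ~` generic); first exact: measurableC.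
    rewrite predeqE => w; split=> [[]//|gw]; split=> // i; have [s hs] := h i; exists s.
    by rewrite /points asboolF.
  rewrite (_ : _ `&` _ = set0) // predeqE => w; split=> // -[Ew gw]; apply: h => i.
  by have [s] := Ew i; rewrite /points asboolF // => hs; exists s.
by split=> //; rewrite mu_generic // EV -mu_generic.
Qed.
End Process.

(** * Existence of a realization *)

Section Realization.
Context {R : realType}.
Local Notation T := (measurableTypeR R).
Local Notation mu := (@unif R).
Local Notation p1 := (@splitting R 2 : T -> T).
Local Notation p2 := (@splitting R 1 : T -> T).

Lemma unif_shift (a : R) (A : set T) : measurable A ->
  mu [set v : T | A (a + (v : R))] = lebesgue_measure (A `&` `[a, a + 1[).
Proof.
move=> mA; pose h : T -> T := fun v => a + (v : R).
have mh : measurable_fun setT h by apply: (@measurable_funD _ _ R) => //; exact: measurable_cst.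
pose m : {measure set T -> \bar R} := mrestr lebesgue_measure (measurable_itv `[a, a + 1[).
have := @eq_pushforward_rays R _ T [the probability T R of mu] h setT m mh measurableT _ A mA.
rewrite setIT; apply => t; rewrite setIT.
transitivity (mu `](t - a), +oo[%classic); last by rewrite unif_gt -lebesgue_ray.
by congr (mu _); rewrite predeqE => v; rewrite /h /= !in_itv /= !andbT ltrBlDl.
Qed.

Definition square (a b : R) : set (T * T) := `[a, a + 1[%classic `*` `[b, b + 1[%classic.

Lemma measurable_square a b : measurable (square a b).
Proof. by apply: measurableX; exact: measurable_itv. Qed.

Definition square_pt (a b : R) (v : T) : T * T := (a + (p1 v : R), b + (p2 v : R)).

Lemma measurable_square_pt a b : measurable_fun setT (square_pt a b).
Proof.
have ms k (x : R) : measurable_fun setT (fun v : T => x + ((splitting k : T -> T) v : R) : T).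
  by apply: (@measurable_funD _ _ R); [exact: measurable_cst|exact: measurable_splitting].
by apply: (@measurable_fun_pair _ _ _ T T T); exact: ms.
Qed.

Lemma square_rect a b (A C : set T) : measurable A -> measurable C ->
  mu (square_pt a b @^-1` (A `*` C)) =
  (lebesgue_measure (A `&` `[a, (a + 1)%R[) * lebesgue_measure (C `&` `[b, (b + 1)%R[))%E.
Proof.
have msh (x : R) (D : set T) : measurable D -> measurable [set v : T | D (x + (v : R))].
  move=> mD; have mh : measurable_fun setT (fun v : T => x + (v : R) : T).
    by apply: (@measurable_funD _ _ R) => //; exact: measurable_cst.
  by have := mh measurableT D mD; rewrite setTI.
move=> mA mC; rewrite -!unif_shift //.
by rewrite -splitting_indep; [|exact: msh|exact: msh].
Qed.

Lemma square_law a b (B : set (T * T)) : measurable B ->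
  mu (square_pt a b @^-1` B) = area (B `&` square a b).
Proof.
move=> mB.
pose C : set (set (T * T)) := [set C | exists A, measurable A /\ exists B, measurable B /\ C = A `*` B].
pose M1 := measure_function_pushforward__canonical__measure_function_Measure
  [the {measure set T -> \bar R} of mu] (measurable_square_pt a b).
pose M2 : {measure set (T * T) -> \bar R} :=
  mrestr ((@lebesgue_measure R) \x (@lebesgue_measure R))%E (measurable_square a b).
apply: (@measure_unique _ R (T * T)%type C (fun=> setT) _ _ _ _ M1 M2) => //.
- rewrite measurable_prod_measurableType //; congr (<<s _ >>).
  rewrite predeqE; split => [[A mA [D mD <-]]|[A [mA [D [mD ->]]]]].
    by exists A; split => //; exists D.
  by exists A => //; exists D.
- move=> /= _ _ [X1 [mX1 [X2 [mX2 ->]]]] [Y1 [mY1 [Y2 [mY2 ->]]]].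
  rewrite -setXI; exists (X1 `&` Y1); split; first exact: measurableI.
  by exists (X2 `&` Y2); split => //; exact: measurableI.
- by move=> _; exists setT; split=> //; exists setT; split=> //; rewrite setXTT.
- by rewrite bigcup_const.
- move=> _ [A [mA [D [mD ->]]]]; apply: etrans (square_rect a b mA mD) _.
  rewrite /M2 /= /mrestr /square -setXI product_measure1E //; exact: measurableI.
- move=> _; apply: (@le_lt_trans _ _ 1%E); last by rewrite ltry.
  by apply: (@probability_le1 _ _ _ [the probability T R of mu]); rewrite preimage_setT.
Qed.

Variable lam : R.
Hypothesis lam_gt0 : 0 < lam.

(** Unit squares with integer corners are numbered by [pickle]; numbers that code no square receive
    intensity 0. *)
Definition cells (n : nat) : option (int * int) := pickle_inv n.
Definition intensity (n : nat) : R := if cells n is Some _ then lam else 0.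
Definition offset (n : nat) : R * R := if cells n is Some x then (x.1%:~R, x.2%:~R) else (0, 0).
Definition cell_map (n : nat) (v : T) : R * R := square_pt (offset n).1 (offset n).2 v.
Definition cell_square (n : nat) : set (T * T) :=
  if cells n is Some x then square x.1%:~R x.2%:~R else set0.

Lemma intensity_ge0 n : 0 <= intensity n.
Proof. by rewrite /intensity; case: (cells n) => [_|//]; exact: ltW. Qed.

Lemma intensity_le n : intensity n <= lam.
Proof. by rewrite /intensity; case: (cells n) => [_|]; [exact: lexx|exact: ltW]. Qed.

Lemma floor_square (x : R * R) (c : int * int) :
  square c.1%:~R c.2%:~R x <-> c = (Num.floor x.1, Num.floor x.2).
Proof.
rewrite /square /= !in_itv /= -!(intrD1 _ : _ = _ :> R).
split; last by move=> ->; split=> /=; exact: floor_itv.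
by case: c => a b /= [/floor_def-> /floor_def->].
Qed.

(** The unit squares partition the plane, so this is the countable additivity of the area. *)
Lemma cvg_intensity (B : set (R * R)) : measurable B -> (area B < +oo)%E ->
  \sum_(n < M) intensity n * law (cell_map n) B @[M --> \oo] --> lam * fine (area B).
Proof.
move=> mB fB.
pose m : {measure set (T * T) -> \bar R} := ((@lebesgue_measure R) \x (@lebesgue_measure R))%E.
have mB' : measurable (B : set (T * T)) := mB.
pose F n : set (T * T) := B `&` cell_square n.
have mF n : measurable (F n).
  apply: measurableI => //; rewrite /cell_square; case: (cells n) => // x; exact: measurable_square.
have FU : \bigcup_n F n = B.
  rewrite predeqE => x; split=> [[n _ []]//|Bx].
  have := pickleK_inv (Num.floor x.1, Num.floor x.2); move: (pickle _) => n nE.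
  by exists n; [exact: I|split; [exact: Bx|rewrite /cell_square /cells nE; apply/floor_square]].
have tF : trivIset setT F.
  apply/trivIsetP => i j _ _ ij; rewrite predeqE => x; split=> // -[[_ +] [_ +]].
  rewrite /cell_square /cells.
  have := pickle_invK (T := (int * int)%type) i; have := pickle_invK (T := (int * int)%type) j.
  case: (pickle_inv i) => // a; case: (pickle_inv j) => // b /= jE iE.
  move=> /floor_square aE /floor_square bE; move/eqP: ij; apply.
  by rewrite -iE -jE aE bE.
have := @measure_semi_sigma_additive _ _ _ m F mF tF _; rewrite FU => /(_ mB') cv.
have fin n : m (F n) = (fine (m (F n)))%:E.
  rewrite fineK // ge0_fin_numE //; apply: le_lt_trans fB.
  by apply: le_measure; rewrite ?inE //; apply: subIsetl.
have fBE : m B = (fine (area B))%:E by rewrite fineK // ge0_fin_numE // measure_ge0.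
rewrite fBE in cv; move/fine_cvg: cv => cv.
have termE n : intensity n * law (cell_map n) B = lam * fine (m (F n)).
  rewrite /intensity /law /F /cell_map /offset /cell_square; case: (cells n) => [x|].
    by congr (_ * fine _); apply: square_law.
  by rewrite mul0r setI0 measure0 mulr0.
apply: (@cvg_trans _ (nbhs (lam * (fine \o (fun n => \sum_(0 <= i < n) m (F i))%E) n @[n --> \oo]))).
  apply: near_eq_cvg; apply: nearW => n /=; rewrite big_mkord.
  rewrite (eq_bigr (fun i : 'I_n => (fine (m (F i)))%:E)); last by move=> i _; exact: fin.
  by rewrite sumEFin /= mulr_sumr; apply: eq_bigr => i _; rewrite termE.
exact: cvgMr.
Qed.

Lemma intensity_inf (K : R) : exists M, K <= \sum_(c < M) intensity c.
Proof.
pose t := 1 + `|K| / lam; have t1 : 1 <= t by rewrite lerDl divr_ge0 // ltW.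
have t0 : 0 < t by apply: lt_le_trans t1.
pose B : set (R * R) := `[0, t[%classic `*` `[0, t[%classic.
have mB : measurable B by apply: measurableX; exact: measurable_itv.
have aB : area B = (t * t)%:E.
  rewrite /area product_measure1E; [|exact: measurable_itv|exact: measurable_itv].
  have e : lebesgue_measure (`[0, t[%classic : set T) = t%:E.
    by rewrite lebesgue_measure_itv /= lte_fin t0 -EFinB subr0.
  by rewrite EFinM; congr (_ * _)%E; exact: e.
have aoo : (area B < +oo)%E by rewrite aB ltry.
have := cvg_intensity mB aoo; rewrite aB /= => cv.
have Kt : K < lam * (t * t).
  have h1 : K <= `|K| := ler_norm K.
  have h2 : lam * t = lam + `|K| by rewrite /t; field; rewrite gt_eqF.
  have h3 : lam * t <= lam * (t * t) by rewrite ler_pM2l // ler_peMr // ltW.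
  by apply: lt_le_trans h3; rewrite h2; apply: le_lt_trans h1 _; rewrite ltrDr.
have /cvgrPdist_lt/(_ _ (_ : 0 < lam * (t * t) - K))[|M _ hM] := cv; first by rewrite subr_gt0.
exists M; have := hM M (leqnn _) => /ltr_normlP[_ h].
have : \sum_(n < M) intensity n * law (cell_map n) B <= \sum_(n < M) intensity n.
  apply: ler_sum => n _; rewrite -[leRHS]mulr1 ler_wpM2l //; first exact: intensity_ge0.
  rewrite /law -lee_fin fineK; first by apply: (@probability_le1 _ _ _ [the probability T R of mu]);
    exact: (measurable_Psi (measurable_square_pt _ _)).
  by rewrite fin_num_measure //; exact: (measurable_Psi (measurable_square_pt _ _)).
by move: h; lra.
Qed.

Lemma unif_le (x : R) : 0 <= x <= 1 -> mu [set w : T | (w : R) <= x] = x%:E.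
Proof.
move=> /andP[x0 x1]; have m1 : measurable (`]x, +oo[%classic : set T) by exact: measurable_itv.
rewrite (_ : [set w : T | _] = ~` `]x, +oo[%classic); last first.
  by rewrite predeqE => w; rewrite /= in_itv /= andbT; split=> h; [apply/negP; rewrite -leNgt|move/negP: h; rewrite -leNgt].
have -> : mu (~` `]x, +oo[%classic) = (1 - mu `]x, +oo[%classic)%E.
  exact: (@probability_setC _ _ _ [the probability T R of mu]).
by rewrite unif_gt -EFinB max_r ?min_r ?subr_ge0 ?gerBl // opprB addrC subrK.
Qed.

Lemma measurable_le (x : R) : measurable [set w : T | (w : R) <= x].
Proof.
rewrite (_ : [set w : T | _] = `]-oo, x]%classic); first exact: measurable_itv.
by rewrite predeqE => w; rewrite /= in_itv.
Qed.

Lemma unif_iid n (x : nat -> R) : (forall j, 0 <= x j <= 1) ->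
  let E := [set w : T | forall j, (j < n)%N -> (p1 (iter j p2 w) : R) <= x j] in
  measurable E /\ mu E = (\prod_(j < n) x j)%:E.
Proof.
elim: n x => [|n IH] x x01 E.
  rewrite (_ : E = setT); last by rewrite predeqE.
  by split; [exact: measurableT|rewrite unif_setT big_ord0].
have [m1 h1] := IH (fun j => x j.+1) (fun j => x01 j.+1).
have -> : E = [set w : T | [set w : T | (w : R) <= x 0%N] (p1 w) /\
   [set w : T | forall j, (j < n)%N -> (p1 (iter j p2 w) : R) <= x j.+1] (p2 w)].
  rewrite predeqE => w; split.
    by move=> h; split=> [|j jn /=]; [exact: (h 0%N)|rewrite -iterSr; exact: (h j.+1)].
  by move=> [/= h0 h] [|j] // jn; rewrite iterSr; exact: h.
split; first by apply: measurable_p12 => //; exact: measurable_le.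
rewrite big_ord_recl; apply: unif_p12 => //; [exact: measurable_le|exact: unif_le].
Qed.

Lemma uniq_fst_inj (I J : eqType) (E : seq (I * J)) e e' : uniq (map fst E) ->
  e \in E -> e' \in E -> e.1 = e'.1 -> e = e'.
Proof.
elim: E => // a E IH /= /andP[na u]; rewrite !inE => /orP[/eqP->|eE] /orP[/eqP->|eE'] // h.
- by move: na; rewrite h map_f.
- by move: na; rewrite -h map_f.
- exact: IH.
Qed.

Lemma unif_iid_seq (E : seq (nat * nat * R)) : uniq (map fst E) ->
  (forall e, e \in E -> 0 <= e.2 <= 1) ->
  let F := [set w : T | forall e, e \in E -> (p1 (iter (pickle e.1) p2 w) : R) <= e.2] in
  measurable F /\ mu F = (\prod_(e <- E) e.2)%:E.
Proof.
move=> uE E01 F; pose n := (\max_(e <- E) pickle e.1).+1.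
have ltn' e : e \in E -> (pickle e.1 < n)%N.
  by move=> eE; rewrite ltnS; exact: (@leq_bigmax_seq _ _ xpredT (fun e : nat * nat * R => pickle e.1)).
(* At most one entry of [E] has the code [j], so this product is a single threshold, or 1 when there
   is no constraint. *)
pose x (j : nat) : R := \prod_(e <- E | pickle e.1 == j) e.2.
have xE e : e \in E -> x (pickle e.1) = e.2.
  move=> eE; rewrite /x big_mkcond (bigD1_seq e) ?(map_uniq uE) //= eqxx big1_seq ?mulr1 // => e' /andP[ne e'E].
  case: ifP => // /eqP /(pcan_inj pickleK) ee; move: ne.
  by rewrite (uniq_fst_inj uE e'E eE ee) eqxx.
have xcase j : (exists2 e, e \in E & pickle e.1 = j) \/ x j = 1.
  have [/hasP[e eE /eqP ej]|hn] := boolP (has (fun e => pickle e.1 == j) E).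
    by left; exists e.
  by right; rewrite /x big_hasC.
have x01 j : 0 <= x j <= 1.
  by have [[e eE <-]|->] := xcase j; [rewrite xE // E01|rewrite ler01 lexx].
have [mE muE] := unif_iid n x01.
have -> : F = [set w : T | forall j, (j < n)%N -> (p1 (iter j p2 w) : R) <= x j].
  rewrite predeqE => w; split=> h.
    move=> j jn; have [[e eE <-]|->] := xcase j; first by rewrite xE //; exact: h.
    by case/andP: (splitting01 2 (iter j p2 w)).
  by move=> e eE; rewrite -xE //; apply: h; exact: ltn'.
split=> //; rewrite muE; congr EFin; rewrite /x (exchange_big_dep xpredT) //=.
by apply: eq_big_seq => e eE; rewrite (big_pred1 (Ordinal (ltn' e eE))) // => j.
Qed.

Lemma RCM_exists (g : R -> R) :
  exists (d : measure_display) (Omega : measurableType d) (P : probability Omega R)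
    (X : Omega -> nat -> R * R) (U : Omega -> nat -> nat -> R), RCM_realization lam g P X U.
Proof.
have I0 := intensity_ge0; have Il := intensity_le.
have mC c : measurable_fun setT (cell_map c) by exact: measurable_square_pt.
have C1 c v : (cell_map c v).1 = (offset c).1 + (p1 v : R) by [].
pose pts := points intensity cell_map.
have mpts n : measurable_fun setT (fun w => pts w n).
  exact: (measurable_points I0 Il mC C1 intensity_inf).
have mall (Ls : seq (nat * set (R * R))) : (forall nD, nD \in Ls -> measurable nD.2) ->
    measurable [set w : T | forall nD, nD \in Ls -> nD.2 (pts w nD.1)].
  elim: Ls => [_|[n D] Ls IH mL].
    by rewrite (_ : [set w | _] = setT); [exact: measurableT|rewrite predeqE].
  rewrite (_ : [set w | _] = [set w : T | D (pts w n)] `&`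
      [set w : T | forall nD, nD \in Ls -> nD.2 (pts w nD.1)]).
    apply: measurableI; last by apply: IH => nD h; apply: mL; rewrite inE h orbT.
    have := mpts n measurableT D (mL (n, D) (mem_head _ _)); by rewrite setTI.
  rewrite predeqE => w; split.
    by move=> h; split=> [|nD nDL]; [exact: (h (n, D) (mem_head _ _))|apply: h; rewrite inE nDL orbT].
  by move=> [h1 h2] nD; rewrite inE => /orP[/eqP->|]; [|exact: h2].
(* One half of the digits builds the points, the other the variables [U], numbered by the codes of
   the pairs; independence is that of the halves. *)
exists _, T, [the probability T R of mu], (fun w => pts (p1 w)),
  (fun w a b => p1 (iter (pickle (a, b)) p2 (p2 w))); split.
- by move=> w; exact: points_inj.
- by move=> n; exact: (measurableT_comp (mpts n) (measurable_splitting 2)).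
- move=> a b; move: (pickle (a, b)) => n _ Y mY.
  have [m2 _] := preserving_comp preserving_p1 (preserving_comp (preserving_iter n) (@preserving_p2 R)).
  exact: (m2 measurableT Y mY).
- move=> k B c mB fB dB.
  have dB' i j x : B i x -> B j x -> i = j.
    move=> Bi Bj; apply/eqP/negPn/negP => /dB h.
    by have : (B i `&` B j) x by []; rewrite h.
  have [mE muE] := @points_poisson R lam intensity cell_map _ I0 Il mC C1 intensity_inf k B c
    (fun i => lam * fine (area (B i))) mB dB' (fun i => cvg_intensity (mB i) (fB i)).
  rewrite -muE -(unif_p1 mE); congr (mu _).
  by rewrite predeqE => w; split=> [h i|h i _]; [exact: (h i I)|exact: (h i)].
- move=> Ls E mL uE hE.
  have [mF muF] := unif_iid_seq uE (fun e eE => (hE e eE).2).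
  have mA := mall Ls mL.
  have fA : mu [set w : T | forall nD, nD \in Ls -> nD.2 (pts w nD.1)] \is a fin_num by rewrite fin_num_measure.
  have pA := unif_p1 mA.
  rewrite [X in _ = (X * _)%E](_ : _ = (fine (mu [set w : T | forall nD, nD \in Ls -> nD.2 (pts w nD.1)]))%:E).
    rewrite -EFinM -(unif_p12 mA mF (esym (fineK fA)) muF).
    apply: (congr1 mu); rewrite predeqE => w; split=> -[h1 h2]; split; [exact: h1| |exact: h1|].
      by move=> [[a b] x] eE; exact: (h2 _ eE).
    by move=> [[a b] x] eE; exact: (h2 _ eE).
  by rewrite fineK.
Qed.
End Realization.

(** * Lattice sums and the radial integral *)

Section QuarterDisc.
Context {R : realType}.
Implicit Types (a b t r x : R).

Lemma sin_le_id t : 0 <= t -> sin t <= t.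
Proof.
rewrite le_eqVlt => /orP[/eqP<-|t0]; first by rewrite sin0.
have [|c _] := @MVT R (@sin R) (@cos R) 0 t t0 (fun x _ => is_derive_sin x).
  by apply: continuous_subspaceT; exact: continuous_sin.
rewrite sin0 !subr0 => ->; rewrite ger_pMl //; exact: cos_le1.
Qed.

(** For [t] between 0 and [pi / 2], the area under the upper unit circle between the abscissas
    [cos t] and 1. *)
Definition disc_angle t := (t - sin t * cos t) / 2.

Lemma ler_cos_pi a b : 0 <= a -> a <= b -> b <= pi -> cos b <= cos a.
Proof.
move=> a0; rewrite le_eqVlt => /orP[/eqP->//|ab] bp.
by apply: ltW; rewrite ltr_cos // in_itv /=; apply/andP; split; move: a0 ab bp; clear; lra.
Qed.

Lemma ler_sin_pihalf a b : 0 <= a -> a <= b -> b <= pi / 2 -> sin a <= sin b.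
Proof.
move=> a0; rewrite le_eqVlt => /orP[/eqP->//|ab] bp; have p0 := pi_gt0 R.
by apply: ltW; rewrite ltr_sin // in_itv /=; apply/andP; split; move: a0 ab bp p0; clear; lra.
Qed.

Lemma disc_angle_ge0 t : 0 <= t -> t <= pi / 2 -> 0 <= disc_angle t.
Proof.
move=> t0 tp; rewrite divr_ge0 // subr_ge0; have p0 := pi_gt0 R.
have s0 : 0 <= sin t by have := ler_sin_pihalf (lexx _) t0 tp; rewrite sin0.
by apply: le_trans (sin_le_id t0); rewrite ler_piMr // cos_le1.
Qed.

(* Since [sin (b - a) <= b - a], the right side exceeds the left by at least
   [(sin b - sin a) * (cos a - cos b) / 2]. *)
Lemma disc_slice a b : 0 <= a -> a <= b -> b <= pi / 2 ->
  sin a * (cos a - cos b) <= disc_angle b - disc_angle a.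
Proof.
move=> a0 ab bp; have p0 := pi_gt0 R.
have ba0 : 0 <= b - a by rewrite subr_ge0.
have := sin_le_id ba0; rewrite sinB => h1.
have h2 : sin a <= sin b by exact: ler_sin_pihalf.
have h3 : cos b <= cos a by apply: ler_cos_pi => //; lra.
have := mulr_ge0 (_ : 0 <= sin b - sin a) (_ : 0 <= cos a - cos b); rewrite !subr_ge0 => /(_ h2 h3).
by rewrite /disc_angle; lra.
Qed.

Lemma quarter_sum r n : 0 < r ->
  \sum_(x < n) (if x.+1%:R <= r then Num.sqrt (r ^+ 2 - x.+1%:R ^+ 2) else 0) <=
  r ^+ 2 * (pi / 4) - (if n%:R <= r then r ^+ 2 * disc_angle (acos (n%:R / r)) else 0).
Proof.
move=> r0; have p0 := pi_gt0 R.
have r20 : 0 < r ^+ 2 by rewrite exprn_gt0.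
have dom (k : nat) : k%:R <= r -> -1 <= k%:R / r <= 1.
  move=> kr; rewrite ler_pdivrMr // mul1r kr andbT.
  by apply: (@le_trans _ _ 0); rewrite ?divr_ge0 // ?ltW // ltrN10.
have ang (k : nat) : k%:R <= r -> 0 <= acos (k%:R / r) <= pi / 2.
  move=> kr; have d := dom k kr; rewrite acos_ge0 //= leNgt; apply/negP => h.
  have : cos (acos (k%:R / r)) < cos (pi / 2).
    rewrite ltr_cos // in_itv /=; last by rewrite acos_ge0 //= acos_lepi.
    by apply/andP; split; move: p0; clear; lra.
  by rewrite acosK ?in_itv //= cos_pihalf ltNge divr_ge0 // ltW.
elim: n => [|n IH].
  rewrite big_ord0 (ltW r0) mul0r acos0 /disc_angle sin_pihalf cos_pihalf mulr0 subr0.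
  by rewrite le_eqVlt; apply/orP; left; apply/eqP; field.
rewrite big_ord_recr /=; case: ifP => h; last first.
  rewrite addr0 subr0; apply: le_trans IH _; rewrite gerBl; case: ifP => // nr.
  by rewrite mulr_ge0 ?(ltW r20) //; have /andP[? ?] := ang n nr; exact: disc_angle_ge0.
have nr : n%:R <= r by apply: le_trans h; rewrite ler_nat.
rewrite nr in IH.
have /andP[a0 ap] := ang _ h; have /andP[b0 bp] := ang _ nr.
have ab : acos (n.+1%:R / r) <= acos (n%:R / r).
  rewrite leNgt; apply/negP => lt.
  have : cos (acos (n.+1%:R / r)) < cos (acos (n%:R / r)).
    by rewrite ltr_cos // in_itv /= acos_ge0 ?acos_lepi ?dom.
  rewrite !acosK ?in_itv /= ?dom // ltr_pM2r ?invr_gt0 // ltr_nat => /ltnW.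
  by rewrite ltnn.
have := disc_slice a0 ab bp; rewrite !acosK ?in_itv /= ?dom // sin_acos ?dom //.
have -> : n.+1%:R / r - n%:R / r = r^-1 by rewrite -mulrBl -natrB // subSnn mul1r.
have -> : Num.sqrt (1 - (n.+1%:R / r) ^+ 2) = Num.sqrt (r ^+ 2 - n.+1%:R ^+ 2) / r.
  have -> : 1 - (n.+1%:R / r) ^+ 2 = (r ^+ 2 - n.+1%:R ^+ 2) / r ^+ 2 by field; rewrite gt_eqF.
  rewrite sqrtrM; last by rewrite subr_ge0; apply: lerXn2r; rewrite ?nnegrE ?(ltW r0).
  by rewrite sqrtrV ?sqr_ge0 // sqrtr_sqr ger0_norm // ltW.
move=> hs; have := ler_wpM2l (ltW r20) hs.
have -> : r ^+ 2 * (Num.sqrt (r ^+ 2 - n.+1%:R ^+ 2) / r / r) = Num.sqrt (r ^+ 2 - n.+1%:R ^+ 2).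
  by field; rewrite gt_eqF.
move: IH; rewrite mulrBr; move: (\sum_(_ < n) _) (Num.sqrt _) (r ^+ 2 * (pi / 4)) => S q P.
move: (r ^+ 2 * disc_angle _) (r ^+ 2 * disc_angle _) => u v; clear; lra.
Qed.

(** A column of the quarter disc holds as many lattice points with positive ordinate as the integer
    part of its height. *)
Lemma quarter_count r n : 0 < r ->
  #|[set v : 'I_n * 'I_n | v.1.+1%:R ^+ 2 + v.2.+1%:R ^+ 2 <= r ^+ 2]|%SET%:R <= r ^+ 2 * (pi / 4).
Proof.
move=> r0; have p0 := pi_gt0 R.
apply: (@le_trans _ _ (\sum_(x < n) (if x.+1%:R <= r then Num.sqrt (r ^+ 2 - x.+1%:R ^+ 2) else 0))); last first.
  apply: le_trans (quarter_sum n r0) _; rewrite gerBl; case: ifP => // nr.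
  have q0 : 0 <= n%:R / r by rewrite divr_ge0 // ltW.
  have q1 : n%:R / r <= 1 by rewrite ler_pdivrMr // mul1r.
  have d : -1 <= n%:R / r <= 1 by rewrite q1 andbT; apply: le_trans q0; rewrite lerN10.
  rewrite mulr_ge0 ?sqr_ge0 //; apply: disc_angle_ge0; first exact: acos_ge0.
  rewrite leNgt; apply/negP => h.
  have : cos (acos (n%:R / r)) < cos (pi / 2).
    rewrite ltr_cos // in_itv /=; last by rewrite acos_ge0 //= acos_lepi.
    by apply/andP; split; move: p0; clear; lra.
  by rewrite acosK ?in_itv //= cos_pihalf ltNge q0.
rewrite -sum1_card natr_sum (eq_bigl (fun v : 'I_n * 'I_n => v.1.+1%:R ^+ 2 + v.2.+1%:R ^+ 2 <= r ^+ 2)); last first.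
  by move=> v; rewrite inE.
rewrite -(pair_big_dep xpredT (fun x y : 'I_n => x.+1%:R ^+ 2 + y.+1%:R ^+ 2 <= r ^+ 2) (fun _ _ => 1 : R)) /=.
apply: ler_sum => x _; case: ifP => hx; last first.
  rewrite big_pred0 // => y; apply/negbTE; rewrite -ltNge.
  apply: (@lt_le_trans _ _ (x.+1%:R ^+ 2)); last by rewrite lerDl sqr_ge0.
  by rewrite ltrXn2r ?nnegrE ?(ltW r0) // ltNge hx.
set z := Num.sqrt _; have z0 : 0 <= z by exact: sqrtr_ge0.
have zE : z ^+ 2 = r ^+ 2 - x.+1%:R ^+ 2.
  by rewrite sqr_sqrtr // subr_ge0 lerXn2r ?nnegrE ?(ltW r0).
rewrite (eq_bigl (fun y : 'I_n => (y < Num.truncn z)%N)); last first.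
  by move=> y; rewrite truncn_gt_nat -[RHS](ler_pXn2r (_ : 0 < 2)%N) ?nnegrE // zE lerBrDr addrC.
rewrite sumr_const; have /andP[tz _] := truncn_itv z0; apply: le_trans tz; rewrite ler_nat.
rewrite cardE -(size_map val) -[leqRHS](size_iota 0); apply: uniq_leq_size.
  by rewrite (map_inj_uniq val_inj) enum_uniq.
by move=> k /mapP[y]; rewrite mem_enum => hy ->; rewrite mem_iota.
Qed.
End QuarterDisc.

Section Layers.
Context {R : realType}.

(* Abel summation against the increments of [G], the layers being the successive radii. *)
Lemma layer_bound (f G : R -> R) (c kap : R) (rs : seq R) : 0 <= kap ->
  (forall r, 0 <= r -> 0 <= f r) -> (forall x y, 0 <= x -> x <= y -> f y <= f x) ->
  0 <= G 0 -> (forall x y, 0 <= x -> x <= y -> f y * (y ^+ 2 - x ^+ 2) <= 2 * (G y - G x)) ->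
  sorted <=%R rs -> (forall r, r \in rs -> 0 <= r) ->
  (forall k, (k < size rs)%N -> c * k.+1%:R <= kap * rs`_k ^+ 2) ->
  \sum_(r <- rs) c * f r + f (last 0 rs) * (kap * last 0 rs ^+ 2 - c * (size rs)%:R) <=
    2 * kap * G (last 0 rs) /\ 0 <= kap * last 0 rs ^+ 2 - c * (size rs)%:R /\ 0 <= last 0 rs.
Proof.
move=> k0 f0 fm G0 hG; elim/last_ind: rs => [|rs x IH] so pos cnt.
  rewrite big_nil /= !mulr0 expr0n /= mulr0 subr0 mulr0 addr0 lexx.
  by split=> //; rewrite mulr_ge0 // mulr_ge0.
have so' : sorted <=%R rs by move: so; rewrite -cats1 => /cat_sorted2[].
have pos' r : r \in rs -> 0 <= r by move=> rin; apply: pos; rewrite mem_rcons inE rin orbT.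
have cnt' k : (k < size rs)%N -> c * k.+1%:R <= kap * rs`_k ^+ 2.
  by move=> ks; have := cnt k; rewrite size_rcons nth_rcons ks ltnS (ltnW ks) => /(_ isT).
have [h1 [h2 h3]] := IH so' pos' cnt'.
have x0 : 0 <= x by apply: pos; rewrite mem_rcons inE eqxx.
set y := last 0 rs in h1 h2 h3; set m := size rs in h1 h2.
have yx : y <= x.
  rewrite /y; case: (rs) so => [|a s]; first by [].
  by rewrite rcons_cons /= rcons_path => /andP[].
have cm : c * m.+1%:R <= kap * x ^+ 2.
  by have := cnt m; rewrite size_rcons nth_rcons ltnn eqxx ltnSn => /(_ isT).
rewrite last_rcons size_rcons -/m -cats1 big_cat big_seq1 /=; split; last by rewrite subr_ge0.
have e1 := ler_wpM2r h2 (fm _ _ h3 yx).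
have e2 := ler_wpM2l k0 (hG _ _ h3 yx).
move: h1 e1 e2; rewrite -natr1; move: (\sum_(_ <- _) _) => S; clear; lra.
Qed.
End Layers.

Section RadialIntegral.
Context {R : realType}.
Variables (f : R -> R) (rho : R).
Hypothesis f01 : forall r : R, 0 <= r -> 0 <= f r <= 1.
Hypothesis f_mono : forall x y : R, 0 <= x -> x <= y -> f y <= f x.
Hypothesis f_range : forall r : R, 0 <= r -> 0 < f r -> r <= rho.
Hypothesis rho_ge0 : 0 <= rho.
Local Notation leb := (@lebesgue_measure R).
Local Notation h := (fun r : R => (r * f r)%:E).

Lemma measurable_radial (D : set R) : measurable D -> D `<=` `[0, +oo[%classic ->
  measurable_fun D h.
Proof.
move=> mD sD; apply/measurable_EFinP.
(* [f] is monotone on nonnegative reals only; precomposition with the maximum with 0 gives a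
   function monotone on the whole line. *)
apply: (@eq_measurable_fun _ _ _ _ D (fun r : R => r * f (Num.max 0 r))).
  move=> r; rewrite inE => /sD; rewrite /= in_itv /= andbT => r0.
  by rewrite max_r.
apply: measurable_funM => //; apply: nonincreasing_measurable => // x y xy.
apply: f_mono; first by rewrite le_max lexx.
by rewrite ge_max !le_max lexx xy orbT.
Qed.

Lemma radial_ge0 r : 0 <= r -> (0 <= h r)%E.
Proof. by move=> r0; rewrite lee_fin mulr_ge0 //; case/andP: (f01 r0). Qed.

Lemma radial_fin : (\int[leb]_(r in `[0%R, +oo[) h r < +oo)%E.
Proof.
have -> : `[0, +oo[%classic = `[0, rho]%classic `|` `]rho, +oo[%classic :> set R.
  rewrite predeqE => r /=; rewrite !in_itv /= !andbT; split.
    by move=> r0; have [h1|h1] := leP r rho; [left; rewrite r0|right].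
  by move=> [/andP[]//|h1]; exact: (le_trans rho_ge0 (ltW h1)).
have s1 : `[0, rho]%classic `<=` (`[0, +oo[%classic : set R).
  by move=> r /=; rewrite !in_itv /= andbT => /andP[].
have s2 : `]rho, +oo[%classic `<=` (`[0, +oo[%classic : set R).
  by move=> r /=; rewrite !in_itv /= !andbT => h1; exact: (le_trans rho_ge0 (ltW h1)).
rewrite ge0_integral_setU; [|exact: measurable_itv|exact: measurable_itv| | |]; last 3 first.
- apply: measurable_radial; first by apply: measurableU; exact: measurable_itv.
  by move=> r [/s1|/s2].
- by move=> r [/s1|/s2]; rewrite /= in_itv /= andbT; exact: radial_ge0.
- rewrite disj_set2E; apply/eqP; rewrite predeqE => r /=; rewrite !in_itv /= !andbT.
  by split=> // -[/andP[_ h1] h2]; have := lt_le_trans h2 h1; rewrite ltxx.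
rewrite [X in (_ + X)%E](_ : _ = 0%E) ?adde0; last first.
  apply: integral0_eq => r /= ; rewrite in_itv /= andbT => hr.
  have r0 : 0 <= r by exact: (le_trans rho_ge0 (ltW hr)).
  have /andP[fr0 _] := f01 r0.
  have [->|fn] := eqVneq (f r) 0; first by rewrite mulr0.
  have fp : 0 < f r by rewrite lt_def fn.
  by have := lt_le_trans hr (f_range r0 fp); rewrite ltxx.
apply: (@le_lt_trans _ _ (\int[leb]_(r in `[0%R, rho]) (cst rho%:E) r)%E); last first.
  have e : (lebesgue_measure (`[0%R, rho]%classic : set R) < +oo)%E.
    by rewrite lebesgue_measure_itv /=; case: ifP => _; rewrite ?ltry // -EFinB ltry.
  by rewrite integral_cst; [apply: lte_mul_pinfty|exact: measurable_itv].
apply: ge0_le_integral.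
- exact: measurable_itv.
- by move=> r /s1; rewrite /= in_itv /= andbT; exact: radial_ge0.
- by apply: measurable_radial => //; exact: measurable_itv.
- exact: measurable_cst.
- move=> r /=; rewrite in_itv /= => /andP[r0 rr]; rewrite lee_fin.
  have /andP[fr0 fr1] := f01 r0.
  by apply: le_trans rr; rewrite ler_piMr.
Qed.

Definition radial (t : R) : R := fine (\int[leb]_(r in `[0%R, t]) h r)%E.

Lemma radialE t : (\int[leb]_(r in `[0%R, t]) h r = (radial t)%:E)%E /\
  radial t <= Rintegral leb `[0, +oo[ (fun r => r * f r).
Proof.
have s1 : `[0, t]%classic `<=` (`[0, +oo[%classic : set R).
  by move=> r /=; rewrite !in_itv /= andbT => /andP[].
have le : (\int[leb]_(r in `[0%R, t]) h r <= \int[leb]_(r in `[0%R, +oo[) h r)%E.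
  apply: ge0_subset_integral; [exact: measurable_itv|exact: measurable_itv| | |exact: s1].
    by apply: measurable_radial => //; exact: measurable_itv.
  by move=> r; rewrite /= in_itv /= andbT; exact: radial_ge0.
have ge : (0 <= \int[leb]_(r in `[0%R, t]) h r)%E.
  by apply: integral_ge0 => r /s1; rewrite /= in_itv /= andbT; exact: radial_ge0.
have f1 : (\int[leb]_(r in `[0%R, t]) h r)%E \is a fin_num.
  by rewrite ge0_fin_numE //; apply: le_lt_trans le radial_fin.
have f2 : (\int[leb]_(r in `[0%R, +oo[) h r)%E \is a fin_num.
  by rewrite ge0_fin_numE ?radial_fin // (le_trans ge).
split; first by rewrite /radial fineK.
by rewrite -lee_fin /radial /Rintegral !fineK.
Qed.

Lemma radial0 : 0 <= radial 0.
Proof.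
by rewrite fine_ge0 //; apply: integral_ge0 => r; rewrite /= in_itv /= => /andP[r0 _]; exact: radial_ge0.
Qed.

Lemma integral_id (x y : R) : x < y ->
  (\int[leb]_(r in `[x, y]) (r%:E) = ((y ^+ 2 - x ^+ 2) / 2)%:E)%E.
Proof.
move=> xy; pose F : R -> R := (2^-1 : R) *: (@id R ^+ 2).
have dF : forall t : R, is_derive t 1 F t.
  move=> t.
  by apply: is_derive_eq; rewrite /GRing.scale /= expr1 mulr1; field.
have cF : forall t : R, F z @[z --> t] --> F t.
  move=> t.
  by apply: differentiable_continuous; apply/derivable1_diffP; exact: ex_derive.
rewrite (@continuous_FTC2 R id F x y xy).
- rewrite -EFinB; congr EFin.
  by rewrite /F /= !fctE /GRing.scale /= mulrBl mulrC [2^-1 * _]mulrC.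
- by apply: continuous_subspaceT => r; exact: cvg_id.
- split; first by move=> r _; exact: ex_derive.
    exact: (cvg_at_right_filter (cF x)).
  exact: (cvg_at_left_filter (cF y)).
- by move=> r _; rewrite derive1E; exact: derive_val.
Qed.

(** Between [x] and [y] the integrand is at least [f y * r], and [r] integrates to
    [(y ^+ 2 - x ^+ 2) / 2]. *)
Lemma radial_incr (x y : R) : 0 <= x -> x <= y -> f y * (y ^+ 2 - x ^+ 2) <= 2 * (radial y - radial x).
Proof.
move=> x0; rewrite le_eqVlt => /orP[/eqP->|xy]; first by rewrite !subrr !mulr0.
have y0 : 0 <= y by exact: (le_trans x0 (ltW xy)).
have s1 : `[0, x]%classic `<=` (`[0, +oo[%classic : set R).
  by move=> r /=; rewrite !in_itv /= andbT => /andP[].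
have s2 : `]x, y]%classic `<=` (`[0, +oo[%classic : set R).
  by move=> r /=; rewrite !in_itv /= andbT => /andP[h1 _]; exact: (le_trans x0 (ltW h1)).
have [ey _] := radialE y; have [ex _] := radialE x.
have sp : `[0, y]%classic = `[0, x]%classic `|` `]x, y]%classic :> set R.
  rewrite predeqE => r /=; rewrite !in_itv /=; split.
    by move=> /andP[r0 ry]; have [h1|h1] := leP r x; [left; rewrite r0|right; rewrite ry].
  move=> [/andP[-> h1]|/andP[h1 ->]]; rewrite ?andbT /=; first exact: (le_trans h1 (ltW xy)).
  exact: (le_trans x0 (ltW h1)).
have := ey; rewrite sp ge0_integral_setU; [|exact: measurable_itv|exact: measurable_itv| | |]; last 3 first.
- apply: measurable_radial; first by apply: measurableU; exact: measurable_itv.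
  by move=> r [/s1|/s2].
- by move=> r [/s1|/s2]; rewrite /= in_itv /= andbT; exact: radial_ge0.
- rewrite disj_set2E; apply/eqP; rewrite predeqE => r /=; rewrite !in_itv /=.
  by split=> // -[/andP[_ h1] /andP[h2 _]]; have := lt_le_trans h2 h1; rewrite ltxx.
rewrite ex => e; have /andP[fy0 _] := f01 y0.
have : ((f y * ((y ^+ 2 - x ^+ 2) / 2))%:E <= \int[leb]_(r in `]x, y]) h r)%E.
  rewrite EFinM -(integral_id xy) -integral_itv_obnd_cbnd; last exact/measurable_EFinP.
  have -> : ((f y)%:E * \int[leb]_(r in `]x, y]) r%:E = \int[leb]_(r in `]x, y]) ((f y)%:E * r%:E))%E.
    apply/esym/ge0_integralZl; [exact: measurable_itv|exact/measurable_EFinP| |by rewrite lee_fin].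
    by move=> r /s2; rewrite /= in_itv /= andbT lee_fin.
  apply: ge0_le_integral.
  - exact: measurable_itv.
  - by move=> r /s2; rewrite /= in_itv /= andbT => r0; rewrite -EFinM lee_fin mulr_ge0.
  - by apply: measurable_funeM; exact/measurable_EFinP.
  - by apply: measurable_radial => //; exact: measurable_itv.
  - move=> r /= hr; rewrite -EFinM lee_fin mulrC; have r0 : 0 <= r.
      by have := s2 r hr; rewrite /= in_itv /= andbT.
    by rewrite ler_wpM2l // f_mono //; move: hr; rewrite in_itv /= => /andP[].
move: e; case: (\int[leb]_(r in `]x, y]) h r)%E => [z| |] //.
rewrite -EFinD => -[e]; rewrite lee_fin => hz; move: e hz; move: (radial y) (radial x) => Y X.
by clear; lra.
Qed.

(** The distances of the lattice points are sorted. The disc through the [k]-th of them, counted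
    from 0, contains at least [k.+1] points, so [quarter_count] supplies the counting hypothesis of
    [layer_bound] with [kap = pi / 4]. The offsets [x.+1] inherited from [Flo] keep the points off
    the axes, where the count could exceed the area. *)
Lemma lattice_sum_le (tm : R) (n : nat) : 0 < tm ->
  4 * \sum_(x < n) \sum_(y < n) tm ^+ 2 * f (tm * rdist x.+1 y.+1) <=
  2 * pi * Rintegral leb `[0, +oo[ (fun r => r * f r).
Proof.
move=> tm0; have p0 := pi_gt0 R.
have aux (S u G I P : R) : S + u <= 2 * (P / 4) * G -> 0 <= u -> P * G <= P * I -> 4 * S <= 2 * P * I by lra.
pose rv (v : 'I_n * 'I_n) : R := tm * rdist v.1.+1 v.2.+1.
have rv0 v : 0 < rv v.
  rewrite mulr_gt0 // sqrtr_gt0 ltr_pwDl ?sqr_ge0 //; by rewrite exprn_gt0 // ltr0n.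
pose rs := sort <=%R [seq rv v | v <- enum {: 'I_n * 'I_n}].
have so : sorted <=%R rs by apply: sort_sorted; exact: le_total.
have mem r : r \in rs -> exists v, r = rv v by rewrite mem_sort => /mapP[v _ ->]; exists v.
have pos r : r \in rs -> 0 <= r by move=> /mem[v ->]; exact: ltW.
have cnt k : (k < size rs)%N -> tm ^+ 2 * k.+1%:R <= pi / 4 * rs`_k ^+ 2.
  move=> ks; set x := rs`_k.
  have [v xv] := mem x (mem_nth 0 ks); have x0 : 0 < x by rewrite xv.
  have r0 : 0 < x / tm by rewrite divr_gt0.
  have := quarter_count n r0.
  set A := #|_|; have kA : (k.+1 <= A)%N.
    have -> : A = count (fun r => r <= x) rs.
      rewrite /rs (permP (permEl (perm_sort _ _))) count_map /A -sum1dep_card -sum1_count big_enum_cond /=.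
      apply: eq_bigl => w /=.
      have rd0 : 0 <= (rdist w.1.+1 w.2.+1 : R) by exact: sqrtr_ge0.
      rewrite [RHS](_ : _ = (rdist w.1.+1 w.2.+1 <= x / tm)); last by rewrite ler_pdivlMr // mulrC.
      rewrite -[RHS](ler_pXn2r (_ : 0 < 2)%N) ?nnegrE //; last exact: ltW.
      by rewrite sqr_sqrtr // addr_ge0 ?sqr_ge0.
    have tk : size (take k.+1 rs) = k.+1 by rewrite size_takel.
    rewrite -(cat_take_drop k.+1 rs) count_cat -[X in (X <= _)%N]tk -[X in (_ <= X + _)%N]size_filter.
    rewrite (all_filterP _) ?leq_addr //; apply/allP => r /(nthP 0)[j]; rewrite tk => jk <-.
    rewrite nth_take //; apply: (sorted_leq_nth (@le_trans _ R) (@lexx _ R) 0 so); rewrite ?inE //.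
    exact: leq_trans jk ks.
  move=> hA; have : k.+1%:R <= (x / tm) ^+ 2 * (pi / 4) by apply: le_trans hA; rewrite ler_nat.
  move=> h1; have tm2 : 0 < tm ^+ 2 by rewrite exprn_gt0.
  have := ler_wpM2l (ltW tm2) h1; rewrite (_ : tm ^+ 2 * ((x / tm) ^+ 2 * (pi / 4)) = pi / 4 * x ^+ 2) //.
  by field; rewrite gt_eqF.
have p40 : 0 <= pi / 4 :> R by rewrite divr_ge0 // ltW.
have [h1 [h2 h3]] := @layer_bound R f radial (tm ^+ 2) (pi / 4) rs p40
  (fun r r0 => proj1 (andP (f01 r0))) f_mono radial0 radial_incr so pos cnt.
have sE : \sum_(x < n) \sum_(y < n) tm ^+ 2 * f (tm * rdist x.+1 y.+1) = \sum_(r <- rs) tm ^+ 2 * f r.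
  rewrite pair_bigA /= (perm_big _ (permEl (perm_sort _ _))) big_map big_enum /=.
  by apply: eq_bigr => v _.
have /andP[fl0 _] := f01 h3; have [_ hG] := radialE (last 0 rs).
have h4 := mulr_ge0 fl0 h2.
have h5 := ler_wpM2l (ltW p0) hG.
rewrite sE; exact: aux h1 h4 h5.
Qed.
End RadialIntegral.

(** * Strict inequalities between critical intensities *)

Theorem theorem4 (R : realType) (p q : R) (f : R -> R) :
  0 < p -> p < q -> q <= 1 ->
  (forall r, 0 <= r -> 0 <= f r <= 1) ->
  (forall a b, 0 <= a -> a <= b -> f b <= f a) ->
  has_ubound [set a : R | 0 <= a /\ 0 < f a] ->
  0 < sup [set a : R | 0 <= a /\ 0 < f a] ->
  critical_intensity (Sscale p f) < critical_intensity (Sscale q f) /\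
  critical_intensity f >
    (2 * pi * Rintegral lebesgue_measure `[0, +oo[ (fun r => r * f r))^-1.
Proof.
move=> p0 pq q1 f01 f_mono ub rho0; set A := [set a : R | _] in ub rho0; set rho := sup A in rho0.
have A0 : A !=set0.
  apply/set0P/eqP => A0; by move: rho0; rewrite /rho A0 sup0 ltxx.
(* In this unit the support of [f] has length [40 * del], so that [30 * del] lies strictly inside
   it. *)
pose del := rho / 40; have del0 : 0 < del by rewrite divr_gt0.
have delm : del * 40%:R = rho by rewrite /del divfK.
have f_range r : 0 <= r -> 0 < f r -> r <= rho by move=> r0 fr; exact: ub_le_sup.
have f_range' r : 0 <= r -> 0 < f r -> r <= del * 40%:R by rewrite delm; exact: f_range.
have f_pos : 0 < f (30 * del).
  have lt : 30 * del < rho by rewrite /del; move: rho0; clear; lra.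
  have [a [a0 fa] ha] := sup_gt A0 lt; apply: lt_le_trans fa (f_mono _ _ _ (ltW ha)).
  by rewrite mulr_ge0 // ltW.
have rex (lam : R) : 0 < lam -> realizable lam by move=> l0 g; exact: RCM_exists.
set L := 2 * pi * _.
have hL : forall (tm : R) (n : nat), 0 < tm ->
    4 * \sum_(x < n) \sum_(y < n) tm ^+ 2 * f (tm * rdist x.+1 y.+1) <= L.
  by move=> tm n; exact: (lattice_sum_le f01 f_mono f_range (ltW rho0)).
have sub (s lam : R) : 0 < s -> s <= 1 -> 0 < lam -> percolates lam (Sscale s f) -> 1 <= lam * L.
  move=> s0 s1 l0 perc; rewrite leNgt; apply/negP => lL.
  exact: (not_percolates del0 f01 f_mono f_range' hL (ltW l0) lL s0 s1 (rex _ l0) perc).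
have ne (s : R) : 0 < s -> s <= 1 -> [set lam : R | 0 < lam /\ percolates lam (Sscale s f)] !=set0.
  move=> s0 s1; have [lam l0 perc] := percolates_large del0 f01 f_mono f_pos s0 s1.
  by exists lam.
have q0 : 0 < q by exact: lt_trans pq.
(* Positivity of the integral is read off from the existence of a percolating intensity, which
   satisfies [1 <= lam * L]. *)
have L0 : 0 < L.
  have [lam [l0 perc]] := ne q q0 q1.
  have := sub q lam q0 q1 l0 perc => h; rewrite -(pmulr_rgt0 _ l0); exact: lt_le_trans h.
have lower (s : R) : 0 < s -> s <= 1 -> L^-1 <= critical_intensity (Sscale s f).
  move=> s0 s1; apply: lb_le_inf; first exact: ne.
  by move=> lam [l0 /(sub s lam s0 s1 l0)]; rewrite -ler_pdivrMr // mul1r.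
have strict (a b : R) : 0 < a -> a < b -> b <= 1 ->
    critical_intensity (Sscale a f) < critical_intensity (Sscale b f).
  move=> a0 ab b1; have b0 : 0 < b by exact: lt_trans ab.
  set lam0 := critical_intensity (Sscale b f).
  have lb s : has_lbound [set lam : R | 0 < lam /\ percolates lam (Sscale s f)].
    by exists 0 => lam [/ltW].
  have l00 : 0 < lam0 by apply: lt_le_trans (lower b b0 b1); rewrite invr_gt0.
  have app (e : R) : 0 < e -> exists2 lam, lam0 <= lam < lam0 + e & percolates lam (Sscale b f).
    move=> e0; have [lam [l0 perc] lt] := inf_adherent e0 (conj (ne b b0 b1) (lb b)).
    by exists lam => //; rewrite lt andbT; apply: ge_inf.
  have [lam' /andP[l1 l2] perc] := percolates_strict del0 f01 f_mono f_range' f_pos erefl l00 a0 ab b1 rex app.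
  by apply: le_lt_trans l2; apply: ge_inf.
split; first exact: strict.
have S1 : Sscale 1 f = f by apply/funext => r; rewrite /Sscale sqrtr1 !mul1r.
have h0 : 0 < (2^-1 : R) by rewrite invr_gt0.
have h1 : (2^-1 : R) < 1 by rewrite invf_lt1 // ltr1n.
rewrite -[X in critical_intensity X]S1; apply: le_lt_trans (strict _ _ h0 h1 (lexx _)).
exact: lower h0 (ltW h1).
Qed.
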